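(* Let $(I,\mathbf\Lambda)$ be a Bruhat–Tits index. The isomorphism $f:\mathcal N^{\mathbf h}_{I,\mathbf\Lambda}\xrightarrow{\sim}X^{\mathbf h}_{I,\mathbf\Lambda}\times\kappa$ (described in the context) induces an isomorphism $\mathcal N^{\mathbf h,0}_{I,\mathbf\Lambda}\xrightarrow{\sim}X^{\mathbf h,0}_{I,\mathbf\Lambda}\times\kappa$.
   Context: Fields. $p$ is an odd prime, $F/\mathbb Q_p$ a finite extension with ring of integers $\mathcal O_F$, uniformizer $\pi$, residue field $\mathbb F_q$; $E/F$ is the unramified quadratic extension with nontrivial automorphism $x\mapsto x^*$; $\breve E$ is the completion of the maximal unramified extension of $E$, with residue field $\kappa=\overline{\mathbb F}_{q}$. For a perfect field $R\supset\mathbb F_q$, $W_{\mathcal O_F}(R)$ is the ring of relative Witt vectors, $F_R$ its fraction field, $\sigma$ the lift of $x\mapsto x^q$. Fix $n,m\ge 1$ and integers $\mathbf h=(h_1<\dots<h_m)$, $0\le h_i\le n$, all of the same parity; $\Delta h_i=(h_{i+1}-h_i)/2$. Framing objects. A strict formal $\mathcal O_F$-module is a formal $p$-divisible group with $\mathcal O_F$-action inducing the natural action on its Lie algebra. For $h\in\{h_1,\dots,h_m\}$ fix $\mathbb X^{[h]}=(\mathbb X,i_{\mathbb X},\lambda^{[h]})$: $\mathbb X$ a supersingular strict formal $\mathcal O_F$-module over $\mathbb F_{q^2}$ of relative $F$-height $2n$; $i_{\mathbb X}$ an $\mathcal O_E$-action extending the $\mathcal O_F$-action with $\mathrm{charpol}(i_{\mathbb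 X}(x)\mid\mathrm{Lie})=(T-x)(T-x^* )^{n-1}$; $\lambda^{[h]}$ an $\mathcal O_E$-linear polarization (the dual having the action $i_{\mathbb X}(x^* )^\vee$) with kernel contained in $\mathbb X[\pi]$ of order $q^{2h}$. For $h<h'$ among the $h_i$ fix isogenies $\alpha_{h',h}:\mathbb X^{[h']}\to\mathbb X^{[h]}$, compatible with composition, $\mathcal O_E$-actions and polarizations (inducing isometries of Dieudonné isocrystals), with kernel in the $\pi$-torsion of order $q^{h'-h}$; $\alpha_{h,h}=\mathrm{id}$. Moduli space. For an $\mathcal O_E$-scheme $S$ on which $\pi$ is locally nilpotent, with $\bar S=S\times_{\mathcal O_F}\mathbb F_q$, $\mathcal N^h(S)$ is the set of isomorphism classes of $(X,i_X,\lambda_X,\rho_X)$: $X$ a strict formal $\mathcal O_F$-module over $S$ of relative height $2n$, $i_X$ an $\mathcal O_E$-action extending the $\mathcal O_F$-action with $\mathrm{charpol}(i_X(x)\mid\mathrm{Lie}X)=(T-x)(T-x^* )^{n-1}$, $\lambda_X$ an $\mathcal O_E$-linear polarization, $\rho_X:X_{\bar S}\to\mathbb X^{[h]}_{\bar S}$ an $\mathcal O_E$-linear quasi-isogeny of height $0$ with $\rho_X^\vee\lambda^{[h]}\rho_X=\lambda_X$ up to a scalar in $\mathcal O_F^\times$. $\mathcal N^{\mathbf h}(S)$ is the set of tuples $(X^{[i]},i_{X^{[i]}},\lambda_{X^{[i]}},\rho_{X^{[i]}})_{1\le i\le m}$ (up to isomorphism) of elements of $\mathcal N^{h_i}(S)$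 such that $\rho_{X^{[i]}}^{-1}\circ\alpha_{h_{i+1},h_i}\circ\rho_{X^{[i+1]}}$ lifts to an isogeny $X^{[i+1]}\to X^{[i]}$ for $1\le i<m$. After base change to $\mathcal O_{\breve E}$ it is represented by a formal scheme $\mathcal N^{\mathbf h}_{E/F}$; $\mathcal N^{\mathbf h}_{E/F,\mathrm{red}}$ is the reduced special fiber, over $\kappa$. Hermitian space. Let $\mathbb N$ be the rational relative Dieudonné module of $\mathbb X^{[h_1]}$, with $\mathcal F,\mathcal V$ ($\mathcal F\mathcal V=\pi$) and pairing $\langle\cdot,\cdot\rangle$ induced by $\lambda^{[h_1]}$, with $\langle\mathcal Fv,w\rangle=\langle v,\mathcal Vw\rangle^\sigma$ and $\langle i(x)v,w\rangle=\langle v,i(x^* )w\rangle$. For $k\supset\kappa$ algebraically closed, $\mathbb N_k=\mathbb N\otimes F_k=\mathbb N_{k,0}\oplus\mathbb N_{k,1}$, where $E$ acts on $\mathbb N_{k,0}$ via a fixed $F$-isomorphism $\varphi_0:E\simeq F_{\mathbb F_{q^2}}$ and on $\mathbb N_{k,1}$ via its conjugate. Put $\tau=\pi\mathcal V^{-2}$ and $C=\mathbb N_{k,0}^\tau$, an $n$-dimensional $F_{\mathbb F_{q^2}}$-space independent of $k$, with $C_k:=C\otimes F_k=\mathbb N_{k,0}$, $\tau=\mathrm{id}\otimes\sigma^2$. The form $\{v,w\}=\delta\langle v,\mathcal Fw\rangle$ (fixed $\delta\in W_{\mathcal O_F}(\mathbb F_{q^2})^\times$, $\delta^\sigma=-\delta$)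 is left linear, right $\sigma$-linear, nondegenerate on $C_k$, hermitian on $C$. For a lattice $A$, $A^\vee$ is the set of $v$ with $\{v,A\}$ integral. $\Lambda_k=\Lambda\otimes W_{\mathcal O_F}(k)$ for a lattice $\Lambda\subset C$. Points. For $k\supset\kappa$ algebraically closed, $\mathcal N^{\mathbf h}_{E/F}(k)$ is identified with the set of chains of $W_{\mathcal O_F}(k)$-lattices $A_m\subset\dots\subset A_1\subset B_1\subset\dots\subset B_m$ in $C_k$ with, for all $i$ (superscripts are colengths): $\pi A_i^\vee\overset{1}{\subset}B_i\subset A_i^\vee$, $\pi B_i^\vee\overset{1}{\subset}A_i\subset B_i^\vee$, $\pi B_i\subset A_i\overset{h_i}{\subset}B_i$. Explicitly, if $M_i\subset\mathbb N_k$ is the image of the Dieudonné module of $X^{[i]}$ under $\alpha_{h_i,h_1}\circ\rho_{X^{[i]}}$, then $A_i=(M_i)_0$ and $B_i=\{x\in\mathbb N_{k,0}:\langle x,(M_i)_1\rangle\subset W_{\mathcal O_F}(k)\}$. Vertex lattices. $\mathcal L_i$ is the set of $W_{\mathcal O_F}(\mathbb F_{q^2})$-lattices $\Lambda\subset C$ with $\pi^{i+1}\Lambda^\vee\subset\Lambda\subset\pi^i\Lambda^\vee$; the type of $\Lambda\in\mathcal L_i$ is $t(\Lambda)=[\Lambda:\pi^{i+1}\Lambda^\vee]$; $\mathcal L_i^{\ge x}=\{\Lambda\in\mathcal L_i: t(\Lambda)\ge x\}$. (Types in $\mathcal L_0$ are $\equiv h_1+1$ and in $\mathcal L_1$ are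 $\equiv n-h_1+1$ mod $2$.) Bruhat–Tits index. A pair $(I,\mathbf\Lambda)$: $I$ a non-empty subset of $\{0,\dots,m\}$ with $0\notin I$ if $h_1=0$ and $m\notin I$ if $h_m=n$; $\mathbf\Lambda$ a collection of $\Lambda_0^i\in\mathcal L_0^{\ge h_i+1}$ for $i\in I\setminus\{0\}$ and $\Lambda_1^j\in\mathcal L_1^{\ge n-h_{j+1}+1}$ for $j\in I\setminus\{m\}$ such that, writing $I=\{i_1<\dots<i_s\}$, $\Lambda_0^{i_1}\subset\pi\Lambda_1^{i_1\vee}\subset\Lambda_0^{i_2}\subset\pi\Lambda_1^{i_2\vee}\subset\dots\subset\Lambda_0^{i_s}\subset\pi\Lambda_1^{i_s\vee}$, where the first term is omitted if $i_1=0$ and the last term is omitted if $i_s=m$. $(I',\mathbf\Lambda')\subset(I,\mathbf\Lambda)$ means: $I\subset I'$, $\Lambda_0'^{i}\subset\Lambda_0^i$ for all $i\in I\setminus\{0\}$, $\Lambda_1'^{j}\subset\Lambda_1^j$ for all $j\in I\setminus\{m\}$. Strata. For $i\in I\setminus\{0\}$, $j\in I\setminus\{m\}$ put $\Lambda_0^{i+}=\alpha_{h_i,h_1}^{-1}(\Lambda_0^i\oplus\mathcal V^{-1}(\Lambda_0^i))$, $\Lambda_0^{i-}=\alpha_{h_i,h_1}^{-1}(\pi\Lambda_0^{i\vee}\oplus\mathcal V(\Lambda_0^{i\vee}))$, $\Lambda_1^{j+}=\alpha_{h_{j+1},h_1}^{-1}(\Lambda_1^j\oplus\mathcal V^{-1}(\Lambda_1^j))$,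 $\Lambda_1^{j-}=\alpha_{h_{j+1},h_1}^{-1}(\pi^2\Lambda_1^{j\vee}\oplus\pi\mathcal V(\Lambda_1^{j\vee}))$. They are Dieudonné modules of strict formal $\mathcal O_F$-modules $X_{\Lambda_0^{i\pm}}$, $X_{\Lambda_1^{j\pm}}$ with quasi-isogenies $\rho_{\Lambda_0^{i\pm}}$, $\rho_{\Lambda_1^{j\pm}}$ over $\kappa$ to $\mathbb X^{[h_i]}$, resp. $\mathbb X^{[h_{j+1}]}$. $\mathcal N^{\mathbf h}_{I,\mathbf\Lambda}$ is the projective closed subscheme of $\mathcal N^{\mathbf h}_{E/F,\mathrm{red}}$ representing the points over $\kappa$-schemes $S$ for which $\rho_{X^{[i]}}^{-1}\circ(\rho_{\Lambda_0^{i-}})_S$ and $(\rho_{\Lambda_1^{j+}})_S^{-1}\circ\rho_{X^{[j+1]}}$ are isogenies for all $i\in I\setminus\{0\}$, $j\in I\setminus\{m\}$; its points over algebraically closed $k\supset\kappa$ are the lattice chains with $B_i\subset(\Lambda_0^i)_k$ ($i\in I\setminus\{0\}$) and $A_{j+1}\subset(\Lambda_1^j)_k$ ($j\in I\setminus\{m\}$). The stratum is $\mathcal N^{\mathbf h,0}_{I,\mathbf\Lambda}=\mathcal N^{\mathbf h}_{I,\mathbf\Lambda}\setminus\bigcup_{(I',\mathbf\Lambda')\subsetneq(I,\mathbf\Lambda)}\mathcal N^{\mathbf h}_{I',\mathbf\Lambda'}$. Fine Deligne–Lusztig varieties. For a connected reductive group $\mathbf G$ over $\overline{\mathbb F}_q$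 with Frobenius $\Phi$, a $\Phi$-stable pair $\mathbf T\subset\mathbf B$ with Coxeter system $(\mathbf W,\mathbf S)$, $J\subset\mathbf S$ and $w\in{}^J\mathbf W$ (minimal length in $\mathbf W_Jw$), $X_J\{w\}\subset\mathbf G/\mathbf P_J$ is the image of $X(w)=\{g\mathbf B: g^{-1}\Phi(g)\in\mathbf Bw\mathbf B\}$ under $\mathbf G/\mathbf B\to\mathbf G/\mathbf P_J$. Closures are taken in $\mathbf G/\mathbf P_J$. A right $\sigma$-semilinear form ($\sigma:x\mapsto x^q$) on $\mathbb F_{q^2}$-spaces is extended to scalars $k\supset\mathbb F_{q^2}$ by $(v\otimes x,w\otimes y)=xy^q(v,w)$. Two complete flags $\mathcal F,\mathcal F'$ are in relative position $w\in S_d$ if there is a basis $(e_1,\dots,e_d)$ adapted to $\mathcal F$ with $(e_{w(1)},\dots,e_{w(d)})$ adapted to $\mathcal F'$. (U) For a nondegenerate hermitian $\mathbb F_{q^2}/\mathbb F_q$-space $V$ of dimension $d$: $\mathbf G=\mathrm{GL}(V_{\overline{\mathbb F}_q})$ with the Frobenius for which $\mathbf G^{\Phi}=\mathrm U(V)$; $\mathbf W=S_d$, $\mathbf S=\{s_1,\dots,s_{d-1}\}$, $s_i=(i\ i+1)$, $\Phi(s_i)=s_{d-i}$. $\mathbf G/\mathbf P_J$ parametrizes flags with members of dimensions $\{x: s_x\notin J\}$; $X_J\{w\}$ is the set of such flags admitting a refinement to a complete flag $\mathcal F$ with $\mathcal F$ and $\mathcal F^\perp$ in relative position $w$. (GL)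 For $\mathbb F_{q^2}$-spaces $V_1,V_2$ of dimension $d$ with a perfect pairing $V_1\times V_2\to\mathbb F_{q^2}$, left linear and right $\sigma$-linear: $\mathbf G=\mathrm{GL}(V_1)\times\mathrm{GL}(V_2)$ over $\overline{\mathbb F}_q$, with the Frobenius exchanging the factors through adjunction, $\mathbf G^\Phi\simeq\mathrm{GL}(V_1)$; $\mathbf W=S_d\times S_d$, $\Phi(w_1,w_2)=(w_0w_2w_0,w_0w_1w_0)$, $w_0(i)=d+1-i$. For $J=J_1\sqcup J_2$, $X_J\{(w,w')\}$ is the set of pairs of flags (with member dimensions $\{x:s_x\notin J_1\}$ in $V_1$ and $\{x:s_x\notin J_2\}$ in $V_2$) refinable to complete flags $(\mathcal F^1,\mathcal F^2)$ with $\mathcal F^1,(\mathcal F^2)^\perp$ in relative position $w$ and $\mathcal F^2,(\mathcal F^1)^\perp$ in relative position $w'$. Here $U^\perp=\{v\in V_1: (v,u)=0\ \forall u\in U\}$ for $U\subset V_2$, and $W^\perp=\{v\in V_2:[v,w]=0\ \forall w\in W\}$ for $W\subset V_1$, where $[v,w]:=(w,v)^q$ on $V_2\times V_1$ is extended to be left linear and right $\sigma$-semilinear over $k$. All varieties are defined over $\mathbb F_{q^2}$. The varieties $X^{\mathbf h}_{I,\mathbf\Lambda}$ and $X^{\mathbf h,0}_{I,\mathbf\Lambda}$. Write $I=\{i_1<\dots<i_s\}$. They are the products of the following $X_{\mathbf\Lambda_\bullet}$, resp. $X^0_{\mathbf\Lambda_\bullet}$. (a) If $i_1\ne0$: kind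 (U) for $V=\Lambda_0^{i_1}/\pi\Lambda_0^{i_1\vee}$ with the form induced by $\{\cdot,\cdot\}$, $d=t(\Lambda_0^{i_1})=2(l-1)+h_{i_1}+1$, flags $U_{i_1}\subset\dots\subset U_1\subset W_1\subset\dots\subset W_{i_1}\subset V$ with $\dim U_i=l+\frac{h_{i_1}-h_i}2$, $\dim W_i=l+\frac{h_{i_1}+h_i}2$. Let $k_1+1<\dots<k_r+1$ be the distinct dimensions $<d$ of these members and $J=\mathbf S\setminus\{s_{k_1+1},\dots,s_{k_r+1}\}$. $X_{\mathbf\Lambda_0}=\overline{X_J\{s_ls_{l+1}\cdots s_{d-1}\}}$. Put $r_0=r-1$ if $l>1$, $r_0=r$ if $l=1$. $X_{\mathbf\Lambda_0}^0=\bigsqcup X_J\{w_1\cdots w_{r_0}s_{l+h_{i_1}}\cdots s_{d-1}\}$ over all $w_i=s_{k_i+1}\cdots s_{k_i+t_i}$ with $0\le t_i\le k_{i+1}-k_i$ (where $k_{r+1}:=d-1$), such that $t_i+t_{r_0+1-i}\ge\Delta h_{i_1-i}$ for all $1\le i\le i_1-1$, and $2t_{i_1}\ge h_1$ if $h_1\ne0$. (b) If $i_s\neq m$: kind (U) for $V=\Lambda_1^{i_s}/\pi^2\Lambda_1^{i_s\vee}$ with the form induced by $\pi^{-1}\{\cdot,\cdot\}$, $d=t(\Lambda_1^{i_s})=2(l-1)+(n-h_{i_s+1})+1$, flags $W_1\subset\dots\subset W_{m-i_s}\subset U_{m-i_s}\subset\dots\subset U_1\subset V$ with $\dim W_i=l+\frac{h_{i_s+i}-h_{i_s+1}}2$,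 $\dim U_i=l+(n-h_{i_s+1})-\frac{h_{i_s+i}-h_{i_s+1}}2$; $k_1,\dots,k_r$, $J$, $r_0$ as in (a) for these dimensions. $X_{\mathbf\Lambda_s}=\overline{X_J\{s_l\cdots s_{d-1}\}}$ and $X_{\mathbf\Lambda_s}^0=\bigsqcup X_J\{w_1\cdots w_{r_0}s_{l+(n-h_{i_s+1})}\cdots s_{d-1}\}$ over all $w_i$ as in (a) with $t_i+t_{r_0+1-i}\ge\Delta h_{i_s+i}$ for all $1\le i\le m-1-i_s$, and $2t_{m-i_s}\ge n-h_m$ if $h_m\neq n$. (c) For $1\le j\le s-1$: kind (GL) for $V_1=\pi\Lambda_0^{i_{j+1}}/\pi^2\Lambda_1^{i_j\vee}$, $V_2=\Lambda_1^{i_j}/\pi\Lambda_0^{i_{j+1}\vee}$ with pairing induced by $\pi^{-1}\{\cdot,\cdot\}$, $t(\Lambda_1^{i_j})=2(l_1-1)+(n-h_{i_j+1})+1$, $t(\Lambda_0^{i_{j+1}})=2(l_0-1)+h_{i_{j+1}}+1$, $d=\dim V_1=\dim V_2=l_0+l_1-1+\frac{h_{i_{j+1}}-h_{i_j+1}}2$, flags $W_1\subset\dots\subset W_N\subset V_1$, $U_N\subset\dots\subset U_1\subset V_2$, $N=i_{j+1}-i_j$, $\dim W_i=l_1+\frac{h_{i_j+i}-h_{i_j+1}}2$, $\dim U_i=l_0+\frac{h_{i_{j+1}}-h_{i_j+i}}2$. Let $k_1+1<\dots<k_r+1$ (resp. $k_1'+1<\dots<k'_{r'}+1$) be the dimensions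 $<d$ of the $W_i$ (resp. $U_i$), giving $J=J_1\sqcup J_2$. $X_{\mathbf\Lambda_j}=\overline{X_J\{(s_{l_1}\cdots s_{d-1},s_{l_0}\cdots s_{d-1})\}}$. Put $r_0=r-1$ if $l_0>1$, $r_0=r$ if $l_0=1$; $r_0'=r'-1$ if $l_1>1$, $r'_0=r'$ if $l_1=1$. $X_{\mathbf\Lambda_j}^0=\bigsqcup X_J\{(w_1\cdots w_{r_0}s_{d-l_0+1}\cdots s_{d-1},\,w_1'\cdots w'_{r_0'}s_{d-l_1+1}\cdots s_{d-1})\}$ over all $w_i=s_{k_i+1}\cdots s_{k_i+t_i}$, $w'_i=s_{k_i'+1}\cdots s_{k_i'+t_i'}$ with $0\le t_i\le k_{i+1}-k_i$, $0\le t_i'\le k_{i+1}'-k_i'$ (where $k_{r+1}=k'_{r'+1}:=d-1$) such that $t_i+t'_{r_0'+1-i}\ge\Delta h_{i_j+i}$ for all $1\le i\le i_{j+1}-i_j-1$. The isomorphism $f$. $D(X)$ denotes the Lie algebra of the universal extension of a strict formal $\mathcal O_F$-module; over a perfect field $D(X)=M(X)/\pi M(X)$ with $M(X)$ the relative Dieudonné module. For a $\kappa$-algebra $R$ and $X\in\mathcal N^{\mathbf h}_{I,\mathbf\Lambda}(R)$, let $\mathbb B_{\Lambda_0^i}=\Lambda_0^{i+}/\Lambda_0^{i-}=\mathrm{Ker}D(X_{\Lambda_0^{i-}}\to X_{\Lambda_0^{i+}})$, $\mathbb B_{\Lambda_1^j}=\Lambda_1^{j+}/\Lambda_1^{j-}=\mathrm{Ker}D(X_{\Lambda_1^{j-}}\to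 X_{\Lambda_1^{j+}})$, with perfect alternating forms induced by $\pi\langle\cdot,\cdot\rangle_{[h_i]}$, $\langle\cdot,\cdot\rangle_{[h_{j+1}]}$ (orthogonals $\dagger'$) and $\mathcal O_E$-gradings whose degree $0$ parts are identified via the $\alpha$'s with $\Lambda_0^i/\pi\Lambda_0^{i\vee}$, $\Lambda_1^j/\pi^2\Lambda_1^{j\vee}$. Let $E^{i',i}=\mathrm{Ker}D((X_{\Lambda_0^{i-}})_R\to X^{[i']})$ ($1\le i'\le i$), $F^{j,j'}=\mathrm{Ker}D((X_{\Lambda_1^{j-}})_R\to X^{[j'+1]})$ ($j\le j'\le m-1$) for the natural isogenies. Then $f(X)$ is: in (a) $U_{i'}=E_0^{i',i_1}$, $W_{i'}=(E_1^{i',i_1})^{\dagger'}$; in (b) $W_i=(F_1^{i_s,i_s+i-1})^{\dagger'}$, $U_i=F_0^{i_s,i_s+i-1}$; in (c) $W_i=(F_1^{i_j,i_j+i-1})^{\dagger'}$, $U_i$ = image of $F_0^{i_j,i_j+i-1}$ in $V_2$. On points over algebraically closed $k\supset\kappa$: in (a) $U_i=A_i/\pi(\Lambda_0^{i_1})_k^\vee$, $W_i=B_i/\pi(\Lambda_0^{i_1})_k^\vee$; in (b) $W_i=\pi B_{i_s+i}/\pi^2(\Lambda_1^{i_s})_k^\vee$, $U_i=A_{i_s+i}/\pi^2(\Lambda_1^{i_s})_k^\vee$; in (c) $W_i=\pi B_{i_j+i}/\pi^2(\Lambda_1^{i_j})_k^\vee$, $U_i=A_{i_j+i}/\pi(\Lambda_0^{i_{j+1}})_k^\vee$.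 *)

(* Defs.v *)
From HB Require Import structures.
From mathcomp Require Import all_boot all_order all_algebra.
From mathcomp Require Import boolp classical_sets.

Set Implicit Arguments.
Unset Strict Implicit.
Unset Printing Implicit Defensive.

Import GRing.Theory.
Local Open Scope classical_set_scope.
Local Open Scope ring_scope.

(** A complete discretely valued field with residue field [k]: its ring of
    integers [oring], embedded by [emb], with a chosen uniformizer. *)
Record cdvf (k : fieldType) := CDVF {
  fld : fieldType;
  oring : idomainType;
  emb : {rmorphism oring -> fld};
  unif : oring;
  res : {rmorphism oring -> k};
  emb_inj : injective emb;
  unif_neq0 : unif != 0;
  fld_frac : forall x : fld, exists a n, x = emb a / emb unif ^+ n;
  res_surj : forall c : k, exists a, res a = c;
  res_ker : forall a, res a = 0 <-> exists a', a = unif * a';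
  unif_separated : forall a, (forall n, exists a', a = unif ^+ n * a') -> a = 0;
  unif_complete : forall u : nat -> oring, exists a,
    forall n, exists a', a - \sum_(i < n) u i * unif ^+ i = unif ^+ n * a'
}.

(** The field [F_k = Frac W_{O_F}(k)] for [k] perfect over the residue field of
    [F].  For perfect [k], [W_{O_F}(k)] is, up to unique isomorphism, the
    complete discrete valuation ring over [O_F] with uniformizer that of [O_F]
    and residue field [k], and [frobO] is the only [O_F]-endomorphism lifting
    [x |-> x ^ q]. *)
Record relwitt (Fq : finFieldType) (OF : cdvf Fq) (k : fieldType)
    (i : {rmorphism Fq -> k}) := RelWitt {
  wdvf :> cdvf k;
  wstr : {rmorphism oring OF -> oring wdvf};
  wstr_unif : wstr (unif OF) = unif wdvf;
  wstr_res : forall a, res wdvf (wstr a) = i (res OF a);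
  frobO : {rmorphism oring wdvf -> oring wdvf};
  frob : {rmorphism fld wdvf -> fld wdvf};
  frob_emb : forall w, frob (emb wdvf w) = emb wdvf (frobO w);
  frobO_res : forall w, res wdvf (frobO w) = res wdvf w ^+ #|Fq|;
  frobO_str : forall a, frobO (wstr a) = wstr a
}.

(** The maps [W_{O_F}(k1) -> W_{O_F}(k2)] and [F_{k1} -> F_{k2}] induced by an
    [F_q]-embedding [j : k1 -> k2]. *)
Record wittmap (Fq : finFieldType) (OF : cdvf Fq) (k1 k2 : fieldType)
    (i1 : {rmorphism Fq -> k1}) (i2 : {rmorphism Fq -> k2})
    (j : {rmorphism k1 -> k2})
    (W1 : relwitt OF i1) (W2 : relwitt OF i2) := WittMap {
  wmapO : {rmorphism oring W1 -> oring W2};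
  wmap : {rmorphism fld W1 -> fld W2};
  wmap_emb : forall w, wmap (emb W1 w) = emb W2 (wmapO w);
  wmap_res : forall w, res W2 (wmapO w) = j (res W1 w);
  wmap_str : forall a, wmapO (wstr W1 a) = wstr W2 a;
  wmap_frob : forall x, wmap (frob W1 x) = frob W2 (wmap x)
}.

Section Lattices.
Variables (k : fieldType) (K : cdvf k) (n : nat).
Local Notation V := 'rV[fld K]_n.

Definition integral (x : fld K) : Prop := exists w, x = emb K w.

(** The reduction of an integral element (a junk value on other elements). *)
Definition red (x : fld K) : k := res K (xget 0 [set w | emb K w = x]).

Definition pi : fld K := emb K (unif K).

Definition is_lattice (L : set V) : Prop :=
  exists2 e : 'M[fld K]_n, e \in unitmx &
    L = [set v | exists c : 'rV[oring K]_n, v = map_mx (emb K) c *m e].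

Definition scale (a : fld K) (L : set V) : set V := [set a *: v | v in L].

Definition simple_ext (L B : set V) : Prop :=
  exists x, [/\ B x, ~ L x, L (pi *: x) &
    B = [set y | exists a c, L a /\ y = a + emb K c *: x]].

(** [colen h A B]: [A] is contained in [B] and [B / A] has a composition series
    of length [h] (for a submodule [A]). *)
Fixpoint colen (h : nat) (A B : set V) : Prop :=
  if h is h'.+1 then exists2 L, colen h' A L & simple_ext L B else A = B.

Definition len (A B : set V) : nat := xget 0%N [set h | colen h A B].

(** The form [{v, w} = v H (w ^ s)^T], left linear and right [s]-semilinear. *)
Definition herm (s : fld K -> fld K) (H : 'M[fld K]_n) (v w : V) : fld K :=
  (v *m H *m (map_mx s w)^T) 0 0.

Definition dual s H (A : set V) : set V :=
  [set v | forall a, A a -> integral (herm s H v a)].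

(** The rows of [b] lie in [L] and reduce to a basis of the [k]-vector space
    [L / L'] (where [pi L] is contained in [L']). *)
Definition lifts_basis d (L L' : set V) (b : 'M[fld K]_(d, n)) : Prop :=
  [/\ forall i, L (row i b),
      forall v, L v -> exists c : 'rV[oring K]_d, L' (v - map_mx (emb K) c *m b)
    & forall c : 'rV[oring K]_d,
        L' (map_mx (emb K) c *m b) <-> map_mx (res K) c = 0].

End Lattices.

(** Classical varieties over an algebraically closed field, as sets of points
    with a topology and a sheaf of [k]-valued functions.  Only the values of
    [phi] on [U] matter in [reg X U phi]. *)

Record swf (k : fieldType) (T : Type) := SWF {
  pts : set T;
  opn : set (set T);
  reg : set T -> set (T -> k)
}.

(** The structure induced on a subset. *)
Definition sub_swf k T (X : swf k T) (S : set T) : swf k T := {|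
  pts := pts X `&` S;
  opn := [set V | exists2 U, opn X U & V = U `&` S];
  reg := fun V => [set psi | forall x, V x -> exists U phi,
    [/\ opn X U, U x, reg X U phi & forall y, U y -> V y -> psi y = phi y]]
|}.

Definition swf_morphism k T1 T2 (X : swf k T1) (Y : swf k T2) (f : T1 -> T2)
    : Prop :=
  [/\ forall x, pts X x -> pts Y (f x),
      forall V, opn Y V -> opn X (pts X `&` f @^-1` V)
    & forall V phi, opn Y V -> reg Y V phi ->
        reg X (pts X `&` f @^-1` V) (phi \o f)].

Definition swf_iso k T1 T2 (X : swf k T1) (Y : swf k T2) (f : T1 -> T2)
    : Prop :=
  swf_morphism X Y f /\
  exists g : T2 -> T1, [/\ swf_morphism Y X g,
    forall x, pts X x -> g (f x) = x & forall y, pts Y y -> f (g y) = y].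

Section FlagVariety.
Variables (k : fieldType) (T : Type) (d : T -> nat) (D : T -> seq nat).

Definition frame := forall t, 'M[k]_(d t).

Definition flagfam := forall t, seq {vspace 'rV[k]_(d t)}.

(** The points of the product over [t] of the varieties of flags in [k ^ (d t)]
    with members of dimensions [D t], a nondecreasing list.  Repeated dimensions
    and the dimension [d t] are allowed; they do not change the variety. *)
Definition is_flag (x : flagfam) : Prop :=
  forall t, [seq \dim U | U <- x t] = D t /\ sorted (fun U W => (U <= W)%VS) (x t).

Inductive polyfun : (frame -> k) -> Prop :=
| poly_const c : polyfun (fun=> c)
| poly_coord t i j : polyfun (fun g => g t i j)
| poly_add p r : polyfun p -> polyfun r -> polyfun (fun g => p g + r g)
| poly_mul p r : polyfun p -> polyfun r -> polyfun (fun g => p g * r g).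

Definition in_GL (g : frame) : Prop := forall t, g t \in unitmx.

Definition flag_of (g : frame) : flagfam := fun t =>
  [seq <<[seq row i (g t) | i : 'I_(d t) <- enum 'I_(d t) & (i < x)%N]>>%VS | x <- D t].

(** Flag varieties are the quotients of [G = prod_t GL_(d t)] by the parabolic
    subgroups: closed sets and regular functions are those whose pullback along
    [flag_of] is closed, respectively regular, on [G]. *)
Definition flag_closed (Z : set flagfam) : Prop :=
  Z `<=` is_flag /\
  exists2 S : set (frame -> k), S `<=` polyfun &
    forall g, in_GL g -> (Z (flag_of g) <-> forall p, S p -> p g = 0).

Definition flag_closure (Y : set flagfam) : set flagfam :=
  [set x | forall Z, flag_closed Z -> Y `<=` Z -> Z x].

Definition flag_variety : swf k flagfam := {|
  pts := is_flag;
  opn := [set U | U `<=` is_flag /\ flag_closed (is_flag `\` U)];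
  reg := fun U => [set phi | forall g, in_GL g -> U (flag_of g) ->
    exists p r, [/\ polyfun p, polyfun r, r g != 0 &
      forall g', in_GL g' -> U (flag_of g') -> r g' != 0 ->
        phi (flag_of g') = p g' / r g']]
|}.

End FlagVariety.

Section DeligneLusztig.
Variables (k : fieldType) (q : nat).

Definition vspace_of d (S : set 'rV[k]_d) : {vspace 'rV[k]_d} :=
  xget 0%VS [set U : {vspace 'rV[k]_d} | forall v, v \in U <-> S v].

(** The form with matrix [P], left linear and right [q]-Frobenius linear. *)
Definition qform d1 d2 (P : 'M[k]_(d1, d2)) (v : 'rV[k]_d1) (u : 'rV[k]_d2) : k :=
  (v *m P *m (map_mx (fun x => x ^+ q) u)^T) 0 0.

Definition perp d1 d2 (P : 'M[k]_(d1, d2)) (U : {vspace 'rV[k]_d2})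
    : {vspace 'rV[k]_d1} :=
  vspace_of [set v | forall u, u \in U -> qform P v u = 0].

(** [C x] is the member of dimension [x], for [0 <= x <= d]. *)
Definition complete_flag d (C : nat -> {vspace 'rV[k]_d}) : Prop :=
  (forall x, (x <= d)%N -> \dim (C x) = x) /\
  (forall x y, (x <= y <= d)%N -> (C x <= C y)%VS).

Definition refines d (C : nat -> {vspace 'rV[k]_d}) (Fl : seq {vspace 'rV[k]_d})
    : Prop :=
  forall U, U \in Fl -> exists2 x, (x <= d)%N & U = C x.

Definition perp_flag d1 d2 (P : 'M[k]_(d1, d2)) (C : nat -> {vspace 'rV[k]_d2})
    : nat -> {vspace 'rV[k]_d1} :=
  fun x => perp P (C (d2 - x)%N).

Definition simple_refl (i x : nat) : nat :=
  if x == i then i.+1 else if x == i.+1 then i else x.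

(** The word [:: i_1; ...; i_r] stands for [s_(i_1) ... s_(i_r)], a composite of
    functions of [{1, ..., d}] (the last reflection acts first). *)
Definition word_act (w : seq nat) (x : nat) : nat := foldr simple_refl x w.

Definition relpos d (C C' : nat -> {vspace 'rV[k]_d}) (w : seq nat) : Prop :=
  exists e : nat -> 'rV[k]_d,
    basis_of fullv [seq e i | i <- iota 1 d] /\
    forall x, (x <= d)%N ->
      C x = <<[seq e i | i <- iota 1 x]>>%VS /\
      C' x = <<[seq e (word_act w i) | i <- iota 1 x]>>%VS.

(** Kind (U), for the hermitian form with matrix [P]. *)
Definition XU d (P : 'M[k]_d) (w : seq nat) (Fl : seq {vspace 'rV[k]_d}) : Prop :=
  exists C, [/\ complete_flag C, refines C Fl & relpos C (perp_flag P C) w].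

(** Kind (GL), for the pairing of [V1] and [V2] with matrix [P]; the reversed
    pairing [[v, w] = (w, v) ^ q] on [V2 x V1] has matrix [(P ^ q)^T]. *)
Definition XGL d1 d2 (P : 'M[k]_(d1, d2)) (w w' : seq nat)
    (Fl1 : seq {vspace 'rV[k]_d1}) (Fl2 : seq {vspace 'rV[k]_d2}) : Prop :=
  exists C1 C2,
    [/\ complete_flag C1 /\ refines C1 Fl1, complete_flag C2 /\ refines C2 Fl2,
        relpos C1 (perp_flag P C2) w
      & relpos C2 (perp_flag (map_mx (fun x => x ^+ q) P)^T C1) w'].

End DeligneLusztig.

(** The distinct dimensions [k_1 + 1 < ... < k_r + 1] smaller than [d]. *)
Definition proper_dims (d : nat) (ds : seq nat) : seq nat :=
  [seq x <- undup ds | (x < d)%N].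

(** [dim_at d ds i = k_i + 1], with [k_(r+1) + 1 = d]. *)
Definition dim_at (d : nat) (ds : seq nat) (i : nat) : nat :=
  nth d (proper_dims d ds) i.-1.

(** [r - 1] if [l > 1], and [r] if [l = 1]. *)
Definition r_zero (l d : nat) (ds : seq nat) : nat :=
  (size (proper_dims d ds) - (1 < l))%N.

Definition tuple_ok (d : nat) (ds : seq nat) (r0 : nat) (t : nat -> nat) : Prop :=
  forall i, (1 <= i <= r0)%N -> (t i <= dim_at d ds i.+1 - dim_at d ds i)%N.

(** [w_1 ... w_(r0) s_a ... s_(d-1)], with [w_i = s_(k_i + 1) ... s_(k_i + t_i)]. *)
Definition word (d : nat) (ds : seq nat) (r0 : nat) (t : nat -> nat) (a : nat)
    : seq nat :=
  flatten [seq iota (dim_at d ds i) (t i) | i <- iota 1 r0] ++ iota a (d - a).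

(** [btLam0 X i] and [btLam1 X j] are meaningful for [i] in [I \ {0}] and [j] in
    [I \ {m}] only. *)
Record btdata (m : nat) (L : Type) := BTData {
  btI : {set 'I_m.+1};
  btLam0 : nat -> L;
  btLam1 : nat -> L
}.

(** The elements [i_1 < ... < i_s] of [I], and [i_j] for [1 <= j <= s]. *)
Definition elts m L (X : btdata m L) : seq nat := [seq val i | i <- enum (btI X)].
Definition elt m L (X : btdata m L) (j : nat) : nat := nth 0%N (elts X) j.-1.

Variant factor_kind := Point | KindA | KindB | KindC.

Section Strata.
Variables (Fq : finFieldType) (OF : cdvf Fq) (Fq2 : finFieldType)
  (i1 : {rmorphism Fq -> Fq2}) (k : fieldType) (i2 : {rmorphism Fq -> k})
  (j12 : {rmorphism Fq2 -> k}) (W2 : relwitt OF i1) (Wk : relwitt OF i2)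
  (u : wittmap j12 W2 Wk).
Variables (n m : nat) (h : nat -> nat) (H : 'M[fld W2]_n).

(** [C] with its form, and [C_k]; a basis of [C] has been chosen. *)
Local Notation C := 'rV[fld W2]_n.
Local Notation Ck := 'rV[fld Wk]_n.
Local Notation pi2 := (pi W2).
Local Notation pik := (pi Wk).
Local Notation q := #|Fq|.

Definition dualC (A : set C) : set C := dual (frob W2) H A.
Definition dualCk (A : set Ck) : set Ck := dual (frob Wk) (map_mx (wmap u) H) A.

(** [L (x) W_{O_F}(k)], as a submodule of [C_k]. *)
Definition extend (L : set C) : set Ck :=
  [set v | exists r (c : 'rV[oring Wk]_r) (b : 'M[fld W2]_(r, n)),
    (forall i, L (row i b)) /\ v = map_mx (emb Wk) c *m map_mx (wmap u) b].

(** A [k]-point of the moduli space of chains of isogenies of strict formal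
    [O_F]-modules, given by Dieudonne lattices [M_m < ... < M_1], is recorded by
    the chain [A_m < ... < A_1 < B_1 < ... < B_m] where [A_i] is the degree 0
    part of [M_i] and [B_i] the dual of its degree 1 part.  A chain is encoded as
    the function [i |-> (A_i, B_i)].  Values for [i] outside
    [{1, ..., m}] are normalized so that equality of functions is equality of
    chains. *)
Definition chain := nat -> set Ck * set Ck.
Definition chA (c : chain) i := (c i).1.
Definition chB (c : chain) i := (c i).2.

Definition Npoint : set chain := [set c |
  [/\ forall i, (i == 0%N) || (m < i)%N -> c i = (set0, set0),
      forall i, (1 <= i <= m)%N -> is_lattice (chA c i) /\ is_lattice (chB c i),
      forall i, (1 <= i < m)%N ->
        chA c i.+1 `<=` chA c i /\ chB c i `<=` chB c i.+1
    & forall i, (1 <= i <= m)%N ->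
        [/\ colen 1 (scale pik (dualCk (chA c i))) (chB c i),
            chB c i `<=` dualCk (chA c i),
            colen 1 (scale pik (dualCk (chB c i))) (chA c i),
            chA c i `<=` dualCk (chB c i)
          & scale pik (chB c i) `<=` chA c i /\ colen (h i) (chA c i) (chB c i)]]].

(** The vertex lattices [L_e], and their types. *)
Definition vertex (e : nat) (L : set C) : Prop :=
  [/\ is_lattice L, scale (pi2 ^+ e.+1) (dualC L) `<=` L
    & L `<=` scale (pi2 ^+ e) (dualC L)].

Definition vtype (e : nat) (L : set C) : nat := len (scale (pi2 ^+ e.+1) (dualC L)) L.

Definition is_bt (X : btdata m (set C)) : Prop :=
  [/\ [/\ btI X != finset.set0, h 1%N = 0%N -> 0%N \notin elts X
        & h m = n -> m \notin elts X],
      forall i, i \in elts X -> i != 0%N ->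
        vertex 0 (btLam0 X i) /\ (h i + 1 <= vtype 0 (btLam0 X i))%N,
      forall j, j \in elts X -> j != m ->
        vertex 1 (btLam1 X j) /\ (n - h j.+1 + 1 <= vtype 1 (btLam1 X j))%N,
      forall i, i \in elts X -> i != 0%N -> i != m ->
        btLam0 X i `<=` scale pi2 (dualC (btLam1 X i))
    & forall j, (1 <= j < #|btI X|)%N ->
        scale pi2 (dualC (btLam1 X (elt X j))) `<=` btLam0 X (elt X j.+1)].

Definition bt_le (X' X : btdata m (set C)) : Prop :=
  [/\ btI X \subset btI X',
      forall i, i \in elts X -> i != 0%N -> btLam0 X' i `<=` btLam0 X i
    & forall j, j \in elts X -> j != m -> btLam1 X' j `<=` btLam1 X j].

Definition bt_lt (X' X : btdata m (set C)) : Prop := bt_le X' X /\ ~ bt_le X X'.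

Definition N_pts (X : btdata m (set C)) : set chain := [set c |
  [/\ Npoint c,
      forall i, i \in elts X -> i != 0%N -> chB c i `<=` extend (btLam0 X i)
    & forall j, j \in elts X -> j != m -> chA c j.+1 `<=` extend (btLam1 X j)]].

Definition N0_pts (X : btdata m (set C)) : set chain := [set c |
  N_pts X c /\ forall X', is_bt X' -> bt_lt X' X -> ~ N_pts X' c].

Variable X : btdata m (set C).
Local Notation s := #|btI X|.
Local Notation i_ := (elt X).
Local Notation Lam0 := (btLam0 X).
Local Notation Lam1 := (btLam1 X).
Local Notation dh a b := ((h b - h a)%N./2).

(** The factors are indexed by [0 <= j <= s]: (a) for [j = 0], (b) for [j = s]
    and (c) otherwise.  A factor that does not occur is a point. *)
Definition kind (j : nat) : factor_kind :=
  if j == 0%N then (if i_ 1 == 0%N then Point else KindA)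
  else if j == s then (if i_ s == m then Point else KindB)
  else KindC.

(** Each factor has two spaces, [(j, false)] and [(j, true)]: they are [V1] and
    [V2] in case (c); otherwise the second one is zero. *)
Definition fspace : Type := ('I_s.+1 * bool)%type.

(** The space indexed by [t] is [top t / bot t]. *)
Definition top (t : fspace) : set C :=
  match kind t.1, t.2 with
  | KindA, false => Lam0 (i_ 1)
  | KindB, false => Lam1 (i_ s)
  | KindC, false => scale pi2 (Lam0 (i_ t.1.+1))
  | KindC, true => Lam1 (i_ t.1)
  | _, _ => [set 0]
  end.

Definition bot (t : fspace) : set C :=
  match kind t.1, t.2 with
  | KindA, false => scale pi2 (dualC (Lam0 (i_ 1)))
  | KindB, false => scale (pi2 ^+ 2) (dualC (Lam1 (i_ s)))
  | KindC, false => scale (pi2 ^+ 2) (dualC (Lam1 (i_ t.1)))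
  | KindC, true => scale pi2 (dualC (Lam0 (i_ t.1.+1)))
  | _, _ => [set 0]
  end.

Definition sdim (t : fspace) : nat := len (bot t) (top t).

(** The number [l] with [t(L) = 2 (l - 1) + a + 1]. *)
Definition ell (e : nat) (L : set C) (a : nat) : nat := ((vtype e L - a.+1)./2).+1.

Definition ellA : nat := ell 0 (Lam0 (i_ 1)) (h (i_ 1)).
Definition ellB : nat := ell 1 (Lam1 (i_ s)) (n - h (i_ s).+1).
Definition ell1 (j : nat) : nat := ell 1 (Lam1 (i_ j)) (n - h (i_ j).+1).
Definition ell0 (j : nat) : nat := ell 0 (Lam0 (i_ j.+1)) (h (i_ j.+1)).

(** Dimensions of the members, in increasing order: [U_(i_1), ..., U_1, W_1, ...,
    W_(i_1)] in (a), [W_1, ..., W_(m - i_s), U_(m - i_s), ..., U_1] in (b), and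
    [W_1, ..., W_N] and [U_N, ..., U_1] in (c). *)
Definition sdims (t : fspace) : seq nat :=
  match kind t.1, t.2 with
  | KindA, false =>
      let r := iota 1 (i_ 1) in
      [seq (ellA + dh i (i_ 1))%N | i <- rev r] ++
      [seq (ellA + (h (i_ 1) + h i)./2)%N | i <- r]
  | KindB, false =>
      let r := iota 1 (m - i_ s) in
      let a := (i_ s).+1 in
      [seq (ellB + dh a (i_ s + i)%N)%N | i <- r] ++
      [seq (ellB + (n - h a) - dh a (i_ s + i)%N)%N | i <- rev r]
  | KindC, false =>
      [seq (ell1 t.1 + dh (i_ t.1).+1 (i_ t.1 + i)%N)%N
         | i <- iota 1 (i_ t.1.+1 - i_ t.1)]
  | KindC, true =>
      [seq (ell0 t.1 + dh (i_ t.1 + i)%N (i_ t.1.+1))%N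
         | i <- rev (iota 1 (i_ t.1.+1 - i_ t.1))]
  | _, _ => [::]
  end.

(** Bases of all the spaces, lifted to [C]. *)
Variable b : forall t : fspace, 'M[fld W2]_(sdim t, n).

Definition lifts_bases : Prop := forall t, lifts_basis (top t) (bot t) (b t).

(** The matrix of the form induced by [a {., .}] on a pair of spaces. *)
Definition gram (a : fld W2) (t t' : fspace) : 'M[k]_(sdim t, sdim t') :=
  \matrix_(i, j) j12 (red (a * herm (frob W2) H (row i (b t)) (row j (b t')))).

Definition ffam (j : 'I_s.+1) := flagfam k (fun e : bool => sdim (j, e)).
Definition fflag (j : 'I_s.+1) : set (ffam j) :=
  @is_flag k bool (fun e : bool => sdim (j, e)) (fun e => sdims (j, e)).

(** The variety [X_J{w}] of kind (U), resp. [X_J{(w, w')}] of kind (GL), in the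
    flag variety of the [j]-th factor ([w'] is not used in kind (U)). *)
Definition XJ (j : 'I_s.+1) (w w' : seq nat) : set (ffam j) :=
  [set x | fflag x /\
    match kind j with
    | Point => True
    | KindA => XU q (gram 1 (j, false) (j, false)) w (x false)
    | KindB => XU q (gram pi2^-1 (j, false) (j, false)) w (x false)
    | KindC => XGL q (gram pi2^-1 (j, false) (j, true)) w w' (x false) (x true)
    end].

Definition Xfactor (j : 'I_s.+1) : set (ffam j) :=
  let d := sdim (j, false) in
  let d' := sdim (j, true) in
  flag_closure (fun e : bool => sdims (j, e))
    match kind j with
    | Point => XJ [::] [::]
    | KindA => XJ (iota ellA (d - ellA)) [::]
    | KindB => XJ (iota ellB (d - ellB)) [::]
    | KindC => XJ (iota (ell1 j) (d - ell1 j)) (iota (ell0 j) (d' - ell0 j))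
    end.

Definition X0factor (j : 'I_s.+1) : set (ffam j) :=
  let d := sdim (j, false) in
  let d' := sdim (j, true) in
  let ds := sdims (j, false) in
  let ds' := sdims (j, true) in
  match kind j with
  | Point => XJ [::] [::]
  | KindA =>
      let r0 := r_zero ellA d ds in
      [set x | exists t,
        [/\ tuple_ok d ds r0 t,
            forall i, (1 <= i <= i_ 1 - 1)%N ->
              (dh (i_ 1 - i)%N (i_ 1 - i).+1 <= t i + t (r0 + 1 - i))%N,
            h 1%N != 0%N -> (h 1%N <= 2 * t (i_ 1))%N
          & XJ (word d ds r0 t (ellA + h (i_ 1))) [::] x]]
  | KindB =>
      let r0 := r_zero ellB d ds in
      [set x | exists t,
        [/\ tuple_ok d ds r0 t,
            forall i, (1 <= i <= m - 1 - i_ s)%N ->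
              (dh (i_ s + i)%N (i_ s + i).+1 <= t i + t (r0 + 1 - i))%N,
            h m != n -> (n - h m <= 2 * t (m - i_ s))%N
          & XJ (word d ds r0 t (ellB + (n - h (i_ s).+1))) [::] x]]
  | KindC =>
      let r0 := r_zero (ell0 j) d ds in
      let r0' := r_zero (ell1 j) d' ds' in
      [set x | exists t t',
        [/\ tuple_ok d ds r0 t, tuple_ok d' ds' r0' t',
            forall i, (1 <= i <= i_ j.+1 - i_ j - 1)%N ->
              (dh (i_ j + i)%N (i_ j + i).+1 <= t i + t' (r0' + 1 - i))%N
          & XJ (word d ds r0 t (d - ell0 j + 1))
               (word d' ds' r0' t' (d' - ell1 j + 1)) x]]
  end.

Definition Xfam := flagfam k sdim.

Definition X_ambient : swf k Xfam := @flag_variety k fspace sdim sdims.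

Definition X_pts : set Xfam :=
  [set x | forall j, Xfactor (fun e : bool => x (j, e))].
Definition X0_pts : set Xfam :=
  [set x | forall j, X0factor (fun e : bool => x (j, e))].

(** The lattices between [(bot t)_k] and [(top t)_k] giving the members. *)
Definition members (c : chain) (t : fspace) : seq (set Ck) :=
  match kind t.1, t.2 with
  | KindA, false =>
      let r := iota 1 (i_ 1) in
      [seq chA c i | i <- rev r] ++ [seq chB c i | i <- r]
  | KindB, false =>
      let r := iota 1 (m - i_ s) in
      [seq scale pik (chB c (i_ s + i)) | i <- r] ++
      [seq chA c (i_ s + i) | i <- rev r]
  | KindC, false =>
      [seq scale pik (chB c (i_ t.1 + i)) | i <- iota 1 (i_ t.1.+1 - i_ t.1)]
  | KindC, true =>
      [seq chA c (i_ t.1 + i) | i <- rev (iota 1 (i_ t.1.+1 - i_ t.1))]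
  | _, _ => [::]
  end.

(** The subspace [L / (bot t)_k] of [(top t)_k / (bot t)_k], in coordinates. *)
Definition reduction (t : fspace) (L : set Ck) : {vspace 'rV[k]_(sdim t)} :=
  vspace_of [set v | exists c : 'rV[oring Wk]_(sdim t),
    map_mx (res Wk) c = v /\ L (map_mx (emb Wk) c *m map_mx (wmap u) (b t))].

Definition f_map (c : chain) : Xfam := fun t =>
  [seq reduction t L | L <- members c t].

End Strata.

(* Main.v *)
(** A point of [N_(I, Lam)] lies in the open stratum iff no lattice of [C] refines
    a lattice of [Lam] and no index can be added to [I] ([open_point]).  Modulo
    the lattices [bot t], the lattices of [C] which could do so are the
    Frobenius-stable subspaces lying above a member of one flag and below the
    orthogonal of a member of the other: reduced echelon bases descend them.

    On the other side, relative position [w], for an increasing word [w], means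
    that [C' x <= C (x + 1)] for all [x], with [C' x = C x] iff [x] is not in [w].
    Thus the conditions on the [t_i] say that the flags refine to complete flags
    that are completely mixed by Frobenius in each gap, which excludes stable
    subspaces there.  Conversely, a gap without stable subspace is filled from
    both ends by orthogonals; when neither end moves, a fixed vector of a
    semilinear map (Lang), isotropic in the self-dual gap, splits off a line.

    Every flag satisfying these conditions lifts, factor by factor, to a piece of
    a lattice chain, and the pieces glue along the lattices of the index; this
    shows that the strata correspond to each other. *)

Require Import Defs.
From HB Require Import structures.
From mathcomp Require Import all_boot all_order all_algebra all_field.
From mathcomp Require Import boolp classical_sets.
From mathcomp Require Import zify ring.

Set Implicit Arguments.
Unset Strict Implicit.
Unset Printing Implicit Defensive.

Import GRing.Theory.
Local Open Scope classical_set_scope.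
Local Open Scope ring_scope.

(** * Orthogonality for Frobenius-sesquilinear forms *)

(* [\dim U] lives in a canonical structure over [nat] that [lia] does not see
   through; the other hypotheses slow it down. *)
Ltac dlia :=
  intros;
  repeat (match goal with
  | H : context [@dimv _ _ _] |- _ => revert H
  | H : is_true (leq _ _) |- _ => revert H
  | H : is_true (andb (leq _ _) _) |- _ => revert H
  | H : is_true (negb (leq _ _)) |- _ => revert H
  | H : is_true (leq _ _) -> _ |- _ => revert H
  | H : is_true (andb (leq _ _) _) -> _ |- _ => revert H
  | H : is_true (negb (_ == _ :> nat)) |- _ => revert H
  | H : @eq nat _ _ |- _ => revert H
  end);
  unfold reverse_coercion;
  repeat (match goal with |- context [@dimv ?F ?V ?U] => generalize (@dimv F V U : nat) end);
  clear; intros;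
  repeat (match goal with
  | _ : context [@Algebra.zero ?T] |- _ => change (@Algebra.zero T) with 0%N in *
  | |- context [@Algebra.zero ?T] => change (@Algebra.zero T) with 0%N in *
  end);
  repeat (match goal with
  | H : @eq ?T ?x ?y |- _ =>
      tryif constr_eq T nat then fail else (unify T nat; change (@eq nat x y) in H)
  | |- @eq ?T ?x ?y =>
      tryif constr_eq T nat then fail else (unify T nat; change (@eq nat x y))
  end); lia.

(** The isomorphism of the closed varieties is given, so only points remain: a chain of [N_pts] lies
    in [N0_pts] iff its flags lie in [X0_pts], and [X0_pts] lies in [X_pts]. The second inclusion is
    not read off from closures of Bruhat cells: a flag in [X0_pts] is lifted to a chain, and [f_map]
    sends chains of [N_pts] into [X_pts]. Over [k] the form is only Frobenius-sesquilinear, so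
    taking orthogonals twice is not the identity but the twist by the square of Frobenius. This one
    operation carries the dictionary: a subspace comes from a lattice of [C] iff it equals its
    double orthogonal, and the words measure how far a flag is from its orthogonal flag. What shapes
    the combinatorics is that a gap and its dual gap must be filled at the same time, each filling
    being tested against the orthogonals of the other. This couples the numbers t_i in pairs. In
    kind (U) the middle gap is its own dual, so it grows from both ends at once, and this is where
    isotropic lines come in. *)

Lemma dim_fullrV (k : fieldType) d : \dim (fullv : {vspace 'rV[k]_d}) = d.
Proof. by rewrite dimvf; exact: mul1n. Qed.

Lemma dim_rV (k : fieldType) d (U : {vspace 'rV[k]_d}) : (\dim U <= d)%N.
Proof. by rewrite -[X in (_ <= X)%N](dim_fullrV k) dimvS ?subvf. Qed.

Section Perp.
Variables (k : fieldType) (q : nat) (sg : {rmorphism k -> k}).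
Hypothesis sgE : forall x, sg x = x ^+ q.

Lemma vspace_ofP d (S : set 'rV[k]_d) (U : {vspace 'rV[k]_d}) :
  (forall v, v \in U <-> S v) -> forall v, v \in vspace_of S <-> S v.
Proof.
move=> HU; rewrite /vspace_of.
pose A := [set U0 : {vspace 'rV[k]_d} | forall v, v \in U0 <-> S v].
by apply: (@xgetPex _ 0%VS A); exists U.
Qed.

(** A free family of maximal size inside [S] spans [S], since any further vector of [S] would
    enlarge it; sizes are bounded by the dimension of the ambient space. This is what makes the
    value chosen by [vspace_of] meaningful. *)
Lemma vspace_of_sub d (S : set 'rV[k]_d) : S 0 ->
  (forall a u v, S u -> S v -> S (a *: u + v)) -> forall v, v \in vspace_of S <-> S v.
Proof.
move=> S0 SD.
have Sspan X : (forall v, v \in X -> S v) -> forall v, v \in <<X>>%VS -> S v.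
  elim: X => [_ v|x X IH SX v]; first by rewrite span_nil memv0 => /eqP ->.
  rewrite span_cons => /memv_addP [_ /vlineP [a ->]] [w wX ->].
  apply: SD; first by apply: SX; rewrite mem_head.
  by apply: IH wX => y yX; apply: SX; rewrite in_cons yX orbT.
have [X [SX fX mX]] : exists X : seq 'rV[k]_d, [/\ forall v, v \in X -> S v, free X
    & forall Y : seq 'rV[k]_d, (forall v, v \in Y -> S v) -> free Y -> (size Y <= size X)%N].
  pose Q m := `[< exists X : seq 'rV[k]_d, [/\ forall v, v \in X -> S v, free X & size X = m] >].
  have exQ : exists m, Q m by exists 0%N; apply/asboolP; exists [::]; split; rewrite ?nil_free.
  have ubQ m : Q m -> (m <= dim 'rV[k]_d)%N.
    by move=> /asboolP [X [_ /eqP fX <-]]; rewrite -fX -dimvf dimvS ?subvf.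
  case: (ex_maxnP exQ ubQ) => m /asboolP [X [SX fX sX]] mm.
  by exists X; split=> // Y SY fY; rewrite sX; apply: mm; apply/asboolP; exists Y.
apply: (@vspace_ofP d S <<X>>%VS) => v; split=> [|Sv]; first exact: Sspan.
case: (boolP (v \in <<X>>%VS)) => // nvX.
have := mX (v :: X); rewrite /= ltnn => -> //; last by rewrite free_cons nvX.
by move=> w; rewrite in_cons => /orP [/eqP ->|/SX].
Qed.

Section One.
Variables (d1 d2 : nat) (P : 'M[k]_(d1, d2)).

Local Notation form := (qform q P).

Lemma qformE v u : form v u = (v *m P *m (map_mx sg u)^T) 0 0.
Proof. by rewrite /qform; congr ((_ *m _^T) _ _); apply/matrixP => i j; rewrite !mxE sgE. Qed.

Lemma qform_linl a v w u : form (a *: v + w) u = a * form v u + form w u.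
Proof. by rewrite !qformE !mulmxDl -!scalemxAl !mxE. Qed.

Lemma qform_linr a v u w : form v (a *: u + w) = sg a * form v u + form v w.
Proof.
rewrite !qformE map_mxD map_mxZ linearD linearZ mulmxDr -scalemxAr /=.
by rewrite mxE [X in X + _]mxE.
Qed.

Lemma qform0l u : form 0 u = 0. Proof. by rewrite qformE !mul0mx mxE. Qed.
Lemma qform0r v : form v 0 = 0. Proof. by rewrite qformE map_mx0 trmx0 mulmx0 mxE. Qed.
Lemma qformDl v w u : form (v + w) u = form v u + form w u.
Proof. by rewrite -[v]scale1r qform_linl mul1r scale1r. Qed.
Lemma qformDr v u w : form v (u + w) = form v u + form v w.
Proof. by rewrite -[u]scale1r qform_linr rmorph1 mul1r scale1r. Qed.
Lemma qformZl a v u : form (a *: v) u = a * form v u.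
Proof. by rewrite -[a *: v]addr0 qform_linl qform0l addr0. Qed.
Lemma qformZr a v u : form v (a *: u) = sg a * form v u.
Proof. by rewrite -[a *: u]addr0 qform_linr qform0r addr0. Qed.

Lemma mem_perp U v : v \in perp q P U <-> forall u, u \in U -> form v u = 0.
Proof.
apply: (@vspace_of_sub d1 [set v | forall u, u \in U -> form v u = 0]) => /=.
- by move=> u _; rewrite qform0l.
- by move=> a w x Hw Hx u uU; rewrite qform_linl Hw // Hx // mulr0 addr0.
Qed.

Lemma perpS (U W : {vspace 'rV[k]_d2}) : (U <= W)%VS -> (perp q P W <= perp q P U)%VS.
Proof.
move=> /subvP UW; apply/subvP => v /mem_perp Hv; apply/mem_perp => u uU.
exact/Hv/UW.
Qed.

Lemma perpD (U W : {vspace 'rV[k]_d2}) : perp q P (U + W) = (perp q P U :&: perp q P W)%VS.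
Proof.
apply/eqP; rewrite eqEsubv subv_cap !perpS ?addvSl ?addvSr //=.
apply/subvP => v; rewrite memv_cap => /andP [/mem_perp vU /mem_perp vW].
by apply/mem_perp => _ /memv_addP [x xU [y yW ->]]; rewrite qformDr vU ?vW ?addr0.
Qed.

Lemma mem_perp_line v u : v \in perp q P <[u]>%VS <-> form v u = 0.
Proof.
split=> [/mem_perp|H]; first by apply; rewrite memv_line.
by apply/mem_perp => _ /vlineP [a ->]; rewrite qformZr H mulr0.
Qed.

(** Invertibility stated through ranks: the two spaces of kind (GL) have dimension indices that are
    equal only propositionally ([nondeg_dim]). *)
Definition nondeg := row_free P && row_full P.

(** The orthogonal is the kernel of [v |-> v *m A], where [A] pairs [v] with the Frobenius twist of
    a basis of [U]. Frobenius preserves the rank of that basis, so the map is onto. *)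
Lemma dim_perp (U : {vspace 'rV[k]_d2}) : nondeg -> \dim (perp q P U) = (d1 - \dim U)%N.
Proof.
move=> /andP [_ Pfull].
pose B : 'M[k]_(\dim U, d2) := \matrix_i (vbasis U)`_i.
have Bfree : row_free B.
  rewrite -kermx_eq0; apply/rowV0P => v /sub_kermxP vB.
  have := basis_free (vbasisP U) => /freeP fU; apply/rowP => i; rewrite mxE.
  apply: (fU (fun i => v 0 i)).
  rewrite -[RHS]vB; apply/rowP => j; rewrite !mxE summxE.
  by apply: eq_bigr => l _; rewrite !mxE.
pose A : 'M[k]_(d1, \dim U) := P *m (map_mx sg B)^T.
have rA : row_full A.
  rewrite /row_full /A (eqmxMfull _ Pfull) mxrank_tr mxrank_map.
  by move: Bfree; rewrite /row_free.
have [A' AA'] := row_fullP rA.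
pose f : {linear 'rV[k]_d1 -> 'rV[k]_(\dim U)} := mulmxr A.
have kerE : perp q P U = lker (linfun f).
  apply/vspaceP => v; rewrite memv_ker lfunE /=; apply/idP/eqP => [/mem_perp H|H].
    apply/rowP => j; rewrite /A mulmxA !mxE -[RHS](H (vbasis U)`_j); last first.
      by apply: vbasis_mem; rewrite mem_nth ?size_tuple.
    rewrite qformE mxE; apply: eq_bigr => l _; rewrite !mxE //.
  apply/mem_perp => u /coord_vbasis ->.
  elim/big_ind: _ => [|x y Hx Hy|i _]; first by rewrite qform0r.
    by rewrite qformDr Hx Hy addr0.
  rewrite qformZr; apply/eqP; rewrite mulf_eq0; apply/orP; right; apply/eqP.
  transitivity ((v *m A) 0 i); last by rewrite H mxE.
  by rewrite qformE /A mulmxA !mxE; apply: eq_bigr => l _; rewrite !mxE.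
have := limg_ker_dim (linfun f) fullv; rewrite capfv -kerE.
have -> : limg (linfun f) = fullv.
  apply/eqP; rewrite eqEsubv subvf /=; apply/subvP => w _.
  apply/memv_imgP; exists (w *m A'); rewrite ?memvf // lfunE /= -mulmxA AA' mulmx1 //.
rewrite !dim_fullrV; exact: (canRL (addnK _)).
Qed.

End One.

Section Two.
Variables (d1 d2 : nat) (P1 : 'M[k]_(d1, d2)) (P2 : 'M[k]_(d2, d1)).
Hypotheses (P12 : P2 = (map_mx sg P1)^T) (ndeg1 : nondeg P1).

Lemma nondeg_dim : d1 = d2.
Proof. by move: ndeg1 => /andP [/eqP e1 /eqP e2]; exact: etrans (esym e1) e2. Qed.

Lemma nondeg_conj : nondeg P2.
Proof.
move: ndeg1; rewrite /nondeg P12 /row_free /row_full mxrank_tr mxrank_map.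
by rewrite andbC.
Qed.

Definition frob2 d (v : 'rV[k]_d) : 'rV[k]_d := map_mx sg (map_mx sg v).

(** Exchanging the arguments costs one Frobenius on the value and two on the vector that moves to
    the left. This is the source of all twists by [frob2]. *)
Lemma qform_conj v u : sg (qform q P1 v u) = qform q P2 (frob2 u) v.
Proof.
rewrite !qformE P12 /frob2; set w := map_mx sg u.
have mapE (M : 'M[k]_1) : sg (M 0 0) = (map_mx sg M) 0 0 by rewrite mxE.
have trE (M : 'M[k]_1) : M 0 0 = M^T 0 0 by rewrite mxE.
by rewrite mapE !map_mxM trE !trmx_mul -!map_trmx ?trmxK mulmxA.
Qed.

(** Under the hypothesis [U + W] has the same orthogonal as [W], hence the same dimension. *)
Lemma perp_reflect (U W : {vspace 'rV[k]_d2}) :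
  (perp q P1 W <= perp q P1 U)%VS -> (U <= W)%VS.
Proof.
move=> H; have := perpD P1 U W; have /capv_idPr -> := H.
move=> /(congr1 (fun X : {vspace _} => \dim X)); rewrite !dim_perp //.
have := dim_rV (U + W); have := dim_rV W; have dE := nondeg_dim => h1 h2 e.
have e' : \dim (U + W) = \dim W by dlia.
have -> : W = (U + W)%VS by apply/eqP; rewrite eqEdim addvSr e' leqnn.
by rewrite addvSl.
Qed.

End Two.
End Perp.

(** * Fixed vectors of injective semilinear maps *)

Section SemilinearFixed.
Variables (k : fieldType) (Q : nat) (s2 : {rmorphism k -> k}).
Hypothesis closedk : forall p : {poly k}, size p != 1%N -> exists x, root p x.
Hypotheses (s2E : forall x, s2 x = x ^+ Q) (Q_gt1 : (1 < Q)%N).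
Variables (V : vectType k) (phi : V -> V).
Hypothesis phiL : forall a v w, phi (a *: v + w) = s2 a *: phi v + phi w.

Lemma semilin0 : phi 0 = 0.
Proof.
have := phiL 1 0 0; rewrite !scale1r addr0 rmorph1 scale1r => /eqP.
by rewrite -subr_eq0 opprD addNKr oppr_eq0 => /eqP.
Qed.

Lemma semilinD v w : phi (v + w) = phi v + phi w.
Proof. by rewrite -[v in LHS]scale1r phiL rmorph1 scale1r. Qed.

Lemma semilinZ a v : phi (a *: v) = s2 a *: phi v.
Proof. by rewrite -[a *: v]addr0 phiL semilin0 addr0. Qed.

Lemma semilin_sum (I : Type) (r : seq I) (f : I -> V) :
  phi (\sum_(i <- r) f i) = \sum_(i <- r) phi (f i).
Proof. exact: (big_morph phi semilinD semilin0). Qed.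

(* With [phi^r v0 = sum a_i phi^i v0], the vector [sum x_i phi^i v0] is fixed as
   soon as [x_i = x_(i-1)^Q + a_i x^Q] and [x_(r-1) = x]: one equation in [x]. *)
Lemma semilin_fixed (L : {vspace V}) : L != 0%VS ->
  (forall v, v \in L -> phi v \in L) -> (forall v, v \in L -> phi v = 0 -> v = 0) ->
  exists2 v, v \in L & v != 0 /\ phi v = v.
Proof.
move=> L0 phiLL phi_inj; pose v0 := vpick L.
have v0L : v0 \in L by exact: memv_pick.
have v0n0 : v0 != 0 by rewrite vpick0.
pose ph i := iter i phi v0; have phL i : ph i \in L by elim: i => //= i /phiLL.
have ph0 i : ph i != 0.
  by elim: i => //= i; apply: contraNneq => /(phi_inj _ (phL i)) ->.
pose X n := [seq ph i | i <- iota 0 n].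
have exP : exists r, free (X r) by exists 0%N; rewrite nil_free.
have ubP r : free (X r) -> (r <= dim V)%N.
  move=> /eqP; rewrite size_map size_iota => <-.
  by rewrite -dimvf dimvS ?subvf.
case: (ex_maxnP exP ubP) => r fr mr.
have phr : ph r \in <<X r>>%VS.
  apply/negPn/negP => nin; have := mr r.+1; rewrite ltnn => H.
  suff : false by []; apply: H.
  have -> : X r.+1 = rcons (X r) (ph r) by rewrite /X -addn1 iotaD add0n map_cat cats1.
  by rewrite (perm_free (Y := ph r :: X r)) ?perm_rcons // free_cons nin.
have sX : size (X r) == r by rewrite size_map size_iota.
pose Xt := Tuple sX; pose a i := if insub i is Some j then coord Xt j (ph r) else 0.
have nthX i : (i < r)%N -> (X r)`_i = ph i.
  by move=> ir; rewrite (nth_map 0%N) ?size_iota // nth_iota.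
have phrE : ph r = \sum_(i < r) a i *: ph i.
  rewrite (coord_span (X := Xt) phr); apply: eq_bigr => i _.
  by rewrite /a valK /= nthX.
have r_gt0 : (0 < r)%N by case: (r) phrE (ph0 r) => // ->; rewrite big_ord0 eqxx.
(* [phi^r v0] is nonzero by injectivity, so some coefficient survives; it makes the polynomial below
   nonconstant. *)
have [i0 ai0] : exists i0 : 'I_r, a i0 != 0.
  apply: contrapT => H; have := ph0 r; rewrite phrE big1 ?eqxx // => i _.
  by have [->|n0] := eqVneq (a i) 0; [rewrite scale0r | case: H; exists i].
(* The closing equation divided by [x]: unrolling the recursion, it reads sum a_i^(Q^(r-1-i))
   x^(Q^(r-i)) = x. The constant term -1 forces every root to be nonzero. *)
pose p : {poly k} :=
  \sum_(i < r) (a i ^+ (Q ^ (r.-1 - i))) *: 'X^(Q ^ (r - i) - 1) - 1.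
have Qpos j : (0 < Q ^ j)%N by rewrite expn_gt0; lia.
have Qi (i : 'I_r) : (0 < Q ^ (r - i) - 1)%N.
  by have := ltn_exp2l 0 (r - i) Q_gt1; have := ltn_ord i; rewrite expn0; lia.
have p0 : p.[0] = -1.
  rewrite !hornerE horner_sum big1 ?add0r // => i _.
  by rewrite !hornerE expr0n; case: eqP (Qi i) => [->|] //; rewrite mulr0.
have [x px0] : exists x, root p x.
  apply: closedk; apply/negP => /eqP sp1.
  (* The exponents Q^(r-i) - 1 are pairwise distinct, so the term of index [i0] cannot cancel. *)
  have : p`_(Q ^ (r - i0) - 1) = 0 by apply: nth_default; rewrite sp1; exact: Qi.
  rewrite coefB coef_sum coef1 [in X in _ - X](gtn_eqF (Qi i0)) subr0.
  rewrite (bigD1 i0) //= coefZ coefXn eqxx mulr1 big1 => [|j ji0].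
    by rewrite addr0 => /eqP; rewrite expf_eq0 (negbTE ai0) andbF.
  rewrite coefZ coefXn; case: eqP => [e|]; last by rewrite mulr0.
  have e' : (Q ^ (r - i0) = Q ^ (r - j))%N by have := Qi i0; lia.
  move/eqP: e'; rewrite eqn_exp2l // => /eqP e'; case/eqP: ji0; apply: val_inj.
  by have := ltn_ord i0; have := ltn_ord j; rewrite /=; lia.
have xn0 : x != 0.
  by apply: contraTneq px0 => ->; rewrite /root p0 oppr_eq0 oner_eq0.
pose xs := fix xs i := if i is j.+1 then s2 (xs j) + a i * x ^+ Q else a 0%N * x ^+ Q.
have xsE i : xs i = \sum_(l < i.+1) a l ^+ (Q ^ (i - l)) * x ^+ (Q ^ (i - l).+1).
  elim: i => [|i IH]; first by rewrite big_ord1 /= subn0 expn0 expr1 expn1.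
  rewrite big_ord_recr /= subnn expn0 expr1 expn1 -/xs IH; congr (_ + _).
  rewrite rmorph_sum; apply: eq_bigr => l _; have li := ltn_ord l.
  rewrite rmorphM /= !s2E -!exprM -!expnSr subSn //; lia.
have xsr : xs r.-1 = x.
  rewrite xsE prednK //; move: px0; rewrite /root !hornerE horner_sum subr_eq0 => /eqP px.
  rewrite -[RHS]mul1r -px mulr_suml; apply: eq_bigr => l _.
  rewrite !hornerE -mulrA -exprSr; congr (_ * _ ^+ _).
  have -> : ((r.-1 - l).+1 = r - l)%N by have := ltn_ord l; lia.
  by have := Qpos (r - l)%N; lia.
exists (\sum_(i < r) xs i *: ph i).
  by apply: memv_suml => i _; apply: memvZ.
split.
  apply/eqP => w0; have /freeP fX : free Xt by [].
  have r1 : (r.-1 < r)%N by rewrite prednK.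
  have := fX (fun i => xs i) _ (Ordinal r1); rewrite /= xsr => H.
  case/eqP: xn0; apply: H; rewrite -[RHS]w0; apply: eq_bigr => i _.
  by rewrite nthX.
rewrite semilin_sum; case: (r) r_gt0 xsr phrE => // r' _ /= xsr phrE.
rewrite big_ord_recr [RHS]big_ord_recl /= xsr semilinZ -/(ph r'.+1) phrE s2E.
rewrite scaler_sumr big_ord_recl /= addrC -addrA; congr (_ + _).
  by rewrite scalerA mulrC.
rewrite -big_split; apply: eq_bigr => i _ /=.
by rewrite semilinZ scalerDl addrC scalerA mulrC.
Qed.
End SemilinearFixed.

(** * Pieces of complete flags and their extension at either end *)

Section Gap.
Variables (k : fieldType) (T1 T2 : vectType k).
Implicit Types (p : {vspace T2} -> {vspace T1}).

(* A piece [c] of a complete flag, between consecutive members [Q] and [Qp] of a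
   given flag; [c'] is the dual piece and [p] takes orthogonals. *)
Definition piece p n (Q Qp : {vspace T1}) (c : nat -> {vspace T1})
    (c' : nat -> {vspace T2}) t : Prop :=
  [/\ [/\ c 0%N = Q, c n = Qp & (t <= n)%N],
      forall x, (x <= n)%N -> \dim (c x) = (\dim Q + x)%N,
      forall x, (x < n)%N -> (c x <= c x.+1)%VS
    & forall x, (x < n)%N -> (p (c' (n - 1 - x)%N) <= c x.+1)%VS /\
        (p (c' (n - 1 - x)%N) = c x <-> (t <= x)%N)].

End Gap.

Definition pcons T (a : T) (c : nat -> T) x := if x is y.+1 then c y else a.
Definition prcons T n (c : nat -> T) (a : T) x := if (x < n)%N then c x else a.

(** In a self-dual gap one piece grows at both ends; it has to be read as the result of either order
    of extension. *)
Lemma pcons_prcons T n (a b : T) c :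
  pcons a (prcons n c b) = prcons n.+1 (pcons a c) b.
Proof. by apply/funext => -[|x] //=; rewrite /prcons ltnS. Qed.

Section Gap2.
Variables (k : fieldType) (T1 T2 : vectType k) (p : {vspace T2} -> {vspace T1}).

(** Orthogonality reverses inclusions, so a member added above [c] goes with a member [P] added
    below [c']. Only the topmost step is new; [t] may differ from [t'] as long as both describe the
    same old positions. *)
Lemma piece_prcons n Q Qn Qp c c' P t t' : piece p n Q Qn c c' t' ->
  (Qn <= Qp)%VS -> \dim Qp = (\dim Q + n.+1)%N -> (t <= n.+1)%N ->
  (forall x, (x < n)%N -> (t <= x)%N = (t' <= x)%N) ->
  (p P <= Qp)%VS -> (p P = Qn <-> (t <= n)%N) ->
  piece p n.+1 Q Qp (prcons n.+1 c Qp) (pcons P c') t.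
Proof.
move=> [[c0 cn _] dc mc pc] QQ dQ tn tt pPQ pPE; split.
- by rewrite /prcons /= ltnn.
- move=> x; rewrite leq_eqVlt => /orP [/eqP ->|xn]; rewrite /prcons ?ltnn ?xn //.
  by apply: dc; rewrite -ltnS.
- move=> x; rewrite ltnS leq_eqVlt => /orP [/eqP ->|xn].
    by rewrite /prcons ltnn ltnSn cn.
  by rewrite /prcons !ltnS xn ltnW // mc.
- move=> x; rewrite ltnS leq_eqVlt => /orP [/eqP ->|xn].
    by rewrite subn1 subnn /= /prcons ltnn ltnSn cn.
  rewrite subn1 /= /prcons !ltnS xn (ltnW xn).
  have -> : (n - x = (n - 1 - x).+1)%N by lia.
  by rewrite /= tt //; apply: pc.
Qed.

(** The mirror image: the new bottom step is mixed, because the orthogonal of the top of [c']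
    differs from [Q]. All old positions shift by one, so [t] becomes [t.+1]. *)
Lemma piece_pcons n Q Q1 Qp c c' P t : piece p n Q1 Qp c c' t ->
  (Q <= Q1)%VS -> \dim Q1 = (\dim Q).+1 ->
  (p (c' n) <= Q1)%VS -> p (c' n) <> Q ->
  piece p n.+1 Q Qp (pcons Q c) (prcons n.+1 c' P) t.+1.
Proof.
move=> [[c0 cn tn] dc mc pc] QQ dQ pPQ pPE; split.
- by [].
- by move=> [|x] /=; rewrite ?addn0 // ltnS => xn; rewrite dc // dQ; dlia.
- by move=> [|x] /=; [rewrite c0 | exact: mc].
- move=> [|x]; rewrite subn1 /= /prcons.
    by move=> _; rewrite subn0 ltnSn c0; split; [exact: pPQ | split=> [/pPE|]].
  rewrite ltnS => xn; have -> : (n - x.+1 < n.+1)%N by lia.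
  have -> : (n - x.+1 = n - 1 - x)%N by lia.
  exact: pc.
Qed.

End Gap2.

(** * The double orthogonal as a Frobenius twist *)

Section Duality.
Variables (k : fieldType) (q : nat) (sg : {rmorphism k -> k}).
Hypothesis sgE : forall x, sg x = x ^+ q.

(** [P2] is the matrix of the reversed pairing. The first two equations together say that the square
    of [sg] fixes all entries, that is, the pairing is defined over the field with q^2 elements. *)
Definition dual_pair d1 d2 (P1 : 'M[k]_(d1, d2)) (P2 : 'M[k]_(d2, d1)) :=
  [/\ P2 = (map_mx sg P1)^T, P1 = (map_mx sg P2)^T & nondeg P1].

Lemma dual_pair_sym d1 d2 (P1 : 'M[k]_(d1, d2)) (P2 : 'M[k]_(d2, d1)) :
  dual_pair P1 P2 -> dual_pair P2 P1.
Proof. by move=> [e1 e2 nd]; split=> //; exact: nondeg_conj e1 nd. Qed.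

Section Pair.
Variables (d1 d2 : nat) (P1 : 'M[k]_(d1, d2)) (P2 : 'M[k]_(d2, d1)).
Hypothesis dp : dual_pair P1 P2.
Local Notation p1 := (perp q P1).
Local Notation p2 := (perp q P2).
Let P12 : P2 = (map_mx sg P1)^T. Proof. by case: dp. Qed.
Let P21 : P1 = (map_mx sg P2)^T. Proof. by case: dp. Qed.
Let nd1 : nondeg P1. Proof. by case: dp. Qed.
Let nd2 : nondeg P2. Proof. by case: (dual_pair_sym dp). Qed.

Lemma dual_dim : d1 = d2. Proof. exact: nondeg_dim nd1. Qed.

Lemma dimp1 U : (\dim (p1 U) + \dim U = d1)%N.
Proof.
by rewrite (dim_perp sgE) // subnK //; have := dim_rV U; have := dual_dim; dlia.
Qed.

Lemma dimp2 U : (\dim (p2 U) + \dim U = d1)%N.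
Proof.
by rewrite (dim_perp sgE) //; have := dim_rV U; have := dual_dim; dlia.
Qed.

Lemma p1_reflect U W : (p1 W <= p1 U)%VS -> (U <= W)%VS.
Proof. exact: (perp_reflect sgE). Qed.
Lemma p2_reflect U W : (p2 W <= p2 U)%VS -> (U <= W)%VS.
Proof. exact: (perp_reflect sgE). Qed.

(** By [qform_conj], [frob2 sg v] is orthogonal to [w] iff [w] is orthogonal to [v] for the reversed
    pairing. So [p1 (p2 U)] is the twist of [U] by the square of Frobenius. *)
Lemma mem_tau U v : (frob2 sg v \in p1 (p2 U)) = (v \in U).
Proof.
have fr w : qform q P1 (frob2 sg v) w = sg (qform q P2 w v).
  by rewrite (qform_conj sgE P21).
apply/idP/idP => [/(mem_perp sgE) H|vU].
  rewrite memvE; apply: p2_reflect; apply/subvP => w wU; apply/(mem_perp_line sgE).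
  by apply: (fmorph_inj sg); rewrite -fr rmorph0 H.
apply/(mem_perp sgE) => w /(mem_perp sgE) Hw.
by rewrite fr Hw // rmorph0.
Qed.

Lemma dim_tau U : \dim (p1 (p2 U)) = \dim U.
Proof. by have := dimp1 (p2 U); have := dimp2 U; dlia. Qed.

(** Invariance under the square of Frobenius ([stableP]), phrased with orthogonals so that it can be
    compared directly with flags and their orthogonals. *)
Definition stable U := p1 (p2 U) = U.

Lemma stable_sub U : (p1 (p2 U) <= U)%VS -> stable U.
Proof. by move=> H; apply/eqP; rewrite eqEdim H dim_tau leqnn. Qed.

Lemma tau_add U v : p1 (p2 (U + <[v]>)) = (p1 (p2 U) + <[frob2 sg v]>)%VS.
Proof.
apply/esym/eqP; rewrite eqEdim subv_add; apply/andP; split.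
  apply/andP; split; first exact/(perpS sgE)/(perpS sgE)/addvSl.
  by rewrite -memvE mem_tau memvE addvSr.
rewrite dim_tau; case: (boolP (v \in U)) => vU.
  have /addv_idPl -> : (<[v]> <= U)%VS by [].
  by rewrite -dim_tau dimvS ?addvSl.
have v0 : frob2 sg v \notin p1 (p2 U) by rewrite mem_tau.
have : (\dim (p1 (p2 U) + <[frob2 sg v]>) > \dim U)%N.
  rewrite -(dim_tau U) ltn_neqAle dimvS ?addvSl // andbT.
  apply: contra v0 => /eqP e; have : (p1 (p2 U) == p1 (p2 U) + <[frob2 sg v]>)%VS.
    by rewrite eqEdim addvSl e leqnn.
  by move/eqP => ->; rewrite memvE addvSr.
have := dimv_sum_cap U <[v]>; rewrite dim_vline.
by case: (v != 0) => /=; dlia.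
Qed.

Lemma tau_min (U W : {vspace 'rV[k]_d1}) : (forall v, v \in U -> frob2 sg v \in W) -> (p1 (p2 U) <= W)%VS.
Proof.
rewrite -(span_basis (vbasisP U)); move: (vbasis U : seq _) => X.
elim: X => [_|v X IH H].
  rewrite span_nil; have : \dim (p1 (p2 0%VS)) = 0%N by rewrite dim_tau dimv0.
  by move/eqP; rewrite dimv_eq0 => /eqP ->; exact: sub0v.
rewrite span_cons addvC tau_add subv_add -memvE H ?andbT; last first.
  by rewrite span_cons memvE addvSl.
by apply: IH => w wX; apply: H; rewrite span_cons; apply: (subvP (addvSr _ _)).
Qed.

Lemma stableP (U : {vspace 'rV[k]_d1}) : (forall v, v \in U -> frob2 sg v \in U) <-> stable U.
Proof.
split=> [H|e v vU]; last by rewrite -e mem_tau.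
exact/stable_sub/tau_min.
Qed.

End Pair.
End Duality.

(** * Filling the gaps of a flag *)

Section Isotropic.
Variables (k : fieldType) (q : nat) (sg : {rmorphism k -> k}).
Hypothesis closedk : forall p : {poly k}, size p != 1%N -> exists x, root p x.
Hypotheses (sgE : forall x, sg x = x ^+ q) (q_gt1 : (1 < q)%N).

Let s2 : {rmorphism k -> k} := (sg \o sg).
Let s2E x : s2 x = x ^+ (q * q).
Proof. by rewrite /s2 /= !sgE exprM. Qed.
Let q2_gt1 : (1 < q * q)%N. Proof. by rewrite (leq_trans q_gt1) // leq_pmulr //; lia. Qed.

Lemma frob2L d a (v w : 'rV[k]_d) : frob2 sg (a *: v + w) = s2 a *: frob2 sg v + frob2 sg w.
Proof. by rewrite /frob2 !map_mxD !map_mxZ. Qed.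

(* A hermitian form of rank at least 2 over a finite field is isotropic: combine
   two orthogonal fixed vectors [x] and [y] into [l y + x]; the root [l] of the
   norm equation is automatically fixed by [s2]. *)
Lemma semilin_isotropic d (P : 'M[k]_d) (phi : 'rV[k]_d -> 'rV[k]_d) (L : {vspace 'rV[k]_d}) :
  dual_pair sg P P ->
  (forall a v w, phi (a *: v + w) = s2 a *: phi v + phi w) ->
  (forall v, v \in L -> phi v \in L) -> (forall v, v \in L -> phi v = 0 -> v = 0) ->
  (forall v w, v \in L -> w \in L -> qform q P (phi v) w = sg (qform q P w v)) ->
  (1 < \dim L)%N ->
  exists2 v, v \in L & [/\ v != 0, phi v = v & qform q P v v = 0].
Proof.
move=> dp phiL phiLL phi_inj phi_form dL.
have L0 : L != 0%VS by apply: contraTneq dL => ->; rewrite dimv0.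
have [x xL [x0 px]] := semilin_fixed closedk s2E q2_gt1 phiL L0 phiLL phi_inj.
have [fx0|fx0] := eqVneq (qform q P x x) 0; first by exists x.
pose L' := (L :&: perp q P <[x]>%VS)%VS.
have memL' y : y \in L' -> y \in L /\ qform q P y x = 0.
  by rewrite memv_cap => /andP [yL /(mem_perp_line sgE)].
have L'0 : L' != 0%VS.
  apply: contraTneq dL => e; have := dimv_sum_cap L (perp q P <[x]>%VS).
  rewrite -/L' e dimv0; have := dimp1 sgE dp <[x]>%VS; rewrite dim_vline x0 /=.
  by have := dim_rV (L + perp q P <[x]>%VS); dlia.
have xy y : y \in L -> qform q P y x = 0 -> qform q P x y = 0.
  by move=> yL H; rewrite -px phi_form // H rmorph0.
have phiL' y : y \in L' -> phi y \in L'.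
  move=> /memL' [yL yx]; rewrite memv_cap phiLL //=; apply/(mem_perp_line sgE).
  by rewrite phi_form // xy // rmorph0.
have [y yL' [y0 py]] := semilin_fixed closedk s2E q2_gt1 phiL L'0 phiL'
  (fun v vL' => phi_inj v (proj1 (memL' v vL'))).
have [yL yx] := memL' y yL'; have xy0 := xy y yL yx.
have [fy0|fy0] := eqVneq (qform q P y y) 0; first by exists y.
set al := qform q P x x in fx0; set ga := qform q P y y in fy0.
have al_fix : sg al = al by rewrite /al -phi_form // px.
have ga_fix : sg ga = ga by rewrite /ga -phi_form // py.
have [l lE] : exists l : k, l ^+ q.+1 = - al / ga.
  pose p : {poly k} := 'X^(q.+1) - (- al / ga)%:P.
  have [l] : exists l, root p l.
    by apply: closedk; rewrite size_XnsubC.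
  by rewrite /root !hornerE subr_eq0 => /eqP; exists l.
have ln0 : l != 0.
  apply: contraNneq fx0 => l0; move: lE; rewrite l0 expr0n /= => /eqP.
  by rewrite eq_sym mulf_eq0 invr_eq0 (negbTE fy0) orbF oppr_eq0.
(* The norm l^(q+1) is fixed by [sg], so l^(q^2+q) = l^(q+1); then l^q is cancelled. *)
have l_fix : s2 l = l.
  apply: (mulIf (expf_neq0 q ln0)); rewrite -exprS s2E.
  rewrite [in LHS]exprM -exprMn -exprSr lE -sgE.
  by rewrite rmorphM rmorphN fmorphV al_fix ga_fix.
exists (l *: y + x); first by rewrite memvD // memvZ.
split.
- apply: contraNneq fx0 => /eqP; rewrite addr_eq0 => /eqP e.
  by move: xy0; rewrite -[x]opprK -e -scaleNr (qformZl sgE) => /eqP;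
    rewrite mulf_eq0 oppr_eq0 (negbTE ln0) (negbTE fy0).
- by rewrite phiL l_fix py px.
- rewrite (qform_linl sgE) !(qformDr sgE) !(qformZr sgE) yx xy0 mulr0 addr0 add0r.
  by rewrite sgE mulrA -exprS lE -/al -/ga divfK // addNr.
Qed.
End Isotropic.

Section GapFill.
Variables (k : fieldType) (q : nat) (sg : {rmorphism k -> k}).
Hypothesis sgE : forall x, sg x = x ^+ q.

(** Matching gaps of two flags in duality. With the dimensions given, each orthogonal is a
    hyperplane in the end of the other gap that contains it. *)
Definition gap_hyp d1 d2 (P1 : 'M[k]_(d1, d2)) (P2 : 'M[k]_(d2, d1)) n Q Qp P Pp :=
  [/\ [/\ (Q <= Qp)%VS, (P <= Pp)%VS, \dim Qp = (\dim Q + n)%N,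
          \dim Pp = (\dim P + n)%N & (\dim Q + \dim Pp = d1 + 1)%N],
      (perp q P1 P <= Qp)%VS, (perp q P2 Qp <= P)%VS,
      (perp q P2 Q <= Pp)%VS & (perp q P1 Pp <= Q)%VS].

Lemma gap_hyp_sym d1 d2 (P1 : 'M[k]_(d1, d2)) (P2 : 'M[k]_(d2, d1)) n Q Qp P Pp :
  d1 = d2 -> gap_hyp P1 P2 n Q Qp P Pp -> gap_hyp P2 P1 n P Pp Q Qp.
Proof. by move=> e [[h1 h2 h3 h4 h5] h6 h7 h8 h9]; split=> //; split=> //; dlia. Qed.

Section Pair.
Variables (d1 d2 : nat) (P1 : 'M[k]_(d1, d2)) (P2 : 'M[k]_(d2, d1)).
Hypothesis dp : dual_pair sg P1 P2.
Local Notation p1 := (perp q P1).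
Local Notation p2 := (perp q P2).
Let dp' := dual_pair_sym dp.

Section Hyp.
Variables (n : nat) (Q Qp : {vspace 'rV[k]_d1}) (P Pp : {vspace 'rV[k]_d2}).
Hypothesis gh : gap_hyp P1 P2 n Q Qp P Pp.
Hypotheses (nQP : ~~ (Q <= p1 P)%VS) (nPQ : ~~ (P <= p2 Q)%VS).

(** [p1 Pp] is a hyperplane of [Q] and lies in [p1 P], while [Q] does not; there is no room for
    anything larger. *)
Lemma capQ_perp : (Q :&: p1 P)%VS = p1 Pp.
Proof.
case: gh => [[QQ PP dQ dP dPQ] hQp hP hPp hQ].
apply/esym/eqP; rewrite eqEdim subv_cap hQ (perpS sgE P1 PP) /=.
have lt : (\dim (Q :&: p1 P) < \dim Q)%N.
  rewrite ltn_neqAle dimvS ?capvSl // andbT; apply: contra nQP => /eqP e.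
  have /eqP <- : (Q :&: p1 P == Q)%VS by rewrite eqEdim capvSl e leqnn.
  exact: capvSr.
by have := dimp1 sgE dp Pp; move: lt; dlia.
Qed.

Lemma cap_tauQ_perp : (p1 (p2 Q) :&: p1 P)%VS = p1 Pp.
Proof.
case: gh => [[QQ PP dQ dP dPQ] hQp hP hPp hQ].
apply/esym/eqP; rewrite eqEdim subv_cap (perpS sgE P1 hPp) (perpS sgE P1 PP) /=.
have lt : (\dim (p1 (p2 Q) :&: p1 P) < \dim Q)%N.
  rewrite -(dim_tau sgE dp Q) ltn_neqAle dimvS ?capvSl // andbT.
  apply: contra nPQ => /eqP e; apply: (p1_reflect sgE dp).
  have /eqP <- : (p1 (p2 Q) :&: p1 P == p1 (p2 Q))%VS by rewrite eqEdim capvSl e leqnn.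
  exact: capvSr.
by have := dimp1 sgE dp Pp; move: lt; dlia.
Qed.

(** [L] is a complement of [p1 Pp] in [p1 P]. The twist of [Qp] contains [p1 P] and is the direct
    sum of [L] and the twist [T] of [Q]; [phi] is [frob2] followed by the projection to [L] along
    [T]. It is injective on [L] because a vector whose twist lies in [T] lies in [Q], which meets
    [L] trivially. *)
Lemma lang_setup : exists (L : {vspace 'rV[k]_d1}) phi,
  [/\ \dim L = n, (L <= p1 P)%VS, (Q :&: L)%VS = 0%VS,
      forall a v w, phi (a *: v + w) = sg (sg a) *: phi v + phi w
    & [/\ forall v, phi v \in L, forall v, v \in L -> phi v = 0 -> v = 0
        & forall v, v \in L -> frob2 sg v - phi v \in p1 (p2 Q)]].
Proof.
case: (gh) => [[QQ PP dQ dP dPQ] hQp hP hPp hQ].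
set T := p1 (p2 Q); pose L := (p1 P :\: p1 Pp)%VS.
have LP : (L <= p1 P)%VS by exact: diffvSl.
have LPp : (L :&: p1 Pp)%VS = 0%VS by exact: capv_diff.
have dL : \dim L = n.
  have := dimv_cap_compl (p1 P) (p1 Pp); rewrite -/L.
  have /capv_idPr -> : (p1 Pp <= p1 P)%VS by exact: perpS PP.
  by have := dimp1 sgE dp P; have := dimp1 sgE dp Pp; dlia.
have LT : (L :&: T)%VS = 0%VS.
  apply/eqP; rewrite -subv0 -LPp subv_cap capvSl -cap_tauQ_perp subv_cap capvSr.
  by rewrite (subv_trans (capvSl _ _) LP).
have QL : (Q :&: L)%VS = 0%VS.
  apply/eqP; rewrite -subv0 -LPp subv_cap capvSr -capQ_perp subv_cap capvSl.
  by rewrite (subv_trans (capvSr _ _) LP).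
have LTE : (L + T)%VS = p1 (p2 Qp).
  have PQp : (p1 P <= p1 (p2 Qp))%VS by exact: (perpS sgE P1 hP).
  have TQp : (T <= p1 (p2 Qp))%VS by exact/(perpS sgE)/(perpS sgE).
  apply/eqP; rewrite eqEdim subv_add (subv_trans LP PQp) TQp /=.
  have := dimv_sum_cap L T; rewrite LT dimv0 {2}/T !(dim_tau sgE dp) => e.
  by move: e dQ dL; dlia.
exists L, (fun v => daddv_pi L T (frob2 sg v)); split=> //.
  move=> a v w; rewrite (frob2L sg) linearP //.
have decomp v : v \in L -> daddv_pi L T (frob2 sg v) + daddv_pi T L (frob2 sg v) = frob2 sg v.
  move=> vL; apply: daddv_pi_add => //; rewrite LTE (mem_tau sgE dp).
  exact: (subvP hQp) _ ((subvP LP) _ vL).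
split=> [v|v vL v0|v vL]; first exact: memv_pi.
  have : frob2 sg v \in T by rewrite -decomp // v0 add0r memv_pi.
  rewrite /T (mem_tau sgE dp) => vQ; apply/eqP; rewrite -memv0 -QL memv_cap vQ vL //.
by rewrite -{1}decomp // addrC addrA addNr add0r memv_pi.
Qed.

(** A vector fixed by [phi] agrees with its twist modulo the twist of [Q], hence lies in the twist
    of [Q + <[v]>]: the line is rational relative to [Q]. *)
Lemma lang_line : (forall p : {poly k}, size p != 1%N -> exists x, root p x) ->
  (1 < q)%N -> (0 < n)%N ->
  exists v, [/\ v \in p1 P, v \notin Q & v \in p1 (p2 (Q + <[v]>))].
Proof.
move=> closedk q_gt1 n0; have [L [phi [dL LP QL phiL [phiLL phi_inj phi_tau]]]] := lang_setup.
have s2E x : (sg \o sg) x = x ^+ (q * q) by rewrite /= !sgE exprM.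
have q2 : (1 < q * q)%N by rewrite (leq_trans q_gt1) // leq_pmulr //; lia.
have L0 : L != 0%VS by rewrite -dimv_eq0 dL -lt0n.
have [v vL [v0 pv]] := semilin_fixed closedk s2E q2 phiL L0 (fun v _ => phiLL v) phi_inj.
exists v; split; first exact: (subvP LP).
  by apply: contra v0 => vQ; rewrite -memv0 -QL memv_cap vQ.
rewrite (tau_add sgE dp) -[v in v \in _](subKr (frob2 sg v)) addrC memv_add //.
  by rewrite memvN -{2}pv phi_tau.
exact: memv_line.
Qed.

Variable v : 'rV[k]_d1.
Hypotheses (vP : v \in p1 P) (vQ : v \notin Q) (vt : v \in p1 (p2 (Q + <[v]>))).
Local Notation Q1 := (Q + <[v]>)%VS.
Local Notation Pp1 := (p2 (Q + <[v]>) + P)%VS.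

Lemma dimQ1 : \dim Q1 = (\dim Q).+1.
Proof.
have v0 : v != 0 by apply: contraNneq vQ => ->; exact: mem0v.
have : (\dim Q < \dim Q1)%N.
  rewrite ltn_neqAle dimvS ?addvSl // andbT; apply: contra vQ => /eqP e.
  have /eqP -> : (Q == Q1)%VS by rewrite eqEdim addvSl e leqnn.
  by rewrite memvE addvSr.
by have := dimv_sum_cap Q <[v]>; rewrite dim_vline v0 /=; dlia.
Qed.

Lemma nPQ1 : ~~ (P <= p2 Q1)%VS.
Proof. by apply: contra nPQ => /subv_trans; apply; exact/(perpS sgE P2)/addvSl. Qed.

Lemma dimPp1 : (\dim Pp1).+1 = \dim Pp.
Proof.
case: (gh) => [[QQ PP dQ dP dPQ] hQp hP hPp hQ].
have lt : (\dim (p2 Q1 :&: P) < \dim P)%N.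
  rewrite ltn_neqAle dimvS ?capvSr // andbT; apply: contra nPQ1 => /eqP e.
  have /eqP <- : (p2 Q1 :&: P == P)%VS by rewrite eqEdim capvSr e leqnn.
  exact: capvSl.
have ge : (\dim (p2 Qp) <= \dim (p2 Q1 :&: P))%N.
  apply: dimvS; rewrite subv_cap hP andbT; apply: (perpS sgE P2).
  by rewrite subv_add QQ -memvE (subvP hQp).
have := dimv_sum_cap (p2 Q1) P; have := dimp2 sgE dp Q1; have := dimp2 sgE dp Qp.
by have := dimQ1; move: lt ge; dlia.
Qed.

(** Raising [Q] to [Q1] lowers the top of the dual gap to [Pp1], and both lengths drop by one. The
    delicate inclusion is [p1 Pp1 <= Q1]: that orthogonal has dimension less than [\dim Q1] and
    contains [p1 Pp + <[v]>], of dimension [\dim Q], so the two coincide. *)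
Lemma gap_lang : gap_hyp P1 P2 n.-1 Q1 Qp P Pp1.
Proof.
case: (gh) => [[QQ PP dQ dP dPQ] hQp hP hPp hQ].
have n0 : (0 < n)%N.
  have : (\dim Q1 <= \dim Qp)%N by rewrite dimvS // subv_add QQ -memvE (subvP hQp).
  by rewrite dimQ1; dlia.
split.
- split; rewrite ?addvSr //; first by rewrite subv_add QQ -memvE (subvP hQp).
  + by have := dimQ1; dlia.
  + by have := dimPp1; dlia.
  + by have := dimQ1; have := dimPp1; dlia.
- exact: hQp.
- exact: hP.
- exact: addvSl.
- rewrite (perpD sgE).
  have lt : (\dim (p1 (p2 Q1) :&: p1 P) < \dim Q1)%N.
    rewrite -(dim_tau sgE dp Q1) ltn_neqAle dimvS ?capvSl // andbT.
    apply: contra nPQ1 => /eqP e; apply: (p1_reflect sgE dp).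
    have /eqP <- : (p1 (p2 Q1) :&: p1 P == p1 (p2 Q1))%VS by rewrite eqEdim capvSl e leqnn.
    exact: capvSr.
  have sub : (p1 Pp + <[v]> <= p1 (p2 Q1) :&: p1 P)%VS.
    rewrite subv_add !subv_cap (perpS sgE P1 PP) -!memvE vP vt !andbT.
    rewrite -cap_tauQ_perp (subv_trans (capvSl _ _)) //.
    exact/(perpS sgE P1)/(perpS sgE P2)/addvSl.
  have dd : \dim (p1 Pp + <[v]>) = \dim Q.
    have vn : v \notin p1 Pp by apply: contra vQ; exact: (subvP hQ).
    have v0 : v != 0 by apply: contraNneq vQ => ->; exact: mem0v.
    have c0 : (p1 Pp :&: <[v]>)%VS = 0%VS.
      apply/eqP; rewrite -subv0; apply/subvP => w; rewrite memv_cap memv0.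
      case/andP => wp /vlineP [a wE]; rewrite wE in wp *.
      have [->|a0] := eqVneq a 0; first by rewrite scale0r.
      by case/negP: vn; rewrite -[v](scalerK a0) memvZ.
    have := dimv_sum_cap (p1 Pp) <[v]>; rewrite c0 dimv0 dim_vline v0 /=.
    by have := dimp1 sgE dp Pp; dlia.
  have /eqP <- : (p1 Pp + <[v]> == p1 (p2 Q1) :&: p1 P)%VS.
    by rewrite eqEdim sub /= dd; move: lt; rewrite dimQ1; dlia.
  by rewrite addvS.
Qed.

End Hyp.

(** [P] and its twist share [p2 Qp], a hyperplane of both, so if [P] is not stable their sum has
    exactly one dimension more. The sum replaces [P], and [p1 P] replaces [Qp] in the other gap. *)
Lemma gap_step n Q Qp P Pp : gap_hyp P1 P2 n Q Qp P Pp ->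
  (Q <= p1 P)%VS -> ~ stable q P2 P1 P ->
  gap_hyp P1 P2 n.-1 Q (p1 P) (P + p2 (p1 P)) Pp /\
  [/\ \dim (P + p2 (p1 P)) = (\dim P).+1, (0 < n)%N & (\dim (p1 P)).+1 = \dim Qp].
Proof.
move=> gh QP ns; case: (gh) => [[QQ PP dQ dP dPQ] hQp hP hPp hQ].
set T := p2 (p1 P); set P' := (P + T)%VS.
have dT : \dim T = \dim P by exact: (dim_tau sgE dp').
have n0 : (0 < n)%N by have := dimvS QP; have := dimp1 sgE dp P; dlia.
have ge : (\dim (p2 Qp) <= \dim (P :&: T))%N.
  by apply: dimvS; rewrite subv_cap hP; apply: (perpS sgE P2).
have lt : (\dim P < \dim P')%N.
  rewrite ltn_neqAle dimvS ?addvSl // andbT; apply/negP => /eqP e; apply: ns.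
  apply: (stable_sub sgE dp'); have /eqP PP' : (P == P')%VS by rewrite eqEdim addvSl e leqnn.
  by rewrite [X in (_ <= X)%VS]PP' addvSr.
have dP' : \dim P' = (\dim P).+1.
  have := dimv_sum_cap P T; have := dimp2 sgE dp Qp; rewrite -/P'.
  by move: lt ge; dlia.
have e1 : (\dim (p1 P)).+1 = \dim Qp by have := dimp1 sgE dp P; dlia.
split; last by split.
split.
- split=> //; try by dlia.
  rewrite subv_add PP /=; apply: subv_trans hPp; exact: (perpS sgE P2).
- by apply: (perpS sgE P1); exact: addvSl.
- exact: addvSr.
- exact: hPp.
- exact: hQ.
Qed.

End Pair.
End GapFill.

Section GapFillThm.
Variables (k : fieldType) (q : nat) (sg : {rmorphism k -> k}).
Hypothesis closedk : forall p : {poly k}, size p != 1%N -> exists x, root p x.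
Hypotheses (sgE : forall x, sg x = x ^+ q) (q_gt1 : (1 < q)%N).

(** The last clause serves the induction: when a line is added at the bottom, the dual piece gets a
    mixed step at its top, and the mixed positions stay an initial interval only if all the inner
    ones are mixed. *)
Definition fillable d1 d2 (P1 : 'M[k]_(d1, d2)) (P2 : 'M[k]_(d2, d1)) n Q Qp P Pp :=
  exists c1 c2 t1 t2, [/\ piece (perp q P1) n Q Qp c1 c2 t1,
    piece (perp q P2) n P Pp c2 c1 t2, (n <= t1 + t2)%N
    & ~~ (Q <= perp q P1 P)%VS -> ~~ (P <= perp q P2 Q)%VS -> t1 = n /\ t2 = n].

Lemma fillable_sym d1 d2 (P1 : 'M[k]_(d1, d2)) (P2 : 'M[k]_(d2, d1)) n Q Qp P Pp :
  fillable P1 P2 n Q Qp P Pp -> fillable P2 P1 n P Pp Q Qp.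
Proof.
move=> [c1 [c2 [t1 [t2 [h1 h2 t12 tn]]]]]; exists c2, c1, t2, t1; split=> //.
  by rewrite addnC.
by move=> a b; case: (tn b a).
Qed.

Definition no_stable d1 d2 (P1 : 'M[k]_(d1, d2)) (P2 : 'M[k]_(d2, d1)) Q P :=
  forall T, stable q P1 P2 T -> (Q <= T)%VS -> ~ (T <= perp q P1 P)%VS.

Section Pair.
Variables (d1 d2 : nat) (P1 : 'M[k]_(d1, d2)) (P2 : 'M[k]_(d2, d1)).
Hypothesis dp : dual_pair sg P1 P2.
Local Notation p1 := (perp q P1).
Local Notation p2 := (perp q P2).
Let dp' := dual_pair_sym dp.

Lemma no_stable_sym Q P : no_stable P1 P2 Q P -> no_stable P2 P1 P Q.
Proof.
move=> ns T sT PT TQ; apply: (ns (p1 T)); rewrite /stable ?sT //.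
  by apply: (p2_reflect sgE dp); rewrite sT.
exact: (perpS sgE).
Qed.

Lemma no_stable_dual Q P : no_stable P1 P2 Q P -> (Q <= p1 P)%VS -> ~ stable q P2 P1 P.
Proof. by move=> ns QP sP; apply: (ns (p1 P)) => //; rewrite /stable sP. Qed.

Lemma no_stableS Q Q' P P' : no_stable P1 P2 Q P -> (Q <= Q')%VS -> (P <= P')%VS ->
  no_stable P1 P2 Q' P'.
Proof.
move=> ns QQ PP T sT QT TP; apply: (ns T sT (subv_trans QQ QT)).
exact: subv_trans TP (perpS sgE P1 PP).
Qed.

(** The new top step of the first piece is an equality of flags and keeps [t1]; the new bottom step
    of the second is mixed and raises [t2]. The sum grows with the length. *)
Lemma fill_step n Q Qp P Pp : gap_hyp q P1 P2 n.+1 Q Qp P Pp ->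
  (Q <= p1 P)%VS -> ~ stable q P2 P1 P ->
  fillable P1 P2 n Q (p1 P) (P + p2 (p1 P)) Pp -> fillable P1 P2 n.+1 Q Qp P Pp.
Proof.
move=> gh QP ns [c1 [c2 [t1 [t2 [h1 h2 t12 _]]]]].
have [_ [dP' _ _]] := gap_step sgE dp gh QP ns.
case: (gh) => [[QQ PP dQ dP dPQ] hQp hP hPp hQ].
have [[c10 c1n t1n] _ _ _] := h1.
exists (prcons n.+1 c1 Qp), (pcons P c2), t1, t2.+1; split.
- apply: (piece_prcons h1) => //; exact: leqW.
- apply: (piece_pcons _ h2) => //; first exact: addvSl.
    by rewrite c1n addvSr.
  by rewrite c1n => e; apply: ns.
- by rewrite addnS ltnS.
- by rewrite QP.
Qed.

End Pair.

Lemma fill_base d1 d2 (p : {vspace 'rV[k]_d2} -> {vspace 'rV[k]_d1})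
  (A Ap : {vspace 'rV[k]_d1}) c' :
  (A <= Ap)%VS -> \dim Ap = (\dim A + 0)%N -> piece p 0 A Ap (fun=> A) c' 0.
Proof.
move=> AA dA; split=> [|x|x|x]; rewrite ?ltn0 //.
  by split=> //; apply/eqP; rewrite eqEdim AA dA addn0 leqnn.
by rewrite leqn0 => /eqP ->; rewrite addn0.
Qed.

Theorem gap_fill n : forall d1 d2 (P1 : 'M[k]_(d1, d2)) (P2 : 'M[k]_(d2, d1)) Q Qp P Pp,
  dual_pair sg P1 P2 -> gap_hyp q P1 P2 n Q Qp P Pp -> no_stable P1 P2 Q P ->
  fillable P1 P2 n Q Qp P Pp.
Proof.
elim: n => [|n IH] d1 d2 P1 P2 Q Qp P Pp dp gh ns.
  case: (gh) => [[QQ PP dQ dP dPQ] hQp hP hPp hQ].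
  by exists (fun=> Q), (fun=> P), 0%N, 0%N; split=> //; apply: fill_base.
(* When [A] lies in the orthogonal of [B], stability of [B] would make that orthogonal a forbidden
   stable subspace; so [B] grows by its twist. *)
have caseI d1' d2' (P1' : 'M[k]_(d1', d2')) (P2' : 'M[k]_(d2', d1')) A Ap B Bp :
    dual_pair sg P1' P2' -> gap_hyp q P1' P2' n.+1 A Ap B Bp -> no_stable P1' P2' A B ->
    (A <= perp q P1' B)%VS -> fillable P1' P2' n.+1 A Ap B Bp.
  move=> dp' gh' ns' AB; have nsB := no_stable_dual ns' AB.
  apply: (fill_step dp' gh' AB nsB); apply: IH => //.
    by case: (gap_step sgE dp' gh' AB nsB).
  exact: (no_stableS ns') (addvSl _ _).
case: (boolP (Q <= perp q P1 P)%VS) => QP; first exact: caseI.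
case: (boolP (P <= perp q P2 Q)%VS) => PQ.
  apply/fillable_sym/caseI => //; first exact: dual_pair_sym.
    by apply: gap_hyp_sym gh; exact: dual_dim dp.
  apply: no_stable_sym; [exact: dp | exact: ns].
(* Neither end moves, so a line is added to [Q]. The smaller gap is again of this type; its
   parameters are therefore full, and the new ones can be [n.+1]. *)
have [v [vP vQ vt]] := lang_line sgE dp gh QP PQ closedk q_gt1 isT.
have gh1 := gap_lang sgE dp gh PQ vP vQ vt.
have QQ1 : (Q <= Q + <[v]>)%VS by exact: addvSl.
have ns1 : no_stable P1 P2 (Q + <[v]>) P by exact: (no_stableS ns).
have [c1 [c2 [t1 [t2 [h1 h2 t12 tn]]]]] := IH _ _ _ _ _ _ _ _ dp gh1 ns1.
have QP1 : ~~ (Q + <[v]> <= perp q P1 P)%VS.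
  by apply: contra QP => /(subv_trans QQ1).
have PQ1 : ~~ (P <= perp q P2 (Q + <[v]>))%VS.
  by apply: contra PQ => /subv_trans; apply; exact: (perpS sgE).
have [e1 e2] := tn QP1 PQ1; rewrite e1 e2 in h1 h2.
case: (gh) => [[QQ PP dQ dP dPQ] hQp hP hPp hQ].
case: (gh1) => [[_ PP1 dQ1 dP1 _] _ _ hPp1 hQ1].
set Pp1 := (perp q P2 (Q + <[v]>) + P)%VS in h2 PP1 dP1 hPp1 hQ1.
have [[_ c2n _] _ _ _] := h2.
exists (pcons Q c1), (prcons n.+1 c2 Pp), n.+1, n.+1; split=> //; last first.
- by rewrite leq_addr.
- apply: (piece_prcons h2) => //.
  + rewrite subv_add PP andbT; apply: subv_trans hPp; exact: (perpS sgE).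
  + by move=> x xn; rewrite leqNgt ltnW ?ltnS //= leqNgt xn.
  + split; last by rewrite ltnn.
    by move=> e; case/negP: PQ; rewrite e addvSr.
- apply: (piece_pcons _ h1) => //.
  + by have := dimQ1 vQ.
  + by rewrite c2n.
  + rewrite c2n => e; case/negP: QP; rewrite -e; exact: (perpS sgE).
Qed.

Section Self.
Variables (d : nat) (P : 'M[k]_d).
Hypothesis dp : dual_pair sg P P.
Local Notation p := (perp q P).

(** In a self-dual gap the line added at the bottom also determines the new top, which contains the
    new bottom only if the line is isotropic. [phi] inherits the symmetry of [frob2] because it
    differs from it by elements of [p (p A)], orthogonal to [L]. *)
Lemma isotropic_line n A Ap : gap_hyp q P P n A Ap A Ap -> ~~ (A <= p A)%VS -> (1 < n)%N ->
  exists v, [/\ v \in p A, v \notin A, v \in p (p (A + <[v]>)) & v \in p (A + <[v]>)].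
Proof.
move=> gh nA n1; have [L [phi [dL LP QL phiL [phiLL phi_inj phi_tau]]]] := lang_setup sgE dp gh nA nA.
have phi_form v w : v \in L -> w \in L -> qform q P (phi v) w = sg (qform q P w v).
  move=> vL wL; have e12 : P = (map_mx sg P)^T by case: dp.
  rewrite (qform_conj sgE e12) -[phi v](subKr (frob2 sg v)) addrC (qformDl sgE).
  have /(mem_perp sgE) : - (frob2 sg v - phi v) \in p (p A) by rewrite memvN phi_tau.
  by move=> /(_ w ((subvP LP) _ wL)) ->; rewrite add0r.
have [|v vL [v0 pv vv]] := semilin_isotropic closedk sgE q_gt1 dp phiL (fun v _ => phiLL v)
  phi_inj phi_form; first by rewrite dL.
exists v; split; first exact: (subvP LP).
- by apply: contra v0 => vQ; rewrite -memv0 -QL memv_cap vQ.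
- rewrite (tau_add sgE dp) -[v in v \in _](subKr (frob2 sg v)) addrC memv_add //.
    by rewrite memvN -{2}pv phi_tau.
  exact: memv_line.
- rewrite (perpD sgE) memv_cap (subvP LP) //=; exact/(mem_perp_line sgE).
Qed.

(** Both ends move together, so the length drops by two. A gap of length 1 is mixed: [A] inside
    [p A] would give equality by dimension, and [A] would be stable. *)
Theorem gap_fill_self n : forall A Ap, gap_hyp q P P n A Ap A Ap -> no_stable P P A A ->
  exists c t, [/\ piece p n A Ap c c t, (n <= t + t)%N & ~~ (A <= p A)%VS -> t = n].
Proof.
have [N] := ubnP n; elim: N n => // N IH [|[|n]] nN A Ap gh ns;
  case: (gh) => [[AA _ dA _ dAA] hAp hA _ _].
- by exists (fun=> A), 0%N; split=> //; exact: fill_base.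
- have nA : ~~ (A <= p A)%VS.
    apply/negP => AP; have [_ [_ _ e]] := gap_step sgE dp gh AP (no_stable_dual ns AP).
    have /eqP eA : (A == p A)%VS by rewrite eqEdim AP; move: e; dlia.
    by apply: (ns A) => //; rewrite /stable -!eA.
  exists (prcons 1 (fun=> A) Ap), 1%N; split=> //; split=> //.
  + by move=> [|[|x]] // _; rewrite /prcons /= ?addn0.
  + by move=> [|x].
  + move=> [|x] // _; rewrite /prcons /=; split=> //; split=> // e.
    by rewrite -{1}e subvv in nA.
- case: (boolP (A <= p A)%VS) => AP.
    have nsA := no_stable_dual ns AP.
    have [[[_ _ _ _ _] _ _ _ _] [dA' _ dpA]] := gap_step sgE dp gh AP nsA.
    set A' := (A + p (p A))%VS in dA'.
    have A'p : (A' <= p A)%VS by rewrite subv_add AP; exact: (perpS sgE).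
    have AA' : (A <= A')%VS by exact: addvSl.
    have gh' : gap_hyp q P P n A' (p A) A' (p A).
      split; rewrite ?addvSr ?(perpS sgE) //.
      by split=> //; move: dA' dpA dA dAA; dlia.
    have ns' : no_stable P P A' A' by exact: (no_stableS ns).
    have [c [t [hc tn _]]] := IH n (ltnW nN) A' (p A) gh' ns'.
    have [[c0 cn tn'] _ _ _] := hc.
    exists (pcons A (prcons n.+1 c Ap)), t.+1; split=> //; last by rewrite addSn addnS.
    rewrite [X in piece _ _ _ _ _ X _]pcons_prcons; apply: (piece_pcons (Q1 := A')) => //.
    + apply: (piece_prcons hc) => //; first by move: dA' dA; dlia.
      exact: leqW.
    + by rewrite /= cn addvSr.
    + by rewrite /= cn => e; apply: nsA.
  have [v [vP vA vt vv]] := isotropic_line gh AP isT.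
  have gh1 := gap_lang sgE dp gh AP vP vA vt.
  case: (gh1) => [[_ _ dA1 dAp1 _] _ _ hAp1 hA1].
  have AA1 : (A <= A + <[v]>)%VS by exact: addvSl.
  have AAp1 : (A <= p (A + <[v]>) + A)%VS by exact: addvSr.
  have A1p : ~~ (A + <[v]> <= p (A + <[v]>))%VS.
    apply: contra AP => /(subv_trans AA1) /subv_trans; apply; exact: (perpS sgE).
  have d1 := dimQ1 vA.
  have Ap1Ap : (p (A + <[v]>) + A <= Ap)%VS.
    rewrite subv_add AA andbT; apply: subv_trans hAp; exact: (perpS sgE).
  have gh' : gap_hyp q P P n (A + <[v]>) (p (A + <[v]>) + A) (A + <[v]>) (p (A + <[v]>) + A).
    split=> //; have s : (A + <[v]> <= p (A + <[v]>) + A)%VS.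
      by rewrite subv_add addvSr -memvE; apply: (subvP (addvSl _ _)).
    by split=> //; move: dA1 dAp1 d1 dA dAA; dlia.
  have ns' : no_stable P P (A + <[v]>) (A + <[v]>) by exact: (no_stableS ns).
  have [c [t [hc _ tn]]] := IH n (ltnW nN) _ _ gh' ns'.
  have {}tn := tn A1p; rewrite {}tn {t} in hc; have [[c0 cn _] _ _ _] := hc.
  exists (pcons A (prcons n.+1 c Ap)), n.+2; split=> //; last by rewrite leq_addr.
  rewrite [X in piece _ _ _ _ _ X _]pcons_prcons.
  apply: (piece_pcons (Q1 := (A + <[v]>)%VS)) => //.
  + have dAp : \dim Ap = (\dim (A + <[v]>) + n.+1)%N by move: d1 dA; dlia.
    apply: (piece_prcons hc) => // [x xn|].
      by rewrite leqNgt ltnW ?ltnS //= leqNgt xn.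
    split; last by rewrite ltnn.
    by move=> e; case/negP: AP; rewrite e.
  + by rewrite /= cn.
  + rewrite /= cn => e; case/negP: AP; rewrite -{1}e; exact: (perpS sgE).
Qed.

End Self.
End GapFillThm.

(** * Relative positions and words *)

Section WordAct.

Lemma word_act_lt w x : (forall a, a \in w -> x < a)%N -> word_act w x = x.
Proof.
elim: w => //= a w IH H; rewrite IH => [|b bw]; last by apply: H; rewrite in_cons bw orbT.
have := H a (mem_head _ _); rewrite /simple_refl => xa.
by case: eqP => [|_]; [lia|case: eqP => //; lia].
Qed.

(** The last reflection acts first: those of larger index fix [x], then [s_x] sends it to [x + 1],
    which the smaller ones fix. Without [s_x], as in the next lemma, [x] can only be lowered. *)
Lemma word_act_in w x : sorted ltn w -> x \in w -> word_act w x = x.+1.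
Proof.
elim: w => //= a w IH; rewrite (path_sortedE ltn_trans) => /andP [/allP aw sw].
rewrite in_cons => /orP [/eqP ->|xw].
  by rewrite word_act_lt // /simple_refl eqxx.
rewrite IH //; have := aw x xw; rewrite /simple_refl /= => ax.
by case: eqP => [|_]; [lia|case: eqP => //; lia].
Qed.

Lemma word_act_notin w x : sorted ltn w -> x \notin w -> (word_act w x <= x)%N.
Proof.
elim: w => //= a w IH; rewrite (path_sortedE ltn_trans) => /andP [_ sw].
rewrite in_cons negb_or => /andP [/eqP xa xw]; have := IH sw xw.
by rewrite /simple_refl; case: eqP => [|_]; [lia|case: eqP => //; lia].
Qed.

Lemma word_act_inj w : injective (word_act w).
Proof.
elim: w => [|a w IH] x y //= H; apply: IH; move: H; rewrite /simple_refl.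
by do 4?case: eqP; lia.
Qed.

Lemma word_act_range d w x : all (fun i => 0 < i < d)%N w -> (0 < x <= d)%N ->
  (0 < word_act w x <= d)%N.
Proof.
elim: w => //= a w IH /andP [ad wd] xd; have := IH wd xd.
by rewrite /simple_refl; do 2?case: eqP; lia.
Qed.

End WordAct.

Lemma iota1S x : iota 1 x.+1 = rcons (iota 1 x) x.+1.
Proof. by rewrite -[x.+1 in LHS]addn1 iotaD cats1 add1n. Qed.

Section Relpos.
Variables (k : fieldType) (d : nat).
Implicit Types C : nat -> {vspace 'rV[k]_d}.

(** At a position [y] of the word, [C' y] has the dimension of [C y] but differs from it, so it has
    a vector outside [C y]. Choosing the basis vector there is what makes one basis serve both
    flags. *)
Lemma choose_adapted C C' (w : seq nat) : complete_flag C -> complete_flag C' ->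
  (forall x, (x < d)%N -> (C' x <= C x.+1)%VS) ->
  (forall x, (0 < x < d)%N -> (C' x = C x <-> x \notin w)) ->
  all (fun i => 0 < i < d)%N w ->
  exists e : nat -> 'rV[k]_d, forall y, (y < d)%N ->
    [/\ e y.+1 \in C y.+1, e y.+1 \notin C y & y \in w -> e y.+1 \in C' y].
Proof.
move=> [dC mC] [dC' mC'] CC' Cw /allP wd.
suff H y : exists v, (y < d)%N -> [/\ v \in C y.+1, v \notin C y & y \in w -> v \in C' y].
  have [e He] := choice H.
  by exists (fun y => e y.-1) => y; exact: He.
have [yd|] := boolP (y < d)%N; last by exists 0.
case: (boolP (y \in w)) => yw.
  have /subvPn [v vC' vC] : ~~ (C' y <= C y)%VS.
    apply/negP => sub; have := wd y yw => y0d.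
    have /(Cw y y0d) : C' y = C y.
      by apply/eqP; rewrite eqEdim sub dC ?dC' ?leqnn // ltnW.
    by rewrite yw.
  by exists v => _; split=> //; exact: (subvP (CC' y yd)).
have /subvPn [v vC' vC] : ~~ (C y.+1 <= C y)%VS.
  by apply/negP => /dimvS; rewrite !dC ?ltnn // ltnW.
by exists v.
Qed.

Lemma adapted_span C (e : nat -> 'rV[k]_d) : complete_flag C ->
  (forall y, (y < d)%N -> e y.+1 \in C y.+1 /\ e y.+1 \notin C y) ->
  forall x, (x <= d)%N -> C x = <<[seq e i | i <- iota 1 x]>>%VS.
Proof.
move=> [dC mC] He; elim=> [|x IH] xd.
  by rewrite span_nil; apply/eqP; rewrite -dimv_eq0 dC.
have [e1 e2] := He x xd.
rewrite iota1S map_rcons -cats1 span_cat -IH 1?ltnW //= span_seq1.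
have lt : (\dim (C x) < \dim (C x + <[e x.+1]>))%N.
  rewrite ltn_neqAle dimvS ?addvSl // andbT.
  apply: contra e2 => /eqP e2; have /eqP -> : (C x == C x + <[e x.+1]>)%VS.
    by rewrite eqEdim addvSl e2 leqnn.
  by rewrite memvE addvSr.
apply/esym/eqP; rewrite eqEdim subv_add mC ?leqnSn //= -memvE e1 /=.
by move: lt; rewrite !dC // ltnW.
Qed.

(** One direction is the bound [word_act w i <= i.+1], improved to [word_act w x <= x] off the word.
    In the other, the vectors of [choose_adapted] permuted by the word lie in the members of [C'];
    being free, they span them by dimension. *)
Lemma relposP C C' (w : seq nat) : complete_flag C -> complete_flag C' ->
  sorted ltn w -> all (fun i => 0 < i < d)%N w ->
  relpos C C' w <-> (forall x, (x < d)%N -> (C' x <= C x.+1)%VS) /\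
    (forall x, (0 < x < d)%N -> (C' x = C x <-> x \notin w)).
Proof.
move=> cC cC' sw wd; have [dC mC] := cC; have [dC' mC'] := cC'; split.
  move=> [e [be He]].
  have sub x y : (x <= d)%N -> (y <= d)%N ->
      (forall i, (0 < i <= x)%N -> (word_act w i <= y)%N) -> (C' x <= C y)%VS.
    move=> xd yd H; rewrite (proj2 (He x xd)) (proj1 (He y yd)).
    apply/span_subvP => u /mapP [i]; rewrite mem_iota => ix ->.
    apply/memv_span/map_f; rewrite mem_iota; have := H i ix.
    have := word_act_range wd (x := i); dlia.
  have wle i : (word_act w i <= i.+1)%N.
    by case: (boolP (i \in w)) => [/(word_act_in sw) ->//|/(word_act_notin sw)/leqW].
  split=> x xd; first by apply: sub => [||i ix]; [dlia|dlia|have := wle i; dlia].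
  have xd' : (x <= d)%N by dlia.
  split=> [e1|xw].
    apply/negP => xw; have : (C x.+1 <= C x)%VS.
      rewrite (proj1 (He x.+1 _)); last by dlia.
      rewrite iota1S map_rcons -cats1 span_cat span_seq1 subv_add.
      rewrite -(proj1 (He x xd')) subvv -memvE -e1 (proj2 (He x xd')) -(word_act_in sw xw).
      by apply/memv_span/(map_f (fun i => e (word_act w i))); rewrite mem_iota; dlia.
    by move/dimvS; rewrite !dC ?ltnn //; dlia.
  apply/eqP; rewrite eqEdim dC // dC' // leqnn andbT; apply: sub => // i ix.
  have [->|] := eqVneq i x; first exact: word_act_notin.
  by have := wle i; dlia.
move=> [CC' Cw]; have [e He] := choose_adapted cC cC' CC' Cw wd.
have Cspan x (xd : (x <= d)%N) : C x = <<[seq e i | i <- iota 1 x]>>%VS.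
  by apply: adapted_span => // y yd; case: (He y yd).
have full D : \dim D = d -> D = fullv :> {vspace 'rV[k]_d}.
  by move=> dD; apply/eqP; rewrite eqEdim subvf dim_fullrV dD leqnn.
have be : basis_of fullv [seq e i | i <- iota 1 d].
  by rewrite basisEdim -(Cspan d (leqnn d)) (full (C d)) ?dC // subvv /= size_map size_iota dim_fullrV.
exists e; split=> // x xd; split; first exact: Cspan.
have pw : perm_eq [seq word_act w i | i <- iota 1 d] (iota 1 d).
  have u : uniq [seq word_act w i | i <- iota 1 d].
    by rewrite (map_inj_uniq (@word_act_inj w)) iota_uniq.
  suff [_ eqi] : (size [seq word_act w i | i <- iota 1 d] = size (iota 1 d)) *
      ([seq word_act w i | i <- iota 1 d] =i iota 1 d).
    by apply: uniq_perm => //; exact: iota_uniq.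
  apply: uniq_min_size => //; last by rewrite size_map !size_iota.
  move=> v /mapP [i]; rewrite !mem_iota => id ->.
  by have := word_act_range wd (x := i); dlia.
have fw : free [seq e (word_act w i) | i <- iota 1 x].
  have : free [seq e (word_act w i) | i <- iota 1 d].
    rewrite (map_comp e (word_act w)) (perm_free (Y := [seq e i | i <- iota 1 d])) ?perm_map //.
    exact: basis_free be.
  have -> : iota 1 d = iota 1 x ++ iota (1 + x) (d - x) by rewrite -iotaD subnKC.
  by rewrite map_cat => /catl_free.
apply/esym/eqP; rewrite eqEdim; apply/andP; split; last first.
  by rewrite dC' // (eqP fw) size_map size_iota.
apply/span_subvP => u /mapP [i]; rewrite mem_iota => ix ->.
have {ix}/andP [i0 ix] : (0 < i <= x)%N by dlia.
apply: (subvP (mC' i x _)); first by rewrite ix.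
case: (boolP (i \in w)) => iw.
  rewrite word_act_in //; have id : (i < d)%N by have /andP [] := (allP wd) i iw.
  by case: (He i id) => _ _; apply.
have -> : C' i = C i.
  have [->|idn] := eqVneq i d; first exact: etrans (full _ (dC' d (leqnn d))) (esym (full _ (dC d (leqnn d)))).
  have id : (0 < i < d)%N by rewrite i0 ltn_neqAle idn (leq_trans ix xd).
  exact: (proj2 (Cw i id) iw).
have := word_act_notin sw iw; have := word_act_range wd (x := i).
rewrite i0 /= => /(_ (leq_trans ix xd)); case: (word_act w i) => // y /= yd yi.
by have [yC _ _] := He y yd; apply: (subvP (mC y.+1 i _)) => //; rewrite yi /= (leq_trans ix xd).
Qed.

End Relpos.

Section GapWord.
Implicit Types (D t : nat -> nat).

(** The words of the strata in terms of the positions [D 1 < ... < D R] of all members, the whole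
    space included when it is one: above [D j] the first [t j] positions are mixed, and above [D R]
    all are. *)
Definition gap_word D t R d :=
  flatten [seq iota (D i) (t i) | i <- iota 1 R.-1] ++ iota (D R) (d - D R).

Definition gap_tuple D t R := forall i, (0 < i < R)%N -> (t i <= D i.+1 - D i)%N.

Variables (D : nat -> nat) (R d : nat).
Hypotheses (R_gt0 : (0 < R)%N) (D_inc : forall j, (0 < j < R)%N -> (D j < D j.+1)%N).

Lemma incr_le i j : (0 < i)%N -> (i <= j <= R)%N -> (D i <= D j)%N.
Proof.
move=> i0; elim: j => [|j IH] ij; first by lia.
have [->//|ne] := eqVneq i j.+1.
have l1 := IH ltac:(lia); have l2 := D_inc (j := j) ltac:(lia); lia.
Qed.

Variable t : nat -> nat.
Hypothesis tD : gap_tuple D t R.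

Lemma mem_gap_word x : reflect ((exists i, (0 < i < R)%N /\ (D i <= x < D i + t i)%N) \/
   (D R <= x < D R + (d - D R))%N) (x \in gap_word D t R d).
Proof.
rewrite mem_cat mem_iota; apply: (iffP orP) => -[H|->]; try by right.
  by left; have /flatten_mapP [i] := H; rewrite !mem_iota => i1 i2; exists i; lia.
left; have [i [i1 i2]] := H; apply/flatten_mapP; exists i; rewrite mem_iota //; lia.
Qed.

Lemma gap_word_sorted : sorted ltn (gap_word D t R d).
Proof.
rewrite (sorted_pairwise ltn_trans).
have H r : (r < R)%N -> pairwise ltn (flatten [seq iota (D i) (t i) | i <- iota 1 r]) /\
    all (fun x => x < D r.+1)%N (flatten [seq iota (D i) (t i) | i <- iota 1 r]).
  elim: r => // r IH rR; have [IH1 IH2] := IH (ltnW rR).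
  have e : iota 1 r.+1 = rcons (iota 1 r) r.+1 by rewrite -[r.+1 in LHS]addn1 iotaD cats1 add1n.
  have tr := tD (i := r.+1) rR; have Dr := D_inc (j := r.+1) rR.
  rewrite e map_rcons flatten_rcons pairwise_cat all_cat IH1 /= -(sorted_pairwise ltn_trans).
  rewrite iota_ltn_sorted andbT; split; last first.
    apply/andP; split; apply/allP => x; first by move/(allP IH2); lia.
    by rewrite mem_iota; lia.
  apply/allrelP => x y /(allP IH2) => xr; rewrite mem_iota; lia.
have [H1 H2] := H R.-1 ltac:(lia).
rewrite pairwise_cat H1 -(sorted_pairwise ltn_trans) iota_ltn_sorted /= andbT.
apply/allrelP => x y /(allP H2); rewrite prednK // mem_iota; lia.
Qed.

Lemma gap_word_bound : (0 < D 1)%N -> (D R <= d)%N -> all (fun i => 0 < i < d)%N (gap_word D t R d).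
Proof.
move=> D1 DRd; apply/allP => x /mem_gap_word H.
have HR j : (0 < j <= R)%N -> (0 < D j)%N by move=> jR; have := @incr_le 1 j isT; lia.
case: H => [[i [iR ix]]|]; last by have := HR R; lia.
have := HR i; have := tD iR; have := D_inc iR; have := @incr_le i.+1 R isT.
move=> h1 h2 h3 h4; have := h1 ltac:(lia); have := h4 ltac:(lia).
lia.
Qed.

End GapWord.

(** * From relative positions to the absence of stable subspaces *)

Section Strata.
Variables (k : fieldType) (q : nat) (sg : {rmorphism k -> k}).
Hypothesis sgE : forall x, sg x = x ^+ q.

(* Two flags [G1 1 < ... < G1 R] and [G2 1 < ... < G2 R] of complementary
   dimensions: the orthogonal of [G2 j] has codimension 1 in [G1 (R + 1 - j)]. *)
Record flag_pair d1 d2 R (D1 D2 : nat -> nat) (G1 : nat -> {vspace 'rV[k]_d1})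
    (G2 : nat -> {vspace 'rV[k]_d2}) : Prop := FlagPair {
  fp_R : (0 < R)%N;
  fp_d : d1 = d2;
  fp_dim1 : forall j, (0 < j <= R)%N -> \dim (G1 j) = D1 j;
  fp_dim2 : forall j, (0 < j <= R)%N -> \dim (G2 j) = D2 j;
  fp_pos1 : (0 < D1 1)%N;
  fp_pos2 : (0 < D2 1)%N;
  fp_inc1 : forall j, (0 < j < R)%N -> (D1 j < D1 j.+1)%N;
  fp_inc2 : forall j, (0 < j < R)%N -> (D2 j < D2 j.+1)%N;
  fp_sub1 : forall j, (0 < j < R)%N -> (G1 j <= G1 j.+1)%VS;
  fp_sub2 : forall j, (0 < j < R)%N -> (G2 j <= G2 j.+1)%VS;
  fp_sum : forall j, (0 < j <= R)%N -> (D1 j + D2 (R.+1 - j) = d1.+1)%N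
}.

Lemma flag_pair_sym d1 d2 R D1 D2 (G1 : nat -> {vspace 'rV[k]_d1})
    (G2 : nat -> {vspace 'rV[k]_d2}) :
  flag_pair R D1 D2 G1 G2 -> flag_pair R D2 D1 G2 G1.
Proof.
case=> R0 d12 h1 h2 h3 h4 h5 h6 h7 h8 h9; split=> // j jR.
have := h9 (R.+1 - j)%N ltac:(lia); have -> : (R.+1 - (R.+1 - j) = j)%N by lia.
lia.
Qed.

Lemma perp_flag_complete d1 d2 (P1 : 'M[k]_(d1, d2)) (P2 : 'M[k]_(d2, d1)) C :
  dual_pair sg P1 P2 -> complete_flag C -> complete_flag (perp_flag q P1 C).
Proof.
move=> dp [dC mC]; have d12 := dual_dim dp; split=> [x xd|x y /andP [xy yd]].
  have := dimp1 sgE dp (C (d2 - x)%N); rewrite /perp_flag dC ?leq_subr //.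
  by move: d12 xd; dlia.
apply: (perpS sgE); apply: mC; lia.
Qed.

Section Pair.
Variables (d1 d2 : nat) (P1 : 'M[k]_(d1, d2)) (P2 : 'M[k]_(d2, d1)).
Hypothesis dp : dual_pair sg P1 P2.
Local Notation p1 := (perp q P1).
Local Notation p2 := (perp q P2).
Variables (R : nat) (D1 D2 : nat -> nat).
Variables (G1 : nat -> {vspace 'rV[k]_d1}) (G2 : nat -> {vspace 'rV[k]_d2}).
Hypothesis fp : flag_pair R D1 D2 G1 G2.
Let d12 := fp_d fp.

Section Forward.
Variables (t1 t2 : nat -> nat) (C1 : nat -> {vspace 'rV[k]_d1}) (C2 : nat -> {vspace 'rV[k]_d2}).
Hypotheses (tD1 : gap_tuple D1 t1 R) (tD2 : gap_tuple D2 t2 R).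
Hypotheses (cC1 : complete_flag C1) (cC2 : complete_flag C2).
Hypotheses (CG1 : forall j, (0 < j <= R)%N -> C1 (D1 j) = G1 j).
Hypotheses (CG2 : forall j, (0 < j <= R)%N -> C2 (D2 j) = G2 j).
Hypotheses (rel1 : relpos C1 (perp_flag q P1 C2) (gap_word D1 t1 R d1)).
Hypotheses (rel2 : relpos C2 (perp_flag q P2 C1) (gap_word D2 t2 R d2)).

Lemma fp_le1 j : (0 < j <= R)%N -> (D1 j <= d1)%N.
Proof. move=> jR; rewrite -(fp_dim1 fp) //; exact: dim_rV. Qed.

Lemma relword1 : (forall x, (x < d1)%N -> (p1 (C2 (d1 - x)%N) <= C1 x.+1)%VS) /\
  (forall x, (0 < x < d1)%N -> (p1 (C2 (d1 - x)%N) = C1 x <-> x \notin gap_word D1 t1 R d1)).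
Proof.
have R0 := fp_R fp; have D1d := @fp_le1 R ltac:(lia).
have e x : (d2 - x = d1 - x)%N by rewrite -d12.
have [H1 H2] := proj1 (relposP cC1 (perp_flag_complete dp cC2)
  (gap_word_sorted d1 R0 (fp_inc1 fp) tD1)
  (gap_word_bound R0 (fp_inc1 fp) tD1 (fp_pos1 fp) D1d)) rel1.
by split=> x xd; [have := H1 x xd | have := H2 x xd]; rewrite /perp_flag e.
Qed.

End Forward.

Lemma gap_word_ge1 t x : gap_tuple D1 t R -> x \in gap_word D1 t R d1 -> (D1 1 <= x)%N.
Proof.
have R0 := fp_R fp; move=> tD /(mem_gap_word _ _ R0) [[i [iR ix]]|H].
  by have := @incr_le D1 R (fp_R fp) (fp_inc1 fp) 1 i isT; lia.
by have := @incr_le D1 R (fp_R fp) (fp_inc1 fp) 1 R isT; lia.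
Qed.

Lemma gap_word_mem1 t j o : gap_tuple D1 t R -> (0 < j < R)%N -> (o < D1 j.+1 - D1 j)%N ->
  (D1 j + o \in gap_word D1 t R d1) = (o < t j)%N.
Proof.
move=> tD jR oj; have inc := @incr_le D1 R (fp_R fp) (fp_inc1 fp).
apply/(mem_gap_word _ _ (fp_R fp))/idP => [[[i [iR ix]]|H]|ot]; last by left; exists j; lia.
- have := tD i iR; have := fp_inc1 fp iR => h1 h2.
  have [ij|ij|ij] := ltngtP i j; last by rewrite ij in ix; lia.
    by have := inc i.+1 j isT; lia.
  by have := inc j.+1 i isT; lia.
- by have := inc j.+1 R isT; lia.
Qed.

Lemma gap_word_tail1 t x : gap_tuple D1 t R -> (D1 R <= x < d1)%N -> x \in gap_word D1 t R d1.
Proof. by move=> tD xR; apply/(mem_gap_word _ _ (fp_R fp)); right; lia. Qed.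
End Pair.

Section Forward2.
Variables (d1 d2 : nat) (P1 : 'M[k]_(d1, d2)) (P2 : 'M[k]_(d2, d1)).
Hypothesis dp : dual_pair sg P1 P2.
Local Notation p1 := (perp q P1).
Local Notation p2 := (perp q P2).
Variables (R : nat) (D1 D2 : nat -> nat).
Variables (G1 : nat -> {vspace 'rV[k]_d1}) (G2 : nat -> {vspace 'rV[k]_d2}).
Hypothesis fp : flag_pair R D1 D2 G1 G2.
Variables (t1 t2 : nat -> nat) (C1 : nat -> {vspace 'rV[k]_d1}) (C2 : nat -> {vspace 'rV[k]_d2}).
Hypotheses (tD1 : gap_tuple D1 t1 R) (tD2 : gap_tuple D2 t2 R).
Hypotheses (cC1 : complete_flag C1) (cC2 : complete_flag C2).
Hypotheses (CG1 : forall j, (0 < j <= R)%N -> C1 (D1 j) = G1 j).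
Hypotheses (CG2 : forall j, (0 < j <= R)%N -> C2 (D2 j) = G2 j).
Local Notation w1 := (gap_word D1 t1 R d1).
Local Notation w2 := (gap_word D2 t2 R d2).
Hypotheses (W1 : forall x, (x < d1)%N -> (p1 (C2 (d1 - x)%N) <= C1 x.+1)%VS)
  (E1 : forall x, (0 < x < d1)%N -> (p1 (C2 (d1 - x)%N) = C1 x <-> x \notin w1)).
Hypotheses (W2 : forall x, (x < d2)%N -> (p2 (C1 (d2 - x)%N) <= C2 x.+1)%VS)
  (E2 : forall x, (0 < x < d2)%N -> (p2 (C1 (d2 - x)%N) = C2 x <-> x \notin w2)).
Let d12 := fp_d fp.
Let fp' := flag_pair_sym fp.
Let R0 := fp_R fp.

Lemma fwd_perp j : (0 < j <= R)%N -> (p1 (G2 j) <= G1 (R.+1 - j))%VS.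
Proof.
move=> jR; have jR' : (0 < R.+1 - j <= R)%N by lia.
have := fp_sum fp jR'; have -> : (R.+1 - (R.+1 - j) = j)%N by lia.
move=> sj; have := @incr_le D1 R (fp_R fp) (fp_inc1 fp) 1 (R.+1 - j)%N isT ltac:(lia) => inc.
have pos := fp_pos1 fp; have le1 := fp_le1 fp jR'.
have := W1 (x := (D1 (R.+1 - j)).-1) ltac:(lia).
rewrite prednK ?CG1 //; last by lia.
have -> : (d1 - (D1 (R.+1 - j)).-1 = D2 j)%N by lia.
by rewrite CG2.
Qed.

Lemma fwd_tau y T : stable q P1 P2 T -> (C1 y <= T)%VS -> (0 < y < d1)%N ->
  y \in w1 -> (d1 - y)%N \notin w2 -> (C1 y.+1 <= T)%VS.
Proof.
move=> sT yT yd yw1 yw2; have [dC1 mC1] := cC1.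
have e2 : p2 (C1 y) = C2 (d1 - y)%N.
  rewrite -(proj2 (E2 (x := (d1 - y)%N) ltac:(move: d12 yd; lia)) yw2).
  by congr (p2 (C1 _)); move: d12 yd; lia.
have yd' : (y < d1)%N by case/andP: yd.
have := W1 yd'; rewrite -e2 => sub; have := proj1 (E1 yd); rewrite -e2 yw1 => ne.
have nsub : ~~ (p1 (p2 (C1 y)) <= C1 y)%VS.
  by apply/negP => /(stable_sub sgE dp) e; have := ne e.
have -> : C1 y.+1 = (C1 y + p1 (p2 (C1 y)))%VS.
  apply/esym/eqP; rewrite eqEdim subv_add sub mC1 ?leqnSn //=.
  have lt : (\dim (C1 y) < \dim (C1 y + p1 (p2 (C1 y))))%N.
    rewrite ltn_neqAle dimvS ?addvSl // andbT; apply: contra nsub => /eqP e.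
    have /eqP eC : (C1 y == C1 y + p1 (p2 (C1 y)))%VS by rewrite eqEdim addvSl e leqnn.
    by rewrite [X in (_ <= X)%VS]eC addvSr.
  by move: lt; rewrite !dC1 // ltnW.
by rewrite subv_add yT -sT; do 2!apply: (perpS sgE).
Qed.

(** Positions from [D1 R] on are all in the first word, and their dual positions are below [D2 1],
    where the second word has nothing; [fwd_tau] climbs to the top. *)
Lemma fwd_full T : stable q P1 P2 T -> (G1 R <= T)%VS -> T = fullv.
Proof.
move=> sT GT; have R1 : (0 < R <= R)%N by lia.
have sR := fp_sum fp R1; have le1 := fp_le1 fp R1.
have H s : (D1 R + s <= d1)%N -> (C1 (D1 R + s)%N <= T)%VS.
  elim: s => [|s IH] sd; first by rewrite addn0 CG1.
  have inc := @incr_le D1 R (fp_R fp) (fp_inc1 fp) 1 R isT ltac:(lia); have pos := fp_pos1 fp.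
  rewrite addnS; apply: fwd_tau => //; [by apply: IH; lia | lia | |].
    by apply: (gap_word_tail1 fp) => //; lia.
  apply/negP => /(gap_word_ge1 fp' tD2); move: sR; rewrite subSnn; lia.
have := H (d1 - D1 R)%N; rewrite subnKC // => /(_ (leqnn _)) sub.
apply/eqP; rewrite eqEdim subvf dim_fullrV.
by have [dC1 _] := cC1; have := dimvS sub; rewrite dC1.
Qed.

(** Along a run of mixed positions, the orthogonal at [x] is the intersection of the orthogonal at
    [x.+1] with [C2 x.+1]. An inclusion of [C2 a] would therefore descend to [x = a], where
    dimensions make it an equality. *)
Lemma fwd_run a x : (0 < a <= x)%N -> (x < d2)%N ->
  (forall y, (a <= y <= x)%N -> y \in w2) -> ~~ (C2 a <= p2 (C1 (d2 - x)%N))%VS.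
Proof.
have [dC2 mC2] := cC2; have [dC1 mC1] := cC1.
have dP y : (y <= d2)%N -> \dim (p2 (C1 (d2 - y)%N)) = y.
  move=> yd; have := dimp2 sgE dp (C1 (d2 - y)%N); rewrite dC1; last by rewrite d12 leq_subr.
  by move: d12 yd; dlia.
have mP y : (y < d2)%N -> (p2 (C1 (d2 - y)%N) <= p2 (C1 (d2 - y.+1)%N))%VS.
  by move=> yd; apply/(perpS sgE)/mC1; move: d12; lia.
elim: x => [|x IH] ax xd H; first by lia.
have xw : x.+1 \in w2 by apply: H; lia.
have ne : p2 (C1 (d2 - x.+1)%N) <> C2 x.+1 by move/(E2 (x := x.+1)); rewrite xw => /(_ xd).
have [e|ax'] := eqVneq a x.+1.
  rewrite e; apply/negP => sub; apply/ne/esym/eqP.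
  by rewrite eqEdim sub dP ?dC2 ?leqnn // ltnW.
apply: contra (IH ltac:(lia) ltac:(lia) (fun y ay => H y ltac:(lia))) => sub.
have sub2 : (C2 a <= C2 x.+1)%VS by apply: mC2; lia.
have xd' : (x < d2)%N by lia.
have -> : p2 (C1 (d2 - x)%N) = (p2 (C1 (d2 - x.+1)%N) :&: C2 x.+1)%VS.
  apply/eqP; rewrite eqEdim subv_cap mP // W2 //= dP ?(ltnW xd') //.
  have lt : (\dim (p2 (C1 (d2 - x.+1)%N) :&: C2 x.+1) < \dim (C2 x.+1))%N.
    rewrite ltn_neqAle dimvS ?capvSr // andbT; apply/negP => /eqP e.
    apply: ne; apply/esym/eqP; rewrite eqEdim dP ?dC2 ?leqnn ?andbT 1?ltnW //.
    have /eqP {1}<- : (p2 (C1 (d2 - x.+1)%N) :&: C2 x.+1 == C2 x.+1)%VS.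
      by rewrite eqEdim capvSr e leqnn.
    exact: capvSl.
  by move: lt; rewrite (dC2 x.+1 (ltnW xd)).
by rewrite subv_cap sub sub2.
Qed.

Lemma fwd_gap j : (0 < j < R)%N -> (D1 j.+1 - D1 j <= t1 j + t2 (R - j))%N ->
  no_stable q P1 P2 (G1 j) (G2 (R - j)).
Proof.
move=> jR tt T sT GT TG; set n := (D1 j.+1 - D1 j)%N in tt; set j' := (R - j)%N in tt TG.
have jR' : (0 < j' < R)%N by rewrite /j'; lia.
have s1 := fp_sum fp (j := j) ltac:(lia); have s2 := fp_sum fp (j := j.+1) ltac:(lia).
have e1 : (R.+1 - j = j'.+1)%N by rewrite /j'; lia.
have e2 : (R.+1 - j.+1 = j')%N by rewrite /j'; lia.
rewrite e1 in s1; rewrite e2 in s2.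
have i1 := fp_inc1 fp jR; have i2 := fp_inc2 fp jR'.
have pos1 := @incr_le D1 R (fp_R fp) (fp_inc1 fp) 1 j isT ltac:(lia).
have pos2 := @incr_le D2 R (fp_R fp) (fp_inc2 fp) 1 j' isT ltac:(lia).
have p01 := fp_pos1 fp; have p02 := fp_pos2 fp.
have le1 := fp_le1 fp (j := j.+1) ltac:(lia).
have t2n : (t2 j' <= n)%N by have := tD2 jR'; rewrite /n; lia.
have [dC1 mC1] := cC1; have [dC2 mC2] := cC2.
(* The first [n - t2 j'] steps can be climbed: they are in the first word because
   [n <= t1 j + t2 j'], and their dual positions are beyond the mixed part of the second. *)
have H o : (o <= n - t2 j')%N -> (C1 (D1 j + o)%N <= T)%VS.
  elim: o => [|o IH] od; first by rewrite addn0 CG1 //; lia.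
  rewrite addnS; apply: fwd_tau => //; [by apply: IH; lia | by rewrite /n in od; lia | |].
    by rewrite (gap_word_mem1 fp) //; rewrite /n in od *; lia.
  have -> : (d1 - (D1 j + o) = D2 j' + (n - 1 - o))%N by rewrite /n in od *; lia.
  rewrite (gap_word_mem1 fp') //; last by rewrite /n in od *; lia.
  by rewrite -leqNgt; lia.
have {}H := H _ (leqnn _).
have [t20|t20] := posnP (t2 j').
  have /dimvS := subv_trans H TG; rewrite t20 subn0.
  have -> : (D1 j + n = D1 j.+1)%N by rewrite /n; lia.
  rewrite dC1 //; have := dimp1 sgE dp (G2 j'); rewrite (fp_dim2 fp); last by lia.
  by move: s2; dlia.
(* What is left of the gap is seen from the other side: [G2 j'] is orthogonal to what has been
   climbed, which contradicts the run of [t2 j'] mixed positions above it. *)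
have sub : (G2 j' <= p2 (C1 (D1 j + (n - t2 j'))%N))%VS.
  apply: subv_trans (perpS sgE P2 H); apply: (p1_reflect sgE dp); by rewrite sT.
have run y : (D2 j' <= y <= D2 j' + t2 j' - 1)%N -> y \in w2.
  move=> yd; have -> : (y = D2 j' + (y - D2 j'))%N by lia.
  by rewrite (gap_word_mem1 fp') //; rewrite /n in t2n; lia.
have := fwd_run (a := D2 j') (x := (D2 j' + t2 j' - 1)%N) ltac:(lia) ltac:(rewrite /n in t2n; lia) run.
rewrite CG2; last by lia.
have -> : (d2 - (D2 j' + t2 j' - 1) = D1 j + (n - t2 j'))%N.
  by rewrite /n in t2n *; move: d12; lia.
by rewrite sub.
Qed.

End Forward2.

End Strata.

(** * Complete flags assembled from filled gaps *)

Section Assembly.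
Variables (k : fieldType) (q : nat) (sg : {rmorphism k -> k}).
Hypothesis sgE : forall x, sg x = x ^+ q.

Section TauSum.
Variables (T1 T2 : vectType k).
Variables (pa : {vspace T2} -> {vspace T1}) (pb : {vspace T1} -> {vspace T2}).

Definition tau_sum G s := iter s (fun T => T + pa (pb T))%VS G.
End TauSum.

(* The complete flag made of the pieces [c j] between [G1 j] and [G1 (j + 1)], of
   the sums of the first transforms by [pa \o pb] of [G1 R] above [G1 R], and of
   the orthogonals of those of [G2 R] below [G1 1]. *)
Definition assemble (T1 T2 : vectType k) (pa : {vspace T2} -> {vspace T1})
    (pb : {vspace T1} -> {vspace T2}) d R (D1 D2 : nat -> nat) G1 G2
    (c : nat -> nat -> {vspace T1}) x :=
  if (x < D1 1)%N then pa (tau_sum pb pa (G2 R) (d - x - D2 R))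
  else if (D1 R <= x)%N then tau_sum pa pb (G1 R) (x - D1 R)
  else let j := count (fun j => D1 j <= x)%N (iota 1 R) in c j (x - D1 j)%N.

Lemma count_incr D R j x : (forall j, (0 < j < R)%N -> (D j < D j.+1)%N) ->
  (0 < j < R)%N -> (D j <= x < D j.+1)%N -> count (fun j => D j <= x)%N (iota 1 R) = j.
Proof.
move=> inc jR xj; have R0 : (0 < R)%N by lia.
have -> : iota 1 R = iota 1 j ++ iota (1 + j) (R - j) by rewrite -iotaD subnKC //; lia.
rewrite count_cat [X in (_ + X)%N](_ : _ = 0%N) ?addn0; last first.
  apply/eqP; rewrite eqn0Ngt -has_count; apply/hasPn => i; rewrite mem_iota => ij.
  by have := @incr_le D R R0 inc j.+1 i isT; rewrite -ltnNge; lia.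
rewrite -[RHS](size_iota 1 j); apply/eqP; rewrite -all_count.
apply/allP => i; rewrite mem_iota => ij.
by have := @incr_le D R R0 inc i j; lia.
Qed.

Section Pair.
Variables (d1 d2 : nat) (P1 : 'M[k]_(d1, d2)) (P2 : 'M[k]_(d2, d1)).
Hypothesis dp : dual_pair sg P1 P2.
Local Notation p1 := (perp q P1).
Local Notation p2 := (perp q P2).
Variables (R : nat) (D1 D2 : nat -> nat).
Variables (G1 : nat -> {vspace 'rV[k]_d1}) (G2 : nat -> {vspace 'rV[k]_d2}).
Hypothesis fp : flag_pair R D1 D2 G1 G2.
Hypothesis perp1 : forall j, (0 < j <= R)%N -> (p1 (G2 j) <= G1 (R.+1 - j))%VS.
Hypothesis perp2 : forall j, (0 < j <= R)%N -> (p2 (G1 j) <= G2 (R.+1 - j))%VS.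
Hypothesis full1 : forall T, stable q P1 P2 T -> (G1 R <= T)%VS -> T = fullv.
Let d12 := fp_d fp.
Let R0 := fp_R fp.

Lemma tau_sum_sub s : (G1 R <= tau_sum p1 p2 (G1 R) s)%VS.
Proof. by elim: s => //= s IH; rewrite (subv_trans IH) ?addvSl. Qed.

(** Each step adds at least one dimension, since no proper stable subspace contains [G1 R], and at
    most one, since a term meets its twist in codimension at most one. The latter holds at the start
    because both contain [p1 (G2 1)], and passes on because the twist of a term lies in the next
    term and in its twist. *)
Lemma dim_tau_sum s : (D1 R + s <= d1)%N -> \dim (tau_sum p1 p2 (G1 R) s) = (D1 R + s)%N.
Proof.
have R1 : (0 < R <= R)%N by rewrite R0 leqnn.
have dG : \dim (G1 R) = D1 R by exact: fp_dim1 fp _ R1.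
set T := tau_sum p1 p2 (G1 R).
have lo s' : (s' < d1 - D1 R)%N -> \dim (T s') = (D1 R + s')%N -> (\dim (T s') < \dim (T s'.+1))%N.
  move=> sd dT; rewrite ltn_neqAle dimvS ?addvSl // andbT; apply/negP => /eqP e.
  have /eqP eT : (T s' == T s'.+1)%VS by rewrite eqEdim addvSl e leqnn.
  have : stable q P1 P2 (T s').
    by apply: (stable_sub sgE dp); rewrite [X in (_ <= X)%VS]eT addvSr.
  move/full1 => /(_ (tau_sum_sub s')) eT'.
  by move: dT; rewrite eT' dim_fullrV; lia.
suff H : (D1 R + s <= d1)%N -> \dim (T s) = (D1 R + s)%N /\ (D1 R + s <= (\dim (T s :&: p1 (p2 (T s)))).+1)%N.
  by move=> sd; case: (H sd).
elim: s => [|s IH] sd.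
  rewrite addn0; split=> //.
  have sub : (p1 (G2 1%N) <= T 0%N :&: p1 (p2 (T 0%N)))%VS.
    rewrite subv_cap; apply/andP; split.
      by have := perp1 (j := 1) R0; rewrite subSS subn0.
    by apply: (perpS sgE); have := perp2 R1; rewrite subSnn.
  have := dimvS sub; have := dimp1 sgE dp (G2 1); rewrite (fp_dim2 fp) //.
  by have := fp_sum fp R1; rewrite subSnn; dlia.
have [dT dI] := IH ltac:(lia).
have dI' : \dim (T s.+1) = (D1 R + s.+1)%N.
  have l := lo s ltac:(lia) dT; have := dimv_sum_cap (T s) (p1 (p2 (T s))).
  rewrite (dim_tau sgE dp) -[(T s + _)%VS]/(T s.+1) => e.
  by move: l e dT dI; dlia.
split=> //; have sub : (p1 (p2 (T s)) <= T s.+1 :&: p1 (p2 (T s.+1)))%VS.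
  by rewrite subv_cap addvSr; do 2!apply: (perpS sgE); exact: addvSl.
by have := dimvS sub; rewrite (dim_tau sgE dp); move: dT; dlia.
Qed.

Variables (c : nat -> nat -> {vspace 'rV[k]_d1}) (c' : nat -> nat -> {vspace 'rV[k]_d2}).
Variable t : nat -> nat.
Hypothesis pc : forall j, (0 < j < R)%N ->
  piece p1 (D1 j.+1 - D1 j) (G1 j) (G1 j.+1) (c j) (c' (R - j)%N) (t j).

Local Notation C := (assemble p1 p2 d1 R D1 D2 G1 G2 c).

Lemma asm_low x : (x < D1 1)%N -> C x = p1 (tau_sum p2 p1 (G2 R) (d1 - x - D2 R)).
Proof. by rewrite /assemble => ->. Qed.

Lemma asm_high x : (D1 R <= x)%N -> C x = tau_sum p1 p2 (G1 R) (x - D1 R).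
Proof.
move=> xR; rewrite /assemble xR ltnNge (leq_trans _ xR) //.
by apply: (@incr_le D1 R R0 (fp_inc1 fp)); rewrite // R0 leqnn.
Qed.

Lemma asm_start j : (0 < j <= R)%N -> C (D1 j) = G1 j.
Proof.
move=> jR; have [->|ne] := eqVneq j R; first by rewrite asm_high // subnn.
have jR' : (0 < j < R)%N by lia.
have inc := @incr_le D1 R R0 (fp_inc1 fp); have l := fp_inc1 fp jR'.
rewrite /assemble ltnNge inc //= leqNgt (leq_trans l) ?inc //=; last by lia.
rewrite (count_incr (j := j) (fp_inc1 fp)) ?leqnn // subnn.
by case: (pc jR') => [[]].
Qed.

Lemma asm_mid j o : (0 < j < R)%N -> (o <= D1 j.+1 - D1 j)%N -> C (D1 j + o)%N = c j o.
Proof.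
move=> jR; have inc := @incr_le D1 R R0 (fp_inc1 fp); have l := fp_inc1 fp jR.
rewrite leq_eqVlt => /orP [/eqP ->|ol].
  rewrite subnKC ?(ltnW l) // asm_start; last by lia.
  by case: (pc jR) => [[]].
have i1 := inc 1%N j isT ltac:(lia); have i2 := inc j.+1 R isT ltac:(lia).
rewrite /assemble ltnNge (leq_trans i1) ?leq_addr //= leqNgt (leq_trans _ i2) /=; last by lia.
rewrite (count_incr (j := j) (fp_inc1 fp)) ?addKn //; lia.
Qed.

Lemma asm_split x : [\/ (x < D1 1)%N, (D1 R <= x)%N |
  exists j o, [/\ (0 < j < R)%N, (o < D1 j.+1 - D1 j)%N & x = (D1 j + o)%N]].
Proof.
have H r : (0 < r <= R)%N -> [\/ (x < D1 1)%N, (D1 r <= x)%N |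
  exists j o, [/\ (0 < j < R)%N, (o < D1 j.+1 - D1 j)%N & x = (D1 j + o)%N]].
  elim: r => // -[_ _|r IH rR]; first by case: (leqP (D1 1) x); [constructor 2|constructor 1].
  have [H|H|H] := IH ltac:(lia); [by constructor 1| |by constructor 3].
  have [h|h] := leqP (D1 r.+2) x; first by constructor 2.
  by constructor 3; exists r.+1, (x - D1 r.+1)%N; split; lia.
by apply: H; lia.
Qed.

End Pair.

Section Assemble2.
Variables (d1 d2 : nat) (P1 : 'M[k]_(d1, d2)) (P2 : 'M[k]_(d2, d1)).
Hypothesis dp : dual_pair sg P1 P2.
Local Notation p1 := (perp q P1).
Local Notation p2 := (perp q P2).
Variables (R : nat) (D1 D2 : nat -> nat).
Variables (G1 : nat -> {vspace 'rV[k]_d1}) (G2 : nat -> {vspace 'rV[k]_d2}).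
Hypothesis fp : flag_pair R D1 D2 G1 G2.
Hypothesis perp1 : forall j, (0 < j <= R)%N -> (p1 (G2 j) <= G1 (R.+1 - j))%VS.
Hypothesis perp2 : forall j, (0 < j <= R)%N -> (p2 (G1 j) <= G2 (R.+1 - j))%VS.
Hypothesis full1 : forall T, stable q P1 P2 T -> (G1 R <= T)%VS -> T = fullv.
Hypothesis full2 : forall T, stable q P2 P1 T -> (G2 R <= T)%VS -> T = fullv.
Let d12 := fp_d fp.
Let R0 := fp_R fp.
Let fp' := flag_pair_sym fp.
Let dp' := dual_pair_sym dp.
Variables (c1 : nat -> nat -> {vspace 'rV[k]_d1}) (c2 : nat -> nat -> {vspace 'rV[k]_d2}).
Variables (t1 t2 : nat -> nat).
Hypothesis pc1 : forall j, (0 < j < R)%N ->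
  piece p1 (D1 j.+1 - D1 j) (G1 j) (G1 j.+1) (c1 j) (c2 (R - j)%N) (t1 j).
Hypothesis pc2 : forall j, (0 < j < R)%N ->
  piece p2 (D2 j.+1 - D2 j) (G2 j) (G2 j.+1) (c2 j) (c1 (R - j)%N) (t2 j).
Local Notation C1 := (assemble p1 p2 d1 R D1 D2 G1 G2 c1).
Local Notation C2 := (assemble p2 p1 d2 R D2 D1 G2 G1 c2).

Let R1 : (0 < R <= R)%N. Proof. by rewrite R0 leqnn. Qed.
Let sR : (D1 R + D2 1 = d1.+1)%N. Proof. by have := fp_sum fp R1; rewrite subSnn. Qed.
Let s1 : (D1 1 + D2 R = d1.+1)%N.
Proof. by have := fp_sum fp (j := 1) R0; rewrite subSS subn0. Qed.

Lemma asm_low_dual x : (x < D1 1)%N -> C1 x = p1 (C2 (d1 - x)%N).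
Proof. by move=> x1; rewrite asm_low // (asm_high _ _ fp') //; lia. Qed.

Lemma asm_dim x : (x <= d1)%N -> \dim (C1 x) = x.
Proof.
move=> xd; case: (asm_split fp x) => [x1|xR|[j [o [jR oj ->]]]].
- rewrite asm_low //; have := dimp1 sgE dp (tau_sum p2 p1 (G2 R) (d1 - x - D2 R)).
  rewrite (dim_tau_sum dp' fp' perp2 perp1 full2); last by move: d12; lia.
  by dlia.
- by rewrite (asm_high _ _ fp) // (dim_tau_sum dp fp perp1 perp2 full1); lia.
- rewrite (asm_mid _ fp pc1) //; last exact: ltnW.
  have [_ dc _ _] := pc1 jR; rewrite dc ?(ltnW oj) // (fp_dim1 fp) //; lia.
Qed.

Lemma asm_incr x : (x < d1)%N -> (C1 x <= C1 x.+1)%VS.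
Proof.
move=> xd; case: (asm_split fp x) => [x1|xR|[j [o [jR oj ->]]]].
- rewrite asm_low //; have [e|ne] := eqVneq x.+1 (D1 1).
    rewrite e (asm_start _ fp pc1) //.
    have -> : (d1 - x - D2 R = 0)%N by lia.
    by have := perp1 R1; rewrite subSnn.
  rewrite asm_low; last by lia.
  apply: (perpS sgE); have -> : (d1 - x - D2 R = (d1 - x.+1 - D2 R).+1)%N by lia.
  exact: addvSl.
- by rewrite !(asm_high _ _ fp) ?(leq_trans xR) // subSn //; exact: addvSl.
- rewrite -addnS !(asm_mid _ fp pc1) //; last exact: ltnW.
  by have [_ _ mc _] := pc1 jR; apply: mc.
Qed.

Lemma asm_complete : complete_flag C1.
Proof.
split=> [x|x y /andP [xy yd]]; first exact: asm_dim.
elim: y xy yd => [|y IH]; first by rewrite leqn0 => /eqP ->.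
rewrite leq_eqVlt => /orP [/eqP ->//|xy] yd.
by apply: subv_trans (asm_incr yd); apply: IH => //; exact: ltnW.
Qed.

Lemma asm_tuple : gap_tuple D1 t1 R.
Proof. by move=> j jR; case: (pc1 jR) => [[]]. Qed.

End Assemble2.

Section Assemble3.
Variables (d1 d2 : nat) (P1 : 'M[k]_(d1, d2)) (P2 : 'M[k]_(d2, d1)).
Hypothesis dp : dual_pair sg P1 P2.
Local Notation p1 := (perp q P1).
Local Notation p2 := (perp q P2).
Variables (R : nat) (D1 D2 : nat -> nat).
Variables (G1 : nat -> {vspace 'rV[k]_d1}) (G2 : nat -> {vspace 'rV[k]_d2}).
Hypothesis fp : flag_pair R D1 D2 G1 G2.
Hypothesis perp1 : forall j, (0 < j <= R)%N -> (p1 (G2 j) <= G1 (R.+1 - j))%VS.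
Hypothesis perp2 : forall j, (0 < j <= R)%N -> (p2 (G1 j) <= G2 (R.+1 - j))%VS.
Hypothesis full1 : forall T, stable q P1 P2 T -> (G1 R <= T)%VS -> T = fullv.
Hypothesis full2 : forall T, stable q P2 P1 T -> (G2 R <= T)%VS -> T = fullv.
Let d12 := fp_d fp.
Let R0 := fp_R fp.
Let fp' := flag_pair_sym fp.
Let dp' := dual_pair_sym dp.
Variables (c1 : nat -> nat -> {vspace 'rV[k]_d1}) (c2 : nat -> nat -> {vspace 'rV[k]_d2}).
Variables (t1 t2 : nat -> nat).
Hypothesis pc1 : forall j, (0 < j < R)%N ->
  piece p1 (D1 j.+1 - D1 j) (G1 j) (G1 j.+1) (c1 j) (c2 (R - j)%N) (t1 j).
Hypothesis pc2 : forall j, (0 < j < R)%N ->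
  piece p2 (D2 j.+1 - D2 j) (G2 j) (G2 j.+1) (c2 j) (c1 (R - j)%N) (t2 j).
Local Notation C1 := (assemble p1 p2 d1 R D1 D2 G1 G2 c1).
Local Notation C2 := (assemble p2 p1 d2 R D2 D1 G2 G1 c2).
Let cC1 := asm_complete dp fp perp1 perp2 full1 full2 pc1.
Let cC2 := asm_complete dp' fp' perp2 perp1 full2 full1 pc2.
Let tD1 := asm_tuple pc1.
Let R1 : (0 < R <= R)%N. Proof. by rewrite R0 leqnn. Qed.
Let sR : (D1 R + D2 1 = d1.+1)%N. Proof. by have := fp_sum fp R1; rewrite subSnn. Qed.
Let s1 : (D1 1 + D2 R = d1.+1)%N.
Proof. by have := fp_sum fp (j := 1) R0; rewrite subSS subn0. Qed.

(** Below [D1 1] the flags are orthogonal by construction, so nothing is mixed. From [D1 R] on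
    everything is, since a proper subspace containing [G1 R] is not stable. In between the pieces
    decide. *)
Lemma asm_relpos : relpos C1 (perp_flag q P1 C2) (gap_word D1 t1 R d1).
Proof.
have D1d := fp_le1 fp R1.
have e21 x : (d2 - x = d1 - x)%N by rewrite d12.
apply/(relposP cC1 (perp_flag_complete sgE dp cC2)
  (gap_word_sorted d1 R0 (fp_inc1 fp) tD1)
  (gap_word_bound R0 (fp_inc1 fp) tD1 (fp_pos1 fp) D1d)).
rewrite /perp_flag.
suff H x : (x < d1)%N -> (p1 (C2 (d2 - x)%N) <= C1 x.+1)%VS /\
    (p1 (C2 (d2 - x)%N) = C1 x <-> x \notin gap_word D1 t1 R d1).
  by split=> x xd; [case: (H x xd) | case: (H x); [case/andP: xd|]].
rewrite e21 => xd; case: (asm_split fp x) => [x1|xR|[j [o [jR oj xE]]]].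
- have e := asm_low_dual P1 P2 fp c1 c2 x1; rewrite -e; split.
    exact: (asm_incr P2 fp perp1 pc1).
  by split=> // _; apply/negP => /(gap_word_ge1 fp tD1); lia.
- have xw : x \in gap_word D1 t1 R d1 by apply: (gap_word_tail1 fp) => //; lia.
  have -> : C2 (d1 - x)%N = p2 (C1 x).
    rewrite (asm_low_dual P2 P1 fp' c2 c1); last by lia.
    by congr (p2 (C1 _)); move: d12; lia.
  rewrite xw; split.
    by rewrite !(asm_high _ _ fp) ?(leq_trans xR) // subSn //; exact: addvSr.
  split=> // sC; have : (G1 R <= C1 x)%VS by rewrite (asm_high _ _ fp) //; exact: tau_sum_sub.
  move/(full1 sC) => e; have [dC1 _] := cC1; have := dC1 x (ltnW xd).
  by rewrite e dim_fullrV; lia.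
- have jR' : (0 < R - j < R)%N by lia.
  have sj := fp_sum fp (j := j) ltac:(lia); have sj1 := fp_sum fp (j := j.+1) ltac:(lia).
  have e1 : (R.+1 - j = (R - j).+1)%N by lia.
  have e2 : (R.+1 - j.+1 = R - j)%N by lia.
  rewrite e1 in sj; rewrite e2 in sj1.
  have -> : (d1 - x = D2 (R - j) + (D1 j.+1 - D1 j - 1 - o))%N by lia.
  rewrite (asm_mid _ fp' pc2) //; last by lia.
  rewrite xE (gap_word_mem1 fp) // -addnS !(asm_mid _ fp pc1) //; last exact: ltnW.
  case: (pc1 jR) => _ _ _ /(_ o oj) [h1 h2]; split=> //.
  by rewrite -leqNgt.
Qed.

End Assemble3.
End Assembly.

(** * Strata of flags characterized by stable subspaces *)

Section StrataThm.
Variables (k : fieldType) (q : nat) (sg : {rmorphism k -> k}).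
Hypothesis closedk : forall p : {poly k}, size p != 1%N -> exists x, root p x.
Hypotheses (sgE : forall x, sg x = x ^+ q) (q_gt1 : (1 < q)%N).

Definition full_at d1 d2 (P1 : 'M[k]_(d1, d2)) (P2 : 'M[k]_(d2, d1)) G :=
  forall T, stable q P1 P2 T -> (G <= T)%VS -> T = fullv.

Section GL.
Variables (d1 d2 : nat) (P1 : 'M[k]_(d1, d2)) (P2 : 'M[k]_(d2, d1)).
Hypothesis dp : dual_pair sg P1 P2.
Variables (R : nat) (D1 D2 : nat -> nat).
Variables (G1 : nat -> {vspace 'rV[k]_d1}) (G2 : nat -> {vspace 'rV[k]_d2}).
Hypothesis fp : flag_pair R D1 D2 G1 G2.

(** The flag counterpart of [open_point]. Fullness forbids refining a lattice of the index, and
    [no_stable] in a gap forbids adding an element to it. *)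
Definition open_cond := [/\
  forall j, (0 < j <= R)%N -> (perp q P1 (G2 j) <= G1 (R.+1 - j))%VS,
  forall j, (0 < j <= R)%N -> (perp q P2 (G1 j) <= G2 (R.+1 - j))%VS,
  full_at P1 P2 (G1 R), full_at P2 P1 (G2 R)
  & forall j, (0 < j < R)%N -> no_stable q P1 P2 (G1 j) (G2 (R - j))].

Definition DL_cond t1 t2 C1 C2 :=
  [/\ gap_tuple D1 t1 R /\ gap_tuple D2 t2 R,
      forall j, (0 < j < R)%N -> (D1 j.+1 - D1 j <= t1 j + t2 (R - j))%N,
      complete_flag C1 /\ complete_flag C2,
      (forall j, (0 < j <= R)%N -> C1 (D1 j) = G1 j) /\
      (forall j, (0 < j <= R)%N -> C2 (D2 j) = G2 j)
    & relpos C1 (perp_flag q P1 C2) (gap_word D1 t1 R d1) /\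
      relpos C2 (perp_flag q P2 C1) (gap_word D2 t2 R d2)].

Lemma DL_open t1 t2 C1 C2 : DL_cond t1 t2 C1 C2 -> open_cond.
Proof.
have dp' := dual_pair_sym dp; have fp' := flag_pair_sym fp.
move=> [[tD1 tD2] tt [cC1 cC2] [CG1 CG2] [rel1 rel2]].
have [W1 E1] := relword1 sgE dp fp tD1 cC1 cC2 rel1.
have [W2 E2] := relword1 sgE dp' fp' tD2 cC2 cC1 rel2.
split.
- exact: (fwd_perp fp CG1 CG2 W1).
- exact: (fwd_perp fp' CG2 CG1 W2).
- exact: (fwd_full sgE dp fp tD1 tD2 cC1 CG1 W1 E1 E2).
- exact: (fwd_full sgE dp' fp' tD2 tD1 cC2 CG2 W2 E2 E1).
- move=> j jR.
  exact: (fwd_gap sgE dp fp tD1 tD2 cC1 cC2 CG1 CG2 W1 E1 W2 E2 jR (tt j jR)).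
Qed.

Lemma flag_gap j : open_cond -> (0 < j < R)%N ->
  (D2 (R - j).+1 - D2 (R - j) = D1 j.+1 - D1 j)%N /\
  gap_hyp q P1 P2 (D1 j.+1 - D1 j) (G1 j) (G1 j.+1) (G2 (R - j)) (G2 (R - j).+1).
Proof.
move=> [perp1 perp2 _ _ _] jR; have jR' : (0 < R - j < R)%N by lia.
have s1 := fp_sum fp (j := j) ltac:(lia); have s2 := fp_sum fp (j := j.+1) ltac:(lia).
have e1 : (R.+1 - j = (R - j).+1)%N by lia.
have e2 : (R.+1 - j.+1 = R - j)%N by lia.
rewrite e1 in s1; rewrite e2 in s2.
have i1 := fp_inc1 fp jR; have i2 := fp_inc2 fp jR'.
split; first by lia.
have e3 : (R.+1 - (R - j) = j.+1)%N by lia.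
have e4 : (R.+1 - (R - j).+1 = j)%N by lia.
have jR1 : (0 < j <= R)%N by lia.
have jR2 : (0 < j.+1 <= R)%N by lia.
have jR3 : (0 < R - j <= R)%N by lia.
have jR4 : (0 < (R - j).+1 <= R)%N by lia.
split.
- split; rewrite ?(fp_sub1 fp) ?(fp_sub2 fp) //.
  + by rewrite !(fp_dim1 fp) //; lia.
  + by rewrite !(fp_dim2 fp) //; lia.
  + by rewrite (fp_dim1 fp) // (fp_dim2 fp) //; lia.
- by have := perp1 _ jR3; rewrite e3.
- by have := perp2 _ jR2; rewrite e2.
- by have := perp2 _ jR1; rewrite e1.
- by have := perp1 _ jR4; rewrite e4.
Qed.

Lemma assemble_DL c1 c2 t1 t2 : open_cond ->
  (forall j, (0 < j < R)%N ->
    [/\ piece (perp q P1) (D1 j.+1 - D1 j) (G1 j) (G1 j.+1) (c1 j) (c2 (R - j)%N) (t1 j),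
        piece (perp q P2) (D2 j.+1 - D2 j) (G2 j) (G2 j.+1) (c2 j) (c1 (R - j)%N) (t2 j)
      & (D1 j.+1 - D1 j <= t1 j + t2 (R - j))%N]) ->
  DL_cond t1 t2 (assemble (perp q P1) (perp q P2) d1 R D1 D2 G1 G2 c1)
                (assemble (perp q P2) (perp q P1) d2 R D2 D1 G2 G1 c2).
Proof.
have dp' := dual_pair_sym dp; have fp' := flag_pair_sym fp.
move=> [perp1 perp2 full1 full2 _] pc.
have pc1 j jR := let: And3 h _ _ := pc j jR in h.
have pc2 j jR := let: And3 _ h _ := pc j jR in h.
split.
- by split; [exact: asm_tuple pc1 | exact: asm_tuple pc2].
- by move=> j jR; case: (pc j jR).
- split; [exact: (asm_complete sgE dp fp perp1 perp2 full1 full2 pc1)|].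
  exact: (asm_complete sgE dp' fp' perp2 perp1 full2 full1 pc2).
- by split=> j jR; [rewrite (asm_start _ fp pc1) | rewrite (asm_start _ fp' pc2)].
- split; [exact: (asm_relpos sgE dp fp perp1 perp2 full1 full2 pc1 pc2)|].
  exact: (asm_relpos sgE dp' fp' perp2 perp1 full2 full1 pc2 pc1).
Qed.

Theorem strata_GL : (exists t1 t2 C1 C2, DL_cond t1 t2 C1 C2) <-> open_cond.
Proof.
split=> [[t1 [t2 [C1 [C2 /DL_open]]]]//|oc].
have H j : exists F : (nat -> {vspace 'rV[k]_d1}) * (nat -> {vspace 'rV[k]_d2}) * nat * nat,
    (0 < j < R)%N ->
    [/\ piece (perp q P1) (D1 j.+1 - D1 j) (G1 j) (G1 j.+1) F.1.1.1 F.1.1.2 F.1.2,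
        piece (perp q P2) (D2 (R - j).+1 - D2 (R - j)) (G2 (R - j)) (G2 (R - j).+1)
          F.1.1.2 F.1.1.1 F.2
      & (D1 j.+1 - D1 j <= F.1.2 + F.2)%N].
  have [jR|nj] := boolP (0 < j < R)%N; last first.
    by exists (fun=> 0%VS, fun=> 0%VS, 0%N, 0%N).
  have [e gh] := flag_gap oc jR; case: (oc) => _ _ _ _ ns.
  have [c1 [c2 [t1 [t2 [h1 h2 h3 _]]]]] := gap_fill closedk sgE q_gt1 dp gh (ns j jR).
  by exists (c1, c2, t1, t2) => _ /=; rewrite e.
have [F HF] := choice H.
exists (fun j => (F j).1.2), (fun j => (F (R - j)%N).2).
eexists; eexists; apply: (@assemble_DL (fun j => (F j).1.1.1) (fun j => (F (R - j)%N).1.1.2)) => //.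
move=> j jR; have jR' : (0 < R - j < R)%N by lia.
have e : (R - (R - j) = j)%N by lia.
have [h1 _ h3] := HF j jR; have [_ h2 _] := HF _ jR'.
by rewrite e in h2 *; split.
Qed.

End GL.

Section U.
Variables (d : nat) (P : 'M[k]_d).
Hypothesis dp : dual_pair sg P P.
Variables (R : nat) (D : nat -> nat) (G : nat -> {vspace 'rV[k]_d}).
Hypothesis fp : flag_pair R D D G G.

Theorem strata_U : (exists t C, DL_cond P P R D D G G t t C C) <-> open_cond P P R G G.
Proof.
split=> [[t [C /(DL_open dp fp)]]//|oc].
pose fills j (F : (nat -> {vspace 'rV[k]_d}) * (nat -> {vspace 'rV[k]_d}) * nat * nat) :=
    [/\ piece (perp q P) (D j.+1 - D j) (G j) (G j.+1) F.1.1.1 F.1.1.2 F.1.2,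
        piece (perp q P) (D (R - j).+1 - D (R - j)) (G (R - j)) (G (R - j).+1)
          F.1.1.2 F.1.1.1 F.2,
        (D j.+1 - D j <= F.1.2 + F.2)%N
      & j = (R - j)%N -> F.1.1.1 = F.1.1.2 /\ F.1.2 = F.2].
have H j : exists F, (0 < j < R)%N -> fills j F.
  have [jR|nj] := boolP (0 < j < R)%N; last first.
    by exists (fun=> 0%VS, fun=> 0%VS, 0%N, 0%N).
  have [e gh] := flag_gap fp oc jR; case: (oc) => _ _ _ _ ns.
  (* The gap with [j = R - j] is its own dual, so the two pieces must be literally the same. *)
  rewrite /fills; have [e2|ne] := eqVneq j (R - j)%N.
    have nsj := ns j jR; rewrite -!e2 in gh nsj *.
    have [c [t [h1 h2 _]]] := gap_fill_self closedk sgE q_gt1 dp gh nsj.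
    by exists (c, c, t, t).
  have [c1 [c2 [t1 [t2 [h1 h2 h3 _]]]]] := gap_fill closedk sgE q_gt1 dp gh (ns j jR).
  exists (c1, c2, t1, t2) => _ /=; rewrite e; split=> // ej.
  by case/eqP: ne.
have [F HF] := choice H.
(* Choices for [j] and [R - j] are made independently; the one for the smaller index is used for
   both gaps. *)
pose c j := if (j <= R - j)%N then (F j).1.1.1 else (F (R - j)%N).1.1.2.
pose t j := if (j <= R - j)%N then (F j).1.2 else (F (R - j)%N).2.
exists t; eexists; apply: (@assemble_DL _ _ P P dp _ _ _ _ _ fp c c) => //.
suff K j : (0 < j < R)%N -> piece (perp q P) (D j.+1 - D j) (G j) (G j.+1) (c j) (c (R - j)%N) (t j)
    /\ (D j.+1 - D j <= t j + t (R - j))%N by move=> j jR; case: (K j jR).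
move=> jR; have jR' : (0 < R - j < R)%N by lia.
have e : (R - (R - j) = j)%N by lia.
rewrite /c /t e; have [ej|nej] := eqVneq j (R - j)%N.
  rewrite -!ej leqnn; have [h1 _ h3 h4] := HF j jR; have [e1 e2] := h4 ej.
  by rewrite -e1 in h1; rewrite -e2 in h3.
have [lt|lt] := leqP j (R - j).
  have -> : (R - j <= j)%N = false by apply/negbTE; move: lt nej; lia.
  by have [h1 _ h3 _] := HF j jR.
rewrite (ltnW lt); have [h1 h2 h3 _] := HF _ jR'; rewrite e in h2 *.
split=> //; have [e' _] := flag_gap fp oc jR; rewrite addnC; lia.
Qed.

End U.
End StrataThm.

(** * Lattices over complete discretely valued fields *)

Section Cdvf.
Variables (k : fieldType) (K : cdvf k).
Local Notation O := (oring K).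
Local Notation F := (fld K).
Local Notation e_ := (emb K).
Local Notation pi := (Defs.pi K).

Definition piO (x : F) : Prop := exists w, x = e_ (unif K * w).

Lemma integralD (x y : F) : integral x -> integral y -> integral (x + y).
Proof. by move=> [a ->] [b ->]; exists (a + b); rewrite rmorphD. Qed.
Lemma integralM (x y : F) : integral x -> integral y -> integral (x * y).
Proof. by move=> [a ->] [b ->]; exists (a * b); rewrite rmorphM. Qed.
Lemma integral_emb a : integral (e_ a). Proof. by exists a. Qed.
Lemma integral_sum (I : Type) (r : seq I) (f : I -> F) :
  (forall i, integral (f i)) -> integral (\sum_(i <- r) f i).
Proof.
move=> H; elim/big_ind: _ => //; last exact: integralD.
by exists 0; rewrite rmorph0.
Qed.

Lemma piOD (x y : F) : piO x -> piO y -> piO (x + y).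
Proof. by move=> [a ->] [b ->]; exists (a + b); rewrite mulrDr rmorphD. Qed.
Lemma pi_neq0 : pi != 0.
Proof. by rewrite /Defs.pi -(rmorph0 (emb K)) (inj_eq (@emb_inj _ K)) unif_neq0. Qed.

Lemma piO_integral (x : F) : piO x <-> integral (pi^-1 * x).
Proof.
split=> [[w ->]|[w e]]; exists w.
  by rewrite rmorphM mulrA mulVf ?mul1r ?pi_neq0.
by rewrite rmorphM -e mulrA divff ?mul1r ?pi_neq0.
Qed.

Lemma res_unif : res K (unif K) = 0.
Proof. by apply/res_ker; exists 1; rewrite mulr1. Qed.

Lemma piO_emb a : piO (e_ a) <-> res K a = 0.
Proof.
split=> [[w /emb_inj ->]|/res_ker [w ->]]; last by exists w.
by rewrite rmorphM res_unif mul0r.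
Qed.

(* Inverse of [1 - pi x] by the geometric series. *)
Lemma res_unit a : res K a != 0 -> a \is a GRing.unit.
Proof.
move=> a0; have [c cE] := res_surj K (res K a)^-1.
have : res K (a * c - 1) = 0 by rewrite rmorphB rmorphM rmorph1 cE divff // subrr.
move/res_ker => [x xE]; have [s sE] := unif_complete (fun i => (- x) ^+ i).
have acs : a * c * s = 1.
  apply/eqP; rewrite -subr_eq0; apply/eqP; apply: unif_separated => n.
  have [y yE] := sE n; exists ((- x) ^+ n * (-1) + a * c * y).
  have geo : (1 + unif K * x) * (\sum_(i < n) (- x) ^+ i * unif K ^+ i) = 1 - (- x * unif K) ^+ n.
    elim: (n) => [|r IH]; first by rewrite big_ord0 mulr0 expr0 subrr.
    by rewrite big_ord_recr mulrDr IH /= exprS [(- x * _) ^+ r]exprMn; ring.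
  have ac : a * c = 1 + unif K * x by rewrite -xE; ring.
  have -> : s = (s - \sum_(i < n) (- x) ^+ i * unif K ^+ i) + \sum_(i < n) (- x) ^+ i * unif K ^+ i.
    by rewrite subrK.
  by rewrite yE mulrDr ac geo exprMn; ring.
by apply/unitrPr; exists (c * s); rewrite mulrA.
Qed.

Lemma unit_res a : a \is a GRing.unit -> res K a != 0.
Proof. by move=> /(rmorph_unit (res K)); rewrite unitfE. Qed.

Lemma unif_val a : a != 0 -> exists n w, w \is a GRing.unit /\ a = unif K ^+ n * w.
Proof.
move=> a0; pose P n := `[< exists w, a = unif K ^+ n * w >].
have [n nP] : exists n, ~~ P n.
  apply: contrapT => H; case/eqP: a0; apply: unif_separated => n.
  by apply: contrapT => nn; apply: H; exists n; apply/asboolP.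
elim: n nP => [|n IH] nP; first by case/asboolP: nP; exists a; rewrite expr0 mul1r.
have [/asboolP [w aE]|] := boolP (P n); last exact: IH.
exists n, w; split=> //; apply: res_unit; apply/negP => /eqP /res_ker [y yE].
by case/asboolP: nP; exists y; rewrite aE yE mulrA -exprSr.
Qed.

Lemma fld_val (x : F) : x != 0 -> exists (z : int) w, w \is a GRing.unit /\ x = e_ w * pi ^ z.
Proof.
move=> x0; have [a [n xE]] := fld_frac x.
have a0 : a != 0 by apply: contraNneq x0 => a0; rewrite xE a0 rmorph0 mul0r.
have [l [w [wu aE]]] := unif_val a0; exists (l%:Z - n%:Z), w; split=> //.
rewrite xE aE rmorphM rmorphXn expfzDr ?pi_neq0 // -exprnP -exprnN.
by rewrite mulrAC mulrC mulrA.
Qed.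

Lemma integral_val w (z : int) : w \is a GRing.unit -> integral (e_ w * pi ^ z) <-> 0 <= z.
Proof.
move=> wu; split=> [|]; last first.
  by case: z => // l _; apply: integralM; [exact: integral_emb | exists (unif K ^+ l); rewrite rmorphXn].
case: z => // l [a]; rewrite NegzE -exprnN => e.
have : e_ w = e_ (a * unif K ^+ l.+1).
  by rewrite rmorphM rmorphXn -e mulfVK // expf_neq0 ?pi_neq0.
move/emb_inj => wE; have := unit_res wu.
by rewrite wE rmorphM rmorphXn res_unif expr0n mulr0 eqxx.
Qed.

Lemma val_uniq w w' (z z' : int) : w \is a GRing.unit -> w' \is a GRing.unit ->
  e_ w * pi ^ z = e_ w' * pi ^ z' -> z = z'.
Proof.
have le v v' (y y' : int) : v \is a GRing.unit -> v' \is a GRing.unit ->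
    e_ v * pi ^ y = e_ v' * pi ^ y' -> y' <= y.
  move=> vu v'u e; rewrite -Num.Theory.subr_ge0 -(integral_val _ vu).
  rewrite expfzDr ?pi_neq0 // mulrA e -mulrA -expfzDr ?pi_neq0 // subrr expr0z mulr1.
  exact: integral_emb.
move=> wu w'u e; apply/eqP; rewrite Order.POrderTheory.eq_le.
by rewrite (le _ _ _ _ wu w'u e) (le _ _ _ _ w'u wu (esym e)).
Qed.

End Cdvf.

(** * Volumes and colengths of lattices *)

Section Lattice.
Variables (k : fieldType) (K : cdvf k) (n : nat).
Local Notation O := (oring K).
Local Notation F := (fld K).
Local Notation V := 'rV[F]_n.
Local Notation em := (map_mx (emb K)).
Local Notation pi := (Defs.pi K).
Implicit Types L M : set V.

Definition submod L := L 0 /\ forall c u v, L u -> L v -> L (emb K c *: u + v).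

Definition span_of d (b : 'M[F]_(d, n)) : set V := [set v | exists c : 'rV[O]_d, v = em c *m b].

Lemma submodD L u v : submod L -> L u -> L v -> L (u + v).
Proof. by move=> [_ H] Lu Lv; rewrite -[u]scale1r -(rmorph1 (emb K)); exact: H. Qed.
Lemma submodZ L c u : submod L -> L u -> L (emb K c *: u).
Proof. by move=> [L0 H] Lu; rewrite -[_ *: u]addr0; exact: H. Qed.
Lemma submodN L u : submod L -> L u -> L (- u).
Proof. by move=> sL Lu; rewrite -scaleN1r -(rmorph1 (emb K)) -rmorphN; exact: submodZ. Qed.
Lemma submodB L u v : submod L -> L u -> L v -> L (u - v).
Proof. by move=> sL Lu Lv; apply: submodD => //; exact: submodN. Qed.
Lemma submod_sum L (I : Type) (r : seq I) (f : I -> V) : submod L ->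
  (forall i, L (f i)) -> L (\sum_(i <- r) f i).
Proof. by move=> sL H; elim/big_ind: _ => //; [case: sL | move=> *; exact: submodD]. Qed.
Lemma submod_mul L d (b : 'M[F]_(d, n)) (c : 'rV[O]_d) : submod L ->
  (forall i, L (row i b)) -> L (em c *m b).
Proof.
move=> sL H; rewrite mulmx_sum_row; apply: submod_sum => // i.
by rewrite mxE; exact: submodZ.
Qed.

Lemma submod_span d (b : 'M[F]_(d, n)) : submod (span_of b).
Proof.
split; first by exists 0; rewrite map_mx0 mul0mx.
move=> c _ _ [x ->] [y ->]; exists (c *: x + y).
by rewrite map_mxD map_mxZ mulmxDl scalemxAl.
Qed.

Lemma span_row d (b : 'M[F]_(d, n)) i : span_of b (row i b).
Proof. by exists (delta_mx 0 i); rewrite map_delta_mx rowE. Qed.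

Lemma submod_lattice L : is_lattice L -> submod L.
Proof. by move=> [e _ ->]; exact: submod_span. Qed.

Lemma scaleE (a : F) L v : a != 0 -> scale a L v <-> L (a^-1 *: v).
Proof.
move=> a0; split=> [[w Lw <-]|Lv]; first by rewrite scalerA mulVf // scale1r.
by exists (a^-1 *: v) => //; rewrite scalerA divff // scale1r.
Qed.

Lemma submod_scale (a : F) L : submod L -> submod (scale a L).
Proof.
move=> [L0 LD]; split; first by exists 0 => //; rewrite scaler0.
move=> c _ _ [u Lu <-] [v Lv <-]; exists (emb K c *: u + v); first exact: LD.
by rewrite scalerDr !scalerA mulrC.
Qed.

Lemma subset_submod_pi L v : submod L -> L v -> L (pi *: v).
Proof. exact: submodZ. Qed.

(** The valuation of the determinant of a basis. It decreases when the lattice grows, and colengths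
    are differences of volumes ([vol_colen]), so lengths can be compared by integer arithmetic. *)
Definition vol L (z : int) := exists e : 'M[F]_n, [/\ e \in unitmx, L = span_of e
  & exists2 w, w \is a GRing.unit & \det e = emb K w * pi ^ z].

Lemma vol_lattice L z : vol L z -> is_lattice L.
Proof. by move=> [e [eu -> _]]; exists e. Qed.

Lemma lattice_vol L : is_lattice L -> exists z, vol L z.
Proof.
move=> [e eu LE]; have := eu; rewrite unitmxE unitfE => /(@fld_val _ K) [z [w [wu dE]]].
by exists z, e; split=> //; exists w.
Qed.

Lemma span_mx d d' (e : 'M[F]_(d, n)) (e' : 'M[F]_(d', n)) : (forall i, span_of e' (row i e)) ->
  exists M : 'M[O]_(d, d'), e = em M *m e'.
Proof.
move=> /choice [c cE]; exists (\matrix_i c i); apply/row_matrixP => i.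
by rewrite row_mul -map_row rowK.
Qed.

(** The matrix expressing one basis in the other is integral, so its determinant has nonnegative
    valuation; if that is zero, the matrix is invertible over the ring of integers. *)
Lemma vol_mono L L' z z' : vol L z -> vol L' z' -> L `<=` L' ->
  (z' <= z)%R /\ (z = z' -> L = L').
Proof.
move=> [e [eu LE [w wu dE]]] [e' [e'u L'E [w' w'u d'E]]] sub.
have [M eM] : exists M : 'M[O]_n, e = em M *m e'.
  by apply: span_mx => i; rewrite -L'E; apply: sub; rewrite LE; exact: span_row.
have dM : emb K w * pi ^ z = emb K (\det M * w') * pi ^ z'.
  by rewrite -dE eM det_mulmx d'E rmorphM mulrA det_map_mx.
have M0 : \det M != 0.
  apply/eqP => M0; move: eu; rewrite unitmxE unitfE dE dM M0 mul0r rmorph0 mul0r eqxx //.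
have [s [v [vu ME]]] := unif_val M0.
have zE : z = s%:Z + z'.
  apply: (@val_uniq _ K w (v * w')) => //; first by rewrite unitrM vu.
  by rewrite dM ME !rmorphM rmorphXn expfzDr ?pi_neq0 // -exprnP; ring.
split; first by rewrite zE; lia.
rewrite zE => e0; have s0 : s = 0%N by lia.
have Mu : M \in unitmx by rewrite unitmxE ME s0 expr0 mul1r.
apply/seteqP; split=> // x; rewrite L'E LE => -[c ->]; exists (c *m invmx M).
by rewrite eM mulmxA -map_mxM mulmxKV.
Qed.

Lemma vol_uniq L z z' : vol L z -> vol L z' -> z = z'.
Proof.
move=> v v'; have [l1 _] := vol_mono v v' (@subset_refl _ L).
by have [l2 _] := vol_mono v' v (@subset_refl _ L); lia.
Qed.

Lemma vol_scale L z (a : int) : vol L z -> vol (scale (pi ^ a) L) (z + n%:Z * a).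
Proof.
have pa0 : pi ^ a != 0 by rewrite expfz_neq0 ?pi_neq0.
move=> [e [eu LE [w wu dE]]]; exists (pi ^ a *: e); split.
- by rewrite unitmxZ ?unitfE.
- apply/seteqP; split=> v.
    by move=> [x]; rewrite LE => -[c ->] <-; exists c; rewrite scalemxAr.
  by move=> [c ->]; exists (em c *m e); [rewrite LE; exists c | rewrite scalemxAr].
- exists w => //; rewrite detZ dE expfzDr ?pi_neq0 // [n%:Z * a]mulrC -exprz_exp -exprnP.
  by ring.
Qed.

Lemma lattice_scale L (a : int) : is_lattice L -> is_lattice (scale (pi ^ a) L).
Proof. by move/lattice_vol => [z /vol_scale v]; exact: vol_lattice (v a). Qed.

Lemma simple_ext_submod L B : simple_ext L B -> submod L -> submod B /\ L `<=` B.
Proof.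
move=> [x [Bx Lx Lpx BE]] sL; split; last first.
  by move=> v Lv; rewrite BE; exists v, 0; rewrite rmorph0 scale0r addr0.
split; rewrite BE; first by exists 0, 0; rewrite rmorph0 scale0r addr0; case: sL.
move=> c _ _ [a [r [La ->]]] [a' [r' [La' ->]]].
exists (emb K c *: a + a'), (c * r + r'); split; first by case: sL => _; apply.
by rewrite scalerDr rmorphD rmorphM scalerDl scalerA addrACA.
Qed.

(** Since [x] is not in [L], some coordinate of [pi *: x] is a unit. Exchanging that basis vector
    for [x] multiplies the determinant by a unit divided by the uniformizer. *)
Lemma vol_simple_ext L B z : vol L z -> simple_ext L B -> vol B (z - 1).
Proof.
move=> vL [x [Bx Lx Lpx BE]]; have sL := submod_lattice (vol_lattice vL).
have [e [eu LE [w wu dE]]] := vL; have := Lpx; rewrite {1}LE => -[c cE].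
have [i ci] : exists i, res K (c 0 i) != 0.
  apply: contrapT => H; apply: Lx; rewrite LE.
  have Hi i : exists y, c 0 i = unif K * y.
    by apply/res_ker; apply: contrapT => ci; apply: H; exists i; apply/eqP.
  have [y yE] := choice Hi; exists (\row_i y i).
  apply: (scalerI (pi_neq0 K)); rewrite cE scalemxAl; congr (_ *m e).
  by apply/rowP => j; rewrite !mxE yE rmorphM.
have ciu := res_unit ci.
(* The identity with row [i] replaced by the coordinates of [x], so that [A *m e] is the exchanged
   basis. *)
pose A : 'M[F]_n := \matrix_(j, l) (if j == i then pi^-1 * emb K (c 0 l) else (j == l)%:R).
have rowA j : j != i -> row j A = delta_mx 0 j.
  by move=> ji; apply/rowP => l; rewrite !mxE (negbTE ji) eq_sym.
have rowAi : row i A = pi^-1 *: em c by apply/rowP => l; rewrite !mxE eqxx.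
have Ax : row i (A *m e) = x.
  by rewrite row_mul rowAi -scalemxAl -cE scalerA mulVf ?pi_neq0 // scale1r.
have Ae j : j != i -> row j (A *m e) = row j e by move=> ji; rewrite row_mul rowA // -rowE.
have dA : \det A = pi^-1 * emb K (c 0 i).
  rewrite (expand_det_col A i) (bigD1 i) //= big1 => [|j ji].
    rewrite addr0 mxE !eqxx /cofactor -signr_odd addnn odd_double expr0 mul1r.
    rewrite (_ : row' i (col' i A) = 1%:M) ?det1 ?mulr1 //.
    apply/matrixP => j l; rewrite !mxE eq_sym (negbTE (neq_lift i j)).
    by rewrite (inj_eq (@lift_inj _ i)).
  by rewrite mxE (negbTE ji) mul0r.
have Au : A \in unitmx.
  rewrite unitmxE dA unitfE mulf_neq0 ?invr_eq0 ?pi_neq0 //.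
  by apply/negP => /eqP; rewrite -(rmorph0 (emb K)) => /emb_inj e0; rewrite e0 rmorph0 eqxx in ci.
exists (A *m e); split; first by rewrite unitmx_mul Au.
- have sA := @submod_span n (A *m e).
  have spx : span_of (A *m e) x by rewrite -Ax; exact: span_row.
  have sp j : span_of (A *m e) (row j e).
    have [->|ji] := eqVneq j i; last by rewrite -Ae //; exact: span_row.
    have -> : row i e = emb K (c 0 i)^-1 *:
        (pi *: x - \sum_(l | l != i) emb K (c 0 l) *: row l e).
      set S := \sum_(l | _) _; rewrite cE mulmx_sum_row (bigD1 i) //=.
      have -> : \sum_(l | l != i) em c 0 l *: row l e = S.
        by apply: eq_bigr => l _; rewrite mxE.
      by rewrite addrK mxE scalerA -rmorphM mulVr // rmorph1 scale1r.
    apply: submodZ => //; apply: submodB => //; first exact: subset_submod_pi.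
    elim/big_ind: _ => [|*|l li]; [by case: sA | exact: submodD |].
    by apply: submodZ => //; rewrite -Ae //; exact: span_row.
  rewrite BE; apply/seteqP; split=> [_ [a [r [La ->]]]|_ [d ->]].
    apply: submodD => //; last exact: submodZ.
    by move: La; rewrite LE => -[d ->]; exact: submod_mul.
  have sB : submod [set y | exists a r, L a /\ y = a + emb K r *: x].
    by rewrite -BE; apply: (proj1 (simple_ext_submod _ sL)); exists x.
  apply: submod_mul => // j; have [->|ji] := eqVneq j i.
    by exists 0, 1; rewrite rmorph1 scale1r add0r Ax; case: sL.
  exists (row j e), 0; rewrite rmorph0 scale0r addr0 Ae //; split=> //.
  by rewrite LE; exact: span_row.
- exists (c 0 i * w); first by rewrite unitrM ciu.
  by rewrite det_mulmx dA dE rmorphM expfzDr ?pi_neq0 // exprN1; ring.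
Qed.

Lemma vol_colen h A B z : vol A z -> colen h A B -> vol B (z - h%:Z).
Proof.
elim: h B => [|h IH] B vA /=; first by move=> <-; have -> : z - 0%:Z = z by lia.
move=> [L /(IH _ vA) vL /(vol_simple_ext vL)].
by have -> : z - h%:Z - 1 = z - h.+1%:Z by lia.
Qed.

Lemma colen_sub h A B : submod A -> colen h A B -> submod B /\ A `<=` B.
Proof.
elim: h B => [|h IH] B sA /=; first by move=> <-; split.
move=> [L /(IH _ sA) [sL AL] /simple_ext_submod /(_ sL) [sB LB]].
by split=> //; exact: subset_trans AL LB.
Qed.

End Lattice.

(** * Submodules between two lattices as subspaces over the residue field *)

Section Lift.
Variables (k : fieldType) (K : cdvf k) (n : nat).
Local Notation O := (oring K).
Local Notation F := (fld K).
Local Notation V := 'rV[F]_n.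
Local Notation em := (map_mx (emb K)).
Local Notation rs := (map_mx (res K)).
Local Notation pi := (Defs.pi K).
Implicit Types L : set V.

Lemma res_lift d (v : 'rV[k]_d) : exists c : 'rV[O]_d, rs c = v.
Proof.
have H i : exists a, res K a = v 0 i by exact: res_surj.
have [c cE] := choice H; exists (\row_i c i); apply/rowP => i.
by rewrite !mxE cE.
Qed.

Variables (d : nat) (T B : set V) (b : 'M[F]_(d, n)).
Hypotheses (sT : submod T) (sB : submod B) (BT : B `<=` T) (lb : lifts_basis T B b).

(** The preimage in [T] of the subspace of [T / B] with coordinates in [U]. Together with [redv] it
    gives the correspondence between subspaces and submodules from [B] to [T] ([redv_lift],
    [lift_redv]). *)
Definition liftv (U : {vspace 'rV[k]_d}) : set V :=
  [set v | exists c : 'rV[O]_d, B (v - em c *m b) /\ rs c \in U].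

Definition redv L : {vspace 'rV[k]_d} :=
  vspace_of [set v | exists c : 'rV[O]_d, rs c = v /\ L (em c *m b)].

Lemma lb_row i : T (row i b). Proof. by case: lb. Qed.
Lemma lb_dec v : T v -> exists c : 'rV[O]_d, B (v - em c *m b).
Proof. by case: lb => _ H _; exact: H. Qed.
Lemma lb_ker (c : 'rV[O]_d) : B (em c *m b) <-> rs c = 0. Proof. by case: lb. Qed.
Lemma lb_T (c : 'rV[O]_d) : T (em c *m b).
Proof. by apply: submod_mul => // i; exact: lb_row. Qed.

Lemma pi_top v : T v -> B (pi *: v).
Proof.
move=> /lb_dec [c Bc]; rewrite -[v](subrK (em c *m b)) scalerDr.
apply: submodD => //; first exact: submodZ.
rewrite scalemxAl -map_mxZ; apply/lb_ker; apply/rowP => i.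
by rewrite !mxE rmorphM res_unif mul0r.
Qed.

Lemma mem_redv L v : submod L -> v \in redv L <-> exists c : 'rV[O]_d, rs c = v /\ L (em c *m b).
Proof.
move=> sL; apply: (@vspace_of_sub k d [set v | exists c : 'rV[O]_d, rs c = v /\ L (em c *m b)]).
  by exists 0; rewrite !map_mx0 mul0mx; split=> //; case: sL.
move=> a _ _ [c [<- Lc]] [c' [<- Lc']]; have [x <-] := res_surj K a.
exists (x *: c + c'); rewrite !map_mxD !map_mxZ mulmxDl -scalemxAl; split=> //.
by case: sL => _; apply.
Qed.

Lemma redv_res L (c : 'rV[O]_d) : submod L -> B `<=` L -> rs c \in redv L <-> L (em c *m b).
Proof.
move=> sL BL; rewrite mem_redv //; split=> [[c' [e Lc']]|]; last by exists c.
rewrite -[em c *m b](subrK (em c' *m b)) -mulmxBl -map_mxB; apply: submodD => //.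
by apply/BL/lb_ker; rewrite map_mxB e subrr.
Qed.

Lemma redvS L L' : submod L -> submod L' -> L `<=` L' -> (redv L <= redv L')%VS.
Proof.
move=> sL sL' LL; apply/subvP => v /(mem_redv _ sL) [c [<- Lc]].
by apply/(mem_redv _ sL'); exists c; split=> //; exact: LL.
Qed.

Lemma redv_sub L L' : submod L -> submod L' -> L `<=` T -> B `<=` L -> B `<=` L' ->
  (redv L <= redv L')%VS -> L `<=` L'.
Proof.
move=> sL sL' LT BL BL' /subvP sub v Lv; have [c Bc] := lb_dec (LT _ Lv).
rewrite -[v](subrK (em c *m b)); apply: submodD => //; first exact: BL'.
apply/(redv_res _ sL' BL')/sub/(redv_res _ sL BL).
by rewrite -[X in L X](subKr v); apply: submodB => //; exact: BL.
Qed.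

Lemma submod_lift U : submod (liftv U).
Proof.
split; first by exists 0; rewrite !map_mx0 mul0mx subr0; split; [case: sB | exact: mem0v].
move=> a u v [c [Bc cU]] [c' [Bc' c'U]]; exists (a *: c + c').
rewrite !map_mxD !map_mxZ mulmxDl -scalemxAl; split.
  by rewrite opprD addrACA -scalerBr; case: sB => _; apply.
by rewrite memvD // memvZ.
Qed.

Lemma lift_sup U : B `<=` liftv U.
Proof. by move=> v Bv; exists 0; rewrite !map_mx0 mul0mx subr0 mem0v. Qed.

Lemma lift_sub U : liftv U `<=` T.
Proof.
move=> v [c [Bc _]]; rewrite -[v](subrK (em c *m b)).
by apply: submodD => //; [exact: BT | exact: lb_T].
Qed.

Lemma lift_mem U (c : 'rV[O]_d) : liftv U (em c *m b) <-> rs c \in U.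
Proof.
split=> [[c' []]|cU]; last by exists c; rewrite subrr; split=> //; case: sB.
by rewrite -mulmxBl -map_mxB lb_ker map_mxB => /eqP; rewrite subr_eq0 => /eqP ->.
Qed.

Lemma redv_lift U : redv (liftv U) = U.
Proof.
apply/vspaceP => v; have [c <-] := res_lift v.
have h := redv_res c (submod_lift U) (@lift_sup U).
by apply/idP/idP => [/h /lift_mem|/lift_mem /h].
Qed.

Lemma lift_redv L : submod L -> B `<=` L -> L `<=` T -> liftv (redv L) = L.
Proof.
move=> sL BL LT; apply/seteqP; split.
  by apply: redv_sub => //; [exact: submod_lift|exact: lift_sub|exact: lift_sup|rewrite redv_lift].
by apply: redv_sub => //; [exact: submod_lift|exact: lift_sup|rewrite redv_lift].
Qed.

Lemma liftS (U U' : {vspace 'rV[k]_d}) : (U <= U')%VS -> liftv U `<=` liftv U'.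
Proof. by move=> /subvP UU v [c [Bc cU]]; exists c; split=> //; exact: UU. Qed.

Lemma lift_simple_ext (U : {vspace 'rV[k]_d}) v : v \notin U -> simple_ext (liftv U) (liftv (U + <[v]>)).
Proof.
move=> vU; have [c cv] := res_lift v.
have L1 : liftv (U + <[v]>) (em c *m b) by apply/lift_mem; rewrite cv memvE addvSr.
exists (em c *m b); split=> //.
- by move/lift_mem; rewrite cv (negbTE vU).
- by apply: lift_sup; apply: pi_top; exact: lb_T.
- apply/seteqP; split=> [y|_ [a [r [La ->]]]]; last first.
    apply: submodD; [exact: submod_lift | exact: (liftS (addvSl _ _)) |].
    by apply: submodZ => //; exact: submod_lift.
  move=> [c' [Bc' /memv_addP [x xU [_ /vlineP [r0 ->] c'E]]]].
  have [r rE] := res_surj K r0; exists (y - emb K r *: (em c *m b)), r; split; last by rewrite subrK.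
  exists (c' - r *: c); rewrite !map_mxB !map_mxZ mulmxBl -scalemxAl; split.
    by rewrite opprB addrA subrK.
  by rewrite c'E cv rE addrK.
Qed.

Lemma colen_lift h (U U' : {vspace 'rV[k]_d}) : (U <= U')%VS -> \dim U' = (\dim U + h)%N -> colen h (liftv U) (liftv U').
Proof.
elim: h U' => [|h IH] U' UU dU /=.
  by congr (liftv _); apply/eqP; rewrite eqEdim UU dU addn0 leqnn.
have U'0 : U' != 0%VS by rewrite -dimv_eq0 dU; lia.
(* A hyperplane of [U'] above [U]: a basis of [U] and all but the last vector of a basis of a
   complement. *)
have [W [UW WU dW]] : exists W, [/\ (U <= W)%VS, (W <= U')%VS & \dim W = (\dim U + h)%N].
  have [X XE] : exists X : seq 'rV[k]_d, size X = (\dim U + h)%N /\ exists2 W, W = <<X>>%VS &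
      [/\ (U <= W)%VS, (W <= U')%VS & \dim W = (\dim U + h)%N].
    pose Y := vbasis U; pose Z := vbasis (U' :\: U).
    have dZ : \dim (U' :\: U) = h.+1.
      have := dimv_cap_compl U' U; have /capv_idPr -> := UU.
      by rewrite dU; dlia.
    have fY : free (Y ++ Z).
      apply: (basis_free (U := (U' :\: U + U)%VS)).
      rewrite addvC; apply: cat_basis; [|exact: vbasisP|exact: vbasisP].
      by apply/directv_addP; rewrite capvC capv_diff.
    have sY : size Y = \dim U by rewrite size_tuple.
    have sZ : size Z = h.+1 by rewrite size_tuple dZ.
    exists (Y ++ take h Z); split.
      by rewrite size_cat sY size_take sZ ltnSn.
    exists <<Y ++ take h Z>>%VS => //; split.
    - by rewrite span_cat (span_basis (vbasisP U)) addvSl.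
    - rewrite span_cat subv_add (span_basis (vbasisP U)) UU /=; apply/span_subvP => v.
      by move/mem_take/vbasis_mem => /(subvP (diffvSl _ _)).
    - have : free (Y ++ take h Z).
        by move: fY; rewrite -{1}(cat_take_drop h Z) catA => /catl_free.
      by move=> /eqP ->; rewrite size_cat sY size_take sZ ltnSn.
  by case: XE => _ [W _ HW]; exists W.
exists (liftv W); first exact: IH.
have /subvPn [v vU' vW] : ~~ (U' <= W)%VS.
  by apply/negP => /dimvS; rewrite dW dU; dlia.
have -> : U' = (W + <[v]>)%VS; last exact: lift_simple_ext.
apply/esym/eqP; rewrite eqEdim subv_add WU -memvE vU' /=.
have lt : (\dim W < \dim (W + <[v]>))%N.
  rewrite ltn_neqAle dimvS ?addvSl // andbT; apply: contra vW => /eqP e.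
  have /eqP -> : (W == W + <[v]>)%VS by rewrite eqEdim addvSl e leqnn.
  by rewrite memvE addvSr.
by move: lt; rewrite dW dU; dlia.
Qed.

Lemma lift0 : liftv 0%VS = B.
Proof.
apply/seteqP; split=> [v [c [Bc]]|v Bv]; last exact: lift_sup.
rewrite memv0 => /eqP /lb_ker Bc'; rewrite -[v](subrK (em c *m b)).
exact: submodD.
Qed.

Lemma liftT : liftv fullv = T.
Proof.
apply/seteqP; split=> [|v /lb_dec [c Bc]]; first exact: lift_sub.
by exists c; rewrite memvf.
Qed.

Lemma vol_lift U z : vol B z -> vol (liftv U) (z - (\dim U)%:Z).
Proof.
move=> vB; apply: (vol_colen vB); rewrite -lift0; apply: colen_lift.
  exact: sub0v.
by rewrite dimv0 add0n.
Qed.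

Lemma colen_top : colen d B T.
Proof.
rewrite -lift0 -[X in colen _ _ X]liftT; apply: colen_lift; first exact: sub0v.
by rewrite dimv0 dim_fullrV.
Qed.

End Lift.

Section Between.
Variables (k : fieldType) (K : cdvf k) (n : nat).
Local Notation F := (fld K).
Local Notation V := 'rV[F]_n.
Local Notation em := (map_mx (emb K)).
Local Notation pi := (Defs.pi K).

Lemma lattice_lifts_basis (T : set V) : is_lattice T ->
  exists e : 'M[F]_n, lifts_basis T (scale pi T) e.
Proof.
move=> lT; have sT := submod_lattice lT; have [e eu TE] := lT; exists e; split.
- by move=> i; rewrite TE; exact: span_row.
- move=> v; rewrite TE => -[c ->]; exists c; rewrite subrr.
  by exists 0; rewrite ?scaler0 // -TE; case: sT.
- move=> c; rewrite scaleE ?pi_neq0 // TE; split=> [[c' cE]|c0].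
    have : em c = pi *: em c'.
      apply: (can_inj (mulmxK eu)); rewrite -scalemxAl -cE scalerA divff ?pi_neq0 //.
      by rewrite scale1r.
    move=> /rowP H; apply/rowP => i; have := H i; rewrite !mxE -rmorphM => /emb_inj ->.
    by rewrite rmorphM res_unif mul0r.
  have H i : exists y, c 0 i = unif K * y by apply/res_ker; move/rowP: c0 => /(_ i); rewrite !mxE.
  have [y yE] := choice H; exists (\row_i y i); rewrite scalemxAl; congr (_ *m e).
  by apply/rowP => i; rewrite !mxE yE rmorphM mulrA mulVf ?mul1r ?pi_neq0.
Qed.

(** Such an [L] is the preimage of a subspace of [T / pi T], so its finiteness is linear algebra
    over the residue field. *)
Lemma lattice_between (T L : set V) : is_lattice T -> submod L ->
  scale pi T `<=` L -> L `<=` T -> is_lattice L /\ exists d, colen d L T.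
Proof.
move=> lT sL piL LT; have sT := submod_lattice lT; have [e lb] := lattice_lifts_basis lT.
have spi : submod (scale pi T) by exact: submod_scale.
have piT : scale pi T `<=` T by exact: subset_trans piL LT.
have LE := lift_redv sT spi piT lb sL piL LT.
have [z vT] := lattice_vol (lattice_scale 1 lT); rewrite expr1z in vT.
split; first by rewrite -LE; exact: vol_lattice (vol_lift sT spi lb _ vT).
exists (n - \dim (redv e L))%N; rewrite -[X in colen _ X _]LE -[X in colen _ _ X](liftT sT piT lb).
apply: (colen_lift sT spi lb); first exact: subvf.
by rewrite dim_fullrV subnKC ?dim_rV.
Qed.

(** Volumes make the colength unique, so the value picked by [len] can only be [h]. *)
Lemma len_vol (A B : set V) za zb h : vol A za -> vol B zb -> colen h A B ->
  len A B = h /\ za = zb + h%:Z.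
Proof.
move=> vA vB cAB; have e h' : colen h' A B -> za = zb + h'%:Z.
  by move=> /(vol_colen vA) vB'; have := vol_uniq vB vB'; lia.
split; last exact: e.
have := @xgetPex _ 0%N [set h | colen h A B] (ex_intro _ h cAB).
by rewrite -/(len A B) => /e; have := e h cAB; lia.
Qed.

Lemma colen_between (A B : set V) za zb h : vol A za -> vol B zb ->
  scale pi B `<=` A -> A `<=` B -> za = zb + h%:Z -> colen h A B.
Proof.
move=> vA vB pB AB e.
have [_ [d cd]] := lattice_between (vol_lattice vB) (submod_lattice (vol_lattice vA)) pB AB.
have [_ e'] := len_vol vA vB cd; have -> // : h = d by lia.
Qed.

End Between.

(** * Duality and descent *)

(** A unit times a power of the uniformizer goes to an element of the same shape with the same
    exponent, so valuations are preserved. *)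
Lemma integral_morph (k1 k2 : fieldType) (K1 : cdvf k1) (K2 : cdvf k2)
    (f : {rmorphism fld K1 -> fld K2}) (g : {rmorphism oring K1 -> oring K2}) :
  (forall w, f (emb K1 w) = emb K2 (g w)) -> g (unif K1) = unif K2 ->
  forall x, integral (f x) <-> integral x.
Proof.
move=> fg gu x; split=> [|[w ->]]; last by exists (g w); rewrite fg.
have [->|x0] := eqVneq x 0; first by move=> _; exists 0; rewrite rmorph0.
have [z [w [wu ->]]] := fld_val x0.
rewrite rmorphM fmorphXz fg fg gu -/(Defs.pi K2) !integral_val //; exact: rmorph_unit.
Qed.

Lemma piO_morph (k1 k2 : fieldType) (K1 : cdvf k1) (K2 : cdvf k2)
    (f : {rmorphism fld K1 -> fld K2}) (g : {rmorphism oring K1 -> oring K2}) :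
  (forall w, f (emb K1 w) = emb K2 (g w)) -> g (unif K1) = unif K2 ->
  forall x, piO (f x) <-> piO x.
Proof.
move=> fg gu x; rewrite !piO_integral -(integral_morph fg gu (_ * x)).
by rewrite rmorphM fmorphV /Defs.pi fg gu.
Qed.

Section Sesquilinear.
Variables (k : fieldType) (K : cdvf k) (n : nat).
Variables (s : {rmorphism fld K -> fld K}) (sO : {rmorphism oring K -> oring K}).
Hypothesis s_emb : forall w, s (emb K w) = emb K (sO w).
Variable H : 'M[fld K]_n.
Local Notation em := (map_mx (emb K)).
Local Notation hm := (herm s H).

Lemma hermDl v w x : hm (v + w) x = hm v x + hm w x.
Proof. by rewrite /herm !mulmxDl mxE. Qed.
Lemma hermZl a v x : hm (a *: v) x = a * hm v x.
Proof. by rewrite /herm -!scalemxAl mxE. Qed.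
Lemma hermDr v w x : hm v (w + x) = hm v w + hm v x.
Proof. by rewrite /herm map_mxD linearD mulmxDr mxE. Qed.
Lemma hermZr a v x : hm v (a *: x) = s a * hm v x.
Proof. by rewrite /herm map_mxZ linearZ -scalemxAr mxE. Qed.
Lemma herm0l x : hm 0 x = 0.
Proof. by rewrite /herm !mul0mx mxE. Qed.
Lemma herm0r x : hm x 0 = 0.
Proof. by rewrite /herm map_mx0 trmx0 mulmx0 mxE. Qed.
Lemma submod_left (I : set (fld K)) (S : set 'rV[fld K]_n) : I 0 -> (forall x y, I x -> I y -> I (x + y)) ->
  (forall x y, integral x -> I y -> I (x * y)) -> submod [set v | forall w, S w -> I (hm v w)].
Proof.
move=> I0 ID IM; split=> [w _|c u v Hu Hv w Sw]; first by rewrite herm0l.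
rewrite hermDl hermZl; apply: ID; last exact: Hv.
by apply: IM; [exact: integral_emb | exact: Hu].
Qed.

(** [f] is the basis dual to [e]: the coordinates of [v] in [f] are the values of the form on [v]
    and the rows of [e]. *)
Lemma dual_span (e f : 'M[fld K]_n) : f \in unitmx -> f *m H *m (map_mx s e)^T = 1%:M ->
  dual s H (span_of e) = span_of f.
Proof.
move=> fu fe; apply/seteqP; split=> [v dv|_ [c ->] _ [x ->]]; last first.
  rewrite /herm map_mxM trmx_mul !mulmxA -(mulmxA (em c) f) -[em c *m _ *m _]mulmxA fe mulmx1.
  rewrite mxE; apply: integral_sum => i; apply: integralM.
    by exists (c 0 i); rewrite mxE.
  by exists (sO (x 0 i)); rewrite !mxE s_emb.
have I i : integral ((v *m invmx f) 0 i).
  have := dv _ (span_row e i); rewrite /herm.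
  have -> : v *m H *m (map_mx s (row i e))^T = (v *m invmx f) *m (f *m H *m (map_mx s e)^T) *m delta_mx i 0.
    have {1}-> : v = v *m invmx f *m f by rewrite mulmxKV.
    by rewrite map_row tr_row colE -!mulmxA.
  by rewrite fe mulmx1 -colE mxE.
have [c cE] := choice I; exists (\row_i c i); rewrite -[LHS](mulmxKV fu); congr (_ *m f).
by apply/rowP => i; rewrite cE !mxE.
Qed.

End Sesquilinear.

Section Witt.
Variables (Fq : finFieldType) (OF : cdvf Fq) (Fq2 : finFieldType)
  (i1 : {rmorphism Fq -> Fq2}) (k : fieldType) (i2 : {rmorphism Fq -> k})
  (j12 : {rmorphism Fq2 -> k}) (W2 : relwitt OF i1) (Wk : relwitt OF i2)
  (u : wittmap j12 W2 Wk).
Hypothesis cardFq2 : #|Fq2| = (#|Fq| ^ 2)%N.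
Variables (n : nat) (H : 'M[fld W2]_n).
Hypotheses (Hu : H \in unitmx) (Hh : forall i j, frob W2 (H i j) = H j i).
Local Notation q := #|Fq|.
Local Notation C := 'rV[fld W2]_n.
Local Notation Ck := 'rV[fld Wk]_n.
Local Notation wm := (map_mx (wmap u)).
Local Notation Hk := (wm H).
Local Notation hC := (herm (frob W2) H).
Local Notation hk := (herm (frob Wk) Hk).
Local Notation dC := (dualC H).
Local Notation dK := (dualCk u H).
Local Notation ext := (extend u).

Lemma frobO_unif (k' : fieldType) (i' : {rmorphism Fq -> k'}) (W : relwitt OF i') :
  frobO W (unif W) = unif W.
Proof. by rewrite -(wstr_unif W) frobO_str. Qed.

Lemma wmapO_unif : wmapO u (unif W2) = unif Wk.
Proof. by rewrite -(wstr_unif W2) wmap_str wstr_unif. Qed.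

Lemma wmap_pi : wmap u (Defs.pi W2) = Defs.pi Wk.
Proof. by rewrite /Defs.pi wmap_emb wmapO_unif. Qed.

Lemma wmap_integral x : integral (wmap u x) <-> integral x.
Proof. exact: (integral_morph (wmap_emb u) wmapO_unif). Qed.
Lemma wmap_piO x : piO (wmap u x) <-> piO x.
Proof. exact: (piO_morph (wmap_emb u) wmapO_unif). Qed.
Lemma frobk_integral x : integral (frob Wk x) <-> integral x.
Proof. exact: (integral_morph (@frob_emb _ _ _ _ Wk) (frobO_unif Wk)). Qed.
Lemma frobk_piO x : piO (frob Wk x) <-> piO x.
Proof. exact: (piO_morph (@frob_emb _ _ _ _ Wk) (frobO_unif Wk)). Qed.

(** First-order expansion, meant for the exponent q^2, whose image in the ring of integers is
    divisible by the uniformizer. *)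
Lemma expDr_mod2 (R : comNzRingType) (x y : R) m :
  exists s, (x + y) ^+ m = x ^+ m + m%:R * x ^+ m.-1 * y + y ^+ 2 * s.
Proof.
elim: m => [|m [s IH]]; first by exists 0; rewrite !expr0 mulr0 mul0r mul0r !addr0.
exists (x * s + m%:R * x ^+ m.-1 + y * s); rewrite exprS IH.
case: m IH => [|m] _; first by rewrite /= !expr0 expr1; ring.
by rewrite /= !exprS -[m.+2%:R]natr1; ring.
Qed.

Lemma q_gt1 : (1 < q)%N. Proof. exact: finNzRing_gt1. Qed.

Lemma card_pchar : exists p r, p \in [pchar Fq] /\ q = (p ^ r.+1)%N.
Proof.
have [p p_pr chp] := finPcharP Fq; have e := card_pprimeChar chp.
exists p, (logn p q).-1; split=> //; rewrite {1}e prednK // lt0n.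
by apply/eqP => l0; move: e q_gt1; rewrite l0 expn0 => ->.
Qed.

Lemma frobenius_rmorphism : exists sg : {rmorphism k -> k}, forall x, sg x = x ^+ q.
Proof.
have [p [r [chp ->]]] := card_pchar; have chk := rmorph_pchar i2 chp.
elim: r.+1 => [|m [sg IH]]; first by exists idfun => x; rewrite expn0 expr1.
exists (pFrobenius_aut chk \o sg) => x.
by rewrite /= pFrobenius_autE IH -exprM expnSr.
Qed.

Lemma card_res0 : (q ^ 2)%:R = 0 :> Fq2.
Proof.
rewrite natrX; have -> : q%:R = 0 :> Fq2; last by rewrite expr0n.
have [p [r [chp ->]]] := card_pchar.
by rewrite natrX (pcharf0 (rmorph_pchar i1 chp)) expr0n.
Qed.

(* The square of Frobenius is trivial modulo every power of the uniformizer,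
   because [a] is [a ^ (q ^ 2)] plus a multiple of the uniformizer. *)
Lemma frobO2 w : frobO W2 (frobO W2 w) = w.
Proof.
pose g w := frobO W2 (frobO W2 w); apply/eqP; rewrite -subr_eq0; apply/eqP.
apply: unif_separated => m; elim: m w => [|[_|m IH]] w.
- by exists (g w - w); rewrite expr0 mul1r.
- have : res W2 (g w - w) = 0.
    by rewrite rmorphB !frobO_res -exprM mulnn -cardFq2 expf_card subrr.
  by move=> /res_ker [a ->]; exists a; rewrite expr1.
(* With w = w^(q^2) + pi b, the induction hypothesis is applied to [w] and to [b]. The term pi b
   gains a power of pi from its factor, and the q^2-th power gains one from the linear term of its
   expansion, q^2 being a multiple of pi. *)
have : res W2 (w - w ^+ (q ^ 2)) = 0 by rewrite rmorphB rmorphXn -cardFq2 expf_card subrr.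
move=> /res_ker [b bE]; have [e eE] := IH w; have [e' e'E] := IH b.
have wE : w = w ^+ (q ^ 2) + unif W2 * b by rewrite -bE addrC subrK.
have gE : g w = g w ^+ (q ^ 2) + unif W2 * g b.
  by rewrite {1}wE /g !rmorphD !rmorphM !rmorphXn !frobO_unif.
have : res W2 (q ^ 2)%:R = 0 by rewrite rmorph_nat card_res0.
move=> /res_ker [z zE]; have [s sE] := expDr_mod2 w (unif W2 ^+ m.+1 * e) (q ^ 2).
have gw : g w = w + unif W2 ^+ m.+1 * e by rewrite -[LHS](subrK w) eE addrC.
have gb : g b = b + unif W2 ^+ m.+1 * e' by rewrite -[LHS](subrK b) e'E addrC.
exists (z * w ^+ (q ^ 2).-1 * e + unif W2 ^+ m * e ^+ 2 * s + e').
rewrite -/(g w) gE {1}gw sE gb zE [X in _ - X]wE !exprS; ring.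
Qed.

Lemma frobK x : frob W2 (frob W2 x) = x.
Proof.
have [a [m ->]] := fld_frac x.
by rewrite !(rmorphM, fmorphV, rmorphXn) !frob_emb frobO2 !frobO_unif.
Qed.

Lemma H_conj : (map_mx (frob W2) H)^T = H.
Proof. by apply/matrixP => i j; rewrite !mxE Hh. Qed.

Lemma map_frob2 m d (A : 'M[fld W2]_(m, d)) : map_mx (frob W2) (map_mx (frob W2) A) = A.
Proof. by apply/matrixP => i j; rewrite !mxE frobK. Qed.

Lemma map_frob_wm m d (A : 'M[fld W2]_(m, d)) :
  map_mx (frob Wk) (wm A) = wm (map_mx (frob W2) A).
Proof. by apply/matrixP => i j; rewrite !mxE wmap_frob. Qed.

Lemma Hk_conj : (map_mx (frob Wk) Hk)^T = Hk.
Proof. by rewrite map_frob_wm map_trmx H_conj. Qed.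

Lemma hk_wm v w : hk (wm v) (wm w) = wmap u (hC v w).
Proof.
have mapE (M : 'M[fld W2]_1) : wmap u (M 0 0) = (wm M) 0 0 by rewrite mxE.
by rewrite /herm map_frob_wm mapE !map_mxM -map_trmx.
Qed.

(** The square of Frobenius is not the identity on F_k, so the hermitian symmetry survives on C_k
    only when the vector moved to the left comes from [C]. *)
Lemma hk_conj v (w : Ck) : frob Wk (hk w (wm v)) = hk (wm v) w.
Proof.
rewrite /herm map_frob_wm.
have mapE (M : 'M[fld Wk]_1) : frob Wk (M 0 0) = (map_mx (frob Wk) M) 0 0 by rewrite mxE.
have trE (M : 'M[fld Wk]_1) : M 0 0 = M^T 0 0 by rewrite mxE.
rewrite mapE !map_mxM -map_trmx (map_frob_wm (map_mx (frob W2) v)) map_frob2 trE !trmx_mul trmxK mulmxA.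
by rewrite Hk_conj.
Qed.

Lemma hC_conj v w : frob W2 (hC v w) = hC w v.
Proof.
rewrite /herm.
have mapE (M : 'M[fld W2]_1) : frob W2 (M 0 0) = (map_mx (frob W2) M) 0 0 by rewrite mxE.
have trE (M : 'M[fld W2]_1) : M 0 0 = M^T 0 0 by rewrite mxE.
by rewrite mapE !map_mxM -map_trmx map_frob2 trE !trmx_mul trmxK mulmxA H_conj.
Qed.

Lemma ext_mem (L : set C) v : L v -> ext L (wm v).
Proof.
move=> Lv; exists 1%N, 1%:M, v; split; last by rewrite map_mx1 mul1mx.
by move=> i; rewrite ord1 (_ : row 0 v = v) //; apply/rowP => j; rewrite mxE.
Qed.

Lemma ext_submod (L : set C) : submod (ext L).
Proof.
split; first by exists 0%N, 0, 0; split=> [[]//|]; rewrite map_mx0 mul0mx.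
move=> c _ _ [r [x [b [Hb ->]]]] [r' [x' [b' [Hb' ->]]]].
exists (r + r')%N, (row_mx (c *: x) x'), (col_mx b b'); split.
  by move=> i; rewrite -(splitK i); case: (split i) => l /=; rewrite ?rowKu ?rowKd.
by rewrite map_row_mx map_col_mx mul_row_col map_mxZ -scalemxAl.
Qed.

Lemma ext_mono (L L' : set C) : L `<=` L' -> ext L `<=` ext L'.
Proof. by move=> LL v [r [x [b [Hb ->]]]]; exists r, x, b; split=> // i; exact: LL. Qed.

Lemma ext_min (L : set C) (M : set Ck) : submod M -> (forall v, L v -> M (wm v)) -> ext L `<=` M.
Proof.
move=> sM H' v [r [x [b [Hb ->]]]]; apply: submod_mul => // i.
by rewrite -map_row; exact: H'.
Qed.

Lemma ext_span d (e : 'M[fld W2]_(d, n)) : ext (span_of e) = span_of (wm e).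
Proof.
apply/seteqP; split.
  apply: ext_min; first exact: submod_span.
  move=> _ [c ->]; exists (map_mx (wmapO u) c); rewrite map_mxM; congr (_ *m _).
  by apply/matrixP => i j; rewrite !mxE wmap_emb.
by move=> _ [c ->]; exists d, c, e; split=> // i; exact: span_row.
Qed.

Lemma ext_scale (a : fld W2) (L : set C) : ext (scale a L) = scale (wmap u a) (ext L).
Proof.
apply/seteqP; split.
  apply: ext_min; first exact/submod_scale/ext_submod.
  by move=> _ [v Lv <-]; exists (wm v); [exact: ext_mem | rewrite map_mxZ].
move=> _ [v [r [x [b [Hb ->]]]] <-]; exists r, x, (a *: b); split.
  by move=> i; exists (row i b) => //; rewrite linearZ.
by rewrite map_mxZ scalemxAr.
Qed.

Definition dual_bases (L : set C) (e f : 'M[fld W2]_n) :=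
  [/\ e \in unitmx, f \in unitmx, L = span_of e &
   [/\ dC L = span_of f, dC (span_of f) = L, dK (ext L) = ext (span_of f)
     & dK (ext (span_of f)) = ext L]].

(** The dual basis is the conjugate transpose of the inverse of [e *m H]. The same matrices are dual
    to each other after extension of scalars, which is why duals commute with [extend]. *)
Lemma dual_basesP L : is_lattice L -> exists e f, dual_bases L e f.
Proof.
move=> [e eu LE]; have eHu : e *m H \in unitmx by rewrite unitmx_mul eu.
pose f := map_mx (frob W2) (invmx (e *m H))^T.
have ef : e *m H *m (map_mx (frob W2) f)^T = 1%:M.
  by rewrite /f map_frob2 trmxK mulmxV.
have fe : f *m H *m (map_mx (frob W2) e)^T = 1%:M.
  have := congr1 (fun M => (map_mx (frob W2) M)^T) ef.
  by rewrite map_mx1 trmx1 !map_mxM !trmx_mul H_conj -map_trmx trmxK map_frob2 mulmxA.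
have fu : f \in unitmx by rewrite map_unitmx unitmx_tr unitmx_inv.
have wmE A B : A *m H *m (map_mx (frob W2) B)^T = 1%:M ->
    wm A *m Hk *m (map_mx (frob Wk) (wm B))^T = 1%:M.
  by move=> AB; rewrite map_frob_wm map_trmx -!map_mxM AB map_mx1.
have femb := @frob_emb _ _ _ _ W2; have fembk := @frob_emb _ _ _ _ Wk.
exists e, f; split=> //; rewrite LE; split.
- exact: dual_span femb _ _ _ fu fe.
- exact: dual_span femb _ _ _ eu ef.
- by rewrite !ext_span /dualCk; apply: (dual_span fembk); [rewrite map_unitmx | exact: wmE].
- by rewrite !ext_span /dualCk; apply: (dual_span fembk); [rewrite map_unitmx | exact: wmE].
Qed.

Lemma lattice_dC L : is_lattice L -> is_lattice (dC L).
Proof. by move=> /dual_basesP [e [f [_ fu _ [-> _ _ _]]]]; exists f. Qed.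
Lemma dCK L : is_lattice L -> dC (dC L) = L.
Proof. by move=> /dual_basesP [e [f [_ fu _ [-> -> _ _]]]]. Qed.
Lemma dK_ext L : is_lattice L -> dK (ext L) = ext (dC L).
Proof. by move=> /dual_basesP [e [f [_ fu _ [-> _ -> _]]]]. Qed.

Lemma ext_vol (L : set C) z : vol L z -> vol (ext L) z.
Proof.
move=> [e [eu -> [w wu dE]]]; exists (wm e); split; rewrite ?map_unitmx ?ext_span //.
exists (wmapO u w); first exact: rmorph_unit.
by rewrite det_map_mx dE rmorphM fmorphXz wmap_pi wmap_emb.
Qed.

Lemma ext_reflect (L : set C) v : is_lattice L -> ext L (wm v) -> L v.
Proof.
move=> [e eu ->]; rewrite ext_span => -[c cE].
have I j : integral ((v *m invmx e) 0 j).
  apply/wmap_integral; exists (c 0 j).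
  have -> : wmap u ((v *m invmx e) 0 j) = (wm v *m invmx (wm e)) 0 j.
    by rewrite -map_invmx -map_mxM [RHS]mxE.
  by rewrite cE mulmxK ?map_unitmx // mxE.
have [y yE] := choice I; exists (\row_j y j); rewrite -[LHS](mulmxKV eu); congr (_ *m e).
by apply/rowP => j; rewrite yE !mxE.
Qed.

Lemma ext_reflect_sub (L L' : set C) : is_lattice L' -> ext L `<=` ext L' -> L `<=` L'.
Proof. by move=> lL' sub v Lv; apply: ext_reflect lL' _; apply/sub/ext_mem. Qed.

Lemma dK_anti A B : A `<=` B -> dK B `<=` dK A.
Proof. by move=> AB v H' w /AB; exact: H'. Qed.
Lemma dC_anti A B : A `<=` B -> dC B `<=` dC A.
Proof. by move=> AB v H' w /AB; exact: H'. Qed.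

Lemma scale_dK a A v : a != 0 -> scale a (dK A) v <-> forall w, A w -> integral (a^-1 * hk v w).
Proof.
move=> a0; rewrite scaleE //; split=> H' w Aw; have := H' w Aw; rewrite hermZl //.
Qed.
Lemma scale_dC a A v : a != 0 -> scale a (dC A) v <-> forall w, A w -> integral (a^-1 * hC v w).
Proof.
move=> a0; rewrite scaleE //; split=> H' w Aw; have := H' w Aw; rewrite hermZl //.
Qed.

Lemma ext_frob (L : set C) v : ext L v ->
  ext L (map_mx (frob Wk) (map_mx (frob Wk) v)).
Proof.
move=> [r [x [b [Hb ->]]]]; exists r, (map_mx (frobO Wk) (map_mx (frobO Wk) x)), b; split=> //.
rewrite !map_mxM !map_frob_wm map_frob2; congr (_ *m _).
by apply/matrixP => i j; rewrite !mxE !frob_emb.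
Qed.

End Witt.

Lemma red_emb (k : fieldType) (K : cdvf k) (w : oring K) : red (emb K w) = res K w.
Proof.
rewrite /red; congr (res K _); apply: (@emb_inj _ K).
exact: (@xgetPex _ 0 [set w' | emb K w' = emb K w] (ex_intro _ w erefl)).
Qed.

Lemma form_basis (k : fieldType) (K : cdvf k) n (s : {rmorphism fld K -> fld K})
    (sO : {rmorphism oring K -> oring K}) (s_emb : forall w, s (emb K w) = emb K (sO w))
    (H : 'M[fld K]_n) d1 d2 (e1 : 'M[fld K]_(d1, n)) (e2 : 'M[fld K]_(d2, n)) a
    (G : 'M[oring K]_(d1, d2)) (c : 'rV[oring K]_d1) (c' : 'rV[oring K]_d2) :
  a *: (e1 *m H *m (map_mx s e2)^T) = map_mx (emb K) G ->
  a * herm s H (map_mx (emb K) c *m e1) (map_mx (emb K) c' *m e2) =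
    emb K ((c *m G *m (map_mx sO c')^T) 0 0).
Proof.
move=> GE; have mapE (M : 'M[oring K]_1) : emb K (M 0 0) = (map_mx (emb K) M) 0 0 by rewrite mxE.
rewrite mapE !map_mxM -GE -scalemxAr -scalemxAl mxE /herm; congr (_ * _).
congr (fun_of_matrix _ 0 0); rewrite map_mxM trmx_mul !mulmxA; congr (_ *m _).
by rewrite -map_trmx; congr (_^T); apply/matrixP => i j; rewrite !mxE s_emb.
Qed.

Lemma frob_rational (Fq2 : finFieldType) (k : fieldType) (j12 : {rmorphism Fq2 -> k}) q
    (cardFq2 : #|Fq2| = (q ^ 2)%N) (sg : {rmorphism k -> k}) (sgE : forall x, sg x = x ^+ q)
    d (T : {vspace 'rV[k]_d}) : (forall v, v \in T -> frob2 sg v \in T) ->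
  exists r (E : 'M[Fq2]_(r, d)), forall v, v \in T <-> (v <= map_mx j12 E)%MS.
Proof.
move=> frT; pose A0 : 'M[k]_(\dim T, d) := \matrix_i (vbasis T)`_i; pose A := row_base A0.
have AE v : v \in T <-> (v <= A)%MS.
  rewrite eq_row_base; split=> [vT|/submxP [x ->]].
    apply/submxP; exists (\row_i coord (vbasis T) i v); rewrite {1}(coord_vbasis vT).
    by rewrite mulmx_sum_row; apply: eq_bigr => i _; rewrite mxE rowK.
  rewrite mulmx_sum_row; apply: memv_suml => i _; rewrite memvZ // rowK vbasis_mem //.
  by rewrite mem_nth // size_tuple.
have fA : row_full A^T by rewrite /row_full mxrank_tr -/(row_free A) row_base_free.
pose f := fullrankfun fA; pose D := colsub f A.
have Du : D \in unitmx.
  by rewrite -unitmx_tr /D trmx_mxsub -row_full_unit; exact: fullrowsub_full.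
(* The reduced echelon basis of [T] is unique, so Frobenius fixes its entries. *)
pose E := invmx D *m A.
have cE : colsub f E = 1%:M by rewrite /E -mulmx_colsub mulVmx.
have EA : (E :=: A)%MS by apply: eqmxMfull; rewrite row_full_unit unitmx_inv.
have fixE : map_mx sg (map_mx sg E) = E.
  have /submxP [Y YE] : (map_mx sg (map_mx sg E) <= E)%MS.
    rewrite EA; apply/row_subP => i; apply/AE; rewrite -!map_row; apply: frT; apply/AE.
    by rewrite -EA row_sub.
  have := congr1 (colsub f) YE; rewrite -mulmx_colsub cE mulmx1 => Y1.
  by rewrite YE -Y1 -!map_mxsub cE !map_mx1 mul1mx.
(* The image of [Fq2] already provides all the roots that X^(q^2) - X can have. *)
have rat x : x ^+ #|Fq2| = x -> exists y, x = j12 y.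
  move=> xx; have [/codomP [y ->]|nx] := boolP (x \in codom j12); first by exists y.
  pose p : {poly k} := 'X^#|Fq2| - 'X.
  have sp : size p = #|Fq2|.+1.
    by rewrite size_polyDl ?size_polyXn // size_polyN size_polyX ltnS finNzRing_gt1.
  have p0 : p != 0 by rewrite -size_poly_eq0 sp.
  have F : all (root p) (x :: codom j12).
    rewrite /= rootE !hornerE xx subrr eqxx /=; apply/allP => _ /codomP [y ->].
    by rewrite rootE !hornerE -rmorphXn expf_card subrr.
  have U : uniq (x :: codom j12).
    by rewrite /= nx map_inj_uniq ?enum_uniq //; exact: fmorph_inj.
  by have := max_poly_roots p0 F U; rewrite /= sp size_codom ltnn.
have R i j : exists y, E i j = j12 y.
  apply: rat; have := congr1 (fun M : 'M__ => M i j) fixE.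
  by rewrite !mxE !sgE -exprM mulnn -cardFq2.
have R' i : exists g, forall j, E i j = j12 (g j) by have [g gE] := choice (R i); exists g.
have [g gE] := choice R'.
exists (\rank A0), (\matrix_(i, j) g i j) => v; rewrite AE -EA.
by have -> : map_mx j12 (\matrix_(i, j) g i j) = E by apply/matrixP => i j; rewrite [RHS]gE !mxE.
Qed.

(** * Quotients of lattices in duality and descent of stable subspaces *)

Section PairDatum.
Variables (Fq : finFieldType) (OF : cdvf Fq) (Fq2 : finFieldType)
  (i1 : {rmorphism Fq -> Fq2}) (k : fieldType) (i2 : {rmorphism Fq -> k})
  (j12 : {rmorphism Fq2 -> k}) (W2 : relwitt OF i1) (Wk : relwitt OF i2)
  (u : wittmap j12 W2 Wk).
Hypothesis cardFq2 : #|Fq2| = (#|Fq| ^ 2)%N.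
Variables (n : nat) (H : 'M[fld W2]_n).
Hypotheses (Hu : H \in unitmx) (Hh : forall i j, frob W2 (H i j) = H j i).
Local Notation q := #|Fq|.
Local Notation C := 'rV[fld W2]_n.
Local Notation Ck := 'rV[fld Wk]_n.
Local Notation wm := (map_mx (wmap u)).
Local Notation Hk := (wm H).
Local Notation hC := (herm (frob W2) H).
Local Notation hk := (herm (frob Wk) Hk).
Local Notation dC := (dualC H).
Local Notation dK := (dualCk u H).
Local Notation ext := (extend u).
Local Notation pi2 := (Defs.pi W2).
Local Notation pik := (Defs.pi Wk).
Variable a : fld W2.
Hypotheses (a0 : a != 0) (fa : frob W2 a = a).
Local Notation ak := (wmap u a).

(** The matrix [gram] for arbitrary families of vectors; on the chosen bases the two are
    convertible. *)
Definition gramG d1 d2 (b1 : 'M[fld W2]_(d1, n)) (b2 : 'M[fld W2]_(d2, n)) : 'M[k]_(d1, d2) :=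
  \matrix_(i, j) j12 (red (a * hC (row i b1) (row j b2))).

(* [T1 / B1] and [T2 / B2] are in duality through the form [a {., .}]. *)
Record pair_datum (T1 B1 T2 B2 : set C) d1 d2 (b1 : 'M[fld W2]_(d1, n))
    (b2 : 'M[fld W2]_(d2, n)) : Prop := PairDatum {
  pd_T1 : is_lattice T1;
  pd_T2 : is_lattice T2;
  pd_B1 : B1 = scale (a^-1 * pi2) (dC T2);
  pd_B2 : B2 = scale (a^-1 * pi2) (dC T1);
  pd_BT1 : B1 `<=` T1;
  pd_BT2 : B2 `<=` T2;
  pd_lb1 : lifts_basis T1 B1 b1;
  pd_lb2 : lifts_basis T2 B2 b2
}.

Lemma pair_datum_sym T1 B1 T2 B2 d1 d2 (b1 : 'M[fld W2]_(d1, n)) (b2 : 'M[fld W2]_(d2, n)) :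
  pair_datum T1 B1 T2 B2 b1 b2 -> pair_datum T2 B2 T1 B1 b2 b1.
Proof. by case. Qed.

Section One.
Variables (T1 B1 T2 B2 : set C) (d1 d2 : nat).
Variables (b1 : 'M[fld W2]_(d1, n)) (b2 : 'M[fld W2]_(d2, n)).
Hypothesis pd : pair_datum T1 B1 T2 B2 b1 b2.
Let lT1 := pd_T1 pd.
Let lT2 := pd_T2 pd.
Let BT1 := pd_BT1 pd.
Let lb1 := pd_lb1 pd.
Let lb2 := pd_lb2 pd.

Let s0 : a^-1 * pi2 != 0. Proof. by rewrite mulf_neq0 ?invr_eq0 ?pi_neq0. Qed.

Lemma pd_lB1 : is_lattice B1.
Proof.
have sB : submod B1 by rewrite (pd_B1 pd); exact/submod_scale/submod_lattice/(lattice_dC u cardFq2 Hu Hh).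
have piB : scale pi2 T1 `<=` B1 by move=> _ [v Tv <-]; exact: (pi_top sB lb1 Tv).
by case: (lattice_between lT1 sB piB BT1).
Qed.

Lemma pd_B1E v : B1 v <-> forall w, T2 w -> piO (a * hC v w).
Proof.
rewrite (pd_B1 pd) scale_dC //.
have e x : (a^-1 * pi2)^-1 * x = pi2^-1 * (a * x) by rewrite invfM invrK mulrCA mulrA.
by split=> h w /h; rewrite e => /piO_integral.
Qed.

Lemma wa0 : ak != 0. Proof. by rewrite fmorph_eq0. Qed.

Lemma ext_B1E v : ext B1 v <-> forall w, ext T2 w -> piO (ak * hk v w).
Proof.
rewrite (pd_B1 pd) ext_scale -(dK_ext u cardFq2 Hu Hh lT2) scale_dK ?fmorph_eq0 //.
have e x : (wmap u (a^-1 * pi2))^-1 * x = pik^-1 * (ak * x).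
  by rewrite rmorphM fmorphV wmap_pi invfM invrK mulrCA mulrA.
by split=> h w /h; rewrite e => /piO_integral.
Qed.

(** Over [k] the extended lattices still determine each other as annihilators modulo the maximal
    ideal. The scalar is taken out of the semilinear argument, which works because Frobenius fixes
    it. *)
Lemma ext_T1E v : ext T1 v <-> forall w, ext B2 w -> piO (ak * hk v w).
Proof.
have [e [f [eu fu TE [dCE dCE' dKE dKE']]]] := dual_basesP u cardFq2 Hu Hh lT1.
have -> : ext T1 = dK (ext (dC T1)) by rewrite dCE.
rewrite (pd_B2 pd) ext_scale.
have fs : frob Wk (wmap u (a^-1 * pi2)) = wmap u (a^-1 * pi2).
  by rewrite -wmap_frob rmorphM fmorphV fa /Defs.pi frob_emb frobO_unif.
have e' x : ak * (wmap u (a^-1 * pi2) * x) = pik * x.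
  by rewrite rmorphM fmorphV wmap_pi mulrA mulrA divff ?wa0 // mul1r.
have piE x : piO (pik * x) <-> integral x.
  by rewrite piO_integral mulrA mulVf ?pi_neq0 // mul1r.
split=> h w => [[w' Ew' <-]|Ew].
  by rewrite (hermZr (frob Wk)) fs e'; apply/piE/h.
apply/piE; rewrite -e' -{1}fs -hermZr; apply: h; by exists w.
Qed.

Lemma pd_integral v w : T1 v -> T2 w -> integral (a * hC v w).
Proof.
move=> Tv Tw; have := pi_top (submod_lattice pd_lB1) lb1 Tv => /pd_B1E /(_ w Tw).
by rewrite hermZl mulrCA piO_integral mulKf ?pi_neq0.
Qed.

Lemma gram_oring : exists G : 'M[oring W2]_(d1, d2),
  [/\ a *: (b1 *m H *m (map_mx (frob W2) b2)^T) = map_mx (emb W2) G,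
      ak *: (wm b1 *m Hk *m (map_mx (frob Wk) (wm b2))^T) = map_mx (emb Wk) (map_mx (wmapO u) G)
    & gramG b1 b2 = map_mx j12 (map_mx (res W2) G)].
Proof.
have I i : exists g : 'I_d2 -> oring W2, forall j, a * hC (row i b1) (row j b2) = emb W2 (g j).
  have J j : integral (a * hC (row i b1) (row j b2)).
    by apply: pd_integral; [exact: lb_row lb1 i | exact: lb_row lb2 j].
  by have [g gE] := choice J; exists g.
have [g gE] := choice I; exists (\matrix_(i, j) g i j).
have GE : a *: (b1 *m H *m (map_mx (frob W2) b2)^T) = map_mx (emb W2) (\matrix_(i, j) g i j).
  apply/matrixP => i j; rewrite !mxE -gE; congr (_ * _); rewrite /herm mxE.
  by apply: eq_bigr => l _; rewrite -row_mul !mxE.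
split=> //.
  rewrite map_frob_wm map_trmx -!map_mxM -map_mxZ GE.
  by apply/matrixP => i j; rewrite !mxE wmap_emb.
by apply/matrixP => i j; rewrite !mxE gE red_emb.
Qed.

End One.

Section Two.
Variables (T1 B1 T2 B2 : set C) (d1 d2 : nat).
Variables (b1 : 'M[fld W2]_(d1, n)) (b2 : 'M[fld W2]_(d2, n)).
Hypothesis pd : pair_datum T1 B1 T2 B2 b1 b2.
Let pd' := pair_datum_sym pd.
Let lT1 := pd_T1 pd.
Let lb1 := pd_lb1 pd.
Let lb2 := pd_lb2 pd.
Let sT1 := submod_lattice lT1.

(** A vector killed by the reduced matrix lifts to an element of [T1] that pairs with [T2] into the
    maximal ideal. It lies in [B1], so its reduced coordinates vanish. *)
Lemma gram_free0 (G : 'M[oring W2]_(d1, d2)) :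
  a *: (b1 *m H *m (map_mx (frob W2) b2)^T) = map_mx (emb W2) G ->
  row_free (map_mx (res W2) G).
Proof.
move=> GE; rewrite -kermx_eq0; apply/rowV0P => x /sub_kermxP xG.
have [c cE] := res_lift W2 x; rewrite -cE; apply/(lb_ker lb1)/(pd_B1E pd) => w Tw.
have [c' Bc'] := lb_dec lb2 Tw; rewrite -[w](subrK (map_mx (emb W2) c' *m b2)).
rewrite (hermDr (frob W2)) mulrDr; apply: piOD.
  have /(pd_B1E pd') /(_ _ (lb_T sT1 lb1 c)) := Bc'.
  by rewrite -(frobk_piO (Wk := W2)) rmorphM fa (hC_conj cardFq2 Hh).
rewrite (form_basis (@frob_emb _ _ _ _ W2) _ _ GE); apply/piO_emb.
have mapE (M : 'M[oring W2]_1) : res W2 (M 0 0) = (map_mx (res W2) M) 0 0 by rewrite mxE.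
by rewrite mapE !map_mxM cE xG mul0mx mxE.
Qed.

End Two.

Section Three.
Variables (T1 B1 T2 B2 : set C) (d1 d2 : nat).
Variables (b1 : 'M[fld W2]_(d1, n)) (b2 : 'M[fld W2]_(d2, n)).
Hypothesis pd : pair_datum T1 B1 T2 B2 b1 b2.
Let pd' := pair_datum_sym pd.
Let lb1 := pd_lb1 pd.
Let lb2 := pd_lb2 pd.
Variable sg : {rmorphism k -> k}.
Hypothesis sgE : forall x, sg x = x ^+ q.

Lemma gram_conj : gramG b2 b1 = (map_mx sg (gramG b1 b2))^T.
Proof.
apply/matrixP => j i; rewrite !mxE.
have [g gE] : integral (a * hC (row i b1) (row j b2)).
  by apply: (pd_integral pd); [exact: lb_row lb1 i | exact: lb_row lb2 j].
have -> : a * hC (row j b2) (row i b1) = emb W2 (frobO W2 g).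
  by rewrite -frob_emb -gE rmorphM fa (hC_conj cardFq2 Hh).
by rewrite gE !red_emb frobO_res sgE rmorphXn.
Qed.

Lemma gram_nondeg : nondeg (gramG b1 b2).
Proof.
have [G [GE _ GE']] := gram_oring pd; have [G2 [G2E _ G2E']] := gram_oring pd'.
have f1 := gram_free0 pd GE; have f2 := gram_free0 pd' G2E.
rewrite /nondeg {1}GE' row_free_map f1 /=.
move: f2; rewrite -(row_free_map j12) -G2E' gram_conj /row_free mxrank_tr mxrank_map.
by rewrite /row_full.
Qed.

End Three.

Section Four.
Variables (T1 B1 T2 B2 : set C) (d1 d2 : nat).
Variables (b1 : 'M[fld W2]_(d1, n)) (b2 : 'M[fld W2]_(d2, n)).
Hypothesis pd : pair_datum T1 B1 T2 B2 b1 b2.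
Let pd' := pair_datum_sym pd.
Let lb1 := pd_lb1 pd.
Let lb2 := pd_lb2 pd.
Variable sg : {rmorphism k -> k}.
Hypothesis sgE : forall x, sg x = x ^+ q.
Local Notation emk := (map_mx (emb Wk)).
Local Notation rsk := (map_mx (res Wk)).
Local Notation P1 := (gramG b1 b2).
Local Notation P2 := (gramG b2 b1).

Lemma gram_dual : dual_pair sg P1 P2.
Proof.
split; [exact: gram_conj pd _ sgE | exact: gram_conj pd' _ sgE |].
exact: (gram_nondeg pd sgE).
Qed.

Lemma form_red (c : 'rV[oring Wk]_d1) (c' : 'rV[oring Wk]_d2) :
  piO (ak * hk (emk c *m wm b1) (emk c' *m wm b2)) <-> qform q P1 (rsk c) (rsk c') = 0.
Proof.
have [G [_ GE GE']] := gram_oring pd.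
rewrite (form_basis (@frob_emb _ _ _ _ Wk) _ _ GE) piO_emb.
have mapE (M : 'M[oring Wk]_1) : res Wk (M 0 0) = (map_mx (res Wk) M) 0 0 by rewrite mxE.
rewrite mapE !map_mxM /qform GE'; set x := (_ *m _) 0 0; set y := (_ *m _) 0 0.
suff -> : x = y by [].
rewrite {}/x {}/y; congr (fun_of_matrix (_ *m _ *m _) 0 0).
  by apply/matrixP => i j; rewrite !mxE wmap_res.
by apply/matrixP => i j; rewrite !mxE frobO_res.
Qed.

(** Independence modulo [ext B1] comes from the Gram matrix: its nondegeneracy over [Fq2] survives
    the extension to [k], and a combination lying in [ext B1] pairs to zero with the lifted basis of
    [T2]. *)
Lemma ext_lb1 : lifts_basis (ext T1) (ext B1) (wm b1).
Proof.
have sB := ext_submod u B1.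
split=> [i|v [r [x [t [Tt ->]]]]|c].
- by rewrite -map_row; apply: ext_mem; exact: lb_row lb1 i.
- have H' i : exists c : 'rV[oring W2]_d1, B1 (row i t - map_mx (emb W2) c *m b1).
    exact: (lb_dec lb1 (Tt i)).
  have [g gE] := choice H'; pose M := \matrix_i g i.
  exists (x *m map_mx (wmapO u) M).
  have -> : map_mx (emb Wk) (x *m map_mx (wmapO u) M) *m wm b1 =
      emk x *m wm (map_mx (emb W2) M *m b1).
    rewrite !map_mxM -!mulmxA; congr (_ *m (_ *m _)).
    by apply/matrixP => i j; rewrite !mxE wmap_emb.
  rewrite -mulmxBr -map_mxB; apply: submod_mul => // i; rewrite -map_row; apply: ext_mem.
  by rewrite linearB /= row_mul -map_row rowK; exact: gE.
split=> [/(ext_B1E pd) h|/rowP c0].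
  have dp := gram_dual; case: dp => _ _ /andP [fr _]; apply/eqP.
  rewrite -(mulmx_free_eq0 _ fr); apply/eqP/rowP => j; rewrite [RHS]mxE.
  have Tj : ext T2 (emk (delta_mx 0 j) *m wm b2).
    by rewrite map_delta_mx -rowE -map_row; apply: ext_mem; exact: lb_row lb2 j.
  have := h _ Tj; rewrite form_red (qformE sgE).
  by rewrite !map_delta_mx trmx_delta -colE mxE.
have H' i : exists y, c 0 i = unif Wk * y.
  by apply/res_ker; have := c0 i; rewrite !mxE.
have [y yE] := choice H'; have -> : emk c = emk (\row_i y i) *m (pik *: 1%:M).
  by rewrite -scalemxAr mulmx1; apply/rowP => i; rewrite !mxE yE rmorphM.
rewrite -mulmxA -scalemxAl mul1mx; apply: submod_mul => // i.
rewrite linearZ /= -map_row -(wmap_pi u) -map_mxZ; apply: ext_mem.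
exact: (pi_top (submod_lattice (pd_lB1 pd)) lb1 (lb_row lb1 i)).
Qed.

End Four.

Section Five.
Variables (T1 B1 T2 B2 : set C) (d1 d2 : nat).
Variables (b1 : 'M[fld W2]_(d1, n)) (b2 : 'M[fld W2]_(d2, n)).
Hypothesis pd : pair_datum T1 B1 T2 B2 b1 b2.
Let pd' := pair_datum_sym pd.
Variable sg : {rmorphism k -> k}.
Hypothesis sgE : forall x, sg x = x ^+ q.
Local Notation emk := (map_mx (emb Wk)).
Local Notation rsk := (map_mx (res Wk)).
Local Notation P1 := (gramG b1 b2).
Local Notation P2 := (gramG b2 b1).
Local Notation red1 := (redv (wm b1)).
Local Notation red2 := (redv (wm b2)).
Let klb1 := ext_lb1 pd sgE.
Let klb2 := ext_lb1 pd' sgE.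
Let eBT1 : ext B1 `<=` ext T1. Proof. exact/ext_mono/(pd_BT1 pd). Qed.
Let eBT2 : ext B2 `<=` ext T2. Proof. exact/ext_mono/(pd_BT2 pd). Qed.

Lemma red_perp L1 L2 : submod L1 -> submod L2 ->
  (forall v w, L1 v -> ext T1 v -> L2 w -> ext T2 w -> piO (ak * hk v w)) ->
  (red1 L1 <= perp q P1 (red2 L2))%VS.
Proof.
move=> sL1 sL2 h; apply/subvP => _ /(mem_redv _ _ sL1) [c [<- Lc]].
apply/(mem_perp sgE) => _ /(mem_redv _ _ sL2) [c' [<- Lc']]; apply/(form_red pd).
by apply: h => //; [exact: lb_T (ext_submod u T1) klb1 c | exact: lb_T (ext_submod u T2) klb2 c'].
Qed.

(** Replacing [v] and [w] by lifts of their coordinates changes them by elements of [ext B1] and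
    [ext B2], whose pairings fall into the maximal ideal. *)
Lemma perp_red L1 L2 v w : submod L1 -> submod L2 -> L1 `<=` ext T1 -> ext B1 `<=` L1 ->
  L2 `<=` ext T2 -> ext B2 `<=` L2 ->
  (red1 L1 <= perp q P1 (red2 L2))%VS -> L1 v -> L2 w -> piO (ak * hk v w).
Proof.
move=> sL1 sL2 LT1 BL1 LT2 BL2 /subvP sub Lv Lw.
have Tv := LT1 _ Lv; have Tw := LT2 _ Lw.
have [c Bc] := lb_dec klb1 Tv; have [c' Bc'] := lb_dec klb2 Tw.
rewrite -[v](subrK (emk c *m wm b1)) (hermDl (frob Wk)) mulrDr; apply: piOD.
  by have /(ext_B1E pd) := Bc; apply.
rewrite -[w](subrK (emk c' *m wm b2)) (hermDr (frob Wk)) mulrDr; apply: piOD.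
  have := (ext_T1E pd (emk c *m wm b1)).1 (lb_T (ext_submod u T1) klb1 c); exact.
have cL : L1 (emk c *m wm b1).
  by rewrite -[X in L1 X](subKr v); apply: submodB => //; exact: BL1.
have cL' : L2 (emk c' *m wm b2).
  by rewrite -[X in L2 X](subKr w); apply: submodB => //; exact: BL2.
apply/(form_red pd); have /(mem_perp sgE) := sub _ ((redv_res klb1 c sL1 BL1).2 cL).
by apply; apply/(redv_res klb2 c' sL2 BL2).
Qed.

(** By [frob_rational] the subspace is spanned by rows with entries in [Fq2]; the lattice is the
    lift of their span [W] over [Fq2]. *)
Lemma descent T : stable q P1 P2 T ->
  exists L, [/\ is_lattice L, B1 `<=` L, L `<=` T1 & ext L = liftv (ext B1) (wm b1) T].
Proof.
move=> stT; have frT := (stableP sgE (gram_dual pd sgE) T).2 stT.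
have [r [E EE]] : exists r (E : 'M[Fq2]_(r, d1)), forall v, v \in T <-> (v <= map_mx j12 E)%MS.
  exact: (frob_rational j12 cardFq2 sgE frT).
have sT1 := submod_lattice (pd_T1 pd); have sB1 := submod_lattice (pd_lB1 pd).
have sE1 := ext_submod u B1.
pose W := <<[seq row i E | i <- enum 'I_r]>>%VS.
have WT x : x \in W -> map_mx j12 x \in T.
  move=> xW; apply/EE; rewrite map_submx.
  have : (W <= linfun (mulmxr (cokermx E)) @^-1: 0)%VS.
    apply/span_subvP => _ /mapP [i _ ->]; rewrite -memv_preim lfunE /= memv0.
    by rewrite -row_mul mulmx_coker row0.
  move/subvP => /(_ _ xW); by rewrite -memv_preim lfunE /= memv0 submxE.
have [z vB] := lattice_vol (pd_lB1 pd); exists (liftv B1 b1 W).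
have lbs := pd_lb1 pd; have sL := submod_lift b1 sB1 W; split.
- exact: vol_lattice (vol_lift sT1 sB1 lbs W vB).
- exact: (@lift_sup _ _ _ _ _ _ _).
- exact: (lift_sub sT1 (pd_BT1 pd) lbs).
apply/seteqP; split.
  apply: ext_min; first exact: submod_lift.
  move=> v [c [Bc cW]]; exists (map_mx (wmapO u) c); split.
    have -> : emk (map_mx (wmapO u) c) = wm (map_mx (emb W2) c).
      by apply/matrixP => i j; rewrite !mxE wmap_emb.
    by rewrite -map_mxM -map_mxB; exact: ext_mem.
  have -> : rsk (map_mx (wmapO u) c) = map_mx j12 (map_mx (res W2) c).
    by apply/matrixP => i j; rewrite !mxE wmap_res.
  exact: WT.
move=> v [c [Bc /EE /submxP [x xE]]].
have sEL := ext_submod u (liftv B1 b1 W).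
have [M ME] : exists M : 'M[oring W2]_(r, d1), map_mx (res W2) M = E.
  have HM i : exists c : 'rV[oring W2]_d1, map_mx (res W2) c = row i E by exact: res_lift.
  have [g gE] := choice HM; exists (\matrix_i g i); apply/row_matrixP => i.
  by rewrite -map_row rowK gE.
have [y yE] := res_lift Wk x; pose c' := y *m map_mx (wmapO u) M.
have cc : rsk (c - c') = 0.
  rewrite map_mxB xE map_mxM yE -[X in _ - X]/(x *m _) (_ : rsk _ = map_mx j12 E) ?subrr //.
  by rewrite -ME; apply/matrixP => i j; rewrite !mxE wmap_res.
rewrite -[v](subrK (emk c *m wm b1)); apply: submodD => //.
  exact: (ext_mono (@lift_sup _ _ _ _ B1 b1 W)).
rewrite -[emk c](subrK (emk c')) mulmxDl -map_mxB; apply: submodD => //.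
  apply: (ext_mono (@lift_sup _ _ _ _ B1 b1 W)); exact/(lb_ker klb1).
have -> : emk c' *m wm b1 = emk y *m wm (map_mx (emb W2) M *m b1).
  rewrite !map_mxM -!mulmxA; congr (_ *m (_ *m _)).
  by apply/matrixP => i j; rewrite !mxE wmap_emb.
apply: submod_mul => // i; rewrite -map_row; apply: ext_mem; rewrite row_mul -map_row.
apply/(lift_mem sB1 lbs); rewrite map_row ME; apply: memv_span.
by apply/mapP; exists i; rewrite ?mem_enum.
Qed.

End Five.

End PairDatum.

(** * Words of the strata *)

(** The default value of [nth] plays the part of k_(r+1) + 1 = d, so removing a final entry [d] from
    the list changes no value. *)
Lemma nth_proper d s i : sorted ltn s -> all (fun x => x <= d)%N s ->
  nth d [seq x <- s | (x < d)%N] i = nth d s i.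
Proof.
elim: s i => // x s IH i xs /andP [xd sd].
have ss : sorted ltn s by exact: path_sorted xs.
rewrite [LHS]/=; have [lt|ge] := ltnP x d; first by case: i => //= i; exact: IH.
have s0 : s = [::].
  case: s xs sd {IH ss} => // y s /= /andP [xy _] /andP [yd _]; lia.
by rewrite s0; case: i => [|[]] //=; lia.
Qed.

Section ProperDims.
Variables (d l R : nat) (ds : seq nat) (D : nat -> nat).
Hypotheses (R0 : (0 < R)%N) (inc : forall j, (0 < j < R)%N -> (D j < D j.+1)%N).
Hypotheses (DR : (D R <= d)%N) (lR : (1 < l)%N = (D R < d)%N).
Hypotheses (sds : sorted leq ds) (mds : ds =i [seq D y | y <- iota 1 R]).

Let sD : sorted ltn [seq D y | y <- iota 1 R].
Proof.
apply/(sortedP 0%N) => i; rewrite size_map size_iota => iR.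
by rewrite !(nth_map 0%N) ?size_iota ?nth_iota //; try lia; apply: inc; lia.
Qed.

Lemma undup_dims : undup ds = [seq D y | y <- iota 1 R].
Proof.
apply: (irr_sorted_eq ltn_trans ltnn) => //; last by move=> x; rewrite mem_undup mds.
by rewrite ltn_sorted_uniq_leq undup_uniq (subseq_sorted leq_trans (undup_subseq ds)).
Qed.

Let aD : all (fun x => x <= d)%N [seq D y | y <- iota 1 R].
Proof.
apply/allP => _ /mapP [y yR ->]; rewrite mem_iota in yR.
by apply: leq_trans DR; apply: (incr_le R0 inc); lia.
Qed.

Lemma dim_at_gap i : (0 < i <= R)%N -> dim_at d ds i = D i.
Proof.
move=> iR; rewrite /dim_at /proper_dims undup_dims nth_proper //.
by rewrite (nth_map 0%N) ?size_iota ?nth_iota; [congr D; lia| lia|lia].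
Qed.

(** The two cases in the definition of r_0 agree here: if l > 1 all [R] members are proper and one
    is subtracted; if l = 1 the last member is the whole space and is not counted. *)
Lemma r_zero_gap : r_zero l d ds = R.-1.
Proof.
rewrite /r_zero /proper_dims undup_dims lR size_filter.
have e : iota 1 R = rcons (iota 1 R.-1) R.
  by rewrite -[in LHS](prednK R0) -[R.-1.+1]addn1 iotaD cats1 add1n prednK.
rewrite e map_rcons -cats1 count_cat /= addn0.
have -> : count (fun x => x < d)%N [seq D i | i <- iota 1 R.-1] = R.-1.
  rewrite -[RHS](size_iota 1 R.-1) -[RHS](size_map D); apply/eqP; rewrite -all_count.
  apply/allP => _ /mapP [y yR ->]; rewrite mem_iota in yR.
  have y1 := inc (j := y) ltac:(lia); have := incr_le R0 inc (i := y.+1) (j := R) isT; lia.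
by case: ltnP; lia.
Qed.

Lemma tuple_gap t : tuple_ok d ds R.-1 t <-> gap_tuple D t R.
Proof.
by split=> H i iR; have Hi := H i ltac:(lia); move: Hi; rewrite !dim_at_gap; lia.
Qed.

Lemma word_gap t : word d ds R.-1 t (D R) = gap_word D t R d.
Proof.
rewrite /word /gap_word; congr (flatten _ ++ _); apply/eq_in_map => i.
by rewrite mem_iota => iR; rewrite dim_at_gap //; lia.
Qed.

End ProperDims.

(** Of two members of a sorted list one contains the other, and dimensions decide which. This also
    covers repeated members, for which positions are ambiguous. *)
Lemma chain_dim (k : fieldType) d (s : seq {vspace 'rV[k]_d}) U W :
  sorted (fun U W => (U <= W)%VS) s -> U \in s -> W \in s -> (\dim U <= \dim W)%N -> (U <= W)%VS.
Proof.
move=> ss Us Ws dd; have tr : transitive (fun U W : {vspace 'rV[k]_d} => (U <= W)%VS).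
  by move=> y x z; exact: subv_trans.
have rf : reflexive (fun U W : {vspace 'rV[k]_d} => (U <= W)%VS) by move=> x; exact: subvv.
have key := sorted_leq_index tr rf ss.
have [le|/ltnW le] := leqP (index U s) (index W s); first exact: key.
by have /eqP -> : W == U by rewrite eqEdim key.
Qed.

Lemma rev_iota_map (T : Type) (f : nat -> T) E :
  [seq f y | y <- rev (iota 1 E)] = [seq f (E.+1 - y)%N | y <- iota 1 E].
Proof.
rewrite map_rev; apply: (@eq_from_nth _ (f 0%N)); rewrite ?size_rev ?size_map ?size_iota // => i iE.
rewrite nth_rev ?size_map ?size_iota // !(nth_map 0%N) ?size_iota ?nth_iota //; try lia.
by congr f; lia.
Qed.

Lemma sorted_iota_map (f : nat -> nat) E : (forall y, (0 < y < E)%N -> (f y <= f y.+1)%N) ->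
  sorted leq [seq f y | y <- iota 1 E].
Proof.
move=> H; apply/(sortedP 0%N) => i; rewrite size_map size_iota => iE.
by rewrite !(nth_map 0%N) ?size_iota ?nth_iota; try lia; apply: H; lia.
Qed.

Lemma refinesP (k : fieldType) d (C : nat -> {vspace 'rV[k]_d}) Fl : complete_flag C ->
  refines C Fl <-> forall U, U \in Fl -> C (\dim U) = U.
Proof.
move=> [dC _]; split=> H U /[dup] UF /H; first by move=> [x xd ->]; rewrite dC.
by move=> e; exists (\dim U); rewrite ?e ?dim_rV.
Qed.

Lemma eq_map_iota (T : eqType) (f g : nat -> T) E :
  [seq f y | y <- iota 1 E] = [seq g y | y <- iota 1 E] -> forall y, (0 < y <= E)%N -> f y = g y.
Proof. by move=> /eq_in_map H y yE; apply: H; rewrite mem_iota; lia. Qed.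

(** The gaps [j] and [R - j] have equal length, so they give the same inequality and those with
    [j < E] suffice. A middle gap, of length [z], exists iff [z != 0]; it pairs with itself, whence
    the factor 2. *)
Lemma sym_gaps (E R z c : nat) (al D t : nat -> nat) : (0 < E)%N ->
  (z != 0%N -> R = 2 * E)%N -> (z = 0%N -> R = 2 * E - 1)%N ->
  (forall i, (1 <= i <= E - 1)%N -> D i.+1 - D i = al i.+1 - al i)%N ->
  (z != 0%N -> D E.+1 - D E = z)%N ->
  (forall j, (0 < j <= R)%N -> D j + D (R.+1 - j) = c)%N ->
  (forall j, (0 < j < R)%N -> D j < D j.+1)%N ->
  (forall j, (0 < j < R)%N -> (D j.+1 - D j <= t j + t (R - j))%N) <->
    (forall i, (1 <= i <= E - 1)%N -> (al i.+1 - al i <= t i + t (R.-1 + 1 - i))%N) /\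
    (z != 0%N -> (z <= 2 * t E)%N).
Proof.
move=> E0 Rz Rz0 lowD midD sumD inc.
have RR : (2 * E - 1 <= R <= 2 * E)%N.
  by have [z0|z0] := eqVneq z 0%N; [rewrite (Rz0 z0) | rewrite (Rz z0)]; clear; lia.
have R1 i : (1 <= i <= E - 1)%N -> (R.-1 + 1 - i = R - i)%N by clear -RR; lia.
split=> [T|[T1 T2] j jR].
  split=> [i iE|z0]; first by rewrite -lowD // R1 //; apply: T; clear -iE RR; lia.
  have RE2 := Rz z0; have e : (R - E = E)%N by clear -RE2; lia.
  have ER : (0 < E < R)%N by clear -RE2 E0; lia.
  by have := T E ER; rewrite e midD //; clear; lia.
have [lt|ge] := ltnP j E.
  have jE : (1 <= j <= E - 1)%N by clear -lt jR; lia.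
  by rewrite lowD // -R1 //; exact: T1.
have [e|ne] := eqVneq j (R - j)%N.
  have z0 : z != 0%N by apply/eqP => /Rz0 Re; clear -e Re E0 jR; lia.
  have je : j = E by have Re := Rz z0; clear -e Re E0 jR; lia.
  by rewrite -!e je midD //; have := T2 z0; clear; lia.
have lt : (1 <= R - j <= E - 1)%N by clear -RR ge ne jR; lia.
have e1 : (R.+1 - j = (R - j).+1)%N by clear -jR; lia.
have jR1 : (0 < j <= R)%N by clear -jR; lia.
have jR2 : (0 < j.+1 <= R)%N by clear -jR; lia.
have jR3 : (0 < R - j < R)%N by clear -jR; lia.
have s1 := sumD j jR1; have s2 := sumD j.+1 jR2; rewrite e1 in s1; rewrite subSS in s2.
have i1 := inc j jR; have i2 := inc _ jR3; have := lowD _ lt; have := T1 _ lt.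
have -> : (R.-1 + 1 - (R - j) = j)%N by clear -jR; lia.
clear -s1 s2 i1 i2; lia.
Qed.

(** * The strata in the indexing of lattice chains *)

Section Chains.
Variables (k : fieldType) (q : nat) (sg : {rmorphism k -> k}).
Hypothesis closedk : forall p : {poly k}, size p != 1%N -> exists x, root p x.
Hypotheses (sgE : forall x, sg x = x ^+ q) (q_gt1 : (1 < q)%N).

Section GLChain.
Variables (d d' : nat) (P1 : 'M[k]_(d, d')) (P2 : 'M[k]_(d', d)).
Hypothesis dp : dual_pair sg P1 P2.
Variables (l1 l0 N : nat) (be : nat -> nat).
Variables (W : nat -> {vspace 'rV[k]_d}) (U : nat -> {vspace 'rV[k]_d'}).
Hypotheses (l1_gt0 : (0 < l1)%N) (l0_gt0 : (0 < l0)%N) (N_gt0 : (0 < N)%N).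
Hypotheses (be1 : be 1%N = 0%N) (be_inc : forall y, (0 < y < N)%N -> (be y < be y.+1)%N).
Hypothesis dE : (d = l0 + l1 - 1 + be N)%N.
Let ds := [seq (l1 + be y)%N | y <- iota 1 N].
Let ds' := [seq (l0 + (be N - be y))%N | y <- rev (iota 1 N)].
Let Fl1 := [seq W y | y <- iota 1 N].
Let Fl2 := [seq U y | y <- rev (iota 1 N)].
Hypotheses (dim1 : [seq \dim A | A <- Fl1] = ds) (dim2 : [seq \dim A | A <- Fl2] = ds').
Hypotheses (sorted1 : sorted (fun A B => (A <= B)%VS) Fl1).
Hypotheses (sorted2 : sorted (fun A B => (A <= B)%VS) Fl2).
Let D1 y := (l1 + be y)%N.
Let D2 y := (l0 + (be N - be (N.+1 - y)))%N.
Let G2 y := U (N.+1 - y)%N.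

Let be_le y : (0 < y <= N)%N -> (be y <= be N)%N.
Proof. by move=> yN; apply: (incr_le N_gt0 be_inc); lia. Qed.

Let inc1 j : (0 < j < N)%N -> (D1 j < D1 j.+1)%N.
Proof. by move=> jN; rewrite /D1 ltn_add2l be_inc. Qed.
Let inc2 j : (0 < j < N)%N -> (D2 j < D2 j.+1)%N.
Proof.
move=> jN; rewrite /D2 subSS; have e : (N.+1 - j = (N - j).+1)%N by lia.
rewrite e; have := be_inc (y := (N - j)%N) ltac:(lia).
have := be_le (y := (N - j).+1) ltac:(lia); lia.
Qed.

Let ds'E : ds' = [seq D2 y | y <- iota 1 N]. Proof. by rewrite /ds' rev_iota_map. Qed.
Let Fl2E : Fl2 = [seq G2 y | y <- iota 1 N]. Proof. by rewrite /Fl2 rev_iota_map. Qed.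

Let dimW y : (0 < y <= N)%N -> \dim (W y) = D1 y.
Proof. by move: y; apply: eq_map_iota; rewrite -[RHS]dim1 /Fl1 -map_comp. Qed.
Let dimG2 y : (0 < y <= N)%N -> \dim (G2 y) = D2 y.
Proof. by move: y; apply: eq_map_iota; rewrite -ds'E -dim2 Fl2E -map_comp. Qed.

Let WF y : (0 < y <= N)%N -> W y \in Fl1.
Proof. by move=> yN; apply: map_f; rewrite mem_iota; lia. Qed.
Let GF y : (0 < y <= N)%N -> G2 y \in Fl2.
Proof. by move=> yN; rewrite Fl2E; apply: map_f; rewrite mem_iota; lia. Qed.

Let fp : flag_pair N D1 D2 W G2.
Proof.
split=> //.
- exact: dual_dim dp.
- by rewrite /D1; lia.
- by rewrite /D2; lia.
- move=> j jN; apply: (chain_dim sorted1); rewrite ?WF ?dimW; try lia.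
  exact: ltnW (inc1 jN).
- move=> j jN; apply: (chain_dim sorted2); rewrite ?GF ?dimG2; try lia.
  exact: ltnW (inc2 jN).
- move=> j jN; rewrite /D1 /D2 dE; have e : (N.+1 - (N.+1 - j) = j)%N by lia.
  by rewrite e; have := be_le jN; lia.
Qed.

(** The second flag is listed by decreasing index, so [U y] is the partner of [W y]; after the
    reindexing [G2] this is [strata_GL]. *)
Lemma GL_chain :
  (exists t t', [/\ tuple_ok d ds (r_zero l0 d ds) t, tuple_ok d' ds' (r_zero l1 d' ds') t',
     forall i, (1 <= i <= N - 1)%N ->
       (be i.+1 - be i <= t i + t' (r_zero l1 d' ds' + 1 - i))%N
   & XGL q P1 (word d ds (r_zero l0 d ds) t (d - l0 + 1))
       (word d' ds' (r_zero l1 d' ds') t' (d' - l1 + 1)) Fl1 Fl2]) <->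
  [/\ forall y, (0 < y <= N)%N -> (perp q P1 (U y) <= W y)%VS /\ (perp q P2 (W y) <= U y)%VS,
      full_at q P1 P2 (W N), full_at q P2 P1 (U 1%N)
    & forall y, (0 < y < N)%N -> no_stable q P1 P2 (W y) (U y.+1)].
Proof.
have dd := dual_dim dp.
have D1N : D1 N = (d - l0 + 1)%N by rewrite /D1; lia.
have D2N : D2 N = (d' - l1 + 1)%N by rewrite /D2 subSnn be1; lia.
have m1 : ds =i [seq D1 y | y <- iota 1 N] by [].
have m2 : ds' =i [seq D2 y | y <- iota 1 N] by rewrite ds'E.
have s1 : sorted leq ds by apply: sorted_iota_map => y /inc1 /ltnW.
have s2 : sorted leq ds' by rewrite ds'E; apply: sorted_iota_map => y /inc2 /ltnW.
have DR1 : (D1 N <= d)%N by lia.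
have DR2 : (D2 N <= d')%N by lia.
have L1 : (1 < l0)%N = (D1 N < d)%N by rewrite D1N; apply/idP/idP; lia.
have L2 : (1 < l1)%N = (D2 N < d')%N by rewrite D2N; apply/idP/idP; lia.
rewrite (r_zero_gap N_gt0 inc1 DR1 L1 s1 m1) (r_zero_gap N_gt0 inc2 DR2 L2 s2 m2) -D1N -D2N.
have P2E : P2 = (map_mx (fun x => x ^+ q) P1)^T.
  have [-> _ _] := dp; apply/matrixP => i j; rewrite !mxE; exact: sgE.
transitivity (exists t1 t2 C1 C2, DL_cond q P1 P2 N D1 D2 W G2 t1 t2 C1 C2).
  split=> [[t [t' [/(tuple_gap N_gt0 inc1 DR1 L1 s1 m1) T1 /(tuple_gap N_gt0 inc2 DR2 L2 s2 m2) T2 T]]]|].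
    move=> [C1 [C2 [[c1 r1] [c2 r2] rel1 rel2]]]; exists t, t', C1, C2; split=> //.
    - move=> j jN; have := T j ltac:(lia); rewrite /D1 subnDl.
      have -> // : (N.-1 + 1 - j = N - j)%N by lia.
    - move/(refinesP _ c1) in r1; move/(refinesP _ c2) in r2; split=> j jN.
        by rewrite -dimW // r1 // WF.
      by rewrite -dimG2 // r2 // GF.
    - rewrite P2E; move: rel1 rel2.
      by rewrite (word_gap N_gt0 inc1 DR1 L1 s1 m1) (word_gap N_gt0 inc2 DR2 L2 s2 m2).
  move=> [t [t' [C1 [C2 [[T1 T2] T [c1 c2] [r1 r2] [rel1 rel2]]]]]]; exists t, t'.
  split; [exact/(tuple_gap N_gt0 inc1 DR1 L1 s1 m1)|exact/(tuple_gap N_gt0 inc2 DR2 L2 s2 m2)| |].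
    move=> j jN; have := T j ltac:(lia); rewrite /D1 subnDl.
    have -> // : (N.-1 + 1 - j = N - j)%N by lia.
  exists C1, C2; rewrite (word_gap N_gt0 inc1 DR1 L1 s1 m1) (word_gap N_gt0 inc2 DR2 L2 s2 m2) -P2E.
  split=> //; split=> //; apply/refinesP => // A.
    by move=> /mapP [y yN ->]; rewrite mem_iota in yN; rewrite dimW ?r1 //; lia.
  by rewrite Fl2E => /mapP [y yN ->]; rewrite mem_iota in yN; rewrite dimG2 ?r2 //; lia.
rewrite (strata_GL closedk sgE q_gt1 dp fp) /open_cond /G2 subSnn.
have inv y : (0 < y <= N)%N -> (N.+1 - (N.+1 - y) = y)%N by lia.
split=> [[o1 o2 o3 o4 o5]|[o1 o2 o3 o4]]; split=> //.
- move=> y yN; split; last by have := o2 y yN; rewrite inv.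
  by have := o1 (N.+1 - y)%N ltac:(lia); rewrite inv.
- move=> y yN; have := o5 y yN; have -> // : (N.+1 - (N - y) = y.+1)%N by lia.
- by move=> y yN; have [|h _] := o1 (N.+1 - y)%N; first lia.
- by move=> y yN; rewrite inv //; case: (o1 y yN).
- move=> y yN; have -> : (N.+1 - (N - y) = y.+1)%N by lia.
  exact: o4.
Qed.

End GLChain.

Section UChain.
Variables (d : nat) (P : 'M[k]_d).
Hypothesis dp : dual_pair sg P P.
Variables (l E hh : nat) (al : nat -> nat).
Variables Q Q' : nat -> {vspace 'rV[k]_d}.
Hypotheses (l_gt0 : (0 < l)%N) (E_gt0 : (0 < E)%N).
Hypotheses (al1 : al 1%N = 0%N) (al_inc : forall y, (0 < y < E)%N -> (al y < al y.+1)%N).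
Hypotheses (al_hh : (2 * al E <= hh)%N) (dE : d = (2 * l.-1 + hh + 1)%N).
Let z := (hh - 2 * al E)%N.
Let ds := [seq (l + al y)%N | y <- iota 1 E] ++ [seq (l + (hh - al y))%N | y <- rev (iota 1 E)].
Let Fl := [seq Q y | y <- iota 1 E] ++ [seq Q' y | y <- rev (iota 1 E)].
Hypotheses (dimF : [seq \dim A | A <- Fl] = ds) (sortedF : sorted (fun A B => (A <= B)%VS) Fl).
(** When the middle gap is empty, [Q E] and [Q' E] are the same member and count once. *)
Let R := (2 * E - (z == 0))%N.
Let D y := if (y <= E)%N then (l + al y)%N else (l + (hh - al (R.+1 - y)))%N.
Let G y := if (y <= E)%N then Q y else Q' (R.+1 - y)%N.

Let R_gt0 : (0 < R)%N. Proof. by rewrite /R; case: (z == 0%N); lia. Qed.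
Let RE : (R = 2 * E \/ R = 2 * E - 1)%N /\ (z != 0%N -> R = 2 * E)%N /\ (z = 0 -> R = 2 * E - 1)%N.
Proof. by rewrite /R; case: eqP => // e; split; try (split => //; lia); lia. Qed.

Let al_le y : (0 < y <= E)%N -> (al y <= al E)%N.
Proof. by move=> yN; apply: (incr_le E_gt0 al_inc); lia. Qed.

Let inc j : (0 < j < R)%N -> (D j < D j.+1)%N.
Proof.
move=> jR; have [RR [Rz Rz0]] := RE; rewrite /D.
have [lt|ge] := leqP j.+1 E.
  by rewrite (ltnW lt) ltn_add2l; apply: al_inc; lia.
have [le|lt] := leqP j E; rewrite ltn_add2l.
  have je : j = E by lia.
  have [z0|z0] := eqVneq z 0%N.
    have R1 := Rz0 z0; have e : (R.+1 - j.+1 = E.-1)%N by lia.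
    rewrite e je; have := al_inc (y := E.-1) ltac:(lia); rewrite prednK //.
    by move: z0; rewrite /z; lia.
  have e : (R.+1 - j.+1 = E)%N by have := Rz z0; lia.
  by rewrite e je; have := al_le (y := E) ltac:(lia); move: z0; rewrite /z; lia.
have e : (R.+1 - j = (R.+1 - j.+1).+1)%N by lia.
rewrite e; have := al_inc (y := (R.+1 - j.+1)%N) ltac:(lia).
have := al_le (y := (R.+1 - j.+1).+1) ltac:(lia); lia.
Qed.

Let dimQ y : (0 < y <= E)%N -> \dim (Q y) = (l + al y)%N.
Proof.
move: y; apply: eq_map_iota; move/eqP: dimF; rewrite map_cat eqseq_cat ?size_map //.
by case/andP => /eqP <- _; rewrite -map_comp.
Qed.
Let dimQ' y : (0 < y <= E)%N -> \dim (Q' y) = (l + (hh - al y))%N.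
Proof.
move: y; apply: eq_map_iota; move/eqP: dimF; rewrite map_cat eqseq_cat ?size_map //.
case/andP => _ /eqP; rewrite !map_rev => /(congr1 rev); rewrite !revK => <-.
by rewrite -map_comp.
Qed.

Let QF y : (0 < y <= E)%N -> Q y \in Fl.
Proof. by move=> yE; rewrite mem_cat map_f // mem_iota; lia. Qed.
Let Q'F y : (0 < y <= E)%N -> Q' y \in Fl.
Proof. by move=> yE; rewrite mem_cat orbC map_f // mem_rev mem_iota; lia. Qed.

Let GE y : (0 < y <= R)%N -> G y \in Fl /\ \dim (G y) = D y.
Proof.
move=> yR; have [RR _] := RE; rewrite /G /D; case: leqP => yE.
  by rewrite QF ?dimQ //; lia.
by rewrite Q'F ?dimQ' //; lia.
Qed.

Let midQ : z = 0%N -> Q E = Q' E.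
Proof.
move=> z0; have EE : (0 < E <= E)%N by lia.
have dd : \dim (Q E) = \dim (Q' E) by rewrite dimQ // dimQ' //; move: z0; rewrite /z; lia.
apply/eqP; rewrite eqEsubv; apply/andP.
by split; apply: (chain_dim sortedF); rewrite ?QF ?Q'F // dd.
Qed.

(* [Q' y] is the member in position [R + 1 - y], even when it coincides with [Q y]. *)
Let GQ y : (0 < y <= E)%N -> G y = Q y /\ G (R.+1 - y) = Q' y.
Proof.
move=> yE; have [RR [Rz Rz0]] := RE; have yE' : (y <= E)%N by lia.
rewrite /G yE'; split=> //; case: leqP => c; last by congr Q'; lia.
have z0 : z = 0%N by apply/eqP; apply/negPn/negP => /Rz; lia.
have -> : y = E by have := Rz0 z0; lia.
have -> : (R.+1 - E = E)%N by have := Rz0 z0; lia.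
exact: midQ.
Qed.

Let DR : D R = (l + hh)%N.
Proof.
have [RR [Rz Rz0]] := RE; rewrite /D subSnn al1 subn0; case: leqP => // c.
have z0 : z = 0%N by apply/eqP; apply/negPn/negP => /Rz; lia.
have E1 : E = 1%N by have := Rz0 z0; lia.
have -> : R = 1%N by have := Rz0 z0; lia.
by move: z0; rewrite /z E1 al1; lia.
Qed.

Let fp : flag_pair R D D G G.
Proof.
have sb j : (0 < j < R)%N -> (G j <= G j.+1)%VS.
  move=> jR; have [|m1 d1] := GE (y := j); first by lia.
  have [|m2 d2] := GE (y := j.+1); first by lia.
  by apply: (chain_dim sortedF) => //; rewrite d1 d2 ltnW // inc.
have pos : (0 < D 1)%N by rewrite /D; case: ifP; lia.
have dm j : (0 < j <= R)%N -> \dim (G j) = D j by move/GE => [].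
split=> //; move=> j jR; have [RR [Rz Rz0]] := RE.
have jR' : (0 < R.+1 - j <= R)%N by lia.
rewrite -!dm //; apply: (etrans _ (esym (congr1 S dE))).
have key y : (0 < y <= E)%N -> (\dim (Q y) + \dim (Q' y) = (2 * l.-1 + hh + 1).+1)%N.
  by move=> yE; rewrite dimQ // dimQ' //; have := al_le yE; lia.
have [le|gt] := leqP j E.
  have [|-> ->] := GQ (y := j); first by lia.
  by apply: key; lia.
have jE : (0 < R.+1 - j <= E)%N by lia.
have := GQ jE; have -> : (R.+1 - (R.+1 - j) = j)%N by lia.
by move=> [-> ->]; rewrite addnC; apply: key.
Qed.

Let mds : ds =i [seq D y | y <- iota 1 R].
Proof.
have [RR [Rz Rz0]] := RE.
move=> x; rewrite /ds mem_cat; apply/orP/mapP => [[]/mapP [y]|[y]].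
- rewrite mem_iota => yE ->; exists y; first by rewrite mem_iota; lia.
  by rewrite /D ifT //; lia.
- rewrite mem_rev mem_iota => yE ->; exists (R.+1 - y)%N; first by rewrite mem_iota; lia.
  have [|g1 g2] := GQ (y := y); first by lia.
  have [|_ <-] := GE (y := (R.+1 - y)%N); first by lia.
  by rewrite g2 dimQ' //; lia.
rewrite mem_iota => yR ->; rewrite /D; case: leqP => c.
  by left; apply/mapP; exists y; rewrite ?mem_iota; lia.
by right; apply/mapP; exists (R.+1 - y)%N; rewrite ?mem_rev ?mem_iota //; lia.
Qed.

Let sds : sorted leq ds.
Proof.
rewrite -dimF; apply: (homo_sorted (e := fun A B : {vspace 'rV[k]_d} => (A <= B)%VS)) => //.
by move=> A B; exact: dimvS.
Qed.

(** The flag is its own dual, so conditions in the upper half follow from the lower half by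
    [no_stable_sym]. Only a middle gap, present when [z != 0], needs a condition of its own. *)
Lemma U_chain :
  (exists t, [/\ tuple_ok d ds (r_zero l d ds) t,
     forall i, (1 <= i <= E - 1)%N -> (al i.+1 - al i <= t i + t (r_zero l d ds + 1 - i))%N,
     z != 0%N -> (z <= 2 * t E)%N
   & XU q P (word d ds (r_zero l d ds) t (l + hh)) Fl]) <->
  [/\ forall y, (0 < y <= E)%N -> (perp q P (Q y) <= Q' y)%VS /\ (perp q P (Q' y) <= Q y)%VS,
      full_at q P P (Q' 1%N),
      forall y, (0 < y < E)%N -> no_stable q P P (Q y) (Q' y.+1)
    & z != 0%N -> no_stable q P P (Q E) (Q E)].
Proof.
have [RR [Rz Rz0]] := RE.
have DRd : (D R <= d)%N by rewrite DR dE; lia.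
have L : (1 < l)%N = (D R < d)%N by rewrite DR dE; apply/idP/idP; lia.
rewrite (r_zero_gap R_gt0 inc DRd L sds mds) -DR.
have tup t : (forall j, (0 < j < R)%N -> (D j.+1 - D j <= t j + t (R - j))%N) <->
    (forall i, (1 <= i <= E - 1)%N -> (al i.+1 - al i <= t i + t (R.-1 + 1 - i))%N) /\
    (z != 0%N -> (z <= 2 * t E)%N).
  have sumD j jR := fp_sum fp (j := j) jR.
  apply: (sym_gaps t E_gt0 Rz Rz0 _ _ sumD inc) => [i iE|z0].
    by rewrite /D !ifT ?subnDl //; clear -iE; lia.
  rewrite /D leqnn ltnn; have -> : (R.+1 - E.+1 = E)%N by have Re := Rz z0; clear -Re; lia.
  by clear; rewrite /z; lia.
transitivity (exists t C, DL_cond q P P R D D G G t t C C).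
  split=> [[t [/(tuple_gap R_gt0 inc DRd L sds mds) T0 T1 T2 [C [c r rel]]]]|].
    exists t, C; split=> //; first by apply/tup.
      move/(refinesP _ c) in r.
      have CG j : (0 < j <= R)%N -> C (D j) = G j by move=> /GE [m <-]; exact: r.
      by split.
    by rewrite -(word_gap R_gt0 inc DRd L sds mds).
  move=> [t [C [[T0 _] /tup [T1 T2] [c _] [CG _] [rel _]]]]; exists t; split=> //.
    exact/(tuple_gap R_gt0 inc DRd L sds mds).
  exists C; rewrite (word_gap R_gt0 inc DRd L sds mds); split=> //.
  have ll y : (0 < y <= E)%N -> (0 < y <= R)%N /\ (0 < R.+1 - y <= R)%N by clear -RR; lia.
  apply/refinesP => // A; rewrite /Fl mem_cat => /orP [] /mapP [y yE ->].
    rewrite mem_iota in yE; have yE' : (0 < y <= E)%N by lia.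
    have [m1 m2] := ll _ yE'; have [<- _] := GQ yE'.
    by have [_ ->] := GE m1; rewrite CG.
  rewrite mem_rev mem_iota in yE; have yE' : (0 < y <= E)%N by lia.
  have [m1 m2] := ll _ yE'; have [_ <-] := GQ yE'.
  by have [_ ->] := GE m2; rewrite CG.
rewrite (strata_U closedk sgE q_gt1 dp fp) /open_cond.
have G1 : G R = Q' 1%N by have [|_ <-] := GQ (y := 1%N); [lia | rewrite subSS subn0].
have inv y : (y <= R)%N -> (R.+1 - (R.+1 - y) = y)%N by clear; lia.
have lowR y : (0 < y <= E)%N -> (0 < y <= R)%N /\ (0 < R.+1 - y <= R)%N by clear -RR; lia.
split=> [[o1 _ o3 _ o5]|[o1 o2 o3 o4]]; split=> //; try by rewrite G1.
- move=> y yE; have [g1 g2] := GQ yE; have [l1 l2] := lowR _ yE; split.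
    by have := o1 y l1; rewrite g1 g2.
  by have := o1 _ l2; rewrite g2 inv ?g1 //; case/andP: l1.
- by rewrite -G1.
- move=> y yE; have yR : (0 < y < R)%N by clear -yE RR; lia.
  have y1 : (0 < y <= E)%N by clear -yE; lia.
  have y2 : (0 < y.+1 <= E)%N by clear -yE; lia.
  have [e1 _] := GQ y1; have [_ e2] := GQ y2.
  by have := o5 y yR; rewrite e1 -e2 subSS.
- move=> z0; have Re := Rz z0; have ER : (0 < E < R)%N by clear -Re E_gt0; lia.
  have EE : (0 < E <= E)%N by clear -E_gt0; lia.
  have [e _] := GQ EE; have := o5 E ER; have -> : (R - E = E)%N by clear -Re; lia.
  by rewrite e.
- move=> j jR; have [le|gt] := leqP j E.
    have jE : (0 < j <= E)%N by clear -jR le; lia.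
    by have [-> ->] := GQ jE; case: (o1 j jE).
  have jE : (0 < R.+1 - j <= E)%N by clear -gt RR jR; lia.
  by have := GQ jE; rewrite inv; [move=> [-> ->]; case: (o1 _ jE) | case/andP: jR].
- move=> j jR; have [le|gt] := leqP j E.
    have jE : (0 < j <= E)%N by clear -jR le; lia.
    by have [-> ->] := GQ jE; case: (o1 j jE).
  have jE : (0 < R.+1 - j <= E)%N by clear -gt RR jR; lia.
  by have := GQ jE; rewrite inv; [move=> [-> ->]; case: (o1 _ jE) | case/andP: jR].
move=> j jR; have low i : (0 < i < E)%N -> no_stable q P P (G i) (G (R - i)).
  move=> iE; have y1 : (0 < i <= E)%N by clear -iE; lia.
  have y2 : (0 < i.+1 <= E)%N by clear -iE; lia.
  have [e1 _] := GQ y1; have [_ e2] := GQ y2.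
  by have := o3 i iE; rewrite e1 -e2 subSS.
have [lt|ge] := ltnP j E; first by apply: low; clear -lt jR; lia.
have [e|ne] := eqVneq j (R - j)%N.
  have z0 : z != 0%N by apply/eqP => /Rz0 Re; clear -Re e E_gt0 jR; lia.
  have je : j = E by have Re := Rz z0; clear -e Re; lia.
  have EE : (0 < E <= E)%N by clear -E_gt0; lia.
  by rewrite -!e je; have [-> _] := GQ EE; exact: o4.
apply: (no_stable_sym sgE dp); have Rj : (0 < R - j < E)%N by clear -jR ge ne RR; lia.
have := low _ Rj; have -> // : (R - (R - j) = j)%N by clear -jR; lia.
Qed.

End UChain.
End Chains.

(** * Conditions on stable subspaces as conditions on lattices of [C] *)

Section LatticeConditions.
Variables (Fq : finFieldType) (OF : cdvf Fq) (Fq2 : finFieldType)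
  (i1 : {rmorphism Fq -> Fq2}) (k : fieldType) (i2 : {rmorphism Fq -> k})
  (j12 : {rmorphism Fq2 -> k}) (W2 : relwitt OF i1) (Wk : relwitt OF i2)
  (u : wittmap j12 W2 Wk).
Hypothesis cardFq2 : #|Fq2| = (#|Fq| ^ 2)%N.
Variables (n : nat) (H : 'M[fld W2]_n).
Hypotheses (Hu : H \in unitmx) (Hh : forall i j, frob W2 (H i j) = H j i).
Local Notation q := #|Fq|.
Local Notation C := 'rV[fld W2]_n.
Local Notation Ck := 'rV[fld Wk]_n.
Local Notation wm := (map_mx (wmap u)).
Local Notation Hk := (wm H).
Local Notation hC := (herm (frob W2) H).
Local Notation hk := (herm (frob Wk) Hk).
Local Notation dC := (dualC H).
Local Notation dK := (dualCk u H).
Local Notation ext := (extend u).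
Local Notation pi2 := (Defs.pi W2).
Local Notation pik := (Defs.pi Wk).
Variable a : fld W2.
Hypotheses (a0 : a != 0) (fa : frob W2 a = a).
Local Notation ak := (wmap u a).

Section Pair.
Variables (T1 B1 T2 B2 : set C) (d1 d2 : nat).
Variables (b1 : 'M[fld W2]_(d1, n)) (b2 : 'M[fld W2]_(d2, n)).
Hypothesis pd : pair_datum H a T1 B1 T2 B2 b1 b2.
Let pd' := pair_datum_sym pd.
Variable sg : {rmorphism k -> k}.
Hypothesis sgE : forall x, sg x = x ^+ q.
Local Notation emk := (map_mx (emb Wk)).
Local Notation rsk := (map_mx (res Wk)).
Local Notation P1 := (gramG j12 H a b1 b2).
Local Notation P2 := (gramG j12 H a b2 b1).
Local Notation red1 := (redv (wm b1)).
Local Notation red2 := (redv (wm b2)).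
Let klb1 := ext_lb1 u cardFq2 Hu Hh a0 fa pd sgE.
Let dp := gram_dual u cardFq2 Hu Hh a0 fa pd sgE.
Let eBT1 : ext B1 `<=` ext T1. Proof. exact/ext_mono/(pd_BT1 pd). Qed.
Let eBT2 : ext B2 `<=` ext T2. Proof. exact/ext_mono/(pd_BT2 pd). Qed.
Let sB1 : submod (ext B1). Proof. exact: ext_submod. Qed.
Let sT1 : submod (ext T1). Proof. exact: ext_submod. Qed.

(** The basis vectors come from [C], where Frobenius squared is the identity, so on coordinates it
    acts by Frobenius alone; and [ext L] is preserved by it. *)
Lemma red_stable L : is_lattice L -> ext B1 `<=` ext L -> ext L `<=` ext T1 ->
  stable q P1 P2 (red1 (ext L)).
Proof.
move=> lL BL LT; have sL := ext_submod u L; apply/(stableP sgE dp) => _ /(mem_redv _ _ sL) [c [<- Lc]].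
have := ext_frob cardFq2 Lc; rewrite !map_mxM !map_frob_wm (map_frob2 cardFq2).
have -> : map_mx (frob Wk) (map_mx (frob Wk) (emk c)) = emk (map_mx (frobO Wk) (map_mx (frobO Wk) c)).
  by apply/matrixP => i j; rewrite !mxE !frob_emb.
have -> : frob2 sg (rsk c) = rsk (map_mx (frobO Wk) (map_mx (frobO Wk) c)).
  by apply/matrixP => i j; rewrite !mxE !frobO_res !sgE.
by move=> Lc'; apply/(mem_redv _ _ sL); eexists; split; last exact: Lc'.
Qed.

(** Stable subspaces are exactly the reductions of lattices of [C]: [red_stable] gives one direction
    and [descent] the other. *)
Lemma full_latt M : submod M -> ext B1 `<=` M -> M `<=` ext T1 ->
  full_at q P1 P2 (red1 M) <->
  forall L, is_lattice L -> M `<=` ext L -> L `<=` T1 -> T1 `<=` L.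
Proof.
move=> sM BM MT; split=> [full L lL ML LT|full T stT MleT].
  have sL := ext_submod u L; have BL := subset_trans BM ML.
  have eLT : ext L `<=` ext T1 by exact: ext_mono.
  have LE := lift_redv sT1 sB1 eBT1 klb1 sL BL eLT.
  apply: (ext_reflect_sub (u := u)) => //.
  rewrite -LE (full _ (red_stable lL BL eLT)) ?(liftT sT1 eBT1 klb1) //.
  exact: redvS.
have [L [lL BL LT LE]] := descent u cardFq2 Hu Hh a0 fa pd sgE stT.
have TL : T1 `<=` L.
  apply: full => //; rewrite LE -(lift_redv sT1 sB1 eBT1 klb1 sM BM MT).
  exact: liftS.
rewrite -(redv_lift sB1 klb1 T) -LE -(redv_lift sB1 klb1 fullv) (liftT sT1 eBT1 klb1).
by congr (redv _ (ext _)); apply/seteqP.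
Qed.

Lemma no_stable_latt M1 M2 : submod M1 -> ext B1 `<=` M1 -> M1 `<=` ext T1 ->
  submod M2 -> ext B2 `<=` M2 -> M2 `<=` ext T2 ->
  no_stable q P1 P2 (red1 M1) (red2 M2) <->
  forall L, is_lattice L -> M1 `<=` ext L -> ~ (forall v w, ext L v -> M2 w -> piO (ak * hk v w)).
Proof.
move=> sM1 BM1 MT1 sM2 BM2 MT2; split=> [ns L lL ML LM|ns T stT MT TM].
  have sL := ext_submod u L.
  have eLT : ext L `<=` ext T1.
    by move=> v Lv; apply/(ext_T1E u cardFq2 Hu Hh a0 fa pd) => w /BM2; exact: LM.
  apply: (ns _ (red_stable lL (subset_trans BM1 ML) eLT)); first exact: redvS.
  by apply: (red_perp cardFq2 Hu Hh a0 fa pd sgE) => // v w Lv _ Mw _; exact: LM.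
have [L [lL BL LT LE]] := descent u cardFq2 Hu Hh a0 fa pd sgE stT.
apply: (ns L lL) => [|v w Lv Mw].
  by rewrite LE -(lift_redv sT1 sB1 eBT1 klb1 sM1 BM1 MT1); exact: liftS.
have sL := ext_submod u L.
apply: (perp_red cardFq2 Hu Hh a0 fa pd sgE sL sM2 _ _ MT2 BM2 _ Lv Mw); try exact: ext_mono.
by rewrite LE (redv_lift sB1 klb1).
Qed.

End Pair.

Section SelfPair.
Variables (T1 B1 : set C) (d1 : nat) (b1 : 'M[fld W2]_(d1, n)).
Hypothesis pd : pair_datum H a T1 B1 T1 B1 b1 b1.
Variable sg : {rmorphism k -> k}.
Hypothesis sgE : forall x, sg x = x ^+ q.
Local Notation P := (gramG j12 H a b1 b1).
Local Notation red1 := (redv (wm b1)).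
Let klb1 := ext_lb1 u cardFq2 Hu Hh a0 fa pd sgE.
Let dp := gram_dual u cardFq2 Hu Hh a0 fa pd sgE.
Let eBT1 : ext B1 `<=` ext T1. Proof. exact/ext_mono/(pd_BT1 pd). Qed.
Let sB1 : submod (ext B1). Proof. exact: ext_submod. Qed.
Let sT1 : submod (ext T1). Proof. exact: ext_submod. Qed.

(* If [M <= T <= M^perp] with [T] stable, then [T :&: T^perp] is moreover isotropic. *)
Lemma no_stable_self_latt M : submod M -> ext B1 `<=` M -> M `<=` ext T1 ->
  no_stable q P P (red1 M) (red1 M) <->
  forall L, is_lattice L -> M `<=` ext L -> ~ (forall v w, ext L v -> ext L w -> piO (ak * hk v w)).
Proof.
move=> sM BM MT; split=> [|ns T stT MleT TM].
  move=> /(no_stable_latt pd sgE sM BM MT sM BM MT) ns L lL ML LL.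
  by apply: (ns L lL ML) => v w Lv /ML; exact: LL.
pose T' := (T :&: perp q P T)%VS.
have stp : stable q P P (perp q P T) by rewrite /stable stT.
have stT' : stable q P P T'.
  apply/(stableP sgE dp) => v; rewrite !memv_cap => /andP [vT vp].
  by rewrite ((stableP sgE dp T).2 stT) // ((stableP sgE dp _).2 stp).
have MT' : (red1 M <= T')%VS.
  by rewrite subv_cap MleT; apply: (p1_reflect sgE dp); rewrite stT.
have TT' : (T' <= perp q P T')%VS.
  by apply: subv_trans (capvSr _ _) _; apply: (perpS sgE); exact: capvSl.
have [L [lL BL LT LE]] := descent u cardFq2 Hu Hh a0 fa pd sgE stT'.
apply: (ns L lL) => [|v w Lv Lw].
  by rewrite LE -(lift_redv sT1 sB1 eBT1 klb1 sM BM MT); exact: liftS.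
have sL := ext_submod u L.
apply: (perp_red cardFq2 Hu Hh a0 fa pd sgE sL sL _ _ _ _ _ Lv Lw); try exact: ext_mono.
by rewrite LE (redv_lift sB1 klb1).
Qed.

End SelfPair.
End LatticeConditions.

(** * Lattice chains and Bruhat-Tits indices *)

Section ChainPoints.
Variables (Fq : finFieldType) (OF : cdvf Fq) (Fq2 : finFieldType)
  (i1 : {rmorphism Fq -> Fq2}) (k : fieldType) (i2 : {rmorphism Fq -> k})
  (j12 : {rmorphism Fq2 -> k}) (W2 : relwitt OF i1) (Wk : relwitt OF i2)
  (u : wittmap j12 W2 Wk).
Hypothesis cardFq2 : #|Fq2| = (#|Fq| ^ 2)%N.
Variables (n : nat) (H : 'M[fld W2]_n).
Hypotheses (Hu : H \in unitmx) (Hh : forall i j, frob W2 (H i j) = H j i).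
Local Notation q := #|Fq|.
Local Notation C := 'rV[fld W2]_n.
Local Notation Ck := 'rV[fld Wk]_n.
Local Notation wm := (map_mx (wmap u)).
Local Notation Hk := (wm H).
Local Notation hC := (herm (frob W2) H).
Local Notation hk := (herm (frob Wk) Hk).
Local Notation dC := (dualC H).
Local Notation dK := (dualCk u H).
Local Notation ext := (extend u).
Local Notation pi2 := (Defs.pi W2).
Local Notation pik := (Defs.pi Wk).
Variables (m : nat) (h : nat -> nat).
Hypothesis h_le : forall i, (1 <= i <= m)%N -> (h i <= n)%N.
Local Notation btd := (btdata m (set C)).

Lemma submod_dK A : submod (dK A).
Proof.
apply: submod_left; first by exists 0; rewrite rmorph0.
- exact: integralD.
- exact: integralM.
Qed.

Lemma dK_gen (L : set C) w : (forall v, L v -> integral (hk w (wm v))) -> dK (ext L) w.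
Proof.
move=> I v; suff : ext L `<=` [set v | integral (hk w v)] by apply.
apply: ext_min => //; split=> [|c x y Ix Iy] /=; first by rewrite herm0r; exists 0; rewrite rmorph0.
rewrite (hermDr (frob Wk)) (hermZr (frob Wk)) frob_emb; apply: integralD => //.
by apply: integralM => //; exact: integral_emb.
Qed.

Lemma scale_dKE (e : int) L : is_lattice L ->
  ext (scale (pi2 ^ e) (dC L)) = scale (pik ^ e) (dK (ext L)).
Proof. by move=> lL; rewrite ext_scale fmorphXz wmap_pi (dK_ext u cardFq2 Hu Hh lL). Qed.

Lemma scaleS (F : fieldType) (K : cdvf F) d (r : fld K) (A B : set 'rV[fld K]_d) :
  A `<=` B -> scale r A `<=` scale r B.
Proof. by move=> AB _ [v Av <-]; exists v => //; exact: AB. Qed.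

Lemma scale1E (F : fieldType) (K : cdvf F) d (A : set 'rV[fld K]_d) : scale 1 A = A.
Proof.
by apply/seteqP; split=> [_ [v Av <-]|v Av]; [rewrite scale1r | exists v; rewrite ?scale1r].
Qed.

Lemma scaleA (F : fieldType) (K : cdvf F) d (r t : fld K) (A : set 'rV[fld K]_d) :
  scale r (scale t A) = scale (r * t) A.
Proof.
apply/seteqP; split=> [_ [_ [v Av <-] <-]|_ [v Av <-]]; first by exists v; rewrite ?scalerA.
by exists (t *: v); [exists v | rewrite scalerA].
Qed.

Lemma dC_scale_dC L : L `<=` scale pi2 (dC (scale pi2 (dC L))).
Proof.
move=> v Lv; apply/(scale_dC _ _ _ (pi_neq0 _)) => _ [w dw <-].
rewrite (hermZr (frob W2)) /Defs.pi frob_emb frobO_unif mulKf ?pi_neq0 //.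
by rewrite -(frobk_integral (Wk := W2)) (hC_conj cardFq2 Hh); exact: dw.
Qed.

(** [Y] is not known to be a lattice in advance, but as a submodule with simple quotient it contains
    [pi A], and [lattice_between] applies. *)
Lemma colen1_vol (F : fieldType) (K : cdvf F) d (Y A : set 'rV[fld K]_d) z :
  vol A z -> submod Y -> colen 1 Y A -> vol Y (z + 1).
Proof.
move=> vA sY cYA; have [sA YA] := colen_sub sY cYA.
have piA : scale (Defs.pi K) A `<=` Y.
  case: cYA => _ <- [x [_ _ Lx AE]] _ [v + <-]; rewrite AE => -[w [c [Yw ->]]].
  rewrite scalerDr; apply: submodD => //; first exact: submodZ.
  by rewrite scalerA mulrC -scalerA; exact: submodZ.
have [lY _] := lattice_between (vol_lattice vA) sY piA YA.
have [z' vY] := lattice_vol lY; have vA' := vol_colen vY cYA.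
by have := vol_uniq vA vA' => ->; rewrite subrK.
Qed.

Section Point.
Variable c : chain Wk n.
Hypothesis cN : Npoint u m h H c.
Local Notation A_ := (chA c).
Local Notation B_ := (chB c).

Lemma np_lattice i : (1 <= i <= m)%N -> is_lattice (A_ i) /\ is_lattice (B_ i).
Proof. by case: cN => _ H' _ _; exact: H'. Qed.

Lemma np_mono i j : (1 <= i)%N -> (i <= j <= m)%N -> A_ j `<=` A_ i /\ B_ i `<=` B_ j.
Proof.
move=> i_gt0; elim: j => [|j IH] ij; first by lia.
have [e|ne] := eqVneq i j.+1; first by rewrite -e; split=> ?.
have [|IH1 IH2] := IH; first by clear -ij ne; lia.
case: cN => _ _ H' _.
have [|h1 h2] := H' j; first by clear -ij ne i_gt0; lia.
by split; [exact: subset_trans h1 IH1 | exact: subset_trans IH2 h2].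
Qed.

Lemma np_dual i : (1 <= i <= m)%N ->
  [/\ scale pik (dK (A_ i)) `<=` B_ i, scale pik (dK (B_ i)) `<=` A_ i,
      A_ i `<=` B_ i & scale pik (B_ i) `<=` A_ i].
Proof.
move=> iM; case: cN => _ _ _ /(_ i iM) [cA _ cB _ [pB cAB]].
have [lA lB] := np_lattice iM; have sA := submod_lattice lA.
split=> //; first by have [] := colen_sub (submod_scale _ (submod_dK _)) cA.
  by have [] := colen_sub (submod_scale _ (submod_dK _)) cB.
by have [] := colen_sub sA cAB.
Qed.

Lemma np_vol i : (1 <= i <= m)%N -> exists z : int,
  [/\ vol (B_ i) z, vol (A_ i) (z + (h i)%:Z),
      vol (scale pik (dK (B_ i))) (z + (h i)%:Z + 1) & vol (scale pik (dK (A_ i))) (z + 1)].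
Proof.
move=> iM; case: cN => _ _ _ /(_ i iM) [cA _ cB _ [pB cAB]].
have [/lattice_vol [z' vA] /lattice_vol [z vB]] := np_lattice iM; exists z.
have e : z' = z + (h i)%:Z by have := vol_uniq vB (vol_colen vA cAB); lia.
rewrite e in vA; have sd A := submod_scale pik (submod_dK A).
by split=> //; [exact: colen1_vol vA (sd _) cB | exact: colen1_vol vB (sd _) cA].
Qed.

(** In the chain of lattices pi L^vee, pi B_i^vee, A_i, B_i, L the second inclusion has colength 1
    and the third colength h_i; this bounds the type from below. *)
Lemma vertex0_of i L : (1 <= i <= m)%N -> is_lattice L -> B_ i `<=` ext L -> L `<=` dC L ->
  vertex H 0 L /\ (h i + 1 <= vtype H 0 L)%N.
Proof.
move=> iM lL BL LL; have [dA dB AB _] := np_dual iM.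
have dE : ext (scale (pi2 ^+ 1) (dC L)) = scale pik (dK (ext L)).
  by have := scale_dKE 1 lL; rewrite !expr1z expr1.
have sub1 : scale pik (dK (ext L)) `<=` scale pik (dK (B_ i)) by exact/scaleS/dK_anti.
have dL : scale (pi2 ^+ 1) (dC L) `<=` L.
  apply: (ext_reflect_sub (u := u)) => //; rewrite dE.
  exact: subset_trans sub1 (subset_trans dB (subset_trans AB BL)).
split; first by split=> //; rewrite expr0 scale1E.
have [z vL] := lattice_vol lL; have ldC := lattice_dC u cardFq2 Hu Hh lL.
have [z' vD] := lattice_vol (lattice_scale 1 ldC); rewrite expr1z -(expr1 pi2) in vD.
have := ext_vol u vD; rewrite dE => vD'; have vL' := ext_vol u vL.
have [zB [vB vA vdB _]] := np_vol iM.
have [e1 _] := vol_mono vD' vdB sub1; have [e2 _] := vol_mono vB vL' BL.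
have pL : scale pi2 L `<=` scale (pi2 ^+ 1) (dC L) by rewrite expr1; exact: scaleS.
have cD := colen_between (h := `|z' - z|%N) vD vL pL dL ltac:(lia).
by rewrite /vtype; have [-> _] := len_vol vD vL cD; lia.
Qed.

(** Here the chain is pi^2 L^vee, pi^2 A_i^vee, pi B_i, A_i, L, with colengths 1 and n - h_i in the
    second and third inclusions. *)
Lemma vertex1_of i L : (1 <= i <= m)%N -> is_lattice L -> A_ i `<=` ext L ->
  L `<=` scale pi2 (dC L) -> vertex H 1 L /\ (n - h i + 1 <= vtype H 1 L)%N.
Proof.
move=> iM lL AL LL; have [dA dB AB pB] := np_dual iM.
have dE : ext (scale (pi2 ^+ 2) (dC L)) = scale (pik ^+ 2) (dK (ext L)).
  by have := scale_dKE 2 lL.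
have sub1 : scale (pik ^+ 2) (dK (ext L)) `<=` scale pik (scale pik (dK (A_ i))).
  by rewrite scaleA; exact/scaleS/dK_anti.
have dL : scale (pi2 ^+ 2) (dC L) `<=` L.
  apply: (ext_reflect_sub (u := u)) => //; rewrite dE.
  exact: (subset_trans sub1 (subset_trans (scaleS dA) (subset_trans pB AL))).
split; first by split=> //; rewrite expr1.
have [z vL] := lattice_vol lL; have ldC := lattice_dC u cardFq2 Hu Hh lL.
have [z' vD] := lattice_vol (lattice_scale 2 ldC); rewrite -exprnP in vD.
have := ext_vol u vD; rewrite dE => vD'; have vL' := ext_vol u vL.
have [zB [vB vA _ vdA]] := np_vol iM; have := vol_scale 1 vdA; rewrite expr1z => vdA'.
have [e1 _] := vol_mono vD' vdA' sub1; have [e2 _] := vol_mono vA vL' AL.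
have pL : scale pi2 L `<=` scale (pi2 ^+ 2) (dC L).
  by rewrite expr2 -scaleA; exact: scaleS.
have hn := h_le iM.
have cD := colen_between (h := `|z' - z|%N) vD vL pL dL ltac:(lia).
by rewrite /vtype; have [-> _] := len_vol vD vL cD; have := h_le iM; lia.
Qed.

End Point.
End ChainPoints.

Section Elts.
Variables (m : nat) (T : Type).
Implicit Types (X : btdata m T).

Lemma eltsP X (i : nat) : reflect (exists2 o : 'I_m.+1, o \in btI X & i = o) (i \in elts X).
Proof.
by apply: (iffP mapP) => -[o oX e]; exists o => //; [rewrite mem_enum in oX|rewrite mem_enum].
Qed.

Lemma elts_le X (i : nat) : i \in elts X -> (i <= m)%N.
Proof. by move=> /eltsP [o _ ->]; rewrite -ltnS. Qed.

Lemma elts_inord X (i : nat) : (i <= m)%N -> (i \in elts X) = (inord i \in btI X).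
Proof.
move=> im; apply/eltsP/idP => [[o oX ->]|oX]; first by rewrite inord_val.
by exists (inord i); rewrite // inordK.
Qed.

Lemma size_elts X : size (elts X) = #|btI X|.
Proof. by rewrite size_map -cardE. Qed.

Lemma elts_sorted X : sorted ltn (elts X).
Proof.
rewrite /elts sorted_map /enum_mem -enumT; apply: sorted_filter.
  by move=> y x z; exact: ltn_trans.
by rewrite -sorted_map val_enum_ord; exact: iota_ltn_sorted.
Qed.

Lemma elt_mem X j : (1 <= j <= #|btI X|)%N -> elt X j \in elts X.
Proof. by move=> jX; rewrite mem_nth // size_elts; lia. Qed.

Lemma elt_lt X j : (1 <= j < #|btI X|)%N -> (elt X j < elt X j.+1)%N.
Proof.
move=> jX; have /(sortedP 0%N) := elts_sorted X; have := @prednK j ltac:(lia).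
rewrite /elt size_elts => e H; rewrite -[j.+1.-1]e; apply: H; lia.
Qed.

Lemma elts_sub X X' : btI X \subset btI X' <-> {subset elts X <= elts X'}.
Proof.
split=> [/fintype.subsetP s i /eltsP [o /s oX ->]|s]; first by apply/eltsP; exists o.
apply/fintype.subsetP => o oX; have /s : (o : nat) \in elts X by apply/eltsP; exists o.
by move=> /eltsP [o' o'X /val_inj ->].
Qed.

Lemma elts_add (X : btdata m T) i (L0 L1 : nat -> T) x : (i <= m)%N ->
  (x \in elts (BTData (inord i |: btI X) L0 L1)) = (x == i) || (x \in elts X).
Proof.
move=> im; have [xm|xm] := leqP x m; last first.
  have nx Y : x \in elts (Y : btdata m T) = false.
    by apply/negbTE/negP => /elts_le; rewrite leqNgt xm.
  by rewrite !nx orbF; apply/esym/negbTE/eqP => e; move: xm; rewrite e ltnNge im.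
rewrite !elts_inord // in_setU1; congr (_ || _); apply/eqP/eqP => [/(congr1 val)|-> //].
by rewrite /= !inordK.
Qed.

End Elts.

(** * Open points and smaller Bruhat-Tits indices *)

Section OpenPoints.
Variables (Fq : finFieldType) (OF : cdvf Fq) (Fq2 : finFieldType)
  (i1 : {rmorphism Fq -> Fq2}) (k : fieldType) (i2 : {rmorphism Fq -> k})
  (j12 : {rmorphism Fq2 -> k}) (W2 : relwitt OF i1) (Wk : relwitt OF i2)
  (u : wittmap j12 W2 Wk).
Hypothesis cardFq2 : #|Fq2| = (#|Fq| ^ 2)%N.
Variables (n : nat) (H : 'M[fld W2]_n).
Hypotheses (Hu : H \in unitmx) (Hh : forall i j, frob W2 (H i j) = H j i).
Local Notation q := #|Fq|.
Local Notation C := 'rV[fld W2]_n.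
Local Notation Ck := 'rV[fld Wk]_n.
Local Notation wm := (map_mx (wmap u)).
Local Notation Hk := (wm H).
Local Notation hC := (herm (frob W2) H).
Local Notation hk := (herm (frob Wk) Hk).
Local Notation dC := (dualC H).
Local Notation dK := (dualCk u H).
Local Notation ext := (extend u).
Local Notation pi2 := (Defs.pi W2).
Local Notation pik := (Defs.pi Wk).
Variables (m : nat) (h : nat -> nat).
Hypothesis m_gt0 : (0 < m)%N.
Hypothesis h_le : forall i, (1 <= i <= m)%N -> (h i <= n)%N.
Local Notation btd := (btdata m (set C)).

(** For a lattice [L] this says that [M] lies in the extension of pi L^vee. With [M] equal to
    A_(i+1), the lattices [L] and pi L^vee can then be inserted at the index [i]. *)
Definition isotropic_pair (L : set C) (M : set Ck) := forall v w, ext L v -> M w -> piO (hk v w).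

(* A point of [N_I,Lam] lies in the open stratum iff no index can be refined or added. *)
Record open_point (X : btd) (c : chain Wk n) : Prop := OpenPoint {
  op_full0 : forall i, i \in elts X -> i != 0%N ->
    forall L, is_lattice L -> chB c i `<=` ext L -> L `<=` btLam0 X i -> btLam0 X i `<=` L;
  op_full1 : forall j, j \in elts X -> j != m ->
    forall L, is_lattice L -> chA c j.+1 `<=` ext L -> L `<=` btLam1 X j -> btLam1 X j `<=` L;
  op_mid : forall i, i \notin elts X -> (0 < i < m)%N ->
    forall L, is_lattice L -> chB c i `<=` ext L -> ~ isotropic_pair L (chA c i.+1);
  op_0 : 0%N \notin elts X -> h 1%N != 0%N ->
    forall L, is_lattice L -> chA c 1%N `<=` ext L -> ~ L `<=` scale pi2 (dC L);
  op_m : m \notin elts X -> h m != n ->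
    forall L, is_lattice L -> chB c m `<=` ext L -> ~ L `<=` dC L
}.

(** A smaller index whose closed set still contains the point can have neither further elements nor
    smaller lattices, so it is not strictly smaller. *)
Lemma open_N0 (X : btd) c : N_pts u h H X c -> open_point X c -> N0_pts u h H X c.
Proof.
move=> cX op; split=> // X' bt' [[II l0 l1] nle] [cN c0 c1]; apply: nle.
have [[_ b0 bm] v0 v1 ch _] := bt'; have /elts_sub sub := II.
have vl e L : vertex H e L -> is_lattice L by case.
have sub' : {subset elts X' <= elts X}.
  move=> i iX'; apply/negPn/negP => iX; have im := elts_le iX'.
  have [i0|i0] := eqVneq i 0%N.
    subst i; have h10 : h 1%N != 0%N by apply/eqP => /b0; rewrite iX'.
    have m0 : 0%N != m by rewrite eq_sym -lt0n.
    have [vi _] := v1 _ iX' m0; apply: (op_0 op iX h10 (vl _ _ vi)); first exact: c1.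
    by case: vi => _ _; rewrite expr1.
  have [e|nm] := eqVneq i m.
    subst i; have hmn : h m != n by apply/eqP => /bm; rewrite iX'.
    have [vi _] := v0 _ iX' i0; apply: (op_m op iX hmn (vl _ _ vi)); first exact: c0.
    by case: vi => _ _; rewrite expr0 scale1E.
  have iM : (0 < i < m)%N by rewrite lt0n i0 ltn_neqAle nm.
  have [vi _] := v0 _ iX' i0; have [vi1 _] := v1 _ iX' nm.
  apply: (op_mid op iX iM (vl _ _ vi)) => [|v w Lv Aw]; first exact: c0.
  have := ext_mono (u := u) (ch _ iX' i0 nm) Lv; have := scale_dKE u cardFq2 Hu Hh 1 (vl _ _ vi1).
  rewrite !expr1z => ->; rewrite scale_dK ?pi_neq0 // => hv; apply/piO_integral/hv; exact: c1.
split; first exact/elts_sub.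
- move=> i iX' i0; have iX := sub' _ iX'; have [vi _] := v0 i iX' i0.
  by apply: (op_full0 op) => //; [exact: vl vi | exact: c0 | exact: l0].
- move=> j jX' jm; have jX := sub' _ jX'; have [vj _] := v1 j jX' jm.
  by apply: (op_full1 op) => //; [exact: vl vj | exact: c1 | exact: l1].
Qed.

(** Lattices that contain the members of a point satisfy the type bounds by [vertex0_of] and
    [vertex1_of]. For consecutive elements x < y of the index, pi Lam1^vee lies in pi A_(x+1)^vee,
    hence in B_(x+1), in B_y and in Lam0. Only integrality and the inclusions at a single element
    are left to check. *)
Lemma bt_through (Y : btd) c : Npoint u m h H c -> btI Y != finset.set0 ->
  (h 1%N = 0%N -> 0%N \notin elts Y) -> (h m = n -> m \notin elts Y) ->
  (forall i, i \in elts Y -> i != 0%N ->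
    [/\ is_lattice (btLam0 Y i), chB c i `<=` ext (btLam0 Y i) & btLam0 Y i `<=` dC (btLam0 Y i)]) ->
  (forall j, j \in elts Y -> j != m -> [/\ is_lattice (btLam1 Y j),
     chA c j.+1 `<=` ext (btLam1 Y j) & btLam1 Y j `<=` scale pi2 (dC (btLam1 Y j))]) ->
  (forall i, i \in elts Y -> i != 0%N -> i != m -> btLam0 Y i `<=` scale pi2 (dC (btLam1 Y i))) ->
  is_bt h H Y /\ N_pts u h H Y c.
Proof.
move=> cN I0 b0 bm v0 v1 ch; split; last first.
  by split=> // [i iY i0|j jY jm]; [case: (v0 i iY i0) | case: (v1 j jY jm)].
split=> //.
- move=> i iY i0; have [lL BL LL] := v0 i iY i0; have im := elts_le iY.
  apply: (vertex0_of (u := u) cardFq2 Hu Hh cN _ lL BL LL); by rewrite lt0n i0.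
- move=> j jY jm; have [lL AL LL] := v1 j jY jm; have im := elts_le jY.
  apply: (vertex1_of (u := u) cardFq2 Hu Hh h_le cN _ lL AL LL).
  by have jlt : (j < m)%N by rewrite ltn_neqAle jm.
move=> j jY; have aY := elt_mem (X := Y) (j := j) ltac:(lia).
have bY := elt_mem (X := Y) (j := j.+1) ltac:(lia); have lt := elt_lt jY.
move: aY bY lt; move: (elt Y j) (elt Y j.+1) => x y xY yY xy.
have ym := elts_le yY; have xm : x != m by rewrite neq_ltn (leq_trans xy ym).
have y0 : y != 0%N by rewrite -lt0n (leq_trans _ xy).
have [lL0 BL _] := v0 y yY y0; have [lL1 AL _] := v1 x xY xm.
apply: (ext_reflect_sub (u := u)) => //.
have := scale_dKE u cardFq2 Hu Hh 1 lL1; rewrite !expr1z => ->.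
have xM : (1 <= x.+1 <= m)%N by rewrite (leq_trans xy ym).
have [dA _ _ _] := np_dual cN xM.
have [_ Bxy] := np_mono cardFq2 Hu cN (i := x.+1) (j := y) isT ltac:(by rewrite xy ym).
apply: subset_trans BL; apply: subset_trans Bxy; apply: subset_trans dA.
exact/scaleS/dK_anti.
Qed.

Definition upd T (f : nat -> T) i x := fun j => if j == i then x else f j.

Lemma N0_open (X : btd) c : is_bt h H X -> N0_pts u h H X c -> open_point X c.
Proof.
move=> [[I0 b0 bm] v0 v1 ch _] [[cN c0 c1] N0].
have w0 i : i \in elts X -> i != 0%N ->
    [/\ is_lattice (btLam0 X i), chB c i `<=` ext (btLam0 X i) & btLam0 X i `<=` dC (btLam0 X i)].
  move=> iX i0; have [[lL _ LL] _] := v0 i iX i0; rewrite expr0 scale1E in LL.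
  by split=> //; exact: c0.
have w1 j : j \in elts X -> j != m -> [/\ is_lattice (btLam1 X j),
    chA c j.+1 `<=` ext (btLam1 X j) & btLam1 X j `<=` scale pi2 (dC (btLam1 X j))].
  move=> jX jm; have [[lL _ LL] _] := v1 j jX jm; rewrite expr1 in LL.
  by split=> //; exact: c1.
have I1 i : (inord i |: btI X) != finset.set0 by apply/set0Pn; exists (inord i); rewrite setU11.
have grow i L0 L1 : (i <= m)%N -> i \notin elts X ->
    (forall x, x \in elts X -> L0 x = btLam0 X x /\ L1 x = btLam1 X x) ->
    bt_lt (BTData (inord i |: btI X) L0 L1) X.
  move=> im iX LE; split.
    split=> /= [|x /LE [-> _] _|x /LE [_ ->] _]; [exact: finset.subsetUr|by []|by []].
  move=> [/fintype.subsetP s _ _]; move: iX; rewrite elts_inord // s ?setU11 //.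
have nin i x : i \notin elts X -> x \in elts X -> (x == i) = false.
  by move=> iX xX; apply: contraNF iX => /eqP <-.
split.
- move=> i iX i0 L lL BL LX; apply: contrapT => nLX.
  pose Y := BTData (btI X) (upd (btLam0 X) i L) (btLam1 X).
  have [] := @bt_through Y c cN I0 b0 bm.
  + move=> x xX x0; rewrite /= /upd; case: eqVneq => [e|_]; last exact: w0.
    have [_ _ LL] := w0 i iX i0; rewrite e; split=> //.
    exact: (subset_trans LX (subset_trans LL (dC_anti LX))).
  + exact: w1.
  + move=> x xX x0 xm; rewrite /= /upd; case: eqVneq => [e|_]; last exact: ch.
    by subst x; exact: subset_trans LX (ch i iX i0 xm).
  move=> bY; apply: N0 => //; split.
    split=> [|x xX x0|x xX xm //]; first exact: subxx.
    by rewrite /= /upd; case: eqVneq => [->|_].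
  by move=> [_ /(_ i iX i0)]; rewrite /= /upd eqxx.
- move=> i iX im L lL AL LX; apply: contrapT => nLX.
  pose Y := BTData (btI X) (btLam0 X) (upd (btLam1 X) i L).
  have dd : scale pi2 (dC (btLam1 X i)) `<=` scale pi2 (dC L) by exact/scaleS/dC_anti.
  have [] := @bt_through Y c cN I0 b0 bm.
  + exact: w0.
  + move=> x xX xm; rewrite /= /upd; case: eqVneq => [e|_]; last exact: w1.
    have [_ _ LL] := w1 i iX im; rewrite e; split=> //.
    exact: (subset_trans LX (subset_trans LL dd)).
  + move=> x xX x0 xm; rewrite /= /upd; case: eqVneq => [e|_]; last exact: ch.
    by subst x; exact: subset_trans (ch i iX x0 im) dd.
  move=> bY; apply: N0 => //; split.
    split=> [|x xX x0 //|x xX xm]; first exact: subxx.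
    by rewrite /= /upd; case: eqVneq => [->|_].
  by move=> [_ _ /(_ i iX im)]; rewrite /= /upd eqxx.
(* The index is enlarged by [i], with Lam0 equal to [L] and Lam1 equal to pi L^vee. *)
- move=> i iX iM L lL BL iso; have im : (i <= m)%N by case/andP: iM => _ /ltnW.
  have i1M : (1 <= i <= m)%N by case/andP: iM => ->.
  have i2M : (1 <= i.+1 <= m)%N by case/andP: iM.
  pose L1 := scale pi2 (dC L).
  have AL1 : chA c i.+1 `<=` scale pik (dK (ext L)).
    move=> w Aw; apply/(scaleE _ _ (pi_neq0 _)); apply: dK_gen => v Lv.
    rewrite hermZl -piO_integral -(frobk_piO (Wk := Wk)) (hk_conj u cardFq2 Hh).
    by apply: iso => //; exact: ext_mem.
  have AL1' : chA c i.+1 `<=` ext L1.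
    by have := scale_dKE u cardFq2 Hu Hh 1 lL; rewrite !expr1z /L1 => ->.
  (* [L] pairs with A_(i+1) into the maximal ideal, so it lies in pi A_(i+1)^vee and hence in
     B_(i+1). Then pi L lies in pi B_(i+1), so in A_(i+1), so in pi L^vee. *)
  have LL : L `<=` dC L.
    apply: (ext_reflect_sub (u := u)); first exact: (lattice_dC u cardFq2 Hu Hh lL).
    rewrite -(dK_ext u cardFq2 Hu Hh lL) => v Lv.
    have [dA _ _ pB] := np_dual cN i2M.
    have Bv : chB c i.+1 v.
      by apply: dA; apply/(scale_dK _ _ _ _ (pi_neq0 _)) => w Aw; apply/piO_integral/iso.
    have : scale pik (dK (ext L)) (pik *: v) by apply: AL1; apply: pB; exists v.
    by move/(scaleE _ _ (pi_neq0 _)); rewrite scalerA mulVf ?pi_neq0 // scale1r.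
  have lL1 : is_lattice L1.
    by have := lattice_scale 1 (lattice_dC u cardFq2 Hu Hh lL); rewrite expr1z.
  have [[_ L1L _] _] := vertex0_of (u := u) cardFq2 Hu Hh cN i1M lL BL LL.
  have LL1 : L `<=` scale pi2 (dC L1) by exact: dC_scale_dC.
  pose Y := BTData (inord i |: btI X) (upd (btLam0 X) i L) (upd (btLam1 X) i L1).
  have inY x : (x \in elts Y) = (x == i) || (x \in elts X) by exact: elts_add.
  case/andP: iM => i_gt0 i_lt.
  have [] := @bt_through Y c cN (I1 i).
  + by move=> /b0 nX; rewrite inY negb_or nX eq_sym -lt0n i_gt0.
  + by move=> /bm nX; rewrite inY negb_or nX eq_sym neq_ltn i_lt.
  + move=> x; rewrite inY /= /upd; case: eqVneq => [->|_] /= xX x0; last exact: w0.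
    by split.
  + move=> x; rewrite inY /= /upd; case: eqVneq => [->|_] /= xX xm; last exact: w1.
    by split=> //; apply: subset_trans LL1; move: L1L; rewrite expr1.
  + move=> x; rewrite inY /= /upd; case: eqVneq => [->|_] /= xX x0 xm; last exact: ch.
    exact: LL1.
  move=> bY; apply: N0 => //; apply: grow => // x xX.
  by rewrite /upd nin.
- move=> iX h1 L lL AL LL.
  pose Y := BTData (inord 0 |: btI X) (btLam0 X) (upd (btLam1 X) 0%N L).
  have inY x : (x \in elts Y) = (x == 0%N) || (x \in elts X) by exact: elts_add.
  have [] := @bt_through Y c cN (I1 0%N).
  + by move=> e; rewrite e in h1.
  + by move=> /bm nX; rewrite inY negb_or nX andbT; move: m_gt0; rewrite lt0n.
  + move=> x; rewrite inY; case: eqVneq => [//|ne] /= xX _; exact: w0.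
  + move=> x; rewrite inY /= /upd; case: eqVneq => [->|ne] /= xX xm; last exact: w1.
    by split.
  + move=> x; rewrite inY /= /upd; case: eqVneq => [//|ne] /= xX _ xm; exact: ch.
  move=> bY; apply: N0 => //; apply: grow => // x xX.
  by rewrite /upd nin.
- move=> iX h1 L lL BL LL.
  pose Y := BTData (inord m |: btI X) (upd (btLam0 X) m L) (btLam1 X).
  have inY x : (x \in elts Y) = (x == m) || (x \in elts X) by exact: elts_add.
  have [] := @bt_through Y c cN (I1 m).
  + by move=> /b0 nX; rewrite inY negb_or nX andbT eq_sym; move: m_gt0; rewrite lt0n.
  + by move=> e; rewrite e eqxx in h1.
  + move=> x; rewrite inY /= /upd; case: eqVneq => [->|_] /= xX x0; last exact: w0.
    by split.
  + move=> x; rewrite inY; case: eqVneq => [//|ne] /= xX _; exact: w1.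
  + move=> x; rewrite inY /= /upd; case: eqVneq => [//|ne] /= xX x0 _; exact: ch.
  move=> bY; apply: N0 => //; apply: grow => // x xX.
  by rewrite /upd nin.
Qed.

End OpenPoints.

(** * Orthogonal subspaces and dual lattices *)

Section PerpLattices.
Variables (Fq : finFieldType) (OF : cdvf Fq) (Fq2 : finFieldType)
  (i1 : {rmorphism Fq -> Fq2}) (k : fieldType) (i2 : {rmorphism Fq -> k})
  (j12 : {rmorphism Fq2 -> k}) (W2 : relwitt OF i1) (Wk : relwitt OF i2)
  (u : wittmap j12 W2 Wk).
Hypothesis cardFq2 : #|Fq2| = (#|Fq| ^ 2)%N.
Variables (n : nat) (H : 'M[fld W2]_n).
Hypotheses (Hu : H \in unitmx) (Hh : forall i j, frob W2 (H i j) = H j i).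
Local Notation q := #|Fq|.
Local Notation C := 'rV[fld W2]_n.
Local Notation Ck := 'rV[fld Wk]_n.
Local Notation wm := (map_mx (wmap u)).
Local Notation Hk := (wm H).
Local Notation hC := (herm (frob W2) H).
Local Notation hk := (herm (frob Wk) Hk).
Local Notation dC := (dualC H).
Local Notation dK := (dualCk u H).
Local Notation ext := (extend u).
Local Notation pi2 := (Defs.pi W2).
Local Notation pik := (Defs.pi Wk).
Variable a : fld W2.
Hypotheses (a0 : a != 0) (fa : frob W2 a = a).
Local Notation ak := (wmap u a).

Section Pair.
Variables (T1 B1 T2 B2 : set C) (d1 d2 : nat).
Variables (b1 : 'M[fld W2]_(d1, n)) (b2 : 'M[fld W2]_(d2, n)).
Hypothesis pd : pair_datum H a T1 B1 T2 B2 b1 b2.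
Let pd' := pair_datum_sym pd.
Variable sg : {rmorphism k -> k}.
Hypothesis sgE : forall x, sg x = x ^+ q.
Local Notation emk := (map_mx (emb Wk)).
Local Notation rsk := (map_mx (res Wk)).
Local Notation P1 := (gramG j12 H a b1 b2).
Local Notation P2 := (gramG j12 H a b2 b1).
Local Notation red1 := (redv (wm b1)).
Local Notation red2 := (redv (wm b2)).
Let klb1 := ext_lb1 u cardFq2 Hu Hh a0 fa pd sgE.
Let klb2 := ext_lb1 u cardFq2 Hu Hh a0 fa pd' sgE.
Let eBT1 : ext B1 `<=` ext T1. Proof. exact/ext_mono/(pd_BT1 pd). Qed.
Let eBT2 : ext B2 `<=` ext T2. Proof. exact/ext_mono/(pd_BT2 pd). Qed.
Let sB1 : submod (ext B1). Proof. exact: ext_submod. Qed.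
Let sT1 : submod (ext T1). Proof. exact: ext_submod. Qed.

(** Elements of [ext B1] pair with [ext T2] into the maximal ideal, and likewise on the other side,
    so the condition depends only on reduced coordinates. *)
Lemma lift_perp U2 v : liftv (ext B1) (wm b1) (perp q P1 U2) v <->
  forall w, liftv (ext B2) (wm b2) U2 w -> piO (ak * hk v w).
Proof.
have sB2 := ext_submod u B2; split=> [[c [Bc cU]] w [c' [Bc' c'U]]|h].
  rewrite -[v](subrK (emk c *m wm b1)) (hermDl (frob Wk)) mulrDr; apply: piOD.
    apply: ((ext_B1E u cardFq2 Hu Hh a0 pd _).1 Bc).
    rewrite -[w](subrK (emk c' *m wm b2)); apply: submodD; [exact: ext_submod|exact: eBT2|].
    exact: (lb_T (ext_submod u T2) klb2).
  rewrite -[w](subrK (emk c' *m wm b2)) (hermDr (frob Wk)) mulrDr; apply: piOD.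
    exact: ((ext_T1E u cardFq2 Hu Hh a0 fa pd _).1 (lb_T sT1 klb1 c)).
  by apply/(form_red u cardFq2 Hu Hh a0 pd); move/(mem_perp sgE): cU; apply.
have Tv : ext T1 v.
  by apply/(ext_T1E u cardFq2 Hu Hh a0 fa pd) => w Bw; apply: h; exact: lift_sup.
have [c Bc] := lb_dec klb1 Tv; exists c; split=> //.
apply/(mem_perp sgE) => x xU; have [c' cx] := res_lift Wk x; rewrite -cx.
apply/(form_red u cardFq2 Hu Hh a0 pd).
have L' : liftv (ext B2) (wm b2) U2 (emk c' *m wm b2) by apply/(lift_mem sB2 klb2); rewrite cx.
rewrite -[emk c *m wm b1](subrK v) (hermDl (frob Wk)) mulrDr; apply: piOD; last exact: h.
apply: ((ext_B1E u cardFq2 Hu Hh a0 pd _).1 _); last exact: (lb_T (ext_submod u T2) klb2).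
by rewrite -opprB; exact: submodN.
Qed.

Lemma perp_le L2 L' : submod L2 -> ext B2 `<=` L2 -> L2 `<=` ext T2 -> submod L' ->
  (forall v, (forall w, L2 w -> piO (ak * hk v w)) -> L' v) ->
  (perp q P1 (red2 L2) <= red1 L')%VS.
Proof.
move=> sL2 BL2 LT2 sL' h; rewrite -(redv_lift sB1 klb1 (perp q P1 (red2 L2))).
apply: redvS => //; first exact: submod_lift.
move=> v /lift_perp H'; apply: h => w Lw; apply: H'.
by rewrite (lift_redv (ext_submod u T2) (ext_submod u B2) eBT2 klb2).
Qed.

End Pair.
End PerpLattices.

Lemma lattice_scaler (k : fieldType) (K : cdvf k) n (a : fld K) (L : set 'rV[fld K]_n) :
  a != 0 -> is_lattice L -> is_lattice (scale a L).
Proof.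
move=> a0 [e eu ->]; exists (a *: e); first by rewrite unitmxZ ?unitfE.
apply/seteqP; split=> [_ [_ [c ->] <-]|_ [c ->]]; first by exists c; rewrite scalemxAr.
by exists (map_mx (emb K) c *m e); [exists c | rewrite scalemxAr].
Qed.

Lemma colen_scale (k : fieldType) (K : cdvf k) n (a : fld K) h (A B : set 'rV[fld K]_n) :
  a != 0 -> colen h A B -> colen h (scale a A) (scale a B).
Proof.
move=> a0; elim: h B => [|h IH] B /=; first by move=> ->.
move=> [L cL [x [Bx nLx pLx BE]]]; exists (scale a L); first exact: IH.
have sE (M : set 'rV[fld K]_n) v : scale a M (a *: v) <-> M v.
  by rewrite (scaleE _ _ a0) scalerA mulVf // scale1r.
exists (a *: x); split.
- exact/sE.
- by move/sE.
- by rewrite scalerA mulrC -scalerA; apply/sE.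
rewrite BE; apply/seteqP; split=> [_ [_ [v [c [Lv ->]]] <-]|_ [_ [c [[v Lv <-] ->]]]].
  by exists (a *: v), c; split; [exact/sE | rewrite scalerDr !scalerA (mulrC a)].
exists (v + emb K c *: x); first by exists v, c.
by rewrite scalerDr !scalerA (mulrC a).
Qed.

Section DualLattices.
Variables (Fq : finFieldType) (OF : cdvf Fq) (Fq2 : finFieldType)
  (i1 : {rmorphism Fq -> Fq2}) (k : fieldType) (i2 : {rmorphism Fq -> k})
  (j12 : {rmorphism Fq2 -> k}) (W2 : relwitt OF i1) (Wk : relwitt OF i2)
  (u : wittmap j12 W2 Wk).
Hypothesis cardFq2 : #|Fq2| = (#|Fq| ^ 2)%N.
Variables (n : nat) (H : 'M[fld W2]_n).
Hypotheses (Hu : H \in unitmx) (Hh : forall i j, frob W2 (H i j) = H j i).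
Local Notation q := #|Fq|.
Local Notation C := 'rV[fld W2]_n.
Local Notation Ck := 'rV[fld Wk]_n.
Local Notation wm := (map_mx (wmap u)).
Local Notation Hk := (wm H).
Local Notation hC := (herm (frob W2) H).
Local Notation hk := (herm (frob Wk) Hk).
Local Notation dC := (dualC H).
Local Notation dK := (dualCk u H).
Local Notation ext := (extend u).
Local Notation pi2 := (Defs.pi W2).
Local Notation pik := (Defs.pi Wk).
Variable a : fld W2.
Hypotheses (a0 : a != 0) (fa : frob W2 a = a).
Local Notation ak := (wmap u a).

Section Pair.
Variables (T1 B1 T2 B2 : set C) (d1 d2 : nat).
Variables (b1 : 'M[fld W2]_(d1, n)) (b2 : 'M[fld W2]_(d2, n)).
Hypothesis pd : pair_datum H a T1 B1 T2 B2 b1 b2.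
Let pd' := pair_datum_sym pd.
Variable sg : {rmorphism k -> k}.
Hypothesis sgE : forall x, sg x = x ^+ q.
Local Notation emk := (map_mx (emb Wk)).
Local Notation rsk := (map_mx (res Wk)).
Local Notation P1 := (gramG j12 H a b1 b2).
Local Notation P2 := (gramG j12 H a b2 b1).
Local Notation red1 := (redv (wm b1)).
Local Notation red2 := (redv (wm b2)).
Let klb1 := ext_lb1 u cardFq2 Hu Hh a0 fa pd sgE.
Let klb2 := ext_lb1 u cardFq2 Hu Hh a0 fa pd' sgE.
Let dp := gram_dual u cardFq2 Hu Hh a0 fa pd sgE.
Let eBT1 : ext B1 `<=` ext T1. Proof. exact/ext_mono/(pd_BT1 pd). Qed.
Let eBT2 : ext B2 `<=` ext T2. Proof. exact/ext_mono/(pd_BT2 pd). Qed.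
Let sB1 : submod (ext B1). Proof. exact: ext_submod. Qed.
Let sT1 : submod (ext T1). Proof. exact: ext_submod. Qed.

Variables (U : {vspace 'rV[k]_d2}) (W : {vspace 'rV[k]_d1}).
Hypotheses (UW : (perp q P1 U <= W)%VS) (WU : (perp q P2 W <= U)%VS).
Hypothesis dUW : (\dim U + \dim W = d1.+1)%N.
Local Notation A := (liftv (ext B2) (wm b2) U).
Local Notation Bw := (liftv (ext B1) (wm b1) W).

Let faK : frob Wk ak = ak. Proof. by rewrite -wmap_frob fa. Qed.

Lemma scale_dual_lift : scale pik (dK A) = scale ak (liftv (ext B1) (wm b1) (perp q P1 U)).
Proof.
have ak0 := wa0 u a0; apply/seteqP; split=> v.
  move=> /(scale_dK _ _ _ _ (pi_neq0 _)) I; apply/(scaleE _ _ ak0).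
  apply/(lift_perp u cardFq2 Hu Hh a0 fa pd sgE) => w /I; rewrite hermZl mulVKf //; by move/piO_integral.
move=> /(scaleE _ _ ak0) /(lift_perp u cardFq2 Hu Hh a0 fa pd sgE) I; apply/(scale_dK _ _ _ _ (pi_neq0 _)) => w /I.
by rewrite hermZl mulVKf // => /piO_integral.
Qed.

Lemma scale_dual_scale_lift : scale pik (dK (scale ak Bw)) = liftv (ext B2) (wm b2) (perp q P2 W).
Proof.
apply/seteqP; split=> v.
  move=> /(scale_dK _ _ _ _ (pi_neq0 _)) I; apply/(lift_perp u cardFq2 Hu Hh a0 fa pd' sgE) => w Lw.
  apply/piO_integral; rewrite -{1}faK -hermZr; apply: I; by exists w.
move=> /(lift_perp u cardFq2 Hu Hh a0 fa pd' sgE) I; apply/(scale_dK _ _ _ _ (pi_neq0 _)) => _ [w Lw <-].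
by rewrite hermZr faK; apply/piO_integral/I.
Qed.

Lemma lift_dual_chain : [/\ is_lattice A, is_lattice (scale ak Bw),
  [/\ colen 1 (scale pik (dK A)) (scale ak Bw), scale ak Bw `<=` dK A,
      colen 1 (scale pik (dK (scale ak Bw))) A & A `<=` dK (scale ak Bw)]
  & forall z1 z2, vol B1 z1 -> vol B2 z2 ->
      vol A (z2 - (\dim U)%:Z) /\ vol Bw (z1 - (\dim W)%:Z)].
Proof.
have sB2 : submod (ext B2) by exact: ext_submod. have sT2 : submod (ext T2) by exact: ext_submod.
have ak0 := wa0 u a0.
have vols z1 z2 : vol B1 z1 -> vol B2 z2 ->
      vol A (z2 - (\dim U)%:Z) /\ vol Bw (z1 - (\dim W)%:Z).
  move=> /(ext_vol u) v1 /(ext_vol u) v2.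
  by split; [exact: vol_lift sT2 sB2 klb2 _ _ v2 | exact: vol_lift sT1 sB1 klb1 _ _ v1].
have [z1 v1] := lattice_vol (pd_lB1 u cardFq2 Hu Hh pd).
have [z2 v2] := lattice_vol (pd_lB1 u cardFq2 Hu Hh pd').
have [vA vB] := vols _ _ v1 v2.
have int v w : ext T1 v -> ext T2 w -> integral (ak * hk v w) /\ integral (ak * hk w v).
  move=> Tv Tw.
  have Bv : ext B1 (pik *: v) by exact: (pi_top sB1 klb1 Tv).
  have Bw' : ext B2 (pik *: w) by exact: (pi_top sB2 klb2 Tw).
  split.
    by have := (ext_B1E u cardFq2 Hu Hh a0 pd _).1 Bv _ Tw; rewrite hermZl mulrCA piO_integral mulKf ?pi_neq0.
  by have := (ext_B1E u cardFq2 Hu Hh a0 pd' _).1 Bw' _ Tv; rewrite hermZl mulrCA piO_integral mulKf ?pi_neq0.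
have LT1 V : liftv (ext B1) (wm b1) V `<=` ext T1 by exact: lift_sub.
have LT2 V : liftv (ext B2) (wm b2) V `<=` ext T2 by exact: lift_sub.
split=> //; [exact: vol_lattice vA | apply: lattice_scaler => //; exact: vol_lattice vB|].
have dp1 := dimp1 sgE dp U; have dp2 := dimp1 sgE (dual_pair_sym dp) W.
have dd := dual_dim dp.
split.
- rewrite scale_dual_lift; apply: colen_scale => //; apply: (colen_lift sT1 sB1 klb1) => //.
  by move: dUW dp1; move: (\dim _) (\dim _) (\dim _); clear; lia.
- move=> _ [v Lv <-] w Lw; rewrite hermZl.
  by have [] := int v w (LT1 _ _ Lv) (LT2 _ _ Lw).
- rewrite scale_dual_scale_lift; apply: (colen_lift sT2 sB2 klb2) => //.
  by move: dUW dp2 dd; move: (\dim _) (\dim _) (\dim _); clear; lia.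
- move=> v Lv _ [w Lw <-]; rewrite hermZr faK.
  by have [] := int w v (LT1 _ _ Lw) (LT2 _ _ Lv).
Qed.

End Pair.
End DualLattices.

(** * The factors of a stratum *)

Lemma seq_iota (T : Type) (x0 : T) (Fl : seq T) E : size Fl = E ->
  Fl = [seq nth x0 Fl y.-1 | y <- iota 1 E].
Proof.
move=> sz; apply: (@eq_from_nth _ x0); first by rewrite size_map size_iota.
move=> i iE; rewrite sz in iE; rewrite (nth_map 0%N) ?size_iota // nth_iota //.
Qed.

Lemma seq_rev_iota (T : Type) (x0 : T) (Fl : seq T) E : size Fl = E ->
  Fl = [seq nth x0 Fl (E - y)%N | y <- rev (iota 1 E)].
Proof.
move=> sz; rewrite {1}(seq_iota x0 sz) rev_iota_map; apply/eq_in_map => y.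
by rewrite mem_iota => yE; congr nth; lia.
Qed.

(** The second half is counted from the top, so that entries with the same index [y] are partners
    under duality. *)
Lemma seq_two_iota (T : Type) (x0 : T) (Fl : seq T) E : size Fl = (E + E)%N ->
  Fl = [seq nth x0 (take E Fl) y.-1 | y <- iota 1 E] ++
       [seq nth x0 (drop E Fl) (E - y)%N | y <- rev (iota 1 E)].
Proof.
move=> sz; rewrite -seq_iota ?size_take ?sz; last by case: ifP; lia.
by rewrite -seq_rev_iota ?cat_take_drop // size_drop sz addnK.
Qed.

Lemma U_list (k : fieldType) d E l hh (al : nat -> nat) (Q Q' : nat -> {vspace 'rV[k]_d}) :
  let Fl := [seq Q y | y <- iota 1 E] ++ [seq Q' y | y <- rev (iota 1 E)] in
  [seq \dim A | A <- Fl] = [seq (l + al y)%N | y <- iota 1 E] ++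
    [seq (l + (hh - al y))%N | y <- rev (iota 1 E)] ->
  sorted (fun A B => (A <= B)%VS) Fl -> (forall y, (0 < y < E)%N -> (al y <= al y.+1)%N) ->
  (forall y, (0 < y <= E)%N -> (2 * al y <= hh)%N) ->
  forall y, (0 < y <= E)%N -> [/\ \dim (Q y) = (l + al y)%N, \dim (Q' y) = (l + (hh - al y))%N,
    (Q y <= Q' y)%VS & (y < E)%N -> (Q y <= Q y.+1)%VS /\ (Q' y.+1 <= Q' y)%VS].
Proof.
move=> Fl dF sF inc bd y yE.
move/eqP: dF; rewrite map_cat eqseq_cat ?size_map // => /andP [/eqP d1 /eqP d2].
have dQ z : (0 < z <= E)%N -> \dim (Q z) = (l + al z)%N.
  by move: z; apply: eq_map_iota; rewrite -d1 -map_comp.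
have dQ' z : (0 < z <= E)%N -> \dim (Q' z) = (l + (hh - al z))%N.
  move: z; apply: eq_map_iota; move: d2; rewrite !map_rev => /(congr1 rev).
  by rewrite !revK => <-; rewrite -map_comp.
have QF z : (0 < z <= E)%N -> Q z \in Fl by move=> zE; rewrite mem_cat map_f // mem_iota; lia.
have Q'F z : (0 < z <= E)%N -> Q' z \in Fl.
  by move=> zE; rewrite mem_cat orbC map_f // mem_rev mem_iota; lia.
split; [exact: dQ|exact: dQ'| |move=> yE'; have yE1 : (0 < y.+1 <= E)%N by clear -yE yE'; lia].
  apply: (chain_dim sF); rewrite ?QF ?Q'F // dQ // dQ' //; have := bd y yE; clear; lia.
have yy : (0 < y < E)%N by clear -yE yE'; lia.
split; apply: (chain_dim sF); rewrite ?QF ?Q'F //.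
  by rewrite !dQ // leq_add2l inc.
by rewrite !dQ' // leq_add2l leq_sub2l // inc.
Qed.

Lemma iota_rev_map (T : Type) (f : nat -> T) E :
  [seq f y | y <- iota 1 E] = [seq f (E.+1 - y)%N | y <- rev (iota 1 E)].
Proof.
rewrite rev_iota_map; apply/eq_in_map => y; rewrite mem_iota => yE; congr f; lia.
Qed.

Section Kinds.
Variables (Fq : finFieldType) (OF : cdvf Fq) (Fq2 : finFieldType)
  (i1 : {rmorphism Fq -> Fq2}) (k : fieldType) (i2 : {rmorphism Fq -> k})
  (j12 : {rmorphism Fq2 -> k}) (W2 : relwitt OF i1) (Wk : relwitt OF i2)
  (u : wittmap j12 W2 Wk).
Hypothesis cardFq2 : #|Fq2| = (#|Fq| ^ 2)%N.
Variables (n : nat) (H : 'M[fld W2]_n).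
Hypotheses (Hu : H \in unitmx) (Hh : forall i j, frob W2 (H i j) = H j i).
Local Notation q := #|Fq|.
Local Notation C := 'rV[fld W2]_n.
Local Notation Ck := 'rV[fld Wk]_n.
Local Notation wm := (map_mx (wmap u)).
Local Notation Hk := (wm H).
Local Notation hC := (herm (frob W2) H).
Local Notation hk := (herm (frob Wk) Hk).
Local Notation dC := (dualC H).
Local Notation dK := (dualCk u H).
Local Notation ext := (extend u).
Local Notation pi2 := (Defs.pi W2).
Local Notation pik := (Defs.pi Wk).
Variables (m : nat) (h : nat -> nat).
Hypothesis m_gt0 : (0 < m)%N.
Hypothesis h_le : forall i, (1 <= i <= m)%N -> (h i <= n)%N.
Hypothesis h_lt : forall i, (1 <= i < m)%N -> (h i < h i.+1)%N.
Hypothesis h_parity : forall i, (1 <= i <= m)%N -> odd (h i) = odd (h 1%N).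
Hypothesis H_parity0 : forall L : set C, vertex H 0 L -> odd (vtype H 0 L) = odd (h 1%N + 1)%N.
Hypothesis H_parity1 : forall L : set C,
  vertex H 1 L -> odd (vtype H 1 L) = odd (n - h 1%N + 1)%N.
Variable X : btdata m (set C).
Hypothesis X_bt : is_bt h H X.
Variable b : forall t : fspace X, 'M[fld W2]_(sdim H t, n).
Hypothesis b_lifts : lifts_bases b.
Hypothesis closedk : forall p : {poly k}, size p != 1%N -> exists x, root p x.
Variable sg : {rmorphism k -> k}.
Hypothesis sgE : forall x, sg x = x ^+ q.
Local Notation s := #|btI X|.
Local Notation i_ := (elt X).
Local Notation Lam0 := (btLam0 X).
Local Notation Lam1 := (btLam1 X).
Local Notation dh x y := ((h y - h x)%N./2).
Let q1 : (1 < q)%N := q_gt1 Fq.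

Lemma h_mono i j : (1 <= i)%N -> (i <= j <= m)%N -> (h i <= h j)%N.
Proof.
move=> i0; elim: j => [|j IH] ij; first by move: ij; rewrite leqNgt i0.
have [-> //|ne] := eqVneq i j.+1.
have jm : (1 <= j < m)%N by clear -ij ne i0; lia.
have ij' : (i <= j <= m)%N by clear -ij ne; lia.
exact: (leq_trans (IH ij') (ltnW (h_lt jm))).
Qed.

(** Equal parity of the h_i makes the halving exact. *)
Lemma h_dh i j : (1 <= i)%N -> (i <= j <= m)%N -> h j = (h i + 2 * dh i j)%N.
Proof.
move=> i0 ij; have le := h_mono i0 ij.
have im : (1 <= i <= m)%N by clear -i0 ij; lia.
have jm : (1 <= j <= m)%N by clear -i0 ij; lia.
have := h_parity im; have := h_parity jm; clear -le => <- e.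
have : ~~ odd (h j - h i) by rewrite oddB // e addbb.
by move: le; clear; lia.
Qed.

Lemma vtype_vol e L x y : vertex H e L -> vol L x -> vol (dC L) y ->
  y + n%:Z * e.+1%:Z = x + (vtype H e L)%:Z.
Proof.
move=> [lL dL LL] vL vD; have := vol_scale e.+1%:Z vD; rewrite -exprnP => vS.
have pL : scale pi2 L `<=` scale (pi2 ^+ e.+1) (dC L) by rewrite exprS -scaleA; exact: scaleS.
have [le _] := vol_mono vS vL dL.
have cD := colen_between (h := absz (y + n%:Z * e.+1%:Z - x)%R) vS vL pL dL ltac:(lia).
by have [<- ->] := len_vol vS vL cD.
Qed.

Lemma hermZpi v w : hC v (pi2 *: w) = pi2 * hC v w.
Proof. by rewrite (hermZr (frob W2)) /Defs.pi frob_emb frobO_unif. Qed.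

Lemma frob_piV : frob W2 pi2^-1 = pi2^-1.
Proof. by rewrite fmorphV /Defs.pi frob_emb frobO_unif. Qed.

Lemma s_gt0 : (0 < s)%N.
Proof. by case: X_bt => [[]]; rewrite -cards_eq0 -lt0n. Qed.

Lemma vert0 i : i \in elts X -> i != 0%N -> vertex H 0 (Lam0 i) /\ (1 <= i <= m)%N.
Proof.
move=> iX i0; case: X_bt => _ /(_ i iX i0) [v _] _ _ _; split=> //.
by rewrite lt0n i0 (elts_le iX).
Qed.

Lemma vert1 i : i \in elts X -> i != m -> vertex H 1 (Lam1 i) /\ (1 <= i.+1 <= m)%N.
Proof.
move=> iX im; case: X_bt => _ _ /(_ i iX im) [v _] _ _; split=> //.
by have : (i < m)%N by rewrite ltn_neqAle im (elts_le iX).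
Qed.

(** The parity of types makes the halving in [ell] exact; the lower bound on the type excludes
    truncation. *)
Lemma ell0E i : i \in elts X -> i != 0%N ->
  vtype H 0 (Lam0 i) = (2 * (ell H 0 (Lam0 i) (h i)).-1 + h i + 1)%N.
Proof.
move=> iX i0; have [v iM] := vert0 iX i0; case: X_bt => _ /(_ i iX i0) [_ ge] _ _ _.
have := H_parity0 v; rewrite /ell /= addn1 /= -(h_parity iM); move: ge; clear; lia.
Qed.

Lemma ell1E i : i \in elts X -> i != m ->
  vtype H 1 (Lam1 i) = (2 * (ell H 1 (Lam1 i) (n - h i.+1)).-1 + (n - h i.+1) + 1)%N.
Proof.
move=> iX im; have [v iM] := vert1 iX im; case: X_bt => _ _ /(_ i iX im) [_ ge] _ _.
have m1 : (1 <= 1 <= m)%N by rewrite m_gt0.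
have := H_parity1 v; rewrite /ell /= addn1 /=.
have -> : odd (n - h 1%N) = odd (n - h i.+1).
  by rewrite !oddB ?h_le // (h_parity iM).
move: ge; clear; lia.
Qed.

(** The scalar in front of the form is 1 for the first factor and the inverse of the uniformizer for
    the others; in each case the space is self-dual or has its partner as dual. *)
Lemma pd_A (j : 'I_s.+1) : kind X j = KindA ->
  pair_datum H 1 (Lam0 (i_ 1)) (scale pi2 (dC (Lam0 (i_ 1)))) (Lam0 (i_ 1))
    (scale pi2 (dC (Lam0 (i_ 1)))) (b (j, false)) (b (j, false)).
Proof.
move=> kj; have := b_lifts (j, false); rewrite /top /bot /= kj => lb.
have i0 : i_ 1 != 0%N.
  apply/negP => /eqP e; move: kj; rewrite /kind e eqxx.
  by case: ifP => // _; case: ifP => // _; case: ifP.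
have iX : i_ 1 \in elts X by apply: elt_mem; rewrite s_gt0.
have [[lL dL LL] _] := vert0 iX i0; rewrite expr1 in dL.
by split; rewrite ?invr1 ?mul1r.
Qed.

Lemma pd_B (j : 'I_s.+1) : kind X j = KindB ->
  pair_datum H pi2^-1 (Lam1 (i_ s)) (scale (pi2 ^+ 2) (dC (Lam1 (i_ s)))) (Lam1 (i_ s))
    (scale (pi2 ^+ 2) (dC (Lam1 (i_ s)))) (b (j, false)) (b (j, false)).
Proof.
move=> kj; have := b_lifts (j, false); rewrite /top /bot /= kj => lb.
have im : i_ s != m.
  apply/negP => /eqP e; move: kj; rewrite /kind e eqxx.
  by case: ifP => _; case: ifP.
have iX : i_ s \in elts X by apply: elt_mem; rewrite s_gt0 leqnn.
have [[lL dL LL] _] := vert1 iX im.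
by split; rewrite ?invrK.
Qed.

Lemma kindC (j : 'I_s.+1) : kind X j = KindC ->
  [/\ (1 <= j < s)%N, i_ j \in elts X, i_ j.+1 \in elts X, (i_ j < i_ j.+1)%N
    & i_ j != m /\ i_ j.+1 != 0%N].
Proof.
rewrite /kind; have [j0|j0] := eqVneq; first by case: ifP.
have [js|js _] := eqVneq; first by case: ifP.
have jM : (1 <= j < s)%N by have := ltn_ord j; rewrite ltnS => js'; rewrite lt0n j0 ltn_neqAle js.
have lt := elt_lt jM; have iX : i_ j \in elts X by apply: elt_mem; lia.
have iX' : i_ j.+1 \in elts X by apply: elt_mem; lia.
by split=> //; have := elts_le iX'; lia.
Qed.

Lemma pd_C (j : 'I_s.+1) : kind X j = KindC ->
  pair_datum H pi2^-1 (scale pi2 (Lam0 (i_ j.+1))) (scale (pi2 ^+ 2) (dC (Lam1 (i_ j))))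
    (Lam1 (i_ j)) (scale pi2 (dC (Lam0 (i_ j.+1)))) (b (j, false)) (b (j, true)).
Proof.
move=> kj; have := b_lifts (j, false); have := b_lifts (j, true); rewrite /top /bot /= kj => lb2 lb1.
have [jM iX iX' lt [im i0]] := kindC kj.
have [v0 _] := vert0 iX' i0; have [v1 _] := vert1 iX im.
have [lL0 _ _] := v0; have [lL1 _ _] := v1.
case: X_bt => _ _ _ _ /(_ _ jM) ch.
have ch' : scale pi2 (dC (Lam0 (i_ j.+1))) `<=` Lam1 (i_ j).
  have ld := lattice_dC u cardFq2 Hu Hh lL1.
  move=> _ [w dw <-]; rewrite -[Lam1 _](dCK u cardFq2 Hu Hh lL1) => x dx.
  rewrite (hermZl (frob W2)) -hermZpi; apply: dw; apply: ch; by exists x.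
split=> //; rewrite ?invrK //.
- by have := lattice_scale 1 lL0; rewrite expr1z.
- have -> : dC (scale pi2 (Lam0 (i_ j.+1))) = scale pi2^-1 (dC (Lam0 (i_ j.+1))).
    apply/seteqP; split=> v.
      move=> dv; apply/(scale_dC _ _ _ _); first by rewrite invr_eq0 pi_neq0.
      move=> w Lw; rewrite invrK -hermZpi; apply: dv; by exists w.
    move=> /(scale_dC _ _ _ _) dv _ [w Lw <-]; rewrite hermZpi -[X in X * _]invrK.
    by apply: dv => //; rewrite invr_eq0 pi_neq0.
  by rewrite scaleA -mulrA divff ?mulr1 ?pi_neq0.
- by rewrite expr2 -scaleA; exact: scaleS.
Qed.

Lemma kindA (j : 'I_s.+1) : kind X j = KindA ->
  [/\ nat_of_ord j = 0%N, i_ 1 \in elts X, i_ 1 != 0%N & (1 <= i_ 1 <= m)%N].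
Proof.
move=> kj; have i0 : i_ 1 != 0%N.
  apply/negP => /eqP e; move: kj; rewrite /kind e eqxx.
  by case: ifP => // _; case: ifP => // _; case: ifP.
have iX : i_ 1 \in elts X by apply: elt_mem; rewrite s_gt0.
split=> //; last by case: (vert0 iX i0).
by move: kj; rewrite /kind; case: eqP => // _; case: ifP => // _; case: ifP.
Qed.

Lemma kindB (j : 'I_s.+1) : kind X j = KindB ->
  [/\ nat_of_ord j = s, i_ s \in elts X, i_ s != m & (i_ s < m)%N].
Proof.
move=> kj; have im : i_ s != m.
  apply/negP => /eqP e; move: kj; rewrite /kind e eqxx.
  by case: ifP => _; case: ifP.
have iX : i_ s \in elts X by apply: elt_mem; rewrite s_gt0 leqnn.
split=> //; last by rewrite ltn_neqAle im (elts_le iX).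
by move: kj; rewrite /kind; case: ifP => _; [case: ifP | case: eqP].
Qed.

(** In this factor the chain index runs backwards: the member at position [y] is U_(i_1 + 1 - y),
    which explains the shape of [al]. *)
Lemma kindA_sdims (j : 'I_s.+1) : kind X j = KindA ->
  let al y := dh ((i_ 1).+1 - y)%N (i_ 1) in
  [/\ sdims h H (j, false) = [seq (ellA h H X + al y)%N | y <- iota 1 (i_ 1)] ++
         [seq (ellA h H X + (h (i_ 1) - al y))%N | y <- rev (iota 1 (i_ 1))],
      forall y, (0 < y <= i_ 1)%N -> h (i_ 1) = (h ((i_ 1).+1 - y) + 2 * al y)%N,
      sdim H (j, false) = (2 * (ellA h H X).-1 + h (i_ 1) + 1)%N
    & sdims h H (j, true) = [::]].
Proof.
move=> kj al; have [j0 iX i0 iM] := kindA kj; set e := i_ 1 in al iX i0 iM *.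
have hE y : (0 < y <= e)%N -> h e = (h (e.+1 - y) + 2 * al y)%N.
  by move=> ye; apply: h_dh; clear -ye iM; lia.
split=> //; last by rewrite /sdims /= kj.
  rewrite /sdims /= kj rev_iota_map (iota_rev_map (fun i => ellA h H X + (h (i_ 1) + h i)./2)%N).
  congr (_ ++ _); apply/eq_in_map => y; rewrite mem_rev mem_iota => ye.
  by have := hE y ltac:(clear -ye; lia); rewrite -/e; move: (al y); clear; lia.
by rewrite -(ell0E iX i0) /sdim /vtype /top /bot /= kj expr1.
Qed.

Lemma kindA_X0 (j : 'I_s.+1) (x : ffam k H j) Q Q' : kind X j = KindA -> fflag h x ->
  x false = [seq Q y | y <- iota 1 (i_ 1)] ++ [seq Q' y | y <- rev (iota 1 (i_ 1))] ->
  let P := gramG j12 H 1 (b (j, false)) (b (j, false)) in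
  X0factor j12 h b x <->
  [/\ forall y, (0 < y <= i_ 1)%N -> (perp q P (Q y) <= Q' y)%VS /\ (perp q P (Q' y) <= Q y)%VS,
      full_at q P P (Q' 1%N),
      forall y, (0 < y < i_ 1)%N -> no_stable q P P (Q y) (Q' y.+1)
    & h 1%N != 0%N -> no_stable q P P (Q (i_ 1)) (Q (i_ 1))].
Proof.
move=> kj fx xE P; have [j0 iX i0 iM] := kindA kj; have pd := pd_A kj.
have dp := gram_dual u cardFq2 Hu Hh (oner_neq0 _) (rmorph1 _) pd sgE.
set e := i_ 1 in xE iX i0 iM *; pose al y := dh (e.+1 - y)%N e.
have [ds hE dE _] := kindA_sdims kj; cbv zeta in ds, hE; rewrite -/e in ds hE dE.
have {}hE : forall y, (0 < y <= e)%N -> h e = (h (e.+1 - y) + 2 * al y)%N := hE.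
have [dF sF] := fx false; rewrite xE -/e ds in dF sF.
have al_inc y : (0 < y < e)%N -> (al y < al y.+1)%N.
  move=> ye; have := hE y ltac:(clear -ye; lia); have := hE y.+1 ltac:(clear -ye; lia).
  have := h_lt (i := (e - y)%N) ltac:(clear -ye iM; lia).
  have -> : (e.+1 - y.+1 = e - y)%N by clear -ye; lia.
  have -> : (e.+1 - y = (e - y).+1)%N by clear -ye; lia.
  clear; lia.
have ee : (0 < e <= e)%N by rewrite leqnn andbT; case/andP: iM.
have e1 : (e.+1 - e = 1)%N by clear; lia.
have he := hE e ee; rewrite e1 in he.
have zE : (h e - 2 * al e = h 1)%N by rewrite he; clear; lia.
have al1 : al 1%N = 0%N by rewrite /al subSS subn0 subnn.
have alh : (2 * al e <= h e)%N by rewrite he; clear; lia.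
have eg : (0 < e)%N by case/andP: iM.
have := U_chain closedk sgE q1 dp (l := ellA h H X) (E := e) (hh := h e) (al := al)
  isT eg al1 al_inc alh dE dF sF.
rewrite zE -/P => <-; rewrite /X0factor kj ds -xE.
have cond y t t' : (0 < y < e)%N -> (al y.+1 - al y <= t + t')%N <->
    (dh (e - y)%N (e - y).+1 <= t + t')%N.
  move=> ye; have a1 := hE y ltac:(clear -ye; lia); have a2 := hE y.+1 ltac:(clear -ye; lia).
  have r1 : (e.+1 - y.+1 = e - y)%N by clear -ye; lia.
  have r2 : (e.+1 - y = (e - y).+1)%N by clear -ye; lia.
  rewrite r1 in a2; rewrite r2 in a1.
  have -> // : (al y.+1 - al y = dh (e - y)%N (e - y).+1)%N.
  have := al_inc y ye; move: a1 a2; clear; lia.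
split=> [[t [T0 T1 T2 [_]]]|[t [T0 T1 T2 xu]]]; [rewrite kj => xu|].
  by exists t; split=> // y ye; apply/cond; [clear -ye; lia | exact: T1].
exists t; split=> //; last by split=> //; rewrite kj.
by move=> y ye; apply/cond; [clear -ye; lia | exact: T1].
Qed.

Lemma kindB_sdims (j : 'I_s.+1) : kind X j = KindB ->
  let al y := dh (i_ s).+1 (i_ s + y)%N in let hh := (n - h (i_ s).+1)%N in
  [/\ sdims h H (j, false) = [seq (ellB h H X + al y)%N | y <- iota 1 (m - i_ s)] ++
         [seq (ellB h H X + (hh - al y))%N | y <- rev (iota 1 (m - i_ s))],
      forall y, (0 < y <= m - i_ s)%N -> h (i_ s + y)%N = (h (i_ s).+1 + 2 * al y)%N,
      sdim H (j, false) = (2 * (ellB h H X).-1 + hh + 1)%N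
    & sdims h H (j, true) = [::]].
Proof.
move=> kj al hh; have [js iX im iM] := kindB kj.
set e := i_ s in al hh iX im iM *; set E := (m - e)%N.
have hE y : (0 < y <= E)%N -> h (e + y)%N = (h e.+1 + 2 * al y)%N.
  by move=> ye; apply: h_dh => //; move: ye; rewrite /E; clear -iM; lia.
have hn y : (0 < y <= E)%N -> (h (e + y) <= n)%N.
  by move=> ye; apply: h_le; move: ye; rewrite /E; clear -iM; lia.
split=> //; last 2 first.
- by rewrite -(ell1E iX im) /sdim /vtype /top /bot /= kj.
- by rewrite /sdims /= kj.
rewrite /sdims /= kj; congr (_ ++ _); apply/eq_in_map => y; rewrite mem_rev mem_iota -/e -/E => ye.
have ye' : (0 < y <= E)%N by clear -ye; lia.
by rewrite -/(al y) -/hh addnBA //; have := hn _ ye'; rewrite hE // /hh; clear; lia.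
Qed.

Lemma kindB_X0 (j : 'I_s.+1) (x : ffam k H j) Q Q' : kind X j = KindB -> fflag h x ->
  x false = [seq Q y | y <- iota 1 (m - i_ s)] ++ [seq Q' y | y <- rev (iota 1 (m - i_ s))] ->
  let P := gramG j12 H pi2^-1 (b (j, false)) (b (j, false)) in
  X0factor j12 h b x <->
  [/\ forall y, (0 < y <= m - i_ s)%N ->
        (perp q P (Q y) <= Q' y)%VS /\ (perp q P (Q' y) <= Q y)%VS,
      full_at q P P (Q' 1%N),
      forall y, (0 < y < m - i_ s)%N -> no_stable q P P (Q y) (Q' y.+1)
    & h m != n -> no_stable q P P (Q (m - i_ s)%N) (Q (m - i_ s)%N)].
Proof.
move=> kj fx xE P; have [js iX im iM] := kindB kj; have pd := pd_B kj.
have dp := gram_dual u cardFq2 Hu Hh (invr_neq0 (pi_neq0 _)) frob_piV pd sgE.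
set e := i_ s in xE iX im iM *; set E := (m - e)%N in xE *.
pose al y := dh e.+1 (e + y)%N; set hh := (n - h e.+1)%N.
have [ds hE dE _] := kindB_sdims kj; cbv zeta in ds, hE, dE; rewrite -/e -/E -/hh in ds hE dE.
have {}hE : forall y, (0 < y <= E)%N -> h (e + y)%N = (h e.+1 + 2 * al y)%N := hE.
have eg : (0 < E)%N by rewrite subn_gt0.
have hm : h m = (h e.+1 + 2 * al E)%N.
  by rewrite -hE ?eg ?leqnn // /E subnKC // ltnW.
have hmn : (h m <= n)%N by apply: h_le; rewrite m_gt0 leqnn.
have [dF sF] := fx false; rewrite xE ds in dF sF.
have step y : (0 < y < E)%N -> (al y < al y.+1)%N /\
    (al y.+1 - al y = dh (e + y)%N (e + y).+1)%N.
  move=> ye; have := hE y ltac:(clear -ye; lia); have := hE y.+1 ltac:(clear -ye; lia).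
  have := h_lt (i := (e + y)%N) ltac:(move: ye; rewrite /E; clear -iM; lia).
  rewrite addnS; clear; lia.
have zE : (hh - 2 * al E = n - h m)%N by rewrite hm /hh; clear; lia.
have al1 : al 1%N = 0%N by rewrite /al addn1 subnn.
have alh : (2 * al E <= hh)%N by move: hmn; rewrite hm /hh; clear; lia.
have nz : (n - h m != 0)%N = (h m != n) by rewrite subn_eq0 leqNgt ltn_neqAle hmn andbT negbK.
have := U_chain closedk sgE q1 dp (l := ellB h H X) (E := E) (hh := hh) (al := al)
  isT eg al1 (fun y ye => (step y ye).1) alh dE dF sF.
rewrite zE -/P nz => <-; rewrite /X0factor kj ds -xE -/e -/E -/hh.
have Ee y : (1 <= y <= m - 1 - e)%N = (1 <= y <= E - 1)%N by rewrite /E subnAC.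
split=> [[t [T0 T1 T2 [_]]]|[t [T0 T1 T2 xu]]]; [rewrite kj => xu|].
  exists t; split=> // y ye; have [_ ->] := step y ltac:(clear -ye; lia).
  by apply: T1; rewrite Ee.
exists t; split=> //; last by split=> //; rewrite kj.
by move=> y; rewrite Ee => ye; have [_ <-] := step y ltac:(clear -ye; lia); exact: T1.
Qed.

(** Both quotients have the same length, and the two types relate each lattice to its dual. Solving
    these equations gives the dimension, and the last identity, from which the colength of A_i in
    B_i is recovered for lifted chains. *)
Lemma kindC_vol (j : 'I_s.+1) : kind X j = KindC -> exists z1 z2 : int,
  [/\ vol (scale (pi2 ^+ 2) (dC (Lam1 (i_ j)))) z1, vol (scale pi2 (dC (Lam0 (i_ j.+1)))) z2,
      sdim H (j, false) = (ell0 h H X j + ell1 h H X j - 1 + dh (i_ j).+1 (i_ j.+1))%N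
    & z2 + (ell1 h H X j)%:Z + n%:Z =
      z1 + (ell0 h H X j)%:Z + (h (i_ j).+1)%:Z + (dh (i_ j).+1 (i_ j.+1))%:Z].
Proof.
move=> kj; have [jM iX iX' lt [im i0]] := kindC kj; have pd := pd_C kj.
have [v0 i0M] := vert0 iX' i0; have [v1 i1M] := vert1 iX im.
have [lL0 _ _] := v0; have [lL1 _ _] := v1.
have [x0 vx0] := lattice_vol lL0; have [x1 vx1] := lattice_vol lL1.
have [y0 vy0] := lattice_vol (lattice_dC u cardFq2 Hu Hh lL0).
have [y1 vy1] := lattice_vol (lattice_dC u cardFq2 Hu Hh lL1).
have e0 := vtype_vol v0 vx0 vy0; have e1 := vtype_vol v1 vx1 vy1.
have dp := gram_dual u cardFq2 Hu Hh (invr_neq0 (pi_neq0 _)) frob_piV pd sgE.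
have dd := dual_dim dp.
have sT1 := submod_lattice (pd_T1 pd); have sT2 := submod_lattice (pd_T2 pd).
have lB1 := pd_lB1 u cardFq2 Hu Hh pd; have lB2 := pd_lB1 u cardFq2 Hu Hh (pair_datum_sym pd).
have c1 := colen_top sT1 (submod_lattice lB1) (pd_BT1 pd) (pd_lb1 pd).
have c2 := colen_top sT2 (submod_lattice lB2) (pd_BT2 pd) (pd_lb2 pd).
have vB1 := vol_scale 2%:Z vy1; rewrite -exprnP in vB1.
have vT1 := vol_scale 1%:Z vx0; rewrite expr1z in vT1.
have vB2 := vol_scale 1%:Z vy0; rewrite expr1z in vB2.
have E1 := vol_uniq vT1 (vol_colen vB1 c1); have E2 := vol_uniq vx1 (vol_colen vB2 c2).
have t0 := ell0E iX' i0; have t1 := ell1E iX im.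
have hh := h_dh (i := (i_ j).+1) (j := i_ j.+1) isT ltac:(clear -lt i0M; lia).
have hn := h_le i0M; have l0 : (0 < ell0 h H X j)%N by []; have l1 : (0 < ell1 h H X j)%N by [].
rewrite -/(ell0 h H X j) in t0; rewrite -/(ell1 h H X j) in t1.
exists (y1 + n%:Z * 2%:Z), (y0 + n%:Z * 1%:Z); split=> //.
  move: e0 e1 E1 E2 dd t0 t1 hh hn l0 l1.
  move: (sdim _ _) (sdim _ _) (vtype _ _ _) (vtype _ _ _) (ell0 _ _ _ _) (ell1 _ _ _ _) (h _) (h _).
  by clear=> *; lia.
move: e0 e1 E1 E2 dd t0 t1 hh hn l0 l1.
move: (sdim _ _) (sdim _ _) (vtype _ _ _) (vtype _ _ _) (ell0 _ _ _ _) (ell1 _ _ _ _) (h _) (h _).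
by clear=> *; lia.
Qed.

Lemma kindC_X0 (j : 'I_s.+1) (x : ffam k H j) W U : kind X j = KindC -> fflag h x ->
  x false = [seq W y | y <- iota 1 (i_ j.+1 - i_ j)] ->
  x true = [seq U y | y <- rev (iota 1 (i_ j.+1 - i_ j))] ->
  let P1 := gramG j12 H pi2^-1 (b (j, false)) (b (j, true)) in
  let P2 := gramG j12 H pi2^-1 (b (j, true)) (b (j, false)) in
  X0factor j12 h b x <->
  [/\ forall y, (0 < y <= i_ j.+1 - i_ j)%N ->
        (perp q P1 (U y) <= W y)%VS /\ (perp q P2 (W y) <= U y)%VS,
      full_at q P1 P2 (W (i_ j.+1 - i_ j)%N), full_at q P2 P1 (U 1%N)
    & forall y, (0 < y < i_ j.+1 - i_ j)%N -> no_stable q P1 P2 (W y) (U y.+1)].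
Proof.
move=> kj fx xE1 xE2 P1 P2; have [jM iX iX' lt [im i0]] := kindC kj; have pd := pd_C kj.
have dp := gram_dual u cardFq2 Hu Hh (invr_neq0 (pi_neq0 _)) frob_piV pd sgE.
have dd := dual_dim dp; have [_ i0M] := vert0 iX' i0.
set e := i_ j in xE1 xE2 iX im lt *; set f := i_ j.+1 in xE1 xE2 iX' i0 i0M lt *.
set N := (f - e)%N in xE1 xE2 *; pose be y := dh e.+1 (e + y)%N.
have Ng : (0 < N)%N by rewrite subn_gt0.
have hE y : (0 < y <= N)%N -> h (e + y)%N = (h e.+1 + 2 * be y)%N.
  by move=> ye; apply: h_dh => //; move: ye; rewrite /N; clear -i0M lt; lia.
have eN : (e + N = f)%N by rewrite subnKC // ltnW.
have step y : (0 < y < N)%N -> (be y < be y.+1)%N /\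
    (be y.+1 - be y = dh (e + y)%N (e + y).+1)%N.
  move=> ye; have := hE y ltac:(clear -ye; lia); have := hE y.+1 ltac:(clear -ye; lia).
  have := h_lt (i := (e + y)%N) ltac:(move: ye; rewrite /N; clear -i0M; lia).
  rewrite addnS; clear; lia.
have be1 : be 1%N = 0%N by rewrite /be addn1 subnn.
have ds : sdims h H (j, false) = [seq (ell1 h H X j + be y)%N | y <- iota 1 N].
  by rewrite /sdims /= kj.
have ds' : sdims h H (j, true) = [seq (ell0 h H X j + (be N - be y))%N | y <- rev (iota 1 N)].
  rewrite /sdims /= kj; apply/eq_in_map => y; rewrite mem_rev mem_iota -/e -/f -/N => ye.
  have a1 := hE y ltac:(clear -ye; lia); have a2 := hE N ltac:(clear -Ng; lia).
  rewrite eN in a2; rewrite a1 a2; clear; lia.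
have dE : sdim H (j, false) = (ell0 h H X j + ell1 h H X j - 1 + be N)%N.
  by have [z1 [z2 [_ _ -> _]]] := kindC_vol kj; rewrite /be eN.
have [dF sF] := fx false; have [dF' sF'] := fx true; rewrite xE1 ds in dF sF; rewrite xE2 ds' in dF' sF'.
have := GL_chain closedk sgE q1 dp (l1 := ell1 h H X j) (l0 := ell0 h H X j) (N := N) (be := be)
  isT isT Ng be1 (fun y ye => (step y ye).1) dE dF dF' sF sF'.
rewrite -/P1 -/P2 => <-; rewrite /X0factor kj ds ds' -xE1 -xE2 -/e -/f -/N.
split=> [[t [t' [T0 T1 T2 [_]]]]|[t [t' [T0 T1 T2 xu]]]]; [rewrite kj => xu|].
  exists t, t'; split=> // y ye; have [_ ->] := step y ltac:(clear -ye; lia); exact: T2.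
exists t, t'; split=> //; last by split=> //; rewrite kj.
by move=> y ye; have [_ <-] := step y ltac:(clear -ye; lia); exact: T2.
Qed.

(** The factor [j] sees the chain indices with i_j < i <= i_(j+1), where i_0 = 0 and i_(s+1) = m.
    Both conventions are imposed by hand, since [elt X 0] is the same as [elt X 1] and [elt X s.+1]
    is a default value. *)
Definition zone_lo (j : nat) : nat := if j == 0%N then 0%N else i_ j.
Definition zone_hi (j : nat) : nat := if j == s then m else i_ j.+1.
Definition zone j i := (zone_lo j < i <= zone_hi j)%N.

Lemma zone_ex i : (0 < i <= m)%N -> exists j : 'I_s.+1, zone j i.
Proof.
move=> iM; have ex : exists j, (i <= zone_hi j)%N && (j <= s)%N.
  by exists s; rewrite /zone_hi eqxx leqnn andbT; case/andP: iM.
case: (ex_minnP ex) => j /andP [ij js] jmin; exists (Ordinal (n := s.+1) (m := j) js).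
rewrite /zone /= ij andbT /zone_lo; case: eqP => [_|/eqP j0]; first by case/andP: iM.
rewrite ltnNge; apply/negP => le; have := jmin j.-1.
have e : zone_hi j.-1 = i_ j.
  by rewrite /zone_hi prednK ?lt0n //; case: eqP => // e; move: js e j0; clear; case: j => //= j; lia.
by rewrite e le /=; move: js j0; clear; case: j => //= j; lia.
Qed.

Lemma zone_cases (j : 'I_s.+1) i : zone j i ->
  [\/ [/\ kind X j = KindA, nat_of_ord j = 0%N & (0 < i <= i_ 1)%N],
      [/\ kind X j = KindB, nat_of_ord j = s & (i_ s < i <= m)%N]
    | kind X j = KindC /\ (i_ j < i <= i_ j.+1)%N].
Proof.
rewrite /zone /zone_lo /zone_hi /kind; have [j0|j0] := eqVneq (j : nat) 0%N.
  rewrite j0 eq_sym (gtn_eqF s_gt0) => iz; apply: Or31; split=> //.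
  by case: eqP => // e; move: iz; rewrite e; clear; lia.
have [js|js] := eqVneq (j : nat) s => iz; last by apply: Or33.
rewrite js in iz; apply: Or32; split=> //.
by case: eqP => // e; move: iz; rewrite e; clear; lia.
Qed.

Lemma zone_A (j : 'I_s.+1) i : kind X j = KindA -> (0 < i <= i_ 1)%N = zone j i.
Proof. by move=> /kindA [j0 _ _ _]; rewrite /zone /zone_lo /zone_hi j0 eq_sym (gtn_eqF s_gt0). Qed.

Lemma zone_B (j : 'I_s.+1) i : kind X j = KindB -> (i_ s < i <= m)%N = zone j i.
Proof.
by move=> /kindB [js _ _ _]; rewrite /zone /zone_lo /zone_hi js eqxx (gtn_eqF s_gt0).
Qed.

Lemma zone_C (j : 'I_s.+1) i : kind X j = KindC -> (i_ j < i <= i_ j.+1)%N = zone j i.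
Proof.
move=> /kindC [/andP [j0 js] _ _ _ _].
by rewrite /zone /zone_lo /zone_hi (gtn_eqF j0) (ltn_eqF js).
Qed.

Lemma elts_elt i : i \in elts X -> exists2 p, (p < s)%N & i = i_ p.+1.
Proof.
move=> iX; exists (index i (elts X)); first by rewrite -size_elts index_mem.
by rewrite /elt /= nth_index.
Qed.

Lemma elt_up j j' : (1 <= j)%N -> (j <= j' <= s)%N -> (i_ j <= i_ j')%N.
Proof.
move=> j0; elim: j' => [|j' IH] jj; first by move: jj; rewrite leqNgt j0.
have [<-//|ne] := eqVneq j j'.+1.
have jM : (j <= j' <= s)%N by clear -jj ne; lia.
have jM' : (1 <= j' < s)%N by clear -jj ne j0; lia.
exact: (leq_trans (IH jM) (ltnW (elt_lt jM'))).
Qed.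

(** * Openness of a point, factor by factor *)

Section OnePoint.
Variable c : chain Wk n.
Hypothesis cX : N_pts u h H X c.
Local Notation A_ := (chA c).
Local Notation B_ := (chB c).
Let cN : Npoint u m h H c. Proof. by case: cX. Qed.

Definition mid_open i := forall L, is_lattice L -> B_ i `<=` ext L -> ~ isotropic_pair u H L (A_ i.+1).

Lemma scale_ext_piO (L : set C) : is_lattice L ->
  (forall v w, ext L v -> ext L w -> piO (hk v w)) <-> L `<=` scale pi2 (dC L).
Proof.
move=> lL; split=> [I v Lv|I v w Lv Lw].
  apply/(scale_dC _ _ _ (pi_neq0 _)) => w Lw; apply/piO_integral/(wmap_piO u).
  by rewrite -(hk_wm u); apply: I; exact: ext_mem.
have := ext_mono (u := u) I Lv; have := scale_dKE u cardFq2 Hu Hh 1 lL; rewrite !expr1z => ->.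
by move=> /(scale_dK _ _ _ _ (pi_neq0 _)) /(_ _ Lw) /piO_integral.
Qed.

Lemma scale_ext_integral (L : set C) : is_lattice L ->
  (forall v w, ext L v -> ext L w -> integral (hk v w)) <-> L `<=` dC L.
Proof.
move=> lL; split=> [I v Lv w Lw|I v w Lv Lw].
  by apply/(wmap_integral u); rewrite -(hk_wm u); apply: I; exact: ext_mem.
by have := ext_mono (u := u) I Lv; rewrite -(dK_ext u cardFq2 Hu Hh lL); apply.
Qed.

(** The factors of kinds (b) and (c) see pi B_i in place of B_i; conditions on all lattices are
    matched by substituting pi L for L. *)
Lemma lattice_rescale (Pr : set C -> Prop) :
  (forall L, is_lattice L -> Pr L) <-> (forall L, is_lattice L -> Pr (scale pi2 L)).
Proof.
split=> HP L lL; first by apply: HP; have := lattice_scale 1 lL; rewrite expr1z.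
have := HP _ (lattice_scale (- 1) lL); rewrite scaleA exprN1 mulfV ?pi_neq0 // scale1E; exact.
Qed.

Lemma scale_subE (r : fld Wk) (A B : set Ck) : r != 0 -> scale r A `<=` scale r B <-> A `<=` B.
Proof.
move=> r0; split=> [AB v Av|]; last exact: scaleS.
have : scale r B (r *: v) by apply: AB; exists v.
by move/(scaleE _ _ r0); rewrite scalerA mulVf // scale1r.
Qed.

Lemma ext_pi (L : set C) : ext (scale pi2 L) = scale pik (ext L).
Proof. by rewrite ext_scale wmap_pi. Qed.

Lemma wpiV : wmap u pi2^-1 = pik^-1. Proof. by rewrite fmorphV wmap_pi. Qed.

Lemma mid_openE i : mid_open i <-> forall L, is_lattice L -> scale pik (B_ i) `<=` ext L ->
  ~ (forall v w, ext L v -> A_ i.+1 w -> piO (wmap u pi2^-1 * hk v w)).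
Proof.
rewrite [X in _ <-> X]lattice_rescale.
have iso L : (forall v w, ext (scale pi2 L) v -> A_ i.+1 w -> piO (wmap u pi2^-1 * hk v w)) <->
    isotropic_pair u H L (A_ i.+1).
  rewrite wpiV; split=> I v w; last first.
    rewrite ext_pi => -[v' Lv <-] Aw; rewrite hermZl mulKf ?pi_neq0 //; exact: I.
  by move=> Lv Aw; have := I (pik *: v) w; rewrite ext_pi hermZl mulKf ?pi_neq0 //; apply=> //; exists v.
split=> M L lL BL I.
  apply: (M L lL _ (proj1 (iso L) I)).
  by apply: (proj1 (scale_subE _ _ (pi_neq0 Wk))); rewrite -ext_pi.
by apply: (M L lL _ (proj2 (iso L) I)); rewrite ext_pi; exact: scaleS.
Qed.

(** Fullness speaks of the lattice at i_1, the gaps of the missing indices below i_1, and the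
    self-dual middle gap of the index 0. The orthogonality relations among the flags hold for every
    point, by the duality between A_i and B_i. *)
Lemma A_open (j : 'I_s.+1) : kind X j = KindA -> fflag h (fun e => f_map u b c (j, e)) ->
  X0factor j12 h b (fun e => f_map u b c (j, e)) <->
  [/\ forall L, is_lattice L -> B_ (i_ 1) `<=` ext L -> L `<=` Lam0 (i_ 1) -> Lam0 (i_ 1) `<=` L,
      forall i, (0 < i < i_ 1)%N -> mid_open i
    & h 1%N != 0%N -> forall L, is_lattice L -> A_ 1%N `<=` ext L -> ~ L `<=` scale pi2 (dC L)].
Proof.
move=> kj fx; have [j0 iX i0 iM] := kindA kj; have pd := pd_A kj.
have a0 := oner_neq0 (fld W2); have fa := rmorph1 (frob W2).
have dp := gram_dual u cardFq2 Hu Hh a0 fa pd sgE.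
set e := i_ 1 in iX i0 iM *; set rv := redv (wm (b (j, false))).
have xE : f_map u b c (j, false) = [seq rv (A_ (e.+1 - y)%N) | y <- iota 1 e] ++
    [seq rv (B_ (e.+1 - y)%N) | y <- rev (iota 1 e)].
  by rewrite /f_map /members /= kj map_cat -!map_comp rev_iota_map [X in _ ++ X]iota_rev_map.
have [[lT _ _] _] := vert0 iX i0.
have sA i : (0 < i <= e)%N -> [/\ submod (A_ i), submod (B_ i),
    ext (scale pi2 (dC (Lam0 e))) `<=` A_ i, A_ i `<=` B_ i & B_ i `<=` ext (Lam0 e)].
  move=> ie; have im : (1 <= i <= m)%N by clear -ie iM; lia.
  have [lA lB] := np_lattice cN im; have [_ _ AB _] := np_dual cN im.
  have [Aei Bie] := np_mono cardFq2 Hu cN (i := i) (j := e) ltac:(clear -ie; lia) ltac:(clear -ie iM; lia).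
  have [_ dB _ _] := np_dual cN iM.
  have BT : B_ e `<=` ext (Lam0 e) by case: cX => _ h0 _; exact: h0.
  split=> //; [exact: submod_lattice|exact: submod_lattice| |exact: (subset_trans Bie BT)].
  rewrite ext_pi -(dK_ext u cardFq2 Hu Hh lT); apply: subset_trans Aei.
  exact: (subset_trans (scaleS (dK_anti BT)) dB).
have KA := kindA_X0 kj fx xE; cbv zeta in KA; apply: (iff_trans KA) => {KA}; rewrite -/e.
have inv y : (0 < y <= e)%N -> (0 < e.+1 - y <= e)%N by clear; lia.
have a1 (x : fld Wk) : wmap u 1 * x = x by rewrite rmorph1 mul1r.
have full := full_latt (u := u) cardFq2 Hu Hh a0 fa pd sgE.
have nsl := no_stable_latt (u := u) cardFq2 Hu Hh a0 fa pd sgE.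
have nss := no_stable_self_latt (u := u) cardFq2 Hu Hh a0 fa pd sgE.
have perps i : (0 < i <= e)%N -> let P := gramG j12 H 1 (b (j, false)) (b (j, false)) in
    (perp q P (rv (A_ i)) <= rv (B_ i))%VS /\ (perp q P (rv (B_ i)) <= rv (A_ i))%VS.
  move=> ie; have [sa sb BA AB BT] := sA i ie; have im : (1 <= i <= m)%N by clear -ie iM; lia.
  have [dA dB _ _] := np_dual cN im.
  have TA := subset_trans AB BT; have BB := subset_trans BA AB.
  split; apply: (perp_le cardFq2 Hu Hh a0 fa pd sgE) => // v I; [apply: dA | apply: dB];
    apply/(scale_dK _ _ _ _ (pi_neq0 _)) => w /I; rewrite a1 => /piO_integral; exact.
have ee : (0 < e <= e)%N by rewrite leqnn andbT; case/andP: iM.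
have e1 : (e.+1 - e = 1)%N by rewrite subSnn.
rewrite subSS subn0 e1; have [sae sbe BAe ABe BTe] := sA e ee.
have F1 := full _ sbe (subset_trans BAe ABe) BTe.
have [sa1 sb1 BA1 AB1 BT1] := sA 1%N ltac:(clear -ee; lia).
have S1 := nss _ sa1 BA1 (subset_trans AB1 BT1).
have selfE L : is_lattice L -> (forall v w, ext L v -> ext L w -> piO (wmap u 1 * hk v w)) <->
    L `<=` scale pi2 (dC L).
  move=> lL; rewrite -(scale_ext_piO lL); split=> I v w Lv Lw; first by rewrite -[hk v w]a1; exact: I.
  by rewrite a1; exact: I.
have midE y : (0 < y < e)%N ->
    no_stable q (gramG j12 H 1 (b (j, false)) (b (j, false)))
      (gramG j12 H 1 (b (j, false)) (b (j, false))) (rv (A_ (e.+1 - y)%N)) (rv (B_ (e.+1 - y.+1)%N)) <->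
    mid_open (e - y)%N.
  move=> ye; have -> : (e.+1 - y.+1 = e - y)%N by rewrite subSS.
  have -> : (e.+1 - y = (e - y).+1)%N by clear -ye; lia.
  have [sa sb BA AB BT] := sA (e - y).+1 ltac:(clear -ye; lia).
  have [sa' sb' BA' AB' BT'] := sA (e - y)%N ltac:(clear -ye; lia).
  have key := nsl _ _ sb' (subset_trans BA' AB') BT' sa BA (subset_trans AB BT).
  split=> [/(no_stable_sym sgE dp) /key M L lL BL I|M].
    by apply: (M L lL BL) => v w Lv Aw; rewrite a1; exact: I.
  apply: (no_stable_sym sgE dp); apply/key => L lL BL I.
  by apply: (M L lL BL) => v w Lv Aw; rewrite -[hk v w]a1; exact: I.
split=> [[_ /F1 F M O]|[F M O]]; split.
- exact: F.
- move=> i ie; have ie' : (0 < e - i < e)%N by clear -ie; lia.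
  have := (midE _ ie').1 (M _ ie'); rewrite subKn //; clear -ie; lia.
- by move=> h1 L lL AL /(selfE L lL); apply: (S1.1 (O h1)).
- by move=> y ye; exact/perps/inv.
- exact/F1.
- by move=> y ye; apply/midE => //; apply: M; clear -ye; lia.
- by move=> h1; apply/S1 => L lL AL /(selfE L lL); exact: O.
Qed.

Lemma piV_perp (M : set Ck) v : (forall w, M w -> piO (wmap u pi2^-1 * hk v w)) ->
  scale (pik ^+ 2) (dK M) v.
Proof.
move=> I; apply/scale_dK; first by rewrite expf_neq0 ?pi_neq0.
by move=> w /I; rewrite wpiV => /piO_integral; rewrite mulrA -invfM -expr2.
Qed.

Lemma piV_perp_pi (M : set Ck) v : (forall w, scale pik M w -> piO (wmap u pi2^-1 * hk v w)) ->
  scale pik (dK M) v.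
Proof.
move=> I; apply/(scale_dK _ _ _ _ (pi_neq0 _)) => w Mw.
have /I : scale pik M (pik *: w) by exists w.
rewrite (hermZr (frob Wk)) wpiV /Defs.pi frob_emb frobO_unif mulKf ?pi_neq0 //.
by move/piO_integral.
Qed.

Lemma pi2_dA i : (1 <= i <= m)%N -> scale (pik ^+ 2) (dK (A_ i)) `<=` scale pik (B_ i).
Proof. by move=> /(np_dual cN) [dA _ _ _]; rewrite expr2 -scaleA; exact: scaleS. Qed.

Lemma ext_pi2_dC (L : set C) : is_lattice L ->
  ext (scale (pi2 ^+ 2) (dC L)) = scale (pik ^+ 2) (dK (ext L)).
Proof. by move=> lL; have := scale_dKE u cardFq2 Hu Hh 2 lL; rewrite -!exprnP. Qed.

Lemma B_open (j : 'I_s.+1) : kind X j = KindB -> fflag h (fun e => f_map u b c (j, e)) ->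
  X0factor j12 h b (fun e => f_map u b c (j, e)) <->
  [/\ forall L, is_lattice L -> A_ (i_ s).+1 `<=` ext L -> L `<=` Lam1 (i_ s) -> Lam1 (i_ s) `<=` L,
      forall i, (i_ s < i < m)%N -> mid_open i
    & h m != n -> forall L, is_lattice L -> B_ m `<=` ext L -> ~ L `<=` dC L].
Proof.
move=> kj fx; have [js iX im iM] := kindB kj; have pd := pd_B kj.
have a0 := invr_neq0 (pi_neq0 W2); have fa := frob_piV.
have dp := gram_dual u cardFq2 Hu Hh a0 fa pd sgE.
set e := i_ s in iX im iM *; set rv := redv (wm (b (j, false))); set E := (m - e)%N.
have xE : f_map u b c (j, false) = [seq rv (scale pik (B_ (e + y)%N)) | y <- iota 1 E] ++
    [seq rv (A_ (e + y)%N) | y <- rev (iota 1 E)].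
  by rewrite /f_map /members /= kj map_cat -!map_comp.
have [[lT _ _] _] := vert1 iX im.
have em : (1 <= e.+1 <= m)%N by [].
have AT : A_ e.+1 `<=` ext (Lam1 e) by case: cX => _ _ h0; exact: h0.
have BBe : ext (scale (pi2 ^+ 2) (dC (Lam1 e))) `<=` scale pik (B_ e.+1).
  by rewrite ext_pi2_dC //; apply: subset_trans (scaleS (dK_anti AT)) (pi2_dA em).
have sA i : (e < i <= m)%N -> [/\ submod (A_ i), submod (scale pik (B_ i)),
    ext (scale (pi2 ^+ 2) (dC (Lam1 e))) `<=` scale pik (B_ i), scale pik (B_ i) `<=` A_ i
    & A_ i `<=` ext (Lam1 e)].
  move=> ie; have im' : (1 <= i <= m)%N by clear -ie; lia.
  have [lA lB] := np_lattice cN im'; have [_ _ _ BA] := np_dual cN im'.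
  have [Aei Bie] := np_mono cardFq2 Hu cN (i := e.+1) (j := i) isT ie.
  split=> //; [exact: submod_lattice|exact/submod_scale/submod_lattice| |exact: (subset_trans Aei AT)].
  exact: (subset_trans BBe (scaleS Bie)).
have KB := kindB_X0 kj fx xE; cbv zeta in KB; apply: (iff_trans KB) => {KB}; rewrite -/e -/E.
have eE : (e + E = m)%N by rewrite subnKC // ltnW.
have full := full_latt (u := u) cardFq2 Hu Hh a0 fa pd sgE.
have nsl := no_stable_latt (u := u) cardFq2 Hu Hh a0 fa pd sgE.
have nss := no_stable_self_latt (u := u) cardFq2 Hu Hh a0 fa pd sgE.
have rng y : (0 < y <= E)%N -> (e < e + y <= m)%N by rewrite -eE; clear; lia.
have perps i : (e < i <= m)%N -> let P := gramG j12 H pi2^-1 (b (j, false)) (b (j, false)) in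
    (perp q P (rv (scale pik (B_ i))) <= rv (A_ i))%VS /\
    (perp q P (rv (A_ i)) <= rv (scale pik (B_ i)))%VS.
  move=> ie; have [sa sb BB BA AT'] := sA i ie; have im' : (1 <= i <= m)%N by clear -ie; lia.
  have [_ dB _ _] := np_dual cN im'; have BT := subset_trans BA AT'; have BA' := subset_trans BB BA.
  split; apply: (perp_le cardFq2 Hu Hh a0 fa pd sgE) => // v I.
    exact/dB/piV_perp_pi.
  exact/(pi2_dA im')/piV_perp.
have [sa1 sb1 BB1 BA1 AT1] := sA e.+1 ltac:(clear -iM; lia).
have F1 := full _ sa1 (subset_trans BB1 BA1) AT1; have A1 : A_ (e + 1)%N = A_ e.+1 by rewrite addn1.
rewrite -A1 -/rv in F1.
have [sam sbm BBm BAm ATm] := sA m ltac:(clear -iM; lia).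
have S1 := nss _ sbm BBm (subset_trans BAm ATm); have BE : B_ (e + E)%N = B_ m by rewrite eE.
rewrite -BE -/rv in S1.
have selfE L : is_lattice L -> (forall v w, ext (scale pi2 L) v -> ext (scale pi2 L) w ->
    piO (wmap u pi2^-1 * hk v w)) <-> L `<=` dC L.
  have e0 x y : piO (wmap u pi2^-1 * hk (pik *: x) (pik *: y)) <-> integral (hk x y).
    rewrite hermZl (hermZr (frob Wk)) wpiV mulKf ?pi_neq0 // /Defs.pi frob_emb frobO_unif.
    by rewrite piO_integral mulKf ?pi_neq0.
  move=> lL; rewrite -(scale_ext_integral lL) ext_pi; split=> I v w.
    by move=> Lv Lw; apply/e0; apply: I; [exists v|exists w].
  by move=> [v' Lv <-] [w' Lw <-]; apply/e0; exact: I.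
have opE : (forall L, is_lattice L -> scale pik (B_ m) `<=` ext L ->
      ~ (forall v w, ext L v -> ext L w -> piO (wmap u pi2^-1 * hk v w))) <->
    (forall L, is_lattice L -> B_ m `<=` ext L -> ~ L `<=` dC L).
  apply: (iff_trans (lattice_rescale _)); split=> M L lL BL I.
    by apply: (M L lL); [rewrite ext_pi; exact: scaleS | apply: (selfE L lL).2].
  apply: (M L lL _ ((selfE L lL).1 I)).
  by apply: (proj1 (scale_subE _ _ (pi_neq0 Wk))); rewrite -ext_pi.
have midE y : (0 < y < E)%N ->
    no_stable q (gramG j12 H pi2^-1 (b (j, false)) (b (j, false)))
      (gramG j12 H pi2^-1 (b (j, false)) (b (j, false))) (rv (scale pik (B_ (e + y)%N)))
      (rv (A_ (e + y.+1)%N)) <-> mid_open (e + y)%N.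
  move=> ye; have [sa sb BB BA AT'] := sA _ (rng y ltac:(clear -ye; lia)).
  have [sa' sb' BB' BA' AT2] := sA _ (rng y.+1 ltac:(clear -ye; lia)).
  have key := nsl _ _ sb BB (subset_trans BA AT') sa' (subset_trans BB' BA') AT2.
  by apply: (iff_trans key); rewrite addnS; apply: iff_sym; exact: mid_openE.
split=> [[_ /F1 F M O]|[F M O]]; split.
- by rewrite -A1.
- move=> i ie; have ie' : (0 < i - e < E)%N by rewrite /E; clear -ie; lia.
  have := (midE _ ie').1 (M _ ie'); rewrite subnKC //; clear -ie; lia.
- by move=> h1; apply: opE.1; rewrite -BE; exact: (S1.1 (O h1)).
- by move=> y ye; exact/perps/rng.
- by apply: F1.2; rewrite A1.
- by move=> y ye; apply/midE => //; apply: M; rewrite -eE; clear -ye; lia.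
- by move=> h1; apply: S1.2; rewrite BE; apply: opE.2; exact: O.
Qed.

(** The two spaces carry one fullness condition each: the flag in V_1 tests the lattice Lam0 at the
    upper end, the flag in V_2 the lattice Lam1 at the lower end. *)
Lemma C_open (j : 'I_s.+1) : kind X j = KindC -> fflag h (fun e => f_map u b c (j, e)) ->
  X0factor j12 h b (fun e => f_map u b c (j, e)) <->
  [/\ forall L, is_lattice L -> A_ (i_ j).+1 `<=` ext L -> L `<=` Lam1 (i_ j) -> Lam1 (i_ j) `<=` L,
      forall L, is_lattice L -> B_ (i_ j.+1) `<=` ext L -> L `<=` Lam0 (i_ j.+1) ->
        Lam0 (i_ j.+1) `<=` L
    & forall i, (i_ j < i < i_ j.+1)%N -> mid_open i].
Proof.
move=> kj fx; have [jM iX iX' lt [im i0]] := kindC kj; have pd := pd_C kj.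
have a0 := invr_neq0 (pi_neq0 W2); have fa := frob_piV.
have pd' := pair_datum_sym pd; have [[lT0 _ _] fM] := vert0 iX' i0; have [[lT1 _ _] em] := vert1 iX im.
set e := i_ j in iX im lt em *; set f := i_ j.+1 in iX' i0 lt fM *; set N := (f - e)%N.
set rv := redv (wm (b (j, false))); set rv2 := redv (wm (b (j, true))).
have xE1 : f_map u b c (j, false) = [seq rv (scale pik (B_ (e + y)%N)) | y <- iota 1 N].
  by rewrite /f_map /members /= kj -!map_comp.
have xE2 : f_map u b c (j, true) = [seq rv2 (A_ (e + y)%N) | y <- rev (iota 1 N)].
  by rewrite /f_map /members /= kj -!map_comp.
have AT : A_ e.+1 `<=` ext (Lam1 e) by case: cX => _ _ h0; exact: h0.
have BT : B_ f `<=` ext (Lam0 f) by case: cX => _ h0 _; exact: h0.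
have BBe : ext (scale (pi2 ^+ 2) (dC (Lam1 e))) `<=` scale pik (B_ e.+1).
  by rewrite ext_pi2_dC //; apply: subset_trans (scaleS (dK_anti AT)) (pi2_dA em).
have BAf : ext (scale pi2 (dC (Lam0 f))) `<=` A_ f.
  rewrite ext_pi -(dK_ext u cardFq2 Hu Hh lT0); have [_ dB _ _] := np_dual cN fM.
  exact: (subset_trans (scaleS (dK_anti BT)) dB).
have sA i : (e < i <= f)%N -> [/\ submod (A_ i), ext (scale pi2 (dC (Lam0 f))) `<=` A_ i
    & A_ i `<=` ext (Lam1 e)] /\ [/\ submod (scale pik (B_ i)),
    ext (scale (pi2 ^+ 2) (dC (Lam1 e))) `<=` scale pik (B_ i)
    & scale pik (B_ i) `<=` ext (scale pi2 (Lam0 f))].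
  move=> ie; have im' : (1 <= i <= m)%N by clear -ie fM; lia.
  have [lA lB] := np_lattice cN im'.
  have [Aei Bie] := np_mono cardFq2 Hu cN (i := e.+1) (j := i) isT ltac:(clear -ie fM; lia).
  have [Aif Bif] := np_mono cardFq2 Hu cN (i := i) (j := f) ltac:(clear -ie; lia) ltac:(clear -ie fM; lia).
  split; split; [exact: submod_lattice|exact: (subset_trans BAf Aif)|exact: (subset_trans Aei AT)
    |exact/submod_scale/submod_lattice|exact: (subset_trans BBe (scaleS Bie))|].
  by rewrite ext_pi; exact: (scaleS (subset_trans Bif BT)).
have KC := kindC_X0 kj fx xE1 xE2; cbv zeta in KC; apply: (iff_trans KC) => {KC}; rewrite -/e -/f -/N.
have eN : (e + N = f)%N by rewrite subnKC // ltnW.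
have full := full_latt (u := u) cardFq2 Hu Hh a0 fa pd sgE.
have full' := full_latt (u := u) cardFq2 Hu Hh a0 fa pd' sgE.
have nsl := no_stable_latt (u := u) cardFq2 Hu Hh a0 fa pd sgE.
have rng y : (0 < y <= N)%N -> (e < e + y <= f)%N by rewrite -eN; clear; lia.
have [[sae BAe ATe] _] := sA e.+1 ltac:(clear -lt; lia).
have F1 := full' _ sae BAe ATe; have A1 : A_ (e + 1)%N = A_ e.+1 by rewrite addn1.
rewrite -A1 -/rv2 in F1.
have [_ [sbf BBf BTf]] := sA f ltac:(clear -lt; lia).
have F0 := full _ sbf BBf BTf; have BN : B_ (e + N)%N = B_ f by rewrite eN.
rewrite -BN -/rv in F0.
have fullE : (forall L, is_lattice L -> scale pik (B_ f) `<=` ext L -> L `<=` scale pi2 (Lam0 f) ->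
      scale pi2 (Lam0 f) `<=` L) <->
    (forall L, is_lattice L -> B_ f `<=` ext L -> L `<=` Lam0 f -> Lam0 f `<=` L).
  have sc (A A' : set C) : scale pi2 A `<=` scale pi2 A' -> A `<=` A'.
    move=> AA v Av; have [v' Av' /(congr1 ( *:%R pi2^-1))] : scale pi2 A' (pi2 *: v).
      by apply: AA; exists v.
    by rewrite !scalerA mulVf ?pi_neq0 // !scale1r => <-.
  apply: (iff_trans (lattice_rescale _)); split=> M L lL BL LL.
    by apply: sc; apply: (M L lL); [rewrite ext_pi; exact: scaleS | exact: scaleS].
  apply: scaleS; apply: (M L lL _ (sc _ _ LL)).
  by apply: (proj1 (scale_subE _ _ (pi_neq0 Wk))); rewrite -ext_pi.
have midE y : (0 < y < N)%N ->
    no_stable q (gramG j12 H pi2^-1 (b (j, false)) (b (j, true)))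
      (gramG j12 H pi2^-1 (b (j, true)) (b (j, false))) (rv (scale pik (B_ (e + y)%N)))
      (rv2 (A_ (e + y.+1)%N)) <-> mid_open (e + y)%N.
  move=> ye; have [_ [sb BB BT']] := sA _ (rng y ltac:(clear -ye; lia)).
  have [[sa BA AT'] _] := sA _ (rng y.+1 ltac:(clear -ye; lia)).
  by apply: (iff_trans (nsl _ _ sb BB BT' sa BA AT')); rewrite addnS; apply: iff_sym; exact: mid_openE.
split=> [[_ F0' /F1 F1' M]|[F1' F0' M]]; split.
- by rewrite -A1.
- by apply: fullE.1; rewrite -BN; exact: F0.1.
- move=> i ie; have ie' : (0 < i - e < N)%N by rewrite /N; clear -ie; lia.
  have := (midE _ ie').1 (M _ ie'); rewrite subnKC //; clear -ie; lia.
- move=> y ye; have [[sa BA AT'] [sb BB BT']] := sA _ (rng y ye).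
  have im' : (1 <= e + y <= m)%N by have := rng y ye; clear -fM; lia.
  have [_ dB _ _] := np_dual cN im'.
  split; [apply: (perp_le cardFq2 Hu Hh a0 fa pd sgE) => // v I
    | apply: (perp_le cardFq2 Hu Hh a0 fa pd' sgE) => // v I].
    exact/(pi2_dA im')/piV_perp.
  exact/dB/piV_perp_pi.
- by apply: F0.2; rewrite BN; exact: fullE.2.
- by apply: F1.2; rewrite A1.
- by move=> y ye; apply/midE => //; apply: M; rewrite -eN; clear -ye; lia.
Qed.

(** Each clause of [open_point] belongs to one factor: Lam0 at [i] to the factor ending there, Lam1
    at [i] to the one starting there, and a missing index to the factor whose zone surrounds it. *)
Lemma open_factors : (forall j : 'I_s.+1, fflag h (fun e => f_map u b c (j, e))) ->
  open_point u H h X c <-> forall j : 'I_s.+1, X0factor j12 h b (fun e => f_map u b c (j, e)).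
Proof.
move=> fx; have sg0 := s_gt0.
have kA (j : 'I_s.+1) : nat_of_ord j = 0%N -> i_ 1 != 0%N -> kind X j = KindA.
  by move=> j0 i0; rewrite /kind j0 /= (negbTE i0).
have kB (j : 'I_s.+1) : nat_of_ord j = s -> i_ s != m -> kind X j = KindB.
  by move=> js im; rewrite /kind js eqxx (negbTE im) (gtn_eqF sg0).
have kC (j : 'I_s.+1) : (1 <= j < s)%N -> kind X j = KindC.
  by move=> /andP [j0 js]; rewrite /kind (gtn_eqF j0) (ltn_eqF js).
have ltX i j : i \in elts X -> (1 <= j < s)%N -> (i_ j < i < i_ j.+1)%N -> False.
  move=> /elts_elt [p ps ->] jM pj; have [le|gt] := leqP p.+1 j.
    by have := @elt_up p.+1 j isT ltac:(clear -le jM; lia); clear -pj; lia.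
  by have := @elt_up j.+1 p.+1 isT ltac:(clear -gt ps; lia); clear -pj; lia.
have lowX i : i \in elts X -> (i_ 1 <= i)%N.
  by move=> /elts_elt [p ps ->]; exact: elt_up.
have hiX i : i \in elts X -> (i <= i_ s)%N.
  by move=> /elts_elt [p ps ->]; apply: elt_up => //; rewrite ps leqnn.
split=> [op j|fo].
  case kd: (kind X j).
  - by rewrite /X0factor kd; split; [exact: fx | rewrite kd].
  - have [j0 iX i0 iM] := kindA kd; apply/(A_open kd (fx j)); split.
    + exact: op_full0 op _ iX i0.
    + move=> i ie; apply: (op_mid op); last by clear -ie iM; lia.
      by apply/negP => /lowX; clear -ie; lia.
    + move=> h1; apply: (op_0 op) => //; apply/negP => /lowX; rewrite leqn0; exact/negP.
  - have [js iX im iM] := kindB kd; apply/(B_open kd (fx j)); split.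
    + exact: op_full1 op _ iX im.
    + move=> i ie; apply: (op_mid op); last by clear -ie; lia.
      by apply/negP => /hiX; clear -ie; lia.
    + by move=> h1; apply: (op_m op) => //; apply/negP => /hiX; clear -iM; lia.
  - have [jM iX iX' lt [im i0]] := kindC kd; have fm := elts_le iX'.
    apply/(C_open kd (fx j)); split.
    + exact: op_full1 op _ iX im.
    + exact: op_full0 op _ iX' i0.
    + move=> i ie; apply: (op_mid op); last by clear -ie fm; lia.
      by apply/negP => /ltX H'; apply: H' jM ie.
split.
- move=> i /elts_elt [p ps ->] i0; pose j : 'I_s.+1 := inord p.
  have jp : nat_of_ord j = p by rewrite inordK // ltnW.
  have [p0|p0] := eqVneq p 0%N.
    rewrite p0 in jp i0 *; have kd := kA j jp i0.
    by have /(A_open kd (fx j)) [] := fo j.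
  have kd : kind X j = KindC by apply: kC; rewrite jp lt0n p0.
  by have /(C_open kd (fx j)) [_ + _] := fo j; rewrite jp.
- move=> i /elts_elt [p ps ->] im; pose j : 'I_s.+1 := inord p.+1.
  have jp : nat_of_ord j = p.+1 by rewrite inordK // ltnW.
  have [p0|p0] := eqVneq p.+1 s.
    rewrite p0 in jp im *; have kd := kB j jp im.
    by have /(B_open kd (fx j)) [] := fo j.
  have kd : kind X j = KindC by apply: kC; rewrite jp /= ltn_neqAle p0.
  by have /(C_open kd (fx j)) [+ _ _] := fo j; rewrite jp.
- move=> i iX iM; have [|j jz] := zone_ex (i := i); first by clear -iM; lia.
  have nX p : (1 <= p <= s)%N -> i != i_ p.
    by move=> pM; apply: contraNneq iX => ->; exact: elt_mem.
  have [[kd j0 iz]|[kd js iz]|[kd iz]] := zone_cases jz.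
  + have /(A_open kd (fx j)) [_ M _] := fo j; apply: M.
    by have := nX 1%N ltac:(clear -sg0; lia); clear -iz; lia.
  + by have /(B_open kd (fx j)) [_ M _] := fo j; apply: M; clear -iz iM; lia.
  + have [jM _ _ _ _] := kindC kd; have /(C_open kd (fx j)) [_ _ M] := fo j; apply: M.
    by have := nX j.+1 ltac:(clear -jM; lia); clear -iz; lia.
- move=> iX; have i0 : i_ 1 != 0%N.
    apply: contraNneq iX => e0; have : i_ 1 \in elts X by apply: elt_mem; rewrite sg0.
    by rewrite e0.
  have kd := kA ord0 erefl i0; by have /(A_open kd (fx _)) [] := fo ord0.
- move=> iX; have im : i_ s != m.
    apply: contraNneq iX => e0; have : i_ s \in elts X by apply: elt_mem; rewrite sg0 leqnn.
    by rewrite e0.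
  have kd := kB ord_max erefl im; by have /(B_open kd (fx _)) [] := fo ord_max.
Qed.

End OnePoint.

(** The piece of a chain determined by one factor; its values outside the zone are unconstrained.
    [zc_hi] and [zc_lo] bound it by the lattices of the index, along which neighbouring pieces are
    glued. *)
Record zone_chain (x : Xfam k H X) (j : 'I_s.+1) (c : chain Wk n) : Prop := ZoneChain {
  zc_dual : forall i, zone j i -> [/\ is_lattice (chA c i), is_lattice (chB c i) &
    [/\ colen 1 (scale pik (dK (chA c i))) (chB c i), chB c i `<=` dK (chA c i),
        colen 1 (scale pik (dK (chB c i))) (chA c i) & chA c i `<=` dK (chB c i)]];
  zc_colen : forall i, zone j i ->
    scale pik (chB c i) `<=` chA c i /\ colen (h i) (chA c i) (chB c i);
  zc_mono : forall i, zone j i -> zone j i.+1 ->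
    chA c i.+1 `<=` chA c i /\ chB c i `<=` chB c i.+1;
  zc_hi : nat_of_ord j != s -> forall i, zone j i -> chB c i `<=` ext (Lam0 (zone_hi j));
  zc_lo : nat_of_ord j != 0%N -> forall i, zone j i -> chA c i `<=` ext (Lam1 (zone_lo j));
  zc_f : forall e, f_map u b c (j, e) = x (j, e)
}.

(** The orthogonality relations of the flags become the duality relations of the chain by
    [lift_dual_chain]; inclusions and colengths are read off from dimensions. *)
Lemma zone_chain_A (x : Xfam k H X) (j : 'I_s.+1) : kind X j = KindA ->
  fflag h (fun e => x (j, e)) -> X0factor j12 h b (fun e => x (j, e)) -> exists c, zone_chain x j c.
Proof.
move=> kj fx x0; have [j0 iX i0 iM] := kindA kj; have pd := pd_A kj.
have a0 := oner_neq0 (fld W2); have fa := rmorph1 (frob W2).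
have [ds hE dE ds'] := kindA_sdims kj; cbv zeta in ds, hE; set e := i_ 1 in iX i0 iM ds hE *.
set al := fun y => dh (e.+1 - y)%N e in ds hE.
have [dF sF] := fx false; have [dF' _] := fx true.
have sz : size (x (j, false)) = (e + e)%N.
  by rewrite -(size_map (fun A : {vspace 'rV[k]_(sdim H (j, false))} => \dim A)) dF ds size_cat !size_map size_rev size_iota.
have xE := seq_two_iota 0%VS sz.
move: (fun y => nth _ (take _ _) _) (fun y => nth _ (drop _ _) _) xE => Q Q' xE.
have [perps _ _ _] := (kindA_X0 kj fx xE).1 x0; rewrite -/e in perps.
rewrite xE ds in dF; rewrite xE in sF.
have al_inc y : (0 < y < e)%N -> (al y <= al y.+1)%N.
  move=> ye; have h1 := hE y ltac:(clear -ye; lia); have h2 := hE y.+1 ltac:(clear -ye; lia).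
  have := h_mono (i := (e.+1 - y.+1)%N) (j := (e.+1 - y)%N) ltac:(clear -ye; lia) ltac:(clear -ye iM; lia).
  by move: h1 h2; rewrite -/(al y) -/(al y.+1); clear; lia.
have al_bd y : (0 < y <= e)%N -> (2 * al y <= h e)%N.
  by move=> ye; rewrite (hE y ye) -/(al y); clear; lia.
have UL := U_list dF sF al_inc al_bd.
have lbk := ext_lb1 u cardFq2 Hu Hh a0 fa pd sgE.
set T := Lam0 e in pd lbk; set B := scale pi2 (dC T) in pd lbk.
have sB : submod (ext B) by exact: ext_submod. have sT : submod (ext T) by exact: ext_submod.
have eBT : ext B `<=` ext T by exact/ext_mono/(pd_BT1 pd).
set bk := wm (b (j, false)) in lbk.
have chain1 y : (0 < y <= e)%N -> _ := fun ye =>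
  lift_dual_chain u cardFq2 Hu Hh a0 fa pd sgE (perps y ye).1 (perps y ye).2.
pose c : chain Wk n := fun i => (liftv (ext B) bk (Q (e.+1 - i)%N), liftv (ext B) bk (Q' (e.+1 - i)%N)).
have inv i : zone j i -> (0 < e.+1 - i <= e)%N /\ (e.+1 - (e.+1 - i) = i)%N.
  by rewrite -(zone_A _ kj) -/e; clear; lia.
have s1 (L : set Ck) : scale (wmap u 1) L = L by rewrite rmorph1 scale1E.
exists c; split.
- move=> i iz; have [ye _] := inv i iz; have [d1 d2 _ _] := UL _ ye.
  have := chain1 _ ye; rewrite s1 => H'; case: H' => [|lA lB CC _]; last by split.
  by rewrite d1 d2 dE; have := al_bd _ ye; have l0 : (0 < ellA h H X)%N by []; move: l0; rewrite -/e; clear; lia.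
- move=> i iz; have [ye e1] := inv i iz; have [d1 d2 QQ _] := UL _ ye; split.
    move=> _ [v Lv <-]; apply: lift_sup; apply: (pi_top sB lbk).
    exact: (lift_sub sT eBT lbk Lv).
  apply: (colen_lift sT sB lbk) => //; rewrite d1 d2.
  by rewrite -[X in (_ + h X)%N]e1; have := hE _ ye; clear; lia.
- move=> i iz iz1; have [ye _] := inv i.+1 iz1; have [ye0 _] := inv i iz.
  have [_ _ _ /(_ _) []] := UL _ ye; first by move: ye0; clear; lia.
  have -> : ((e.+1 - i.+1).+1 = e.+1 - i)%N by move: ye0; clear; lia.
  by move=> Q1 Q2; split; exact: liftS.
- move=> js i iz; have -> : zone_hi j = e by rewrite /zone_hi (negbTE js) j0.
  exact: (lift_sub sT eBT lbk).
- by rewrite j0.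
- case.
    rewrite /f_map /members /= kj /=; move: dF'; rewrite /= ds'; by case: (x (j, true)).
  rewrite xE /f_map /members /= kj map_cat -!map_comp -/e rev_iota_map [X in _ ++ X]iota_rev_map.
  congr (_ ++ _); apply/eq_in_map => y; rewrite ?mem_rev mem_iota => ye.
    have e2 : (e.+1 - (e.+1 - y) = y)%N by clear -ye; lia.
    by rewrite /chA /c /= e2; exact: (redv_lift sB lbk).
  have e2 : (e.+1 - (e.+1 - y) = y)%N by clear -ye; lia.
  by rewrite /chB /c /= e2; exact: (redv_lift sB lbk).
Qed.

Lemma scale_piVK (L : set Ck) : scale pik (scale (wmap u pi2^-1) L) = L.
Proof. by rewrite wpiV scaleA divff ?pi_neq0 // scale1E. Qed.

Lemma sub_scale_piV (L M : set Ck) : (forall v, L v -> M (pik *: v)) -> L `<=` scale (wmap u pi2^-1) M.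
Proof.
move=> LM v Lv; rewrite wpiV; apply/scaleE; first by rewrite invr_eq0 pi_neq0.
by rewrite invrK; exact: LM.
Qed.

Lemma vol_scale_piV (L : set Ck) z : vol L z -> vol (scale (wmap u pi2^-1) L) (z - n%:Z).
Proof. by move=> /(vol_scale (-1)); rewrite wpiV exprN1 mulrN1. Qed.

Lemma zone_chain_B (x : Xfam k H X) (j : 'I_s.+1) : kind X j = KindB ->
  fflag h (fun e => x (j, e)) -> X0factor j12 h b (fun e => x (j, e)) -> exists c, zone_chain x j c.
Proof.
move=> kj fx x0; have [js iX im iM] := kindB kj; have pd := pd_B kj.
have a0 := invr_neq0 (pi_neq0 W2); have fa := frob_piV.
have [ds hE dE ds'] := kindB_sdims kj; cbv zeta in ds, hE, dE.
set e := i_ s in iX im iM pd ds hE dE *; set E := (m - e)%N in ds hE.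
set al := fun y => dh e.+1 (e + y)%N in ds hE; set hh := (n - h e.+1)%N in ds dE.
have [dF sF] := fx false; have [dF' _] := fx true.
have sz : size (x (j, false)) = (E + E)%N.
  by rewrite -(size_map (fun A : {vspace 'rV[k]_(sdim H (j, false))} => \dim A)) dF ds size_cat !size_map size_rev size_iota.
have xE := seq_two_iota 0%VS sz.
move: (fun y => nth _ (take _ _) _) (fun y => nth _ (drop _ _) _) xE => Q Q' xE.
have [perps _ _ _] := (kindB_X0 kj fx xE).1 x0; rewrite -/e -/E in perps.
rewrite xE ds in dF; rewrite xE in sF.
have rng y : (0 < y <= E)%N -> (e.+1 <= e + y <= m)%N by rewrite /E; clear -iM; lia.
have al_inc y : (0 < y < E)%N -> (al y <= al y.+1)%N.
  move=> ye; have h1 := hE y ltac:(clear -ye; lia); have h2 := hE y.+1 ltac:(clear -ye; lia).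
  have := h_mono (i := (e + y)%N) (j := (e + y.+1)%N) ltac:(clear -ye; lia) ltac:(have := rng y.+1; clear -ye; lia).
  by move: h1 h2; rewrite -/(al y) -/(al y.+1); clear; lia.
have hn y : (0 < y <= E)%N -> (h (e + y) <= n)%N by move=> /rng ye; apply: h_le; move: ye; clear; lia.
have al_bd y : (0 < y <= E)%N -> (2 * al y <= hh)%N.
  by move=> ye; have := hn y ye; rewrite (hE y ye) -/(al y) /hh; clear; lia.
have UL := U_list dF sF al_inc al_bd.
have lbk := ext_lb1 u cardFq2 Hu Hh a0 fa pd sgE.
set T := Lam1 e in pd lbk; set B := scale (pi2 ^+ 2) (dC T) in pd lbk.
have sB : submod (ext B) by exact: ext_submod. have sT : submod (ext T) by exact: ext_submod.
have eBT : ext B `<=` ext T by exact/ext_mono/(pd_BT1 pd).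
set bk := wm (b (j, false)) in lbk.
have chain1 y : (0 < y <= E)%N -> _ := fun ye =>
  lift_dual_chain u cardFq2 Hu Hh a0 fa pd sgE (perps y ye).2 (perps y ye).1.
(* The flag contains pi B_i, so B_i is the lift divided by the uniformizer. *)
pose c : chain Wk n := fun i => (liftv (ext B) bk (Q' (i - e)%N),
  scale (wmap u pi2^-1) (liftv (ext B) bk (Q (i - e)%N))).
have inv i : zone j i -> (0 < i - e <= E)%N /\ (e + (i - e) = i)%N.
  by rewrite -(zone_B _ kj) -/e /E; clear; lia.
have dUW y : (0 < y <= E)%N -> (\dim (Q' y) + \dim (Q y) = (sdim H (j, false)).+1)%N.
  move=> ye; have [d1 d2 _ _] := UL _ ye; rewrite d1 d2 dE.
  by have l0 : (0 < ellB h H X)%N by []; move: l0; have := al_bd _ ye; rewrite -/(al _); clear; lia.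
have Api i v : zone j i -> chA c i v -> ext B (pik *: v).
  by move=> iz Av; apply: (pi_top sB lbk); exact: (lift_sub sT eBT lbk Av).
exists c; split.
- by move=> i /inv [ye _]; case: (chain1 _ ye (dUW _ ye)).
- move=> i iz; have [ye e1] := inv i iz; have [d1 d2 QQ _] := UL _ ye.
  have [_ _ _ vols] := chain1 _ ye (dUW _ ye).
  have pB : scale pik (chB c i) `<=` chA c i by rewrite /chB /c /= scale_piVK; exact: liftS.
  split=> //; have [z vz] := lattice_vol (pd_lB1 u cardFq2 Hu Hh pd).
  have [vA vB] := vols z z vz vz; apply: (colen_between vA (vol_scale_piV vB) pB).
    by apply: sub_scale_piV => v Av; apply: lift_sup; exact: Api iz Av.
  rewrite d1 d2 -[X in _ = _ + (h X)%:Z]e1; have := hE _ ye; have := hn _ ye; rewrite /hh; clear; lia.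
- move=> i iz iz1; have [ye _] := inv i iz; have [ye1 e1] := inv i.+1 iz1.
  have eS : ((i - e).+1 = i.+1 - e)%N by move: ye; clear; lia.
  have [_ _ _ /(_ _) []] := UL _ ye; first by move: ye1; rewrite -eS; case/andP.
  by rewrite eS => Q1 Q2; split; [exact: liftS | apply: scaleS; exact: liftS].
- by rewrite js eqxx.
- move=> j0 i iz; have -> : zone_lo j = e by rewrite /zone_lo (negbTE j0) js.
  exact: (lift_sub sT eBT lbk).
- case.
    rewrite /f_map /members /= kj /=; move: dF'; rewrite /= ds'; by case: (x (j, true)).
  rewrite xE /f_map /members /= kj map_cat -!map_comp -/e -/E.
  congr (_ ++ _); apply/eq_in_map => y _; rewrite /= ?/chB ?/chA /c /= addKn ?scale_piVK;
    exact: (redv_lift sB lbk).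
Qed.

Lemma zone_chain_C (x : Xfam k H X) (j : 'I_s.+1) : kind X j = KindC ->
  fflag h (fun e => x (j, e)) -> X0factor j12 h b (fun e => x (j, e)) -> exists c, zone_chain x j c.
Proof.
move=> kj fx x0; have [jM iX iX' lt [im i0]] := kindC kj; have pd := pd_C kj.
have a0 := invr_neq0 (pi_neq0 W2); have fa := frob_piV.
have pd' := pair_datum_sym pd; have [[lT0 _ LL0] fM] := vert0 iX' i0.
have [[lT1 _ LL1] em] := vert1 iX im.
have [z1 [z2 [vz1 vz2 dE zE]]] := kindC_vol kj.
set e := i_ j in iX im lt em pd LL1 lT1 vz1 dE zE *.
set f := i_ j.+1 in iX' i0 lt fM pd LL0 lT0 vz2 dE zE *; set N := (f - e)%N.
pose be y := dh e.+1 (e + y)%N.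
have eN : (e + N = f)%N by rewrite subnKC // ltnW.
have Ng : (0 < N)%N by rewrite subn_gt0.
have hE y : (0 < y <= N)%N -> h (e + y)%N = (h e.+1 + 2 * be y)%N.
  by move=> ye; apply: h_dh => //; move: ye; rewrite /N; clear -fM lt; lia.
have be_le y y' : (0 < y)%N -> (y <= y' <= N)%N -> (be y <= be y')%N.
  move=> y0 yy; have h1 := hE y ltac:(clear -y0 yy; lia); have h2 := hE y' ltac:(clear -y0 yy; lia).
  have := h_mono (i := (e + y)%N) (j := (e + y')%N) ltac:(clear -y0; lia)
    ltac:(move: yy; rewrite /N; clear -fM lt; lia).
  by rewrite h1 h2; clear; lia.
have ds : sdims h H (j, false) = [seq (ell1 h H X j + be y)%N | y <- iota 1 N].
  by rewrite /sdims /= kj.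
have ds' : sdims h H (j, true) = [seq (ell0 h H X j + (be N - be y))%N | y <- rev (iota 1 N)].
  rewrite /sdims /= kj; apply/eq_in_map => y; rewrite mem_rev mem_iota -/e -/f -/N => ye.
  have a1 := hE y ltac:(clear -ye; lia); have a2 := hE N ltac:(clear -Ng; lia).
  rewrite eN in a2; rewrite a1 a2; clear; lia.
have [dF sF] := fx false; have [dF' sF'] := fx true; rewrite ds in dF; rewrite ds' in dF'.
have sz : size (x (j, false)) = N.
  by rewrite -(size_map (fun A : {vspace 'rV[k]_(sdim H (j, false))} => \dim A)) dF size_map size_iota.
have sz' : size (x (j, true)) = N.
  by rewrite -(size_map (fun A : {vspace 'rV[k]_(sdim H (j, true))} => \dim A)) dF' size_map size_rev size_iota.
have xE := seq_iota 0%VS sz; have xE' := seq_rev_iota 0%VS sz'.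
move: (fun y => nth _ _ y.-1) (fun y => nth _ _ (N - y)%N) xE xE' => W U xE xE'.
have [perps _ _ _] := (kindC_X0 kj fx xE xE').1 x0; rewrite -/e -/f -/N in perps.
rewrite xE in dF sF; rewrite xE' in dF' sF'.
have dW y : (0 < y <= N)%N -> \dim (W y) = (ell1 h H X j + be y)%N.
  by move: y; apply: eq_map_iota; rewrite -dF -map_comp.
have dU y : (0 < y <= N)%N -> \dim (U y) = (ell0 h H X j + (be N - be y))%N.
  move: y; apply: eq_map_iota; move: dF'; rewrite -map_comp !map_rev => /(congr1 rev).
  by rewrite !revK.
have WF y : (0 < y <= N)%N -> W y \in [seq W y | y <- iota 1 N].
  by move=> ye; rewrite map_f // mem_iota; clear -ye; lia.
have UF y : (0 < y <= N)%N -> U y \in [seq U y | y <- rev (iota 1 N)].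
  by move=> ye; rewrite map_f // mem_rev mem_iota; clear -ye; lia.
have lb1 := ext_lb1 u cardFq2 Hu Hh a0 fa pd sgE; have lb2 := ext_lb1 u cardFq2 Hu Hh a0 fa pd' sgE.
set T1 := scale pi2 (Lam0 f) in pd pd' lb1; set T2 := Lam1 e in pd pd' lb1 lb2.
set B1 := scale (pi2 ^+ 2) (dC T2) in pd pd' lb1 vz1.
set B2 := scale pi2 (dC (Lam0 f)) in pd pd' lb2 vz2.
have sB1 : submod (ext B1) by exact: ext_submod. have sT1 : submod (ext T1) by exact: ext_submod.
have sB2 : submod (ext B2) by exact: ext_submod. have sT2 : submod (ext T2) by exact: ext_submod.
have eBT1 : ext B1 `<=` ext T1 by exact/ext_mono/(pd_BT1 pd).
have eBT2 : ext B2 `<=` ext T2 by exact/ext_mono/(pd_BT2 pd).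
set b1 := wm (b (j, false)) in lb1; set b2 := wm (b (j, true)) in lb2.
have TB2 : ext T1 `<=` ext B2 by apply/ext_mono/scaleS; move: LL0; rewrite expr0 scale1E.
have TB1 : scale pik (ext T2) `<=` ext B1.
  rewrite -ext_pi; apply/ext_mono; rewrite /B1 expr2 -scaleA; apply: scaleS.
  by move: LL1; rewrite expr1.
have chain1 y : (0 < y <= N)%N -> _ := fun ye =>
  lift_dual_chain u cardFq2 Hu Hh a0 fa pd sgE (perps y ye).1 (perps y ye).2.
pose c : chain Wk n := fun i => (liftv (ext B2) b2 (U (i - e)%N),
  scale (wmap u pi2^-1) (liftv (ext B1) b1 (W (i - e)%N))).
have inv i : zone j i -> (0 < i - e <= N)%N /\ (e + (i - e) = i)%N.
  by rewrite -(zone_C _ kj) -/e -/f /N; clear; lia.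
have dUW y : (0 < y <= N)%N -> (\dim (U y) + \dim (W y) = (sdim H (j, false)).+1)%N.
  move=> ye; rewrite dU // dW // dE -/e -/f -eN -/(be N).
  have l0 : (0 < ell0 h H X j)%N by []; have l1 : (0 < ell1 h H X j)%N by [].
  by have := be_le y N ltac:(clear -ye; lia) ltac:(clear -ye; lia); move: l0 l1; clear; lia.
exists c; split.
- by move=> i /inv [ye _]; case: (chain1 _ ye (dUW _ ye)).
- move=> i iz; have [ye e1] := inv i iz.
  have [_ _ _ vols] := chain1 _ ye (dUW _ ye).
  have pB : scale pik (chB c i) `<=` chA c i.
    rewrite /chB /chA /c /= scale_piVK => v Lv; apply: lift_sup; apply: TB2.
    exact: (lift_sub sT1 eBT1 lb1 Lv).
  split=> //; have [vA vB] := vols z1 z2 vz1 vz2; apply: (colen_between vA (vol_scale_piV vB) pB).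
    apply: sub_scale_piV => v Av; apply: lift_sup; apply: TB1; exists v => //.
    exact: (lift_sub sT2 eBT2 lb2 Av).
  (* The two members live in different quotients, so their colength is a difference of volumes,
     evaluated by the last identity of [kindC_vol]. *)
  rewrite dU // dW // -[X in _ = _ + (h X)%:Z]e1 hE //.
  have := be_le (i - e)%N N ltac:(clear -ye; lia) ltac:(clear -ye; lia).
  by move: zE; rewrite -eN -/(be N); clear; lia.
- move=> i iz iz1; have [ye _] := inv i iz; have [ye1 e1] := inv i.+1 iz1.
  have eS : ((i - e).+1 = i.+1 - e)%N by move: ye; clear; lia.
  have bb := be_le (i - e)%N (i.+1 - e)%N ltac:(clear -ye; lia) ltac:(clear -ye1; lia).
  split; [apply: liftS; apply: (chain_dim sF') | apply: scaleS; apply: liftS; apply: (chain_dim sF)];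
    rewrite ?UF ?WF //; rewrite ?dU ?dW //; move: bb; clear; lia.
- move=> js i iz; have -> : zone_hi j = f by rewrite /zone_hi (negbTE js).
  rewrite /chB /c /=; have -> : ext (Lam0 f) = scale (wmap u pi2^-1) (ext T1).
    by rewrite /T1 ext_pi wpiV scaleA mulVf ?pi_neq0 // scale1E.
  by apply: scaleS; exact: (lift_sub sT1 eBT1 lb1).
- move=> j0 i iz; have -> : zone_lo j = e by rewrite /zone_lo (negbTE j0).
  exact: (lift_sub sT2 eBT2 lb2).
- case.
    rewrite xE' /f_map /members /= kj -!map_comp -/e -/f -/N.
    by apply/eq_in_map => y _; rewrite /= /chA /c /= addKn; exact: (redv_lift sB2 lb2).
  rewrite xE /f_map /members /= kj -!map_comp -/e -/f -/N.
  by apply/eq_in_map => y _; rewrite /= /chB /c /= addKn scale_piVK; exact: (redv_lift sB1 lb1).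
Qed.

Lemma zone_chain_ex (x : Xfam k H X) (j : 'I_s.+1) :
  fflag h (fun e => x (j, e)) -> X0factor j12 h b (fun e => x (j, e)) -> exists c, zone_chain x j c.
Proof.
move=> fx x0; case kj: (kind X j).
- have nz i : ~ zone j i by move/zone_cases => [[]|[]|[]]; rewrite kj.
  exists (fun=> (set0, set0)); split; try by [move=> i /nz | move=> ? i /nz].
  move=> e; have [] := fx e; rewrite /f_map /members /sdims /= kj.
  by case: (x (j, e)).
- exact: zone_chain_A.
- exact: zone_chain_B.
- exact: zone_chain_C.
Qed.

(** * Gluing the pieces of a chain *)

Lemma zone_uniq (j j' : 'I_s.+1) i : zone j i -> zone j' i -> j = j'.
Proof.
wlog le : j j' / (j <= j')%N => [W z z'|].
  by have [le|/ltnW le] := leqP j j'; [exact: W | apply/esym/W].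
move=> /andP [_ hi] /andP [lo _]; apply/val_inj/eqP; rewrite eqn_leq le leqNgt; apply/negP => lt.
have js : (j < s)%N by have := ltn_ord j'; move: lt; clear; rewrite /=; lia.
have j'0 : (0 < j')%N by exact: leq_ltn_trans lt.
move: hi lo; rewrite /zone_hi /zone_lo (ltn_eqF js) (gtn_eqF j'0).
have := elt_up (j := j.+1) (j' := j') isT ltac:(have := ltn_ord j'; move: lt; clear; rewrite /=; lia).
by clear; lia.
Qed.

Lemma zone_below p : (p < s)%N -> (0 < i_ p.+1)%N -> zone p (i_ p.+1).
Proof.
move=> ps i0; rewrite /zone /zone_lo /zone_hi (ltn_eqF ps) leqnn andbT.
by case: eqP => // /eqP p0; apply: elt_lt; rewrite lt0n p0.
Qed.

Lemma zone_above p : (0 < p <= s)%N -> (i_ p < m)%N -> zone p (i_ p).+1.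
Proof.
move=> /andP [p0 ps] im; rewrite /zone /zone_lo /zone_hi (gtn_eqF p0) leqnn /=.
by case: eqP => // /eqP np; apply: elt_lt; rewrite p0 ltn_neqAle np.
Qed.

Lemma add_in_range a z i : (a < z)%N -> (1 <= i < 1 + (z - a))%N -> (a < a + i <= z)%N.
Proof. by lia. Qed.

Lemma members_zone (c c' : chain Wk n) (j : 'I_s.+1) e : (forall i, zone j i -> c i = c' i) ->
  f_map u b c (j, e) = f_map u b c' (j, e).
Proof.
move=> cc; rewrite /f_map /members /=; case kj: (kind X j); case: e => //=; congr map.
- congr (_ ++ _); apply/eq_in_map => i; rewrite ?mem_rev mem_iota => ie; rewrite /chA /chB cc //;
    by rewrite -(zone_A _ kj); clear -ie; lia.
- have [_ _ _ lt] := kindB kj; congr (_ ++ _); apply/eq_in_map => i; rewrite ?mem_rev mem_iota => ie;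
    by rewrite /chA /chB cc // -(zone_B _ kj); exact: add_in_range lt ie.
- have [_ _ _ lt _] := kindC kj; apply/eq_in_map => i; rewrite ?mem_rev mem_iota => ie;
    by rewrite /chA /chB cc // -(zone_C _ kj); exact: add_in_range lt ie.
- have [_ _ _ lt _] := kindC kj; apply/eq_in_map => i; rewrite ?mem_rev mem_iota => ie;
    by rewrite /chA /chB cc // -(zone_C _ kj); exact: add_in_range lt ie.
Qed.

Lemma sub_dual_swap L0 L1 : L0 `<=` scale pi2 (dC L1) -> L1 `<=` scale pi2 (dC L0).
Proof.
move=> I v Lv; apply/(scale_dC _ _ _ (pi_neq0 _)) => w /I /(scale_dC _ _ _ (pi_neq0 _)) /(_ v Lv).
by rewrite -(frobk_integral (Wk := W2)) rmorphM frob_piV (hC_conj cardFq2 Hh).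
Qed.

(** Every index lies in exactly one zone, so the pieces define a chain; only the inclusions between
    neighbouring zones are new. *)
Lemma chain_of_flags (x : Xfam k H X) : (forall j : 'I_s.+1, fflag h (fun e => x (j, e))) ->
  (forall j : 'I_s.+1, X0factor j12 h b (fun e => x (j, e))) ->
  exists c, N_pts u h H X c /\ f_map u b c = x.
Proof.
move=> fx x0; have sg0 := s_gt0.
have [F FE] := choice (fun j => zone_chain_ex (fx j) (x0 j)).
have zex i : exists j : 'I_s.+1, (0 < i <= m)%N -> zone j i.
  have [iM|nM] := boolP (0 < i <= m)%N; last by exists ord0.
  by have [j jz] := zone_ex iM; exists j.
have [J JE] := choice zex.
(* The default is the normalization that [Npoint] imposes outside the range of indices. *)
pose c : chain Wk n := fun i => if (0 < i <= m)%N then F (J i) i else (set0, set0).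
have zm (j : 'I_s.+1) i : zone j i -> (0 < i <= m)%N.
  move=> /zone_cases [[kj _ iz]|[kj _ iz]|[kj iz]].
  - by have [_ _ _ eM] := kindA kj; move: iz eM; clear; lia.
  - by move: iz; clear; lia.
  - have [_ _ iX _ _] := kindC kj; have := elts_le iX; move: iz; clear; lia.
have cE (j : 'I_s.+1) i : zone j i -> c i = F j i.
  by move=> jz; have iM := zm _ _ jz; rewrite /c iM (zone_uniq (JE i iM) jz).
have AE (j : 'I_s.+1) i : zone j i -> chA c i = chA (F j) i by move=> /cE; rewrite /chA => ->.
have BE (j : 'I_s.+1) i : zone j i -> chB c i = chB (F j) i by move=> /cE; rewrite /chB => ->.
have Bhi i : i \in elts X -> i != 0%N -> chB c i `<=` ext (Lam0 i).
  move=> /elts_elt [p ps ->] i0; have pz := zone_below ps ltac:(by rewrite lt0n).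
  pose j : 'I_s.+1 := inord p; have jp : nat_of_ord j = p by rewrite inordK // ltnW.
  have jz : zone j (i_ p.+1) by rewrite jp.
  have hi : zone_hi j = i_ p.+1 by rewrite /zone_hi jp (ltn_eqF ps).
  by rewrite (BE _ _ jz) -[X in Lam0 X]hi; apply: (zc_hi (FE j)) => //; rewrite jp (ltn_eqF ps).
have Alo i : i \in elts X -> i != m -> chA c i.+1 `<=` ext (Lam1 i).
  move=> iX im; have lt : (i < m)%N by rewrite ltn_neqAle im (elts_le iX).
  move: iX im lt => /elts_elt [p ps ->] im lt; have pz := zone_above (p := p.+1) ps lt.
  pose j : 'I_s.+1 := inord p.+1; have jp : nat_of_ord j = p.+1 by rewrite inordK.
  have jz : zone j (i_ p.+1).+1 by rewrite jp.
  have lo : zone_lo j = i_ p.+1 by rewrite /zone_lo jp.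
  by rewrite (AE _ _ jz) -[X in Lam1 X]lo; apply: (zc_lo (FE j)) => //; rewrite jp.
have dual_sub i : (0 < i <= m)%N -> [/\ is_lattice (chA c i), is_lattice (chB c i),
    scale pik (dK (chA c i)) `<=` chB c i & scale pik (dK (chB c i)) `<=` chA c i].
  move=> iM; have jz := JE i iM; have [lA lB [c1 _ c2 _]] := zc_dual (FE _) jz.
  rewrite (AE _ _ jz) (BE _ _ jz); split=> //.
    by have [] := colen_sub (submod_scale _ (submod_dK _ _ _)) c1.
  by have [] := colen_sub (submod_scale _ (submod_dK _ _ _)) c2.
exists c; split; last first.
  apply: functional_extensionality_dep => -[j e]; rewrite -(zc_f (FE j)).
  by apply: members_zone => i; exact: cE.
split=> //; split.
- move=> i im; rewrite /c; case: ifP => // /andP [i0 le].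
  by move: im; rewrite (gtn_eqF i0) ltnNge le.
- by move=> i /dual_sub [].
- move=> i iM; have iM1 : (0 < i <= m)%N by move: iM; clear; lia.
  have iM2 : (0 < i.+1 <= m)%N by move: iM; clear; lia.
  have jz := JE _ iM1; have jz' := JE _ iM2.
  have [e|ne] := eqVneq (J i) (J i.+1).
    rewrite -e in jz'; have [MA MB] := zc_mono (FE _) jz jz'.
    by rewrite (AE _ _ jz) (BE _ _ jz) (AE _ _ jz') (BE _ _ jz').
  (* Here [i] ends a zone, so it belongs to the index. Then A_(i+1) lies in Lam1, which lies in pi
     Lam0^vee, so in pi B_i^vee and in A_i; the inclusion of B_i in B_(i+1) is dual. *)
  have nz : ~~ zone (J i) i.+1 by apply: contra ne => z; apply/eqP; exact: zone_uniq z jz'.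
  have hi : zone_hi (J i) = i by move: jz nz; rewrite /zone; clear; lia.
  have js : (J i : nat) != s.
    by apply/eqP => js; move: hi iM; rewrite /zone_hi js eqxx; clear; lia.
  rewrite /zone_hi (negbTE js) in hi.
  have iX : i \in elts X.
    rewrite -[X in X \in _]hi; apply: elt_mem; have := ltn_ord (J i); rewrite ltnS leq_eqVlt (negbTE js).
    by move=> /= ->.
  have i0 : i != 0%N by rewrite -lt0n; case/andP: iM1.
  have im : i != m by rewrite neq_ltn; case/andP: iM => _ ->.
  have [[v0 _ _] _] := vert0 iX i0; have [[v1 _ _] _] := vert1 iX im.
  case: X_bt => _ _ _ /(_ i iX i0 im) ch _; have ch' := sub_dual_swap ch.
  have [_ _ _ dB] := dual_sub i iM1; have [_ _ dA _] := dual_sub _ iM2.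
  have E0 := scale_dKE u cardFq2 Hu Hh 1 v0; have E1 := scale_dKE u cardFq2 Hu Hh 1 v1.
  rewrite !expr1z in E0 E1; split.
    apply: subset_trans (Alo i iX im) _; apply: subset_trans (ext_mono (u := u) ch') _.
    by rewrite E0; apply: subset_trans dB; exact/scaleS/dK_anti/Bhi.
  apply: subset_trans (Bhi i iX i0) _; apply: subset_trans (ext_mono (u := u) ch) _.
  by rewrite E1; apply: subset_trans dA; exact/scaleS/dK_anti/Alo.
- move=> i iM; have jz := JE i iM; have [_ _ [c1 c2 c3 c4]] := zc_dual (FE _) jz.
  by rewrite (AE _ _ jz) (BE _ _ jz); split=> //; exact: zc_colen (FE _) _ jz.
Qed.

End Kinds.

(** * Restriction of isomorphisms to strata *)

(** The smaller subset carries the structure induced from [A], not from the larger subset [S], so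
    open sets and regular functions must be compared through [A]. Regularity being local, it
    suffices to shrink to intersections of open sets. That [S0] lies in [S] keeps the inverse map
    defined on all of [S0]. *)
Lemma swf_iso_sub (k : fieldType) T1 T2 (N : swf k T1) (A : swf k T2) (S S0 : set T2)
    (N0 : set T1) (f : T1 -> T2) :
  (forall U, opn A U -> U `<=` pts A) ->
  (forall U V, opn A U -> opn A V -> opn A (U `&` V)) ->
  (forall U V phi, V `<=` U -> reg A U phi -> reg A V phi) ->
  (forall c, pts N c -> N0 c <-> S0 (f c)) -> (forall x, pts A x -> S0 x -> S x) ->
  swf_iso N (sub_swf A S) f -> swf_iso (sub_swf N N0) (sub_swf A S0) f.
Proof.
move=> opA opI regS NS SS [[fp fo fr] [g [[gp go gr] gf fg]]].
have regA U psi : opn A U -> reg A U psi -> reg (sub_swf A S) (U `&` S) psi.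
  by move=> oU rU x [Ux _]; exists U, psi.
have opS U : opn A U -> opn (sub_swf A S) (U `&` S) by move=> oU; exists U.
split.
  split=> [c [Nc N0c]|_ [U oU ->]|_ phi [U oU ->] rphi].
  - by have [Ac _] := fp c Nc; split=> //; apply/NS.
  - exists (pts N `&` f @^-1` (U `&` S)); first exact/fo/opS.
    apply/seteqP; split=> c /=.
      by move=> [[Nc N0c] [Uc _]]; have [_ Sc] := fp c Nc.
    by move=> [[Nc [Uc _]] N0c]; split=> //; split=> //; apply/NS.
  - move=> c [[Nc N0c] fc]; have [U' [psi [oU' U'c rU' e]]] := rphi _ fc.
    exists (pts N `&` f @^-1` (U' `&` S)), (psi \o f); split.
    + exact/fo/opS.
    + by have [_ Sc] := fp c Nc.
    + by apply: fr; [exact: opS | exact: regA].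
    + by move=> c' [_ [U'c' _]] [_ fc'] /=; exact: e.
have gS y : pts A y -> S0 y -> pts N (g y) /\ N0 (g y).
  move=> Ay S0y; have Sy := SS y Ay S0y; have Ny := gp y (conj Ay Sy).
  by split=> //; apply/(NS _ Ny); rewrite fg.
exists g; split; first split.
- by move=> y [Ay S0y]; exact: gS.
- move=> _ [W oW ->]; have [U oU UE] := go W oW; exists U => //.
  apply/seteqP; split=> y /=.
    move=> [[Ay S0y] [Wy _]]; split=> //.
    suff : (U `&` S) y by case.
    by rewrite -UE; split=> //; split=> //; exact: SS.
  move=> [Uy S0y]; have Ay := opA U oU y Uy; have Sy := SS y Ay S0y.
  have : (U `&` S) y by []. rewrite -UE => -[_ Wy].
  by split=> //; split=> //; case: (gS y Ay S0y).
- move=> _ phi [W oW ->] rphi y [[Ay S0y] gy].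
  have [W' [psi [oW' W'y rW' e]]] := rphi _ gy.
  have Sy := SS y Ay S0y.
  have [U1 oU1 U1E] := go W' oW'.
  have Ey : (pts (sub_swf A S) `&` g @^-1` W') y by split.
  have [U2 [chi [oU2 U2y rU2 e2]]] := gr _ _ oW' rW' y Ey.
  exists (U1 `&` U2), chi; split.
  + exact: opI.
  + by split=> //; have : (U1 `&` S) y by [rewrite -U1E]; case.
  + by apply: regS rU2 => z [].
  + move=> y' [U1y' U2y'] [[Ay' S0y'] gy'] /=; have Sy' := SS y' Ay' S0y'.
    have Ey' : (pts (sub_swf A S) `&` g @^-1` W') y' by rewrite U1E.
    by rewrite -(e2 y' U2y' Ey') /=; apply: e => //; case: Ey'.
- by move=> c [Nc _]; exact: gf.
- by move=> y [Ay S0y]; apply: fg; split=> //; exact: SS.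
Qed.

(** * Open sets and regular functions of flag varieties *)

Section FlagVarietyOpen.
Variables (k : fieldType) (T : Type) (d : T -> nat) (D : T -> seq nat).
Local Notation FV := (flag_variety k d D).

(** The union of the two closed complements is cut out by the products of their equations. *)
Lemma flag_variety_opnI U V : opn FV U -> opn FV V -> opn FV (U `&` V).
Proof.
move=> [Uf [_ [S1 p1 E1]]] [Vf [_ [S2 p2 E2]]]; split; first by move=> x [/Uf].
split; first by move=> x [].
exists [set p | exists2 p1, S1 p1 & exists2 p2, S2 p2 & p = (fun g => p1 g * p2 g)].
  by move=> _ [r1 /p1 h1 [r2 /p2 h2 ->]]; exact: poly_mul.
move=> g gG; split.
  move=> [fg nUV] _ [r1 s1 [r2 s2 ->]].
  have [Ug|nUg] := pselect (U (flag_of D g)).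
    have nV : (@is_flag k T d D `\` V) (flag_of D g) by split=> // Vg; exact: nUV.
    by rewrite ((E2 g gG).1 nV _ s2) mulr0.
  by rewrite ((E1 g gG).1 (conj fg nUg) _ s1) mul0r.
move=> z; have [Z1|nZ1] := pselect (forall p, S1 p -> p g = 0).
  by have [fg nU] := (E1 g gG).2 Z1; split=> // -[].
have Z2 r2 : S2 r2 -> r2 g = 0.
  move=> s2; apply: contrapT => /eqP n2; apply: nZ1 => r1 s1.
  have /eqP := z (fun g => r1 g * r2 g) (ex_intro2 _ _ r1 s1 (ex_intro2 _ _ r2 s2 erefl)).
  by rewrite mulf_eq0 (negbTE n2) orbF => /eqP.
by have [fg nV] := (E2 g gG).2 Z2; split=> // -[].
Qed.

Lemma flag_variety_regS U V phi : V `<=` U -> reg FV U phi -> reg FV V phi.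
Proof.
move=> VU rU g gG Vg; have [p [r [pp pr rg e]]] := rU g gG (VU _ Vg).
by exists p, r; split=> // g' gG' Vg' rg'; apply: e => //; exact: VU.
Qed.

End FlagVarietyOpen.

Theorem theorem4p3
  (Fq : finFieldType) (OF : cdvf Fq)
  (charF0 : [pchar (fld OF)] =i pred0) (p_odd : (2 \notin [pchar Fq])%N)
  (Fq2 : finFieldType) (i1 : {rmorphism Fq -> Fq2})
  (cardFq2 : #|Fq2| = (#|Fq| ^ 2)%N)
  (k : closedFieldType) (i2 : {rmorphism Fq -> k}) (j12 : {rmorphism Fq2 -> k})
  (i12 : forall x, j12 (i1 x) = i2 x)
  (W2 : relwitt OF i1) (Wk : relwitt OF i2) (u : wittmap j12 W2 Wk)
  (n m : nat) (n_gt0 : (1 <= n)%N) (m_gt0 : (1 <= m)%N)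
  (h : nat -> nat)
  (h_le : forall i, (1 <= i <= m)%N -> (h i <= n)%N)
  (h_lt : forall i, (1 <= i < m)%N -> (h i < h i.+1)%N)
  (h_parity : forall i, (1 <= i <= m)%N -> odd (h i) = odd (h 1%N))
  (H : 'M[fld W2]_n) (H_nondeg : H \in unitmx)
  (H_herm : forall i j, frob W2 (H i j) = H j i)
  (H_parity0 : forall L : set 'rV[fld W2]_n,
     vertex H 0 L -> odd (vtype H 0 L) = odd (h 1%N + 1)%N)
  (H_parity1 : forall L : set 'rV[fld W2]_n,
     vertex H 1 L -> odd (vtype H 1 L) = odd (n - h 1%N + 1)%N)
  (X : btdata m (set 'rV[fld W2]_n)) (X_bt : is_bt h H X)
  (b : forall t : fspace X, 'M[fld W2]_(sdim H t, n)) (b_lifts : lifts_bases b)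
  (N : swf k (chain Wk n)) (N_ptsE : pts N = N_pts u h H X)
  (f_iso : swf_iso N (sub_swf (X_ambient k h H X) (X_pts j12 h b)) (f_map u b)) :
  swf_iso (sub_swf N (N0_pts u h H X))
          (sub_swf (X_ambient k h H X) (X0_pts j12 h b)) (f_map u b).

Proof.
have closedk (p : {poly k}) : size p != 1%N -> exists x, root p x by move/closed_rootP.
have [sg sgE] := frobenius_rmorphism i2.
have [[fp _ _] _] := f_iso.
have fx c : N_pts u h H X c -> forall j, fflag h (fun e => f_map u b c (j, e)).
  by move=> cX j e; have [|fl _] := fp c; [rewrite N_ptsE | exact: fl].
apply: swf_iso_sub f_iso.
- by move=> U [].
- exact: flag_variety_opnI.
- exact: flag_variety_regS.
- move=> c; rewrite N_ptsE => cX.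
  have key := open_factors cardFq2 H_nondeg H_herm m_gt0 h_le h_lt h_parity H_parity0 H_parity1
    X_bt b_lifts closedk sgE cX (fx c cX).
  split=> [/(N0_open cardFq2 H_nondeg H_herm m_gt0 h_le X_bt) /key //|/key].
  exact: (open_N0 cardFq2 H_nondeg H_herm m_gt0 cX).
(* A point of [X0_pts] is the image of a chain in [N_pts], and such images lie in [X_pts]; no
   closure is computed. *)
move=> x xf x0.
have [c [cX <-]] := chain_of_flags u cardFq2 H_nondeg H_herm m_gt0 h_le h_lt h_parity H_parity0
  H_parity1 X_bt b_lifts closedk sgE (x := x) (fun j e => xf (j, e)) x0.
by have [|_] := fp c; rewrite ?N_ptsE.
Qed.
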